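(* For any $X_0=(y_0,U_0,h_0,r_0)\in\mathcal G$, the system $$\zeta_t=U,\quad \bar U_t=-Q-c(\chi'\circ y)U,\quad h_t=2(U^2+\tfrac12k^2-P)U_\xi,\quad \bar r_t=-kU_\xi,\quad c_t=0,\quad k_t=0$$ admits a unique global solution $X(t)=(y(t),U(t),h(t),r(t))$ in $C^1([0,\infty),E)$ with initial data $X_0$. We have $X(t)\in\mathcal G$ for all times. If $\mathcal G$ is equipped with the topology induced by the $E$-norm, then the mapping $S\colon\mathcal G\times[0,\infty)\to\mathcal G$ defined as $S_t(X_0)=X(t)$ is a continuous semigroup. More precisely, given $M>0$ and $T>0$, there exists a constant $C_M$ which depends only on $M$ and $T$ such that, for any two elements $X_\alpha,X_\beta\in\mathcal G$ with $\|X_\alpha\|_E\le M$ and $\|X_\beta\|_E\le M$, $$\|S_tX_\alpha-S_tX_\beta\|_E\le C_M\|X_\alpha-X_\beta\|_E$$ for any $t\in[0,T]$.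
   Context: **Function spaces.** Fix (once and for all) a smooth function $\chi:\mathbb R\to\mathbb R$ with support in $[0,\infty)$, $\chi(x)=1$ for $x\ge1$, $\chi'\ge0$. $H_{0,\infty}(\mathbb R)$ is the space of functions $v=\bar v+c\,\chi$ with $\bar v\in H^1(\mathbb R)$, $c\in\mathbb R$, normed by $\|\bar v\|_{H^1}+|c|$. $L^2_{\rm const}(\mathbb R)$ is the space of functions $\rho=\bar\rho+k$ with $\bar\rho\in L^2(\mathbb R)$, $k\in\mathbb R$, normed by $\|\bar\rho\|_{L^2}+|k|$. $V=\{f\in C(\mathbb R)\cap L^\infty(\mathbb R): f_\xi\in L^2(\mathbb R)\}$ with norm $\|f\|_{L^\infty}+\|f_\xi\|_{L^2}$. $E=V\times H_{0,\infty}(\mathbb R)\times L^2(\mathbb R)\times L^2_{\rm const}(\mathbb R)$ with the sum of the norms. **Lagrangian notation.** For $X=(\zeta,U,h,r)\in E$ put $y(\xi)=\xi+\zeta(\xi)$ (one also writes $X=(y,U,h,r)$), let $c$ and $k$ be the constants attached to $U\in H_{0,\infty}$ and $r\in L^2_{\rm const}$, and set $\bar U=U-c\,\chi\circ y\in H^1$, $\bar r=r-k\,y_\xi\in L^2$. $X$ is identified with $(\zeta,\bar U,c,h,\bar r,k)$. In the system, for fixed $t$, $$P(\xi)=\tfrac14\int_{\mathbb R}e^{-|y(\xi)-y(\eta)|}\big((2\bar U^2+4c\bar U\chi\circ y)y_\xi+2k\bar r+h\big)(\eta)\,d\eta+c^2g\circ y(\xi)+\tfrac12k^2,$$ $$Q(\xi)=-\tfrac14\int_{\mathbb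 R}\operatorname{sign}(\xi-\eta)e^{-|y(\xi)-y(\eta)|}\big((2\bar U^2+4c\bar U\chi\circ y)y_\xi+2k\bar r+h\big)(\eta)\,d\eta+c^2g'\circ y(\xi),$$ $$g(x)=\chi^2(x)+\tfrac12\int_{\mathbb R}e^{-|x-z|}(2\chi'^2+2\chi\chi'')(z)\,dz.$$ $\mathcal G$ is the set of $X=(\zeta,U,h,r)\in E$ with $\zeta,U\in W^{1,\infty}(\mathbb R)$, $h,r\in L^\infty(\mathbb R)$, and, almost everywhere, $y_\xi\ge0$, $h\ge0$, $y_\xi+h>0$, $y_\xi h=U_\xi^2+\bar r^2$. ''Continuous semigroup'' means $S_0=\mathrm{Id}$, $S_{t+s}=S_t\circ S_s$, and $(X,t)\mapsto S_tX$ is continuous. *)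

(* Defs.v *)
From HB Require Import structures.
From mathcomp Require Import all_boot all_order all_algebra.
From mathcomp Require Import all_classical all_reals all_analysis.

Set Implicit Arguments.
Unset Strict Implicit.
Unset Printing Implicit Defensive.

Import Order.TTheory GRing.Theory Num.Theory.
Import numFieldNormedType.Exports.

Local Open Scope classical_set_scope.
Local Open Scope ring_scope.

Section FunctionSpaces.
Context {R : realType}.
Local Notation mu := (@lebesgue_measure R).
Implicit Types f g phi chi : R -> R.

Definition smooth f := forall n x, derivable (derive1n n f) x 1.

Definition cutoff chi :=
  [/\ smooth chi,
      forall x, x < 0 -> chi x = 0,
      forall x, 1 <= x -> chi x = 1 &
      forall x, 0 <= derive1 chi x].

Definition test_function phi :=
  smooth phi /\ exists M : R, forall x, M < `|x| -> phi x = 0.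

(* [g] is a distributional derivative of [f] *)
Definition weak_deriv f g :=
  [/\ locally_integrable setT f, locally_integrable setT g &
      forall phi, test_function phi ->
        \int[mu]_x (f x * derive1 phi x) = - \int[mu]_x (g x * phi x)].

(* A representative of f_xi; it is determined up to a null set when it exists,
   and is meaningless otherwise. *)
Definition wD f : R -> R := xget (cst 0) [set g | weak_deriv f g].

Definition inLp (p : \bar R) f := f \in Lfun mu p.
Definition Lpnorm (p : \bar R) f : R := fine ('N[mu]_p[EFin \o f])%E.

Definition L2 : set (R -> R) := inLp 2%:E.
Definition L2norm f := Lpnorm 2%:E f.
Definition Loo : set (R -> R) := inLp +oo%E.
Definition Loonorm f := Lpnorm +oo%E f.

(* Elements of H^1(R) are identified with their continuous representatives. *)
Definition H1 : set (R -> R) :=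
  [set f | [/\ continuous f, L2 f & exists2 g, weak_deriv f g & L2 g]].
Definition H1norm f : R := Num.sqrt (L2norm f ^+ 2 + L2norm (wD f) ^+ 2).

Definition W1oo : set (R -> R) :=
  [set f | Loo f /\ exists2 g, weak_deriv f g & Loo g].

Definition Vspace : set (R -> R) :=
  [set f | [/\ continuous f, Loo f & exists2 g, weak_deriv f g & L2 g]].
Definition Vnorm f : R := Loonorm f + L2norm (wD f).

(* The decompositions v = vbar + c chi and rho = rhobar + k are unique, which
   makes cst_H0oo and cst_L2const the constants c and k attached to v and rho. *)
Definition H0oo chi : set (R -> R) :=
  [set v | exists c : R, H1 (fun x => v x - c * chi x)].
Definition cst_H0oo chi (v : R -> R) : R :=
  xget 0 [set c | H1 (fun x => v x - c * chi x)].
Definition H0oonorm chi (v : R -> R) : R :=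
  let c := cst_H0oo chi v in H1norm (fun x => v x - c * chi x) + `|c|.

Definition L2const : set (R -> R) :=
  [set rho | exists k : R, L2 (fun x => rho x - k)].
Definition cst_L2const (rho : R -> R) : R :=
  xget 0 [set k | L2 (fun x => rho x - k)].
Definition L2constnorm (rho : R -> R) : R :=
  let k := cst_L2const rho in L2norm (fun x => rho x - k) + `|k|.

End FunctionSpaces.

(* Quadruples (zeta, U, h, r) with the pointwise vector space structure. *)
Definition lag (R : realType) : Type :=
  ((R -> R^o) * (R -> R^o) * (R -> R^o) * (R -> R^o))%type.
HB.instance Definition _ (R : realType) := GRing.Lmodule.on (lag R).

Section Lagrangian.
Context {R : realType}.
Local Notation mu := (@lebesgue_measure R).
Implicit Types (chi : R -> R) (X Y : lag R).

Definition zetaL X : R -> R := X.1.1.1.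
Definition UL X : R -> R := X.1.1.2.
Definition hL X : R -> R := X.1.2.
Definition rL X : R -> R := X.2.

Definition yL X : R -> R := fun xi => xi + zetaL X xi.
Definition cL chi X : R := cst_H0oo chi (UL X).
Definition kL X : R := cst_L2const (rL X).
Definition UbarL chi X : R -> R := fun xi => UL X xi - cL chi X * chi (yL X xi).
Definition rbarL X : R -> R := fun xi => rL X xi - kL X * wD (yL X) xi.

Definition Espace chi : set (lag R) :=
  [set X | [/\ Vspace (zetaL X), H0oo chi (UL X), L2 (hL X) & L2const (rL X)]].
Definition Enorm chi X : R :=
  Vnorm (zetaL X) + H0oonorm chi (UL X) + L2norm (hL X) + L2constnorm (rL X).

(* Equality in E: the components h and r are classes modulo null sets. *)
Definition eqlag X Y :=
  [/\ zetaL X = zetaL Y, UL X = UL Y,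
      ae_eq mu setT (hL X) (hL Y) & ae_eq mu setT (rL X) (rL Y)].

Definition Gset chi : set (lag R) :=
  [set X | [/\ Espace chi X,
    W1oo (zetaL X) /\ W1oo (UL X),
    Loo (hL X) /\ Loo (rL X) &
    {ae mu, forall xi, let yx := wD (yL X) xi in
      [/\ 0 <= yx, 0 <= hL X xi, 0 < yx + hL X xi &
          yx * hL X xi = wD (UL X) xi ^+ 2 + rbarL X xi ^+ 2]}]].

Definition gfun chi (x : R) : R :=
  chi x ^+ 2 + 2^-1 * \int[mu]_z (expR (- `|x - z|) *
    (2 * derive1 chi z ^+ 2 + 2 * chi z * derive1n 2 chi z)).

Definition source chi X (eta : R) : R :=
  let Ub := UbarL chi X eta in
  (2 * Ub ^+ 2 + 4 * cL chi X * Ub * chi (yL X eta)) * wD (yL X) eta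
  + 2 * kL X * rbarL X eta + hL X eta.

Definition PL chi X (xi : R) : R :=
  4^-1 * \int[mu]_eta (expR (- `|yL X xi - yL X eta|) * source chi X eta)
  + cL chi X ^+ 2 * gfun chi (yL X xi) + 2^-1 * kL X ^+ 2.

Definition QL chi X (xi : R) : R :=
  - 4^-1 * \int[mu]_eta
      (Num.sg (xi - eta) * expR (- `|yL X xi - yL X eta|) * source chi X eta)
  + cL chi X ^+ 2 * derive1 (gfun chi) (yL X xi).

(* On [0, +oo[ the curve u has derivative du at t in the space S normed by N;
   the derivative is one-sided at t = 0. *)
Definition has_tderiv (W : lmodType R) (S : set W) (N : W -> R)
    (u : R -> W) (t : R) (du : W) :=
  S du /\
  N ((s - t)^-1 *: (u s - u t) - du) @[s --> within [set s | 0 <= s] t^']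
    --> (0 : R).

Definition C1E chi (X : R -> lag R) :=
  (forall t, 0 <= t -> Espace chi (X t)) /\
  exists dX : R -> lag R, forall t, 0 <= t ->
    has_tderiv (Espace chi) (Enorm chi) X t (dX t) /\
    Enorm chi (dX s - dX t) @[s --> within [set s | 0 <= s] (nbhs t)]
      --> (0 : R).

(* Each equation is understood in the norm of the corresponding component of
   (zeta, Ubar, c, h, rbar, k). *)
Definition system chi (X : R -> lag R) := forall t, 0 <= t ->
  let: (c, k) := (cL chi (X t), kL (X t)) in
  let: (U, y, P, Q) := (UL (X t), yL (X t), PL chi (X t), QL chi (X t)) in
  [/\ has_tderiv (W := R -> R^o) Vspace Vnorm (fun s => zetaL (X s)) t U,
      has_tderiv (W := R -> R^o) H1 H1norm (fun s => UbarL chi (X s)) t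
        (fun xi => - Q xi - c * derive1 chi (y xi) * U xi),
      has_tderiv (W := R -> R^o) L2 L2norm (fun s => hL (X s)) t
        (fun xi => 2 * (U xi ^+ 2 + 2^-1 * k ^+ 2 - P xi) * wD U xi),
      has_tderiv (W := R -> R^o) L2 L2norm (fun s => rbarL (X s)) t
        (fun xi => - k * wD U xi) &
      has_tderiv (W := R^o) setT Num.norm (fun s => cL chi (X s)) t 0 /\
      has_tderiv (W := R^o) setT Num.norm (fun s => kL (X s)) t 0].

Definition global_solution chi (X0 : lag R) (X : R -> lag R) :=
  [/\ C1E chi X, system chi X & eqlag (X 0) X0].

(* S_t(X_0) = X(t), where X is the solution starting from X_0 *)
Definition flow chi (t : R) (X0 : lag R) : lag R :=
  xget (fun=> X0) [set X : R -> lag R | global_solution chi X0 X] t.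

End Lagrangian.

(* Main.v *)
(** In the coordinates (zeta, U - c chi, h, r - k, c, k) the vector space
structure of E is pointwise, and adjoining the space derivatives of the first
two as unknowns turns the system into an ODE. Replacing the kernel
exp(-|y(x)-y(s)|) by exp(-sgn(x-s)(y(x)-y(s))), which is the same when y is
nondecreasing, keeps the adjoined unknowns equal to the derivatives for every
y. The right-hand side is then locally Lipschitz in the norms built on L^2 and
on the intersection of L^2 and L^oo, and Euler polygons for a radially
truncated right-hand side converge. The quantity y_x h - U_x^2 - rbar^2 is
conserved at each point, so the conditions defining G persist; they bound P
and Q by the energy, the integral of Ubar^2 y_x + h, whose growth is at most
exponential because its rate is an exact derivative up to terms weighted by
chi'. Hence solutions are global and bounded in terms of the E-norm of the data,
and Gronwall's inequality gives the Lipschitz estimate.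

For uniqueness, a competing solution in E need not have nondecreasing y. It is
compared with the constructed one in the weaker norm
sup_x int exp(-|x-s|) |f(s)| ds. The adjoined derivative of U then satisfies its
equation only up to a defect supported where the sign of y(x)-y(s) is wrong; there
the nondecreasing y_a of the constructed solution varies by at most twice
sup |y-y_a|, and the y_a-measure of such a strip is its height, so the defect is
linear in the difference of the two solutions. *)

From HB Require Import structures.
Require Import Defs.
From mathcomp Require Import all_boot all_order all_algebra.
From mathcomp Require Import all_classical all_reals all_analysis.
From mathcomp Require Import measurable_realfun ess_sup_inf.
From mathcomp Require Import ring lra.

Set Implicit Arguments.
Unset Strict Implicit.
Unset Printing Implicit Defensive.

Import Order.TTheory GRing.Theory Num.Theory.
Import numFieldNormedType.Exports.
Local Open Scope classical_set_scope.
Local Open Scope ring_scope.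

(** * Integrals on the line *)

Section Integrals.
Context {R : realType}.
Local Notation mu := (@lebesgue_measure R).
Implicit Types (f g : R -> R) (a b c : R).

(** The same estimates are needed in several strengths. Conditions imposed at every point, and their
    pointwise ODEs, call for unknowns bounded at each point, hence for L^2 intersected with bounded
    functions; but the Lipschitz constant may depend on the E-norm only, which sees derivatives
    through L^2. Uniqueness forces a third space, uniformly local L^1: the defect of a competing
    solution is controlled by the measure of a strip, which gives smallness in an L^1 sense only.
    The right-hand side is therefore estimated once, for an abstract norm [fnorm], and used for all
    three. Neither U^2 nor P decays. The rates are integrable because g - chi^2 decays
    exponentially, which frees U^2 + k^2/2 - P of constants at infinity. The energy contains the
    integral of h, a priori only square-integrable; the constraint y_x h = U_x^2 + rbar^2 turns it
    into products of two L^2 functions, which can be differentiated in time. Boundedness of the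
    derivatives is used qualitatively: the a priori constants depend only on the time and on an
    L^2-type norm of the data. *)

Definition mf f := measurable_fun [set: R] f.
Definition ig f := mu.-integrable [set: R] (EFin \o f).
Definition It f : R := \int[mu]_x f x.
(** No orientation: the value is 0 for b < a, and additivity asks for ordered endpoints. *)
Definition io a b f : R := \int[mu]_(x in `[a, b]) f x.
(** Local integrability tested on segments, the form used by the interval calculus; [li_locally]
    identifies it with the library notion. *)
Definition li f := mf f /\ forall a b, mu.-integrable `[a, b]%classic (EFin \o f).

Lemma ig_mf f : ig f -> mf f.
Proof. by case/integrableP => /measurable_EFinP. Qed.

Lemma mfE f : mf f -> measurable_fun [set: R] (EFin \o f).
Proof. by move=> h; apply/measurable_EFinP. Qed.
Lemma mfD f g : mf f -> mf g -> mf (fun x => f x + g x).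
Proof. exact: measurable_funD. Qed.
Lemma mfB f g : mf f -> mf g -> mf (fun x => f x - g x).
Proof. exact: measurable_funB. Qed.
Lemma mfM f g : mf f -> mf g -> mf (fun x => f x * g x).
Proof. exact: measurable_funM. Qed.
Lemma mfN f : mf f -> mf (fun x => - f x).
Proof. by move=> m; exact: measurableT_comp. Qed.
Lemma mfX f n : mf f -> mf (fun x => f x ^+ n).
Proof. exact: measurable_funX. Qed.
Lemma mf_cst (k : R) : mf (fun=> k).
Proof. exact: measurable_cst. Qed.
Lemma mf_abs f : mf f -> mf (fun x => `|f x|).
Proof. by move=> m; exact: measurableT_comp. Qed.
Lemma mf_cont f : continuous f -> mf f.
Proof. exact: continuous_measurable_fun. Qed.
Lemma mf_comp f g : mf f -> mf g -> mf (fun x => f (g x)).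
Proof. by move=> m1 m2; exact: (measurableT_comp m1 m2). Qed.
Lemma mf_id : mf (fun x => x).
Proof. exact: measurable_id. Qed.
Lemma mf_exp f : mf f -> mf (fun x => expR (f x)).
Proof. by move=> m; exact: (measurableT_comp (@measurable_expR R) m). Qed.
Lemma mf_sg f : mf f -> mf (fun x => Num.sg (f x)).
Proof.
move=> m; apply: (mf_comp (f := Num.sg)) => //.
have -> : Num.sg = (fun x : R => \1_(`]0, +oo[%classic) x - \1_(`]-oo, 0[%classic) x).
  apply/funext => x; rewrite !indicE.
  case: sgrP => x0; rewrite ?x0 !(mem_setE, in_itv)/= ?andbT ?ltxx ?subrr//.
    by rewrite x0 ltNge (ltW x0) subr0.
  by rewrite x0 ltNge (ltW x0) sub0r.
by apply: mfB; apply: measurable_indic.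
Qed.

Lemma igD f g : ig f -> ig g -> ig (fun x => f x + g x).
Proof. by move=> ? ?; exact: (@integrableD _ _ _ mu setT measurableT (EFin \o f) (EFin \o g)). Qed.
Lemma igZ k f : ig f -> ig (fun x => k * f x).
Proof. by move=> ?; exact: (@integrableZl _ _ _ mu setT measurableT k (EFin \o f)). Qed.
Lemma igN f : ig f -> ig (fun x => - f x).
Proof. by move=> ?; exact: (@integrableN _ _ _ mu setT (EFin \o f)). Qed.
Lemma igB f g : ig f -> ig g -> ig (fun x => f x - g x).
Proof. by move=> ? ?; apply: igD => //; exact: igN. Qed.
Lemma ig0 : ig (fun=> 0).
Proof. exact: integrable0. Qed.
Lemma ig_le f g : mf f -> (forall x, `|f x| <= g x) -> ig g -> ig f.
Proof.
move=> m fg; apply: le_integrable => //; first exact/measurable_EFinP.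
by move=> x _ /=; rewrite lee_fin (le_trans (fg x))// ler_norm.
Qed.
Lemma ig_abs f : ig f -> ig (fun x => `|f x|).
Proof.
by move=> i; exact: (@integrable_norm _ _ _ mu setT f i).
Qed.

Lemma ItD f g : ig f -> ig g -> It (fun x => f x + g x) = It f + It g.
Proof. by move=> ? ?; rewrite /It RintegralD. Qed.
Lemma ItB f g : ig f -> ig g -> It (fun x => f x - g x) = It f - It g.
Proof. by move=> ? ?; rewrite /It RintegralB. Qed.
Lemma ItZ k f : ig f -> It (fun x => k * f x) = k * It f.
Proof. by move=> ?; rewrite /It RintegralZl. Qed.
Lemma ItN f : ig f -> It (fun x => - f x) = - It f.
Proof.
move=> i; rewrite -mulN1r -ItZ//; congr It.
by apply/funext => x; rewrite mulN1r.
Qed.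
Lemma It_le f g : ig f -> ig g -> (forall x, f x <= g x) -> It f <= It g.
Proof. by move=> ? ? fg; apply: le_Rintegral. Qed.
Lemma It_ge0 f : (forall x, 0 <= f x) -> 0 <= It f.
Proof. by move=> f0; apply: Rintegral_ge0. Qed.
Lemma It_norm f : ig f -> `|It f| <= It (fun x => `|f x|).
Proof. by move=> i; exact: le_normr_Rintegral. Qed.
Lemma It_normle f g : ig f -> ig g -> (forall x, `|f x| <= g x) -> `|It f| <= It g.
Proof.
by move=> fi gi fg; rewrite (le_trans (It_norm fi))// It_le//; exact: ig_abs.
Qed.
(** Measurability of [g] is a separate hypothesis because it is Borel measurability, which is not
    inherited along almost everywhere equality. *)
Lemma It_ae f g : ig f -> mf g -> ae_eq mu setT f g -> ig g /\ It f = It g.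
Proof.
move=> fi mg fg.
have fg' : ae_eq mu setT (EFin \o f) (EFin \o g).
  by apply: filterS fg => x /= h _; rewrite /= h.
have e : (\int[mu]_x (EFin \o f) x = \int[mu]_x (EFin \o g) x)%E.
  apply: ae_eq_integral => //; last exact/measurable_EFinP.
  exact: (mfE (ig_mf fi)).
split; last by rewrite /It /Rintegral e.
apply/integrableP; split; first exact/measurable_EFinP.
case/integrableP : (fi) => _; apply: le_lt_trans.
rewrite le_eqVlt; apply/orP; left; apply/eqP; apply: ae_eq_integral => //.
- by apply: measurableT_comp => //; exact/measurable_EFinP.
- by apply: measurableT_comp => //; exact: (mfE (ig_mf fi)).
- by apply: filterS fg' => x /= h _; case: (h I) => ->.
Qed.

Lemma It0_ae f : ig f -> (forall x, 0 <= f x) -> It f = 0 -> {ae mu, forall x, f x = 0}.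
Proof.
move=> fi f0 I0.
have := @ae_eq_integral_abs _ _ _ mu setT measurableT (EFin \o f)
   (mfE (ig_mf fi)).
case=> + _.
have -> : (\int[mu]_x `|(EFin \o f) x| = 0)%E.
  rewrite -[LHS]fineK.
    congr EFin; rewrite -I0; congr fine; apply: eq_integral => x _ /=.
    by rewrite ger0_norm.
  apply: integrable_fin_num => //; first exact: integrable_abse.
by move=> /(_ erefl); apply: filterS => x /= /(_ I) [].
Qed.

Lemma aeS (P Q : R -> Prop) : (forall x, P x -> Q x) ->
  {ae mu, forall x, P x} -> {ae mu, forall x, Q x}.
Proof. by move=> PQ; apply: filterS => //; exact: (ae_filter_ringOfSetsType mu). Qed.

Lemma aeS2 (P1 P2 Q : R -> Prop) : (forall x, P1 x -> P2 x -> Q x) ->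
  {ae mu, forall x, P1 x} -> {ae mu, forall x, P2 x} -> {ae mu, forall x, Q x}.
Proof. by move=> PQ; apply: filterS2 => //; exact: (ae_filter_ringOfSetsType mu). Qed.

Lemma li_mf f : li f -> mf f. Proof. by case. Qed.
Lemma ig_li f : ig f -> li f.
Proof.
by move=> i; split; [exact: ig_mf|move=> a b; exact: integrableS i].
Qed.
Lemma liD f g : li f -> li g -> li (fun x => f x + g x).
Proof.
move=> [m1 h1] [m2 h2]; split; first exact: mfD.
by move=> a b; exact: (@integrableD _ _ _ mu _ (measurable_itv _) (EFin \o f) (EFin \o g)).
Qed.
Lemma liN f : li f -> li (fun x => - f x).
Proof.
move=> [m1 h1]; split; first exact: mfN.
by move=> a b; exact: (@integrableN _ _ _ mu _ (EFin \o f)).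
Qed.
Lemma liB f g : li f -> li g -> li (fun x => f x - g x).
Proof. by move=> h1 h2; exact: (liD h1 (liN h2)). Qed.
Lemma liZ k f : li f -> li (fun x => k * f x).
Proof.
move=> [m1 h1]; split; first by apply: mfM => //; exact: mf_cst.
by move=> a b; exact: (@integrableZl _ _ _ mu _ (measurable_itv _) k (EFin \o f)).
Qed.
Lemma li_le f g : mf f -> (forall x, `|f x| <= g x) -> li g -> li f.
Proof.
move=> m fg [_ h]; split=> // a b; apply: le_integrable (h a b) => //.
  by apply/measurable_EFinP; exact: measurable_funS m.
by move=> x _ /=; rewrite lee_fin (le_trans (fg x))// ler_norm.
Qed.
Lemma li_abs f : li f -> li (fun x => `|f x|).
Proof.
move=> [m h]; split; first exact: mf_abs.
by move=> a b; exact: (@integrable_norm _ _ _ mu _ f).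
Qed.
Lemma li_cont f : continuous f -> li f.
Proof.
move=> cf; split; first exact: mf_cont.
move=> a b; apply: continuous_compact_integrable; first exact: segment_compact.
exact: continuous_subspaceT.
Qed.

Definition lbd g := forall a b, exists K, forall x, a <= x <= b -> `|g x| <= K.

Lemma liM f g : li f -> mf g -> lbd g -> li (fun x => f x * g x).
Proof.
move=> [m h] mg bg; split; first exact: mfM.
move=> a b; have [K hK] := bg a b.
apply: (@le_integrable _ _ _ mu _ _ _ (EFin \o (fun x => K * f x))) => //.
- by apply/measurable_EFinP; apply: measurable_funS (mfM m mg).
- move=> x; rewrite /= in_itv/= => /hK gK.
  rewrite lee_fin mulrC !normrM ler_wpM2r// (le_trans gK)// ler_norm//.
- exact: (@integrableZl _ _ _ mu _ (measurable_itv _) K (EFin \o f)).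
Qed.

Lemma cont_lbd f : continuous f -> lbd f.
Proof.
move=> cf a b; have [ab|ba] := leP a b; last first.
  by exists 0 => x /andP[ax xb]; move: (le_trans ax xb); rewrite leNgt ba.
have cn : {within `[a, b], continuous (fun x => `|f x|)}.
  by apply: continuous_subspaceT => x; apply: continuous_comp; [exact: cf|exact: (@norm_continuous _ R)].
have [m mab hm] := EVT_max ab cn.
by exists `|f m| => x xab; apply: hm; rewrite in_itv.
Qed.

Lemma ioD a b f g : li f -> li g -> io a b (fun x => f x + g x) = io a b f + io a b g.
Proof. by move=> [_ h1] [_ h2]; rewrite /io RintegralD. Qed.
Lemma ioB a b f g : li f -> li g -> io a b (fun x => f x - g x) = io a b f - io a b g.
Proof. by move=> [_ h1] [_ h2]; rewrite /io RintegralB. Qed.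
Lemma ioZ a b k f : li f -> io a b (fun x => k * f x) = k * io a b f.
Proof. by move=> [_ h1]; rewrite /io RintegralZl. Qed.
Lemma io_le a b f g : li f -> li g -> (forall x, a <= x <= b -> f x <= g x) ->
  io a b f <= io a b g.
Proof.
move=> [_ h1] [_ h2] fg; by rewrite /io le_Rintegral.
Qed.
Lemma io_ge0 a b f : (forall x, a <= x <= b -> 0 <= f x) -> 0 <= io a b f.
Proof. by move=> f0; apply: Rintegral_ge0 => x /=; rewrite in_itv; exact: f0. Qed.
Lemma io_norm a b f : li f -> `|io a b f| <= io a b (fun x => `|f x|).
Proof. by move=> [_ h1]; exact: le_normr_Rintegral. Qed.
Lemma io_normle a b f g : li f -> li g -> (forall x, a <= x <= b -> `|f x| <= g x) ->
  `|io a b f| <= io a b g.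
Proof.
by move=> lf lg fg; rewrite (le_trans (io_norm _ _ lf))// io_le//; exact: li_abs.
Qed.
Lemma io_cst a b k : a <= b -> io a b (fun=> k) = k * (b - a).
Proof.
move=> ab; rewrite /io Rintegral_cst//= lebesgue_measure_itv/= lte_fin.
move: ab; rewrite le_eqVlt => /predU1P[->|->] //=; by rewrite ltxx subrr.
Qed.
Lemma io_pt a f : io a a f = 0.
Proof. by rewrite /io set_itv1 Rintegral_set1. Qed.
Lemma io_cat a b c f : li f -> a <= b -> b <= c -> io a c f = io a b f + io b c f.
Proof.
move=> [_ h] ab bc; apply/eqP; rewrite addrC -subr_eq; apply/eqP.
rewrite /io Rintegral_itvB ?bnd_simp//.
rewrite Rintegral_itv_obnd_cbnd//; apply: integrableS (h b c) => //.
by apply: subset_itvr; rewrite bnd_simp.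
Qed.
Lemma io_eq a b f g : (forall x, a <= x <= b -> f x = g x) -> io a b f = io a b g.
Proof. by move=> fg; apply: eq_Rintegral => x; rewrite inE/= in_itv => /fg. Qed.
Lemma io_le_It a b f : ig f -> (forall x, 0 <= f x) -> io a b f <= It f.
Proof.
move=> fi f0; rewrite /io /It Rintegral_mkcond; apply: It_le => //.
  by rewrite /ig -restrict_EFin; apply/integrable_restrict => //=; rewrite setTI; exact: integrableS fi.
by move=> x; rewrite patchE; case: ifP.
Qed.

End Integrals.

Ltac mfs := repeat first [ assumption | exact: mf_cst | exact: mf_id | apply: mf_exp
  | apply: mf_abs | apply: mf_sg | apply: mfD | apply: mfB | apply: mfM | apply: mfN | apply: mfX ].

(** * Absolutely continuous functions *)

Section AbsolutelyContinuous.
Context {R : realType}.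
Local Notation mu := (@lebesgue_measure R).
Implicit Types (f g F G : R -> R) (a b c : R).

(** The derivative is part of the data, as a chosen representative: calculus rules become rules on
    pairs, free of pointwise differentiability, and [ac_ae] says how far the second entry is
    determined. *)
Definition ac F f := li f /\ forall a b, a <= b -> F b - F a = io a b f.

(** Passage to the limit in dyadic schemes: an inequality with error [K / 2 ^+ n] for every n loses
    its error. *)
Lemma le_geom0 (x K : R) : (forall n : nat, x <= K / 2 ^+ n) -> x <= 0.
Proof.
move=> h; rewrite leNgt; apply/negP => x0.
have K0 : 0 < K by have := h 0%N; rewrite expr0 divr1; exact: lt_le_trans.
have := archi_boundP (ltW (divr_gt0 K0 x0)); set n := Num.bound _ => nK.
have := h n; rewrite leNgt => /negP; apply.
rewrite ltr_pdivrMr ?exprn_gt0// mulrC -ltr_pdivrMr//.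
apply: (lt_trans nK); rewrite -natrX ltr_nat; exact: ltn_expl.
Qed.

Lemma ac_li F f : ac F f -> li f. Proof. by case. Qed.

Lemma ac_cont F f : ac F f -> continuous F.
Proof.
move=> [[_ lf] h] x; have x1 : x - 1 < x + 1 by lra.
have := parameterized_integral_continuous (ltW x1) (lf (x - 1) (x + 1)).
move/(continuous_within_itvP _ x1) => [+ _ _] => /(_ x).
rewrite in_itv/=; have -> : x - 1 < x < x + 1 by apply/andP; split; lra.
move=> /(_ isT) /cvgrPdist_lt ci; apply/cvgrPdist_lt => /= e e0.
near=> z; have -> : F x - F z = io (x - 1) x f - io (x - 1) z f.
  rewrite -!h; first ring; last lra.
  by near: z; exists 1 => //= z' /=; rewrite ltr_norml => /andP[_]; lra.
by near: z; exact: ci.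
Unshelve. all: by end_near. Qed.

(** Splitting [a, b] where [m] takes its midpoint value halves the quadratic bound, so n splittings
    gain a factor 2^-n. This takes the place of differentiation theorems in the product and chain
    rules below. *)
Lemma quad_const (H m : R -> R) C A B : continuous m ->
  {homo m : x y / x <= y} ->
  (forall a b, A <= a -> a <= b -> b <= B -> `|H b - H a| <= C * (m b - m a) ^+ 2) ->
  A <= B -> H A = H B.
Proof.
move=> cm mm h AB.
have hn n : forall a b, A <= a -> a <= b -> b <= B ->
    `|H b - H a| <= (C / 2 ^+ n) * (m b - m a) ^+ 2.
  elim: n => [|n IH] a b Aa ab bB; first by rewrite expr0 divr1; exact: h.
  have mab := mm _ _ ab.
  have [|z zab mz] := @IVT _ m a b ((m a + m b) / 2) ab (continuous_subspaceT cm).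
    by rewrite min_l// max_r//; apply/andP; split; lra.
  move: zab; rewrite in_itv/= => /andP[az zb].
  have -> : H b - H a = (H b - H z) + (H z - H a) by ring.
  rewrite (le_trans (ler_normD _ _))//.
  rewrite (le_trans (lerD (IH _ _ (le_trans Aa az) zb bB) (IH _ _ Aa az (le_trans zb bB))))//.
  have -> : C / 2 ^+ n.+1 = C / 2 ^+ n / 2 by rewrite exprS invfM mulrA mulrAC.
  rewrite mz; set E := C / _; rewrite le_eqVlt; apply/orP; left; apply/eqP; by field.
have : `|H B - H A| <= 0.
  apply: (@le_geom0 _ (C * (m B - m A) ^+ 2)) => n.
  by rewrite (le_trans (hn n _ _ _ AB _))// mulrAC.
by rewrite normr_le0 subr_eq0 => /eqP.
Qed.

Definition prim f x := if 0 <= x then io 0 x f else - io x 0 f.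

Lemma ac_prim f : li f -> ac (prim f) f.
Proof.
move=> lf; split=> // a b ab; rewrite /prim.
case: (leP 0 a) => a0; case: (leP 0 b) => b0.
- by rewrite (io_cat lf a0 ab) addrC addKr.
- by move: (le_trans a0 ab); rewrite leNgt b0.
- by rewrite opprK (io_cat lf (ltW a0) b0) addrC.
- by rewrite opprK addrC (io_cat lf ab (ltW b0)) addrK.
Qed.

Lemma acD F f G g : ac F f -> ac G g -> ac (fun x => F x + G x) (fun x => f x + g x).
Proof.
move=> [lf h1] [lg h2]; split=> [|a b ab]; first exact: liD.
by rewrite ioD// -h1// -h2//; ring.
Qed.
Lemma acZ k F f : ac F f -> ac (fun x => k * F x) (fun x => k * f x).
Proof.
move=> [lf h1]; split=> [|a b ab]; first exact: liZ.
by rewrite ioZ// -h1//; ring.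
Qed.
Lemma acN F f : ac F f -> ac (fun x => - F x) (fun x => - f x).
Proof.
move=> h; have := acZ (-1) h.
by under eq_fun do rewrite mulN1r; under [X in ac _ X]eq_fun do rewrite mulN1r.
Qed.
Lemma acB F f G g : ac F f -> ac G g -> ac (fun x => F x - G x) (fun x => f x - g x).
Proof. by move=> h1 h2; exact: acD h1 (acN h2). Qed.
Lemma li_cst k : li (fun=> k : R).
Proof. by apply: li_cont => x; exact: cst_continuous. Qed.
Lemma ac_cst k : ac (fun=> k) (fun=> 0).
Proof.
split=> [|a b ab]; first exact: li_cst.
by rewrite io_cst// mul0r subrr.
Qed.
Lemma ac_id : ac (fun x => x) (fun=> 1).
Proof.
split=> [|a b ab]; first exact: li_cst.
by rewrite io_cst// mul1r.
Qed.

Lemma prim_homo f : li f -> (forall x, 0 <= f x) -> {homo prim f : x y / x <= y}.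
Proof.
move=> lf f0 x y xy; rewrite -subr_ge0 (ac_prim lf).2//.
by apply: io_ge0.
Qed.

Lemma io_mono a b c d f : li f -> (forall x, 0 <= f x) -> a <= b -> b <= c -> c <= d ->
  io b c f <= io a d f.
Proof.
move=> lf f0 ab bc cd; rewrite (io_cat lf ab (le_trans bc cd)) (io_cat lf bc cd).
have := @io_ge0 _ a b f (fun x _ => f0 x); have := @io_ge0 _ c d f (fun x _ => f0 x).
lra.
Qed.

Lemma ac_incr F f a b s : ac F f -> a <= s <= b -> `|F s - F a| <= io a b (fun x => `|f x|).
Proof.
move=> [lf h] /andP[as_ sb]; rewrite h// (le_trans (io_norm _ _ lf))//.
by apply: io_mono => //; exact: li_abs.
Qed.

Lemma liMc f G k : li f -> continuous G -> li (fun x => f x * (G x - k)).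
Proof.
move=> lf cG; have cGk : continuous (fun x => G x - k).
  by move=> x; apply: cvgB; [exact: cG|exact: cvg_cst].
by apply: liM => //; [exact: mf_cont|exact: cont_lbd].
Qed.

(** Subtract from the product a primitive of the candidate derivative. An increment of the result is
    the product of the two increments minus two integrals, of f and g against deviations from the
    left endpoint. Each of the three is at most the product of the masses of |f| and |g|, whence the
    constant 3, and [quad_const] applies. *)
Lemma ac_mul F f G g : ac F f -> ac G g ->
  ac (fun x => F x * G x) (fun x => f x * G x + F x * g x).
Proof.
move=> aF aG; have [lf hf] := aF; have [lg hg] := aG.
have cF := ac_cont aF; have cG := ac_cont aG.
have l1 : li (fun x => f x * G x) by apply: liM => //; [exact: mf_cont|exact: cont_lbd].
have l2 : li (fun x => F x * g x).
  have -> : (fun x => F x * g x) = (fun x => g x * F x) by apply/funext => x; rewrite mulrC.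
  by apply: liM => //; [exact: mf_cont|exact: cont_lbd].
split=> [|A B AB]; first exact: liD.
have lD := liD l1 l2.
rewrite -(ac_prim lD).2//; set h := (fun x => _ + _).
suff : F A * G A - prim h A = F B * G B - prim h B by move=> e; lra.
have lm : li (fun x => `|f x| + `|g x|) by apply: liD; exact: li_abs.
apply: (@quad_const (fun x => F x * G x - prim h x) (prim (fun x => `|f x| + `|g x|)) 3) => //.
- exact: (ac_cont (ac_prim lm)).
- by apply: prim_homo => // x; rewrite addr_ge0.
move=> a b Aa ab bB; rewrite (ac_prim lm).2// (ioD a b (li_abs lf) (li_abs lg)).
set mf_ := io a b (fun x => `|f x|); set mg_ := io a b (fun x => `|g x|).
have mf0 : 0 <= mf_ by apply: io_ge0.
have mg0 : 0 <= mg_ by apply: io_ge0.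
have dF s : a <= s <= b -> `|F s - F a| <= mf_ by exact: ac_incr.
have dG s : a <= s <= b -> `|G s - G a| <= mg_ by exact: ac_incr.
have lf1 : li (fun x => f x * (G x - G a)).
  exact: liMc.
have lg1 : li (fun x => g x * (F x - F a)).
  exact: liMc.
have -> : F b * G b - prim h b - (F a * G a - prim h a) =
    (F b - F a) * (G b - G a) - (io a b (fun x => f x * (G x - G a)) +
       io a b (fun x => g x * (F x - F a))).
  have -> : prim h b = prim h a + io a b h by rewrite -(ac_prim lD).2// addrC subrK.
  have -> : io a b h = io a b (fun x => G a * f x + F a * g x +
     (f x * (G x - G a) + g x * (F x - F a))).
    by apply: io_eq => x _; rewrite /h; ring.
  rewrite !ioD// ?ioZ//; try exact: liZ; try (by apply: liD => //; exact: liZ).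
  by rewrite -hf// -hg//; ring.
have i1 : `|io a b (fun x => f x * (G x - G a))| <= mg_ * mf_.
  rewrite /mf_ -(ioZ a b mg_ (li_abs lf)); apply: io_normle => //; first exact/liZ/li_abs.
  by move=> x xab; rewrite normrM mulrC ler_wpM2r// dG.
have i2 : `|io a b (fun x => g x * (F x - F a))| <= mf_ * mg_.
  rewrite /mg_ -(ioZ a b mf_ (li_abs lg)); apply: io_normle => //; first exact/liZ/li_abs.
  by move=> x xab; rewrite normrM mulrC ler_wpM2r// dF.
have i3 : `|(F b - F a) * (G b - G a)| <= mf_ * mg_.
  by rewrite normrM ler_pM// ?dF ?dG ?ab ?lexx.
rewrite (le_trans (ler_normB _ _))// (le_trans (lerD i3 (ler_normD _ _)))//.
nra.
Qed.

(* A quadratic remainder, uniform on bounded sets, is what the chain rule for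
   absolutely continuous functions needs. *)
Definition quadr (Phi phi : R -> R) := forall K, exists C, forall x y,
  `|x| <= K -> `|y| <= K -> `|Phi y - Phi x - phi x * (y - x)| <= C * (y - x) ^+ 2.

(** Adding the remainders based at [x] and at [y] leaves exactly the product of the increments of
    [phi] and of the argument. *)
Lemma quadr_lip Phi phi : quadr Phi phi -> forall K, exists C, 0 <= C /\ forall x y,
  `|x| <= K -> `|y| <= K -> `|phi y - phi x| <= C * `|y - x|.
Proof.
move=> q K; have [C hC] := q K; exists (2 * `|C|); split; first by rewrite mulr_ge0.
move=> x y xK yK; have [->|yx] := eqVneq y x; first by rewrite !subrr normr0 mulr0.
have p : 0 < `|y - x| by rewrite normr_gt0 subr_eq0.
rewrite -(ler_pM2r p) -normrM.
have h1 := hC _ _ xK yK; have h2 := hC _ _ yK xK.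
have -> : (phi y - phi x) * (y - x) = (Phi y - Phi x - phi x * (y - x)) + (Phi x - Phi y - phi y * (x - y)) by ring.
rewrite (le_trans (ler_normD _ _))// (le_trans (lerD h1 h2))//.
have -> : (x - y) ^+ 2 = (y - x) ^+ 2 by ring.
rewrite -mulrA -expr2 real_normK ?num_real//.
have := ler_norm C; have := sqr_ge0 (y - x); nra.
Qed.

Lemma quadr_cont Phi phi : quadr Phi phi -> continuous phi.
Proof.
move=> q x; apply/cvgrPdist_lt => e e0 /=.
have [C [C0 h]] := quadr_lip q (`|x| + 1).
near=> y; rewrite distrC; apply: (@le_lt_trans _ _ (C * `|y - x|)).
  apply: h; first by rewrite lerDl.
  have -> : y = (y - x) + x by ring.
  rewrite (le_trans (ler_normD _ _))// addrC lerD2l.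
  near: y; exists 1 => //= z /=; rewrite distrC => /ltW; done.
apply: (@le_lt_trans _ _ ((C + 1) * `|y - x|)); first by rewrite ler_wpM2r// lerDl.
rewrite mulrC -ltr_pdivlMr; last by lra.
near: y; exists (e / (C + 1)) => /=; first by rewrite divr_gt0//; lra.
by move=> z /=; rewrite distrC.
Unshelve. all: by end_near. Qed.

(** Same scheme as the product rule, relative to the mass of |f|: the error is the quadratic
    remainder of [Phi] plus the integral of f against the oscillation of [phi], which is locally
    Lipschitz. *)
Lemma ac_chain Phi phi F f : quadr Phi phi -> ac F f ->
  ac (fun x => Phi (F x)) (fun x => f x * phi (F x)).
Proof.
move=> q aF; have [lf hf] := aF; have cF := ac_cont aF.
have cphi := quadr_cont q.
have cpF : continuous (fun x => phi (F x)).
  by move=> x; apply: (@continuous_comp _ _ _ F phi); [exact: cF|exact: cphi].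
have lh : li (fun x => f x * phi (F x)).
  by apply: liM => //; [exact: mf_cont|exact: cont_lbd].
split=> // A B AB.
rewrite -(ac_prim lh).2//; set h := (fun x => _ * _).
suff : Phi (F A) - prim h A = Phi (F B) - prim h B by move=> e; lra.
have lm := li_abs lf.
have [K hK] := cont_lbd cF A B.
have [C1 hC1] := q K; have [C2 [C20 hC2]] := quadr_lip q K.
apply: (@quad_const (fun x => Phi (F x) - prim h x) (prim (fun x => `|f x|)) (`|C1| + C2)) => //.
- exact: (ac_cont (ac_prim lm)).
- exact: prim_homo.
move=> a b Aa ab bB; rewrite (ac_prim lm).2//.
set m := io a b (fun x => `|f x|).
have m0 : 0 <= m by apply: io_ge0.
have dF s : a <= s <= b -> `|F s - F a| <= m by exact: ac_incr.
have bK s : a <= s <= b -> `|F s| <= K.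
  by move=> /andP[as_ sb]; apply: hK; rewrite (le_trans Aa as_) (le_trans sb bB).
have aab : a <= a <= b by rewrite lexx.
have bab : a <= b <= b by rewrite lexx ab.
have l1 : li (fun x => f x * (phi (F x) - phi (F a))).
  exact: (liMc _ lf cpF).
have -> : Phi (F b) - prim h b - (Phi (F a) - prim h a) =
   (Phi (F b) - Phi (F a) - phi (F a) * (F b - F a)) - io a b (fun x => f x * (phi (F x) - phi (F a))).
  have -> : prim h b = prim h a + io a b h by rewrite -(ac_prim lh).2// addrC subrK.
  have -> : io a b h = io a b (fun x => phi (F a) * f x + f x * (phi (F x) - phi (F a))).
    by apply: io_eq => x _; rewrite /h; ring.
  by rewrite !ioD// ?ioZ//; [rewrite -hf//; ring|exact: liZ].
have i1 := hC1 _ _ (bK _ aab) (bK _ bab).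
have i2 : `|io a b (fun x => f x * (phi (F x) - phi (F a)))| <= (C2 * m) * m.
  rewrite /m -(ioZ a b (C2 * _) lm); apply: io_normle => //; first exact: liZ.
  move=> x xab; rewrite normrM mulrC ler_wpM2r// (le_trans (hC2 _ _ (bK _ aab) (bK _ xab)))//.
  by rewrite ler_wpM2l// dF.
have i3 : (F b - F a) ^+ 2 <= m ^+ 2.
  by rewrite -[X in X <= _]real_normK ?num_real// ler_sqr ?nnegrE// dF.
rewrite (le_trans (ler_normB _ _))// (le_trans (lerD i1 i2))//.
have := ler_norm C1; have := sqr_ge0 (F b - F a); have := normr_ge0 C1; nra.
Qed.

(** Mean value theorem applied twice; both intermediate points stay in [-K, K], where [psi] is
    bounded. *)
Lemma quadr_der (Phi phi psi : R -> R) : (forall x : R, is_derive x 1 Phi (phi x)) ->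
  (forall x : R, is_derive x 1 phi (psi x)) -> continuous psi -> quadr Phi phi.
Proof.
move=> d1 d2 cpsi K; have [C hC] := cont_lbd cpsi (- K) K; exists C.
have c1 : continuous Phi by move=> x; apply: differentiable_continuous; apply/derivable1_diffP; exact: (@ex_derive _ _ _ _ _ _ _ (d1 x)).
have c2 : continuous phi by move=> x; apply: differentiable_continuous; apply/derivable1_diffP; exact: (@ex_derive _ _ _ _ _ _ _ (d2 x)).
have mv (P p : R -> R) : continuous P -> (forall x : R, is_derive x 1 P (p x)) -> forall x y,
   exists2 z, P y - P x = p z * (y - x) & Num.min x y <= z <= Num.max x y.
  move=> cP dP x y; case: (leP x y) => xy.
    have [z zxy e] := MVT_segment xy (fun z _ => dP z) (continuous_subspaceT cP).
    by exists z => //; rewrite in_itv/= in zxy.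
  have [z zxy e] := MVT_segment (ltW xy) (fun z _ => dP z) (continuous_subspaceT cP).
  by exists z; [lra|rewrite in_itv/= in zxy].
move=> x y xK yK.
have [z -> zxy] := mv _ _ c1 d1 x y.
have [t e txz] := mv _ _ c2 d2 x z.
have -> : phi z * (y - x) - phi x * (y - x) = psi t * (z - x) * (y - x) by rewrite -e; ring.
rewrite !normrM -[X in _ <= C * X]real_normK ?num_real// expr2 mulrA.
move: xK yK; rewrite !ler_norml => /andP[x1 x2] /andP[y1 y2].
have zx : `|z - x| <= `|y - x|.
  move: zxy; case: (leP x y) => xy /andP[z1 z2].
    by rewrite !ger0_norm; lra.
  by rewrite !ler0_norm; lra.
have tK : `|psi t| <= C.
  apply: hC; move: txz zxy; case: (leP x y) => xy; case: (leP x z) => xz /andP[t1 t2] /andP[z1 z2]; lra.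
rewrite ler_wpM2r// ler_pM//.
Qed.

End AbsolutelyContinuous.

(** * Weak derivatives *)

Section WeakDerivatives.
Context {R : realType}.
Local Notation mu := (@lebesgue_measure R).
Implicit Types (f g F G phi chi : R -> R) (a b c : R).

Definition dr f f' := forall x : R, is_derive x 1 f (f' x).

Lemma dr_derivable f : (forall x : R, derivable f x 1) -> dr f (derive1 f).
Proof. by move=> d x; apply: DeriveDef => //; rewrite derive1E. Qed.
Lemma dr_derive1 f f' : dr f f' -> derive1 f = f'.
Proof. by move=> d; apply/funext => x; rewrite derive1E; apply: derive_val. Qed.
Lemma dr_ex f f' : dr f f' -> forall x, derivable f x 1.
Proof. by move=> d x; exact: ex_derive. Qed.
Lemma dr_cont f f' : dr f f' -> continuous f.
Proof. by move=> d x; apply: differentiable_continuous; apply/derivable1_diffP; exact: dr_ex d x. Qed.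
Lemma drM f f' g g' : dr f f' -> dr g g' -> dr (fun x => f x * g x) (fun x => f' x * g x + f x * g' x).
Proof.
move=> d1 d2 x; have := is_deriveM (d1 x) (d2 x).
by move/is_derive_eq; apply; rewrite addrC mulrC.
Qed.
Lemma drD f f' g g' : dr f f' -> dr g g' -> dr (fun x => f x + g x) (fun x => f' x + g' x).
Proof. by move=> d1 d2 x; exact: (is_deriveD (d1 x) (d2 x)). Qed.
Lemma dr_comp f f' g g' : dr f f' -> dr g g' -> dr (fun x => f (g x)) (fun x => f' (g x) * g' x).
Proof. by move=> d1 d2 x; exact: (is_derive1_comp (d1 (g x)) (d2 x)). Qed.
Lemma dr_cst k : dr (fun=> k) (fun=> 0).
Proof. by move=> x; exact: is_derive_cst. Qed.
Lemma dr_id : dr (fun x => x) (fun=> 1).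
Proof. by move=> x; exact: is_derive_id. Qed.
Lemma dr_aff k c : dr (fun x => k * x + c) (fun=> k).
Proof.
move=> x; have := drD (drM (dr_cst k) dr_id) (dr_cst c) x.
by move/is_derive_eq; apply; ring.
Qed.

(** [Ck n f] gives n + 1 derivatives, by recursion on the derivative: the shape in which closure
    under products and affine substitutions is an induction. It serves to show that products of
    rescaled cutoffs are test functions. *)
Fixpoint Ck n f := (forall x : R, derivable f x 1) /\
  if n is n'.+1 then Ck n' (derive1 f) else True.

Lemma CkP f : smooth f <-> forall n, Ck n f.
Proof.
split=> [sf n|h n].
  elim: n f sf => [|n IH] f sf; split; try exact: (sf 0%N); first exact: I.
  by apply: IH => k x; rewrite -derive1Sn; exact: sf.
move: (h n) => {h}; elim: n f => [|n IH] f; first by case.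
by move=> [_ h] x; rewrite derive1Sn; exact: IH.
Qed.

Lemma CkW n f : Ck n.+1 f -> Ck n f.
Proof.
elim: n f => [|n IH] f h; first by split; [exact: h.1|exact: I].
by split; [exact: h.1|exact: IH h.2].
Qed.

Lemma Ck_add n f g : Ck n f -> Ck n g -> Ck n (fun x => f x + g x).
Proof.
elim: n f g => [|n IH] f g [d1 h1] [d2 h2];
  split; try exact: (dr_ex (drD (dr_derivable d1) (dr_derivable d2))); first exact: I.
by rewrite (dr_derive1 (drD (dr_derivable d1) (dr_derivable d2))); exact: IH.
Qed.

Lemma Ck_mul n f g : Ck n f -> Ck n g -> Ck n (fun x => f x * g x).
Proof.
elim: n f g => [|n IH] f g.
  by move=> [d1 _] [d2 _]; split; last exact: I; exact: (dr_ex (drM (dr_derivable d1) (dr_derivable d2))).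
move=> k1 k2; have := CkW k1; have := CkW k2.
case: k1 => d1 h1; case: k2 => d2 h2 k2 k1; split.
  exact: (dr_ex (drM (dr_derivable d1) (dr_derivable d2))).
rewrite (dr_derive1 (drM (dr_derivable d1) (dr_derivable d2))).
by apply: Ck_add; exact: IH.
Qed.

Lemma Ck_cst n k : Ck n (fun=> k).
Proof.
elim: n k => [|n IH] k; split; try exact: (dr_ex (dr_cst k)); first exact: I.
by rewrite (dr_derive1 (dr_cst k)).
Qed.

Lemma Ck_aff n k c f : Ck n f -> Ck n (fun x => f (k * x + c)).
Proof.
elim: n f => [|n IH] f [d h];
  split; try exact: (dr_ex (dr_comp (dr_derivable d) (dr_aff k c))); first exact: I.
rewrite (dr_derive1 (dr_comp (dr_derivable d) (dr_aff k c))).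
by apply: Ck_mul; [exact: IH|exact: Ck_cst].
Qed.

Lemma smooth_dr f : smooth f -> dr f (derive1 f).
Proof. by move=> sf; apply: dr_derivable => x; exact: (sf 0%N). Qed.
Lemma smooth_derive f : smooth f -> smooth (derive1 f).
Proof. by move=> sf n x; rewrite -derive1Sn; exact: sf. Qed.
Lemma smooth_quadr f : smooth f -> quadr f (derive1 f).
Proof.
move=> sf; have s1 := smooth_derive sf; have s2 := smooth_derive s1.
exact: (quadr_der (smooth_dr sf) (smooth_dr s1) (dr_cont (smooth_dr s2))).
Qed.

Lemma quadr_ac f f' : quadr f f' -> ac f f'.
Proof.
move=> q; have := ac_chain q (@ac_id R).
by under [X in ac _ X]eq_fun do rewrite mul1r.
Qed.

Lemma It_io a b f : (forall x, ~ (a <= x <= b) -> f x = 0) -> It f = io a b f.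
Proof.
move=> h; rewrite /io Rintegral_mkcond /It; congr Rintegral; apply/funext => x.
by rewrite patchE; case: ifPn => // /negP; rewrite inE/= in_itv => /h ->.
Qed.

Lemma li_locally f : li f <-> locally_integrable setT f.
Proof.
split=> [[m h]|[m _ h]].
  split=> //; first exact: openT.
  move=> K _ cK; have [M [_ hM]] := compact_bounded cK.
  have KM : K `<=` `[- (M + 1), M + 1]%classic.
    by move=> x Kx; rewrite /= in_itv/= -ler_norml; apply: hM Kx; rewrite ltrDl.
  case/integrableP : (h (- (M + 1)) (M + 1)) => m' h'.
  rewrite (le_lt_trans _ h')//; apply: ge0_subset_integral => //.
  - exact: compact_measurable.
  - by apply: measurable_funS (mfE (mf_abs m)).
split=> // a b; apply/integrableP; split.
  by apply: measurable_funS (mfE m).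
by apply: h => //; exact: segment_compact.
Qed.

(** The difference quotients of a primitive are nonnegative and converge to [g] almost everywhere by
    Lebesgue differentiation. The primitive is started at -n, for every n, in order to reach all
    points. *)
Lemma io_ge0_ae g : li g -> (forall a b, a <= b -> 0 <= io a b g) ->
  {ae mu, forall x, 0 <= g x}.
Proof.
move=> lg g0; pose gn (n : nat) x := if - n%:R <= x then g x else 0.
have h (n : nat) : {ae mu, forall x, - n%:R < x -> 0 <= g x}.
  pose f x := g x * \1_(`[- n%:R, +oo[%classic) x.
  have lf : li f.
    apply: liM => //; first exact: measurable_indic.
    by move=> a b; exists 1 => x _; rewrite indicE; case: (_ \in _); rewrite ?normr1 ?normr0.
  have := @FTC1 R f (BLeft (- n%:R)).
  have intf y : mu.-integrable [set` Interval (BLeft (- n%:R)) (BRight y)] (EFin \o f) by exact: lf.2.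
  move=> /(_ intf); move/li_locally : (lf) => ll /(_ ll).
  apply: aeS => x /= hx nx; move: hx => /(_ _)[|dF F'].
    by rewrite lte_fin.
  have fx : f x = g x by rewrite /f indicE mem_set ?mulr1//= in_itv/= (ltW nx).
  rewrite -fx -F' derive1E; apply: limr_ge; first exact: dF.
  near=> t; rewrite /= /GRing.scale /= mulr1.
  have t0 : t != 0 by near: t; exact: nbhs_dnbhs_neq.
  have tn : - n%:R <= t + x.
    near: t; apply: nbhs_dnbhs; exists (x + n%:R) => /=; first lra.
    by move=> z /=; rewrite sub0r normrN ltr_norml => /andP[]; lra.
  have inc u v : - n%:R <= u -> u <= v -> io (- n%:R) u f <= io (- n%:R) v f.
    move=> nu uv; rewrite (io_cat lf nu uv) lerDl.
    rewrite (@io_eq _ _ _ f g); first exact: g0.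
    move=> z /andP[uz _]; rewrite /f indicE mem_set ?mulr1//= in_itv/= andbT.
    exact: le_trans uz.
  have [tp|tm] := ltP 0 t.
    rewrite mulr_ge0 ?invr_ge0 ?(ltW tp)// subr_ge0; apply: inc; lra.
  by rewrite mulr_le0// ?invr_le0// subr_le0; apply: inc; lra.
have := ae_foralln h; apply: filterS => x hx.
apply: (hx (Num.bound `|x|)); rewrite -ltrNl.
by rewrite (le_lt_trans (ler_norm _))// normrN archi_boundP.
Unshelve. all: by end_near. Qed.

Lemma io_eq_ae f g : li f -> li g -> (forall a b, a <= b -> io a b f = io a b g) ->
  ae_eq mu setT f g.
Proof.
move=> lf lg e.
have h1 : {ae mu, forall x, 0 <= f x - g x}.
  by apply: io_ge0_ae; [exact: liB|move=> a b ab; rewrite ioB// e// subrr].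
have h2 : {ae mu, forall x, 0 <= g x - f x}.
  by apply: io_ge0_ae; [exact: liB|move=> a b ab; rewrite ioB// e// subrr].
apply: aeS2 h1 h2 => x; rewrite !subr_ge0 => h1 h2 _.
by apply/eqP; rewrite eq_le h1 h2.
Qed.

Lemma ac_ae F f g : ac F f -> ac F g -> ae_eq mu setT f g.
Proof. by move=> [l1 h1] [l2 h2]; apply: io_eq_ae => // a b ab; rewrite -h1// h2. Qed.

Lemma li_ae f g : li f -> mf g -> ae_eq mu setT f g -> li g /\ forall a b, io a b f = io a b g.
Proof.
move=> [m h] mg fg.
have r a b : ig (f \_ `[a, b]).
  by rewrite /ig -restrict_EFin; apply/integrable_restrict => //=; rewrite setTI.
have r' a b := It_ae (r a b) (g := g \_ `[a, b]).
have {}r' a b : ig (g \_ `[a, b]) /\ It (f \_ `[a, b]) = It (g \_ `[a, b]).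
  apply: r'; first by apply/(measurable_restrictT _ _).1 => //; exact: measurable_funS mg.
  by apply: filterS fg => x e _; rewrite !patchE e.
split; last by move=> a b; rewrite /io (Rintegral_mkcond mu _ f) (Rintegral_mkcond mu _ g); exact: (r' a b).2.
split=> // a b; have := (r' a b).1; rewrite /ig -restrict_EFin.
by move/integrable_restrict; rewrite setTI; apply.
Qed.

Lemma ac_aer F f g : ac F f -> mf g -> ae_eq mu setT f g -> ac F g.
Proof.
move=> [lf h] mg fg; have [lg e] := li_ae lf mg fg.
by split=> // a b ab; rewrite h.
Qed.

Lemma ac_weak F f : ac F f -> weak_deriv F f.
Proof.
move=> aF; have cF := ac_cont aF; split.
- exact/li_locally/li_cont.
- exact/li_locally/(ac_li aF).
move=> phi [sphi [M hM]].
have ap := quadr_ac (smooth_quadr sphi).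
(* Strictly beyond M, so that [phi] vanishes near every point outside [-K, K] and its derivative
   vanishes there too. *)
pose K := `|M| + 1.
have MK : M < K by rewrite (le_lt_trans (ler_norm M))// ltrDl.
have z0 x : ~ (- K <= x <= K) -> phi x = 0.
  by move=> h; apply: hM; apply: (lt_trans MK); rewrite ltNge ler_norml; exact/negP.
have z1 x : ~ (- K <= x <= K) -> derive1 phi x = 0.
  move=> h; rewrite derive1E.
  have -> : 'D_1 phi x = 'D_1 (fun=> 0 : R) x; last by apply: derive_val.
  apply: near_eq_derive.
  have : K < `|x| by rewrite ltNge ler_norml; exact/negP.
  move=> Kx; near=> y; apply: hM; apply: (lt_trans MK).
  near: y; exists (`|x| - K) => /=; first lra.
  move=> y /=; have := ler_normD (x - y) y; rewrite subrK; lra.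
have := (ac_mul aF ap).2 (- K) K; rewrite -/K.
have K0 : - K <= K by rewrite /K; have := normr_ge0 M; lra.
move=> /(_ K0).
have e1 : phi K = 0.
  by apply: hM; rewrite ger0_norm//; rewrite /K; have := normr_ge0 M; lra.
have e2 : phi (- K) = 0.
  by apply: hM; rewrite normrN ger0_norm//; rewrite /K; have := normr_ge0 M; lra.
rewrite e1 e2 !mulr0 subrr ioD; last 2 first.
- by apply: liM; [exact: ac_li aF|exact: (mf_cont (ac_cont ap))|exact: (cont_lbd (ac_cont ap))].
- under eq_fun do rewrite mulrC.
  by apply: liM; [exact: ac_li ap|exact: mf_cont|exact: cont_lbd].
move=> /eqP; rewrite eq_sym addr_eq0 => /eqP e.
rewrite (_ : Rintegral _ _ _ = io (- K) K (fun x => F x * derive1 phi x)); last first.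
  by apply: It_io => x /z1 ->; rewrite mulr0.
rewrite -/(It (fun x => f x * phi x)) (@It_io (- K) K) ?e ?opprK// => x /z0 ->.
by rewrite mulr0.
Unshelve. all: by end_near. Qed.

Lemma cont_eps f x e : continuous f -> 0 < e ->
  exists2 d, 0 < d & forall y, `|y - x| < d -> `|f y - f x| < e.
Proof.
move=> cf e0; have /cvgrPdist_lt /(_ e e0) := cf x.
case=> d d0 h; exists d => // y yx; rewrite distrC; apply: h => /=.
by rewrite distrC.
Qed.

Lemma cont_lim_left f c k : continuous f -> (forall x, x < c -> f x = k) -> f c = k.
Proof.
move=> cf h; apply/eqP; rewrite -subr_eq0 -normr_le0; apply/ler_addgt0Pl => e e0.
have [d d0 hd] := cont_eps c cf e0.
have := hd (c - d / 2); rewrite h; last lra.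
move=> hh; rewrite addr0 distrC; apply: ltW; apply: hh.
by rewrite ltr_norml; apply/andP; split; lra.
Qed.

Lemma cont_lim_right f c k : continuous f -> (forall x, c < x -> f x = k) -> f c = k.
Proof.
move=> cf h; apply/eqP; rewrite -subr_eq0 -normr_le0; apply/ler_addgt0Pl => e e0.
have [d d0 hd] := cont_eps c cf e0.
have := hd (c + d / 2); rewrite h; last lra.
move=> hh; rewrite addr0 distrC; apply: ltW; apply: hh.
by rewrite ltr_norml; apply/andP; split; lra.
Qed.

Lemma derive1_locally_cst f x k d : 0 < d -> (forall y, `|y - x| < d -> f y = k) ->
  derive1 f x = 0.
Proof.
move=> d0 h; rewrite derive1E.
have -> : 'D_1 f x = 'D_1 (fun=> k : R) x; last by apply: derive_val.
by apply: near_eq_derive; exists d => // y /= yx; apply: h; rewrite distrC.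
Qed.

(** * The cutoff function and the regularity of weak derivatives *)

Section Cutoff.
Context (chi : R -> R) (chiP : cutoff chi).

Lemma chi_smooth : smooth chi. Proof. by case: chiP. Qed.
Lemma chi_cont : continuous chi. Proof. exact: dr_cont (smooth_dr chi_smooth). Qed.
Lemma chi_le0 x : x <= 0 -> chi x = 0.
Proof.
case: chiP => _ h _ _; rewrite le_eqVlt => /predU1P[->|]; last exact: h.
exact: cont_lim_left chi_cont _.
Qed.
Lemma chi_ge1 x : 1 <= x -> chi x = 1. Proof. by case: chiP => _ _ h _; exact: h. Qed.
Lemma dchi_ge0 x : 0 <= derive1 chi x. Proof. by case: chiP. Qed.
Lemma ac_chi : ac chi (derive1 chi). Proof. exact: quadr_ac (smooth_quadr chi_smooth). Qed.
Lemma chi_homo : {homo chi : x y / x <= y}.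
Proof.
move=> x y xy; rewrite -subr_ge0 ac_chi.2//; apply: io_ge0 => z _; exact: dchi_ge0.
Qed.
Lemma chi_01 x : 0 <= chi x <= 1.
Proof.
apply/andP; split.
  have [x0|/ltW x0] := leP x 0; first by rewrite chi_le0.
  by rewrite -(chi_le0 (lexx 0)) chi_homo.
have [x1|/ltW x1] := leP 1 x; first by rewrite chi_ge1.
by rewrite -(chi_ge1 (lexx 1)) chi_homo.
Qed.
(** Outside [0, 1] the cutoff is locally constant; the two endpoints follow by continuity of the
    derivatives. *)
Lemma dn_chi_out n x : x <= 0 \/ 1 <= x -> derive1n n.+1 chi x = 0.
Proof.
have c : forall k, continuous (derive1n k chi).
  by move=> k; apply: (@dr_cont _ (derive1 (derive1n k chi))); apply: dr_derivable => z; exact: chi_smooth.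
have lt0 k : forall z, z < 0 -> derive1n k chi z = 0.
  elim: k => [|k IH] z z0; first by case: chiP => _ h _ _; exact: h.
  rewrite derive1nS; apply: (@derive1_locally_cst _ _ 0 (- z)); first lra.
  by move=> w; rewrite ltr_norml => /andP[? ?]; apply: IH; lra.
have gt1 k : forall z, 1 < z -> derive1n k.+1 chi z = 0.
  elim: k => [|k IH] z z0; rewrite derive1nS.
    apply: (@derive1_locally_cst _ _ 1 (z - 1)); first lra.
    by move=> w; rewrite ltr_norml => /andP[? ?]; apply: chi_ge1; lra.
  apply: (@derive1_locally_cst _ _ 0 (z - 1)); first lra.
  by move=> w; rewrite ltr_norml => /andP[? ?]; apply: IH; lra.
case; rewrite le_eqVlt.
  by move=> /predU1P[->|]; [exact: (cont_lim_left (c _) (lt0 _))|exact: lt0].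
by move=> /predU1P[<-|]; [exact: (cont_lim_right (c _) (gt1 _))|exact: gt1].
Qed.

(* Tests the weak derivative against chi((x-a)/d) chi((b-x)/d), which tends to
   the indicator of [a, b] as d -> 0. *)
Lemma weak_ac f g : continuous f -> weak_deriv f g -> ac f g.
Proof.
move=> cf [_ /li_locally lg wd]; split=> // a b.
rewrite le_eqVlt => /predU1P[->|ab]; first by rewrite io_pt subrr.
have lin (e i1 i2 fa fb G1 G2 G3 g1 g3 m1 m3 : R) : `|i1 - fa| <= e -> `|i2 + fb| <= e ->
    `|g1 - G1| <= m1 -> `|g3 - G3| <= m3 -> m1 <= e -> m3 <= e ->
    i1 + i2 = - (g1 + (G2 + g3)) -> `|fb - fa - (G1 + (G2 + G3))| <= 4 * e.
  rewrite !ler_norml; clear; lra.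
apply/eqP; rewrite -subr_eq0 -normr_le0; apply/ler_addgt0Pl => e' e0'.
rewrite addr0; have [e ee e0] : exists2 e, e' = 4 * e & 0 < e.
  by exists (e' / 4); [field|lra].
have lag := li_abs lg; have cm := ac_cont (ac_prim lag).
set m := prim _ in cm.
have [d1 d10 h1] := cont_eps a cf e0; have [d2 d20 h2] := cont_eps b cf e0.
have [d3 d30 h3] := cont_eps a cm e0; have [d4 d40 h4] := cont_eps b cm e0.
pose D := Num.min (Num.min d1 d2) (Num.min d3 d4).
have D0 : 0 < D by rewrite !lt_min d10 d20 d30 d40.
(* Below the moduli of continuity, at both ends, of [f] and of the mass of |g|; at most a third of
   the interval, so that the two ramps do not meet. *)
pose d := Num.min (D / 2) ((b - a) / 3).
have d0 : 0 < d by rewrite lt_min; apply/andP; split; move: D0 ab; clear; lra.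
have dab : d <= (b - a) / 3 by rewrite ge_min lexx orbT.
have dD : d < D by rewrite gt_min; apply/orP; left; move: D0; clear; lra.
move: (dD); rewrite !lt_min => /andP[/andP[dd1 dd2] /andP[dd3 dd4]].
pose k := d^-1; have k0 : 0 < k by rewrite invr_gt0.
have kd : k * d = 1 by rewrite mulVf// gt_eqF.
pose A x := chi (k * x + - (k * a)); pose B x := chi (- k * x + k * b).
pose A' x := derive1 chi (k * x + - (k * a)) * k.
pose B' x := derive1 chi (- k * x + k * b) * - k.
have sC : smooth chi := chi_smooth.
have dA : dr A A' by exact: dr_comp (smooth_dr sC) (dr_aff k _).
have dB : dr B B' by exact: dr_comp (smooth_dr sC) (dr_aff (- k) _).
have sA : smooth A by apply/CkP => n; apply: Ck_aff; exact: (CkP chi).1.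
have sB : smooth B by apply/CkP => n; apply: Ck_aff; exact: (CkP chi).1.
have aA : ac A A' by rewrite -(dr_derive1 dA); exact: quadr_ac (smooth_quadr sA).
have aB : ac B B' by rewrite -(dr_derive1 dB); exact: quadr_ac (smooth_quadr sB).
pose phi x := A x * B x; pose phi' x := A' x * B x + A x * B' x.
have dphi : dr phi phi' by exact: drM.
have ephi : derive1 phi = phi' by exact: dr_derive1.
have kE x : k * x + - (k * a) = k * (x - a) by ring.
have kE' x : - k * x + k * b = k * (b - x) by ring.
have A0 x : x <= a -> A x = 0.
  by move=> xa; rewrite /A kE chi_le0// pmulr_rle0// subr_le0.
have B0 x : b <= x -> B x = 0.
  by move=> xa; rewrite /B kE' chi_le0// pmulr_rle0// subr_le0.
have A1 x : a + d <= x -> A x = 1.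
  by move=> xa; rewrite /A kE chi_ge1// -kd ler_pM2l// lerBrDl.
have B1 x : x <= b - d -> B x = 1.
  by move=> xa; rewrite /B kE' chi_ge1// -kd ler_pM2l// lerBrDr addrC -lerBrDr.
have A'0 x : x <= a \/ a + d <= x -> A' x = 0.
  move=> h; rewrite /A' kE -derive1n1 dn_chi_out ?mul0r//; case: h => h; [left|right].
    by rewrite pmulr_rle0// subr_le0.
  by rewrite -kd ler_pM2l// lerBrDl.
have B'0 x : b <= x \/ x <= b - d -> B' x = 0.
  move=> h; rewrite /B' kE' -derive1n1 dn_chi_out ?mul0r//; case: h => h; [left|right].
    by rewrite pmulr_rle0// subr_le0.
  by rewrite -kd ler_pM2l// lerBrDr addrC -lerBrDr.
have test : test_function phi.
  split; first by apply/CkP => n; apply: Ck_mul; [exact: (CkP A).1|exact: (CkP B).1].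
  exists (`|a| + `|b|) => x; rewrite /phi.
  have [xa|ax] := leP x a; first by rewrite A0// mul0r.
  have [bx|xb] := leP b x; first by rewrite B0// mulr0.
  move=> h; exfalso; move: h; apply/negP; rewrite -leNgt ler_norml.
  have := ler_norm b; have := ler_norm (- a); rewrite normrN.
  by have := normr_ge0 a; have := normr_ge0 b; move: ax xb; clear => ? ? ? ? ? ?; apply/andP; split; lra.
have := wd _ test; rewrite ephi.
rewrite -/(It (fun x => f x * phi' x)) -/(It (fun x => g x * phi x)).
have phi0 x : ~ (a <= x <= b) -> phi x = 0.
  move=> h; rewrite /phi; have [xa|ax] := leP x a; first by rewrite A0// mul0r.
  have [bx|xb] := leP b x; first by rewrite B0// mulr0.
  by exfalso; apply: h; rewrite !ltW.
have phi'0 x : ~ (a <= x <= b) -> phi' x = 0.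
  move=> h; rewrite /phi'; have [xa|ax] := leP x a.
    by rewrite A0// A'0 ?mul0r ?addr0//; left.
  have [bx|xb] := leP b x; first by rewrite B0// B'0 ?mulr0 ?addr0//; left.
  by exfalso; apply: h; rewrite !ltW.
rewrite (@It_io a b) => [|x /phi'0 ->]; last by rewrite mulr0.
rewrite (@It_io a b) => [|x /phi0 ->]; last by rewrite mulr0.
have lA' := ac_li aA; have lB' := ac_li aB.
have swap u : li u -> li (fun x => f x * u x).
  move=> lu; under eq_fun do rewrite mulrC.
  by apply: liM => //; [exact: mf_cont|exact: cont_lbd].
have cA := ac_cont aA; have cB := ac_cont aB.
have aphi := ac_mul aA aB.
have lphi' : li (fun x => f x * phi' x) by exact: swap (ac_li aphi).
have cphi := ac_cont aphi.
have lgp : li (fun x => g x * phi x).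
  by apply: liM => //; [exact: mf_cont|exact: cont_lbd].
have p1 : a <= a + d by rewrite lerDl ltW.
have p2 : a + d <= b - d by move: dab ab; clear; lra.
have p3 : b - d <= b by move: d0; clear; lra.
have p4 : a + d <= b by exact: le_trans p2 p3.
rewrite (io_cat lphi' p1 p4) (io_cat lphi' p2 p3) (io_cat lgp p1 p4) (io_cat lgp p2 p3).
rewrite (@io_eq _ (a + d) (b - d) _ (fun=> 0)) ?io_cst ?mul0r ?add0r//; last first.
  by move=> x /andP[h5 h6]; rewrite /phi' A'0 ?B'0 ?mul0r ?mulr0 ?addr0 ?mulr0//; right.
rewrite (@io_eq _ a (a + d) _ (fun x => f x * A' x)); last first.
  by move=> x /andP[h5 h6]; rewrite /phi' (B'0 x) ?B1 ?mulr0 ?addr0 ?mulr1//; [exact: le_trans h6 p2|right; exact: le_trans h6 p2].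
rewrite (@io_eq _ (b - d) b _ (fun x => f x * B' x)); last first.
  by move=> x /andP[h5 h6]; rewrite /phi' (A'0 x) ?A1 ?mul0r ?add0r ?mul1r//; [exact: le_trans p2 h5|right; exact: le_trans p2 h5].
rewrite (@io_eq _ (a + d) (b - d) (fun x => g x * phi x) g); last first.
  by move=> x /andP[h5 h6]; rewrite /phi A1// B1// !mulr1.
rewrite (io_cat lg p1 p4) (io_cat lg p2 p3).
(* [A'] is nonnegative with integral 1 over the ramp, so this integral is an average of [f] near
   [a]. The other ramp is treated in the same way, with the opposite sign. *)
have q1 : `|io a (a + d) (fun x => f x * A' x) - f a| <= e.
  have -> : f a = io a (a + d) (fun x => f a * A' x).
    by rewrite ioZ// -aA.2// A1// A0// subr0 mulr1.
  rewrite -ioB//; [|exact: swap|exact: liZ].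
  have -> : e = io a (a + d) (fun x => e * A' x).
    by rewrite ioZ// -aA.2// A1// A0// subr0 mulr1.
  apply: io_normle; [by apply: liB; [exact: swap|exact: liZ]|exact: liZ|].
  move=> x /andP[h5 h6]; rewrite -mulrBl normrM (ger0_norm (x := A' x)); last first.
    by rewrite mulr_ge0 ?dchi_ge0// ltW.
  rewrite ler_wpM2r ?mulr_ge0 ?dchi_ge0 ?(ltW k0)//; apply/ltW/h1.
  by move: h5 h6 dd1; clear => *; rewrite ger0_norm; lra.
have q2 : `|io (b - d) b (fun x => f x * B' x) + f b| <= e.
  have -> : f b = - io (b - d) b (fun x => f b * B' x).
    by rewrite ioZ// -aB.2// (B0 b)// (B1 (b - d))// sub0r mulrN1 opprK.
  rewrite -ioB//; [|exact: swap|exact: liZ].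
  have -> : e = io (b - d) b (fun x => - e * B' x).
    by rewrite ioZ// -aB.2// (B0 b)// (B1 (b - d))// sub0r mulrNN mulr1.
  apply: io_normle; [by apply: liB; [exact: swap|exact: liZ]|exact: liZ|].
  have B'le x : B' x <= 0 by rewrite mulr_ge0_le0 ?dchi_ge0// oppr_le0 ltW.
  move=> x /andP[h5 h6]; rewrite -mulrBl normrM (ler0_norm (B'le x)) mulNr -mulrN.
  rewrite ler_wpM2r ?oppr_ge0//; apply/ltW/h2.
  by move: h5 h6 dd2; clear => *; rewrite ler0_norm; lra.
have phi01 x : 0 <= phi x <= 1.
  have /andP[c1 c2] := chi_01 (k * x + - (k * a)); have /andP[c3 c4] := chi_01 (- k * x + k * b).
  by rewrite mulr_ge0//= -[1]mulr1 ler_pM.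
have gp u v : u <= v -> `|io u v (fun x => g x * phi x) - io u v g| <= m v - m u.
  move=> uv; rewrite -ioB// (ac_prim lag).2//; apply: io_normle => //; first exact: liB.
  move=> x _; rewrite -[X in _ - X]mulr1 -mulrBr normrM -[leRHS]mulr1 ler_wpM2l//.
  by have := phi01 x; rewrite ler_norml; clear; lra.
have q3 : m (a + d) - m a <= e.
  by rewrite (le_trans (ler_norm _))//; apply/ltW/h3; move: dd3 d0; clear => *; rewrite ger0_norm; lra.
have q4 : m b - m (b - d) <= e.
  rewrite -opprB (le_trans (ler_norm _))// normrN; apply/ltW/h4; move: dd4 d0; clear => *; rewrite ler0_norm; lra.
have q5 := gp _ _ p1; have q6 := gp _ _ p3.
move=> E; rewrite ee; exact: lin q1 q2 q5 q6 q3 q4 E.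
Qed.

(** [wD] is the value of a choice operator: the derivative [g] at hand makes the set of candidates
    inhabited, and [weak_ac] upgrades whatever was picked. *)
Lemma wD_ac f g : ac f g -> ac f (wD f) /\ ae_eq mu setT (wD f) g.
Proof.
move=> afg; have : ac f (wD f).
  apply: weak_ac; first exact: ac_cont afg.
  rewrite /wD; case: xgetP => [h _ //|/(_ g)]; case.
  exact: ac_weak.
by move=> h; split=> //; exact: ac_ae h afg.
Qed.

End Cutoff.

End WeakDerivatives.

(** * Real induction and Gronwall's inequality *)

Section Growth.
Context {R : realType}.
Implicit Types (t s : R) (phi : R -> R).

(** Continuous induction: closure from the left puts the supremum of the good times among the good
    times, and extension to the right excludes that it lies below T. *)
Lemma real_ind (T : R) (P : R -> Prop) : 0 <= T -> P 0 ->
  (forall t, 0 <= t < T -> (forall s, 0 <= s <= t -> P s) ->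
     exists2 d, 0 < d & forall s, t <= s <= t + d -> s <= T -> P s) ->
  (forall t, 0 < t <= T -> (forall s, 0 <= s < t -> P s) -> P t) ->
  forall t, 0 <= t <= T -> P t.
Proof.
move=> T0 P0 hr hl.
pose A := [set t | 0 <= t <= T /\ forall s, 0 <= s <= t -> P s].
have A0 : A 0 by split; [rewrite lexx|move=> s s0; rewrite (_ : s = 0)//; apply/eqP; rewrite eq_le andbC].
have ubA : ubound A T by move=> t [/andP[]].
have sA : has_sup A by split; [exists 0|exists T].
pose m := sup A.
have m0 : 0 <= m by exact: (ub_le_sup sA.2 A0).
have mT : m <= T by apply: ge_sup => //; exists 0.
have below s : 0 <= s < m -> P s.
  move=> /andP[s0 sm]; have [t [tT ht] st] := sup_gt (ex_intro _ _ A0) sm.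
  by apply: ht; rewrite s0 ltW.
have Pm : P m.
  move: m0; rewrite le_eqVlt => /predU1P[<-//|m0]; apply: hl => //.
  by rewrite m0.
have upto s : 0 <= s <= m -> P s.
  move=> /andP[s0]; rewrite le_eqVlt => /predU1P[->//|sm]; apply: below.
  by rewrite s0.
have mE : m = T.
  apply/eqP; rewrite eq_le mT leNgt; apply/negP => mlt.
  have [|d d0 hd] := hr m _ upto; first by rewrite m0.
  pose m' := Num.min (m + d) T.
  have mm' : m < m' by rewrite lt_min mlt ltrDl d0.
  have : A m'.
    split; first by rewrite (le_trans m0 (ltW mm')) ge_min lexx orbT.
    move=> s /andP[s0 sm']; have [sm|ms] := leP s m; first by apply: upto; rewrite s0.
    move: sm'; rewrite le_min => /andP[smd sT].
    by apply: hd => //; rewrite (ltW ms) smd.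
  by move/(ub_le_sup (proj2 sA)); rewrite leNgt mm'.
by move=> t; rewrite -{1}mE; exact: upto.
Qed.

(** The gap between [B] and [M] is what continuity needs: as long as [phi] is at most [M] it is at
    most [B], hence it stays at most [M] a little longer. *)
Lemma bootstrap (T M B : R) phi : 0 <= T -> B < M -> phi 0 <= M ->
  (forall t, 0 <= t <= T -> forall e, 0 < e -> exists2 d, 0 < d &
     forall s, 0 <= s <= T -> `|s - t| < d -> `|phi s - phi t| <= e) ->
  (forall t, 0 <= t <= T -> (forall s, 0 <= s <= t -> phi s <= M) -> phi t <= B) ->
  forall t, 0 <= t <= T -> phi t <= B.
Proof.
move=> T0 BM p0 cphi h.
suff H : forall t, 0 <= t <= T -> phi t <= M.
  move=> t /andP[t0 tT]; apply: h; first by rewrite t0.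
  by move=> s /andP[s0 st]; apply: H; rewrite s0 (le_trans st tT).
apply: real_ind => // t.
  move=> /andP[t0 tT] hs.
  have tT' : 0 <= t <= T by rewrite t0 ltW.
  have e0 : 0 < M - B by rewrite subr_gt0.
  have [d d0 hd] := cphi t tT' _ e0.
  exists (d / 2); first by rewrite divr_gt0.
  move=> s /andP[ts sd] sT.
  have := hd s; rewrite (le_trans t0 ts) sT => /(_ isT).
  have -> : `|s - t| < d by move: ts sd d0; clear => *; rewrite ger0_norm; lra.
  move=> /(_ isT); have := h t tT' hs.
  by have := ler_norm (phi s - phi t); clear; lra.
move=> /andP[t0 tT] hs; apply/ler_addgt0Pl => e e0.
have [d d0 hd] := cphi t (introT andP (conj (ltW t0) tT)) _ e0.
pose s := Num.max 0 (t - d / 2).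
have s0 : 0 <= s by rewrite le_max lexx.
have st : s < t by rewrite gt_max t0; move: d0; clear; lra.
have sd : t - d / 2 <= s by rewrite le_max lexx orbT.
have := hd s; rewrite s0 (le_trans (ltW st) tT) => /(_ isT).
have -> : `|s - t| < d by move: st sd d0; clear => *; rewrite ltr0_norm; lra.
have := hs s; rewrite s0 st => /(_ isT) ? /(_ isT) h1.
by have := ler_norm (phi t - phi s); rewrite distrC; move: h1; lra.
Qed.

(** The hypothesis is on increments, on both sides of each time, so it applies to norms of curves.
    [phi] is compared by continuous induction with [psi], which starts e higher and grows with a
    margin over the rate allowed to [phi], enough to absorb the error e; then e tends to 0. *)
Lemma gronwall (T L K : R) phi : 0 <= T -> 0 <= L -> 0 <= K ->
  (forall t, 0 <= t <= T -> 0 <= phi t) ->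
  (forall t, 0 <= t <= T -> forall e, 0 < e -> exists2 d, 0 < d &
     forall s, 0 <= s <= T -> `|s - t| < d ->
       `|phi s - phi t| <= `|s - t| * (L * phi t + K + e)) ->
  forall t, 0 <= t <= T -> phi t <= (phi 0 + K * t) * expR (L * t).
Proof.
move=> T0 L0 K0 p0 h.
have key e : 0 < e -> forall t, 0 <= t <= T ->
    phi t <= (phi 0 + e + (K + 2 * e) * t) * expR (L * t).
  move=> e0; pose A := phi 0 + e; pose B := K + 2 * e.
  have A0 : 0 <= A by rewrite addr_ge0 ?p0 ?lexx// ltW.
  have B0 : 0 <= B by rewrite /B; move: K0 e0; clear; lra.
  pose psi t := (A + B * t) * expR (L * t).
  have psi_ge0 t : 0 <= t -> 0 <= psi t.
    by move=> t0; rewrite mulr_ge0 ?expR_ge0// addr_ge0// mulr_ge0.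
  have inc t s : 0 <= t -> t <= s -> psi t + (s - t) * (L * psi t + B) <= psi s.
    move=> t0 ts.
    have e1 : expR (L * t) * (1 + L * (s - t)) <= expR (L * s).
      have -> : L * s = L * t + L * (s - t) by ring.
      by rewrite expRD ler_wpM2l ?expR_ge0// expR_ge1Dx.
    have e2 : 1 <= expR (L * s).
      by rewrite -expR0 ler_expR mulr_ge0// (le_trans t0 ts).
    have st0 : 0 <= s - t by rewrite subr_ge0.
    rewrite /psi; have -> : (A + B * s) * expR (L * s) =
      (A + B * t) * expR (L * s) + B * (s - t) * expR (L * s) by ring.
    have AB : 0 <= A + B * t by rewrite addr_ge0// mulr_ge0.
    have := ler_wpM2l AB e1; have := ler_wpM2l (mulr_ge0 B0 st0) e2.
    by set E1 := expR _; set E2 := expR _; clear; nra.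
  have mono t s : 0 <= t -> t <= s -> psi t <= psi s.
    move=> t0 ts; apply: le_trans (inc _ _ t0 ts).
    by rewrite lerDl mulr_ge0 ?subr_ge0// addr_ge0// mulr_ge0// psi_ge0.
  apply: real_ind => //.
    by rewrite !mulr0 expR0 mulr1 addr0 lerDl ltW.
  - move=> t /andP[t0 tT] hs.
    have pt : phi t <= psi t by apply: hs; rewrite t0 lexx.
    have [d d0 hd] := h t (introT andP (conj t0 (ltW tT))) _ e0.
    exists (d / 2); first by rewrite divr_gt0.
    move=> s /andP[ts sd] sT; apply: le_trans (inc _ _ t0 ts).
    have := hd s; rewrite (le_trans t0 ts) sT => /(_ isT).
    have -> : `|s - t| < d by move: ts sd d0; clear => *; rewrite ger0_norm; lra.
    have st0 : 0 <= s - t by rewrite subr_ge0.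
    rewrite (ger0_norm st0) => /(_ isT) h1.
    have h2 : (s - t) * (L * phi t + K + e) <= (s - t) * (L * psi t + B).
      apply: ler_wpM2l => //; rewrite /B; have := ler_wpM2l L0 pt.
      by move: e0; clear; lra.
    by have := ler_norm (phi s - phi t); move: h1 h2 pt; clear; lra.
  - move=> t /andP[t0 tT] hs.
    have tT' : 0 <= t <= T by rewrite tT ltW.
    apply/ler_addgt0Pl => e' e0'.
    have [d d0 hd] := h t tT' 1 ltr01.
    pose C := L * phi t + K + 1.
    have C0 : 0 < C by rewrite /C ltr_wpDl// addr_ge0// mulr_ge0// p0.
    pose d' := Num.min (d / 2) (e' / C).
    have d0' : 0 < d' by rewrite lt_min !divr_gt0.
    pose s := Num.max 0 (t - d').
    have s0 : 0 <= s by rewrite le_max lexx.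
    have st : s < t by rewrite gt_max t0; move: d0'; clear; lra.
    have sd : t - d' <= s by rewrite le_max lexx orbT.
    have sd2 : t - s <= d / 2.
      have : d' <= d / 2 by rewrite ge_min lexx.
      by move: sd; clear; lra.
    have sd3 : (t - s) * C <= e'.
      rewrite -ler_pdivlMr//; have : d' <= e' / C by rewrite ge_min lexx orbT.
      by move: sd; clear; lra.
    have := hd s; rewrite s0 (le_trans (ltW st) tT) => /(_ isT).
    have st0 : s - t < 0 by rewrite subr_lt0.
    rewrite (ltr0_norm st0) opprB => /(_ _)h1.
    have {}h1 := h1 ltac:(move: sd2 d0; clear; lra).
    have := hs s; rewrite s0 st => /(_ isT) h2; rewrite -/(psi s) -/(psi t) in h2 *.
    have h3 := mono _ _ s0 (ltW st).
    have := ler_norm (phi t - phi s); rewrite distrC.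
    by move: h1 h2 h3 sd3; rewrite -/C; clear; lra.
move=> t tT; apply/ler_addgt0Pl => e e0.
have t0 : 0 <= t by case/andP: tT.
pose E := (1 + 2 * t) * expR (L * t).
have E0 : 0 < E by rewrite mulr_gt0 ?expR_gt0//; move: t0; clear; lra.
have := key (e / E) (divr_gt0 e0 E0) t tT; move=> h1; apply: (le_trans h1); rewrite le_eqVlt; apply/orP; left; apply/eqP.
have -> : (phi 0 + e / E + (K + 2 * (e / E)) * t) * expR (L * t) =
  e / E * E + (phi 0 + K * t) * expR (L * t) by rewrite /E; ring.
by rewrite divfK// gt_eqF.
Qed.

End Growth.

(** * Differential equations in seminormed spaces *)

Section ZmodIdentities.
Variable V : zmodType.
Implicit Types a b c d u v x y : V.
Lemma zid1 y a b x c : y + a + b - (x + c) = y - x + (a + a - c) + (b - a).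
Proof. by rewrite opprD !addrA [RHS](ACl (1*3*6*2*5*(4*7)))%AC/= subrr addr0. Qed.
Lemma zid2 x y u v c d a :
  y - x - a = y - v - (x - u) + (v - u - c) + (c - d + (d - a)).
Proof.
rewrite opprB !addrA [RHS](ACl (1*4*11*(2*5)*(3*6)*(7*8)*(9*10)))%AC/=.
by rewrite !addNr subrr !addr0.
Qed.
End ZmodIdentities.

Section EulerArithmetic.
Context {R : realType}.
Implicit Types a b c d g k l m q u v w : R.
Lemma euler_ar1 w u v l : 0 <= l -> w <= l * u -> u <= v -> w + u <= (1 + l) * v.
Proof. by move=> l0 wu uv; have := ler_wpM2l l0 uv; lra. Qed.
Lemma euler_ar2 a b q w c : 0 <= a -> 1 <= (1 + a) * b -> 0 <= q -> w <= b * (c * q) ->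
  (1 + a) * w + q <= (1 + a) * b * ((c + 1) * q).
Proof.
move=> a0 p1 q0 h; have a1 : 0 <= 1 + a by rewrite addr_ge0.
have := ler_wpM2l a1 h; have := ler_wpM2r q0 p1; lra.
Qed.
Lemma euler_ar3 g l k m a b c : 0 <= g -> 0 <= l -> 0 <= k -> 0 <= m ->
  a <= l * k * m ^+ 2 -> b <= l * c -> c <= m * k -> a + g * b <= l * k * (m + g) ^+ 2.
Proof.
move=> g0 l0 k0 m0 h1 h2 h3.
have := ler_wpM2l g0 h2; have := ler_wpM2l (mulr_ge0 g0 l0) h3.
have : 0 <= l * k * (m * g) by rewrite !mulr_ge0.
have : 0 <= l * k * (g ^+ 2) by rewrite !mulr_ge0.
lra.
Qed.
End EulerArithmetic.

Section Seminormed.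
Context {R : realType} {W : lmodType R}.
Implicit Types (S : set W) (N : W -> R) (x y : W).

(** The norms in use are meaningful only on a subspace [S] of the module of all functions or tuples.
    They are seminorms, since functions equal almost everywhere remain distinct elements. *)
Record seminormed S N : Prop := Seminormed {
  sn0 : S 0;
  snD : forall x y, S x -> S y -> S (x + y);
  snZ : forall (a : R) x, S x -> S (a *: x);
  sn_ge0 : forall x, S x -> 0 <= N x;
  sn_triangle : forall x y, S x -> S y -> N (x + y) <= N x + N y;
  sn_scale : forall (a : R) x, S x -> N (a *: x) = `|a| * N x }.

(** Differentiability in little-o form, without quotients; times are nonnegative, so it is one-sided
    at 0. *)
Definition tdiff N (u : R -> W) (t : R) (du : W) :=
  forall e, 0 < e -> exists2 d, 0 < d & forall s, 0 <= s -> `|s - t| < d ->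
    N (u s - u t - (s - t) *: du) <= e * `|s - t|.

Section Theory.
Variables (S : set W) (N : W -> R) (sn : seminormed S N).

Lemma snN x : S x -> S (- x).
Proof. by move=> Sx; rewrite -scaleN1r; exact: snZ sn _ _ Sx. Qed.
Lemma snB x y : S x -> S y -> S (x - y).
Proof. by move=> Sx Sy; apply: (snD sn) => //; exact: snN. Qed.
Lemma sn_opp x : S x -> N (- x) = N x.
Proof. by move=> Sx; rewrite -scaleN1r (sn_scale sn)// normrN normr1 mul1r. Qed.
Lemma sn_dist x y : S x -> S y -> N (x - y) = N (y - x).
Proof. by move=> Sx Sy; rewrite -opprB sn_opp//; exact: snB. Qed.
Lemma sn_zero : N 0 = 0.
Proof. by rewrite -(scale0r (0 : W)) (sn_scale sn) ?normr0 ?mul0r//; exact: sn0 sn. Qed.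
Lemma sn_sub x y : S x -> S y -> N (x - y) <= N x + N y.
Proof.
by move=> Sx Sy; rewrite (le_trans (sn_triangle sn Sx (snN Sy)))// sn_opp.
Qed.
Lemma sn_tri x y z : S x -> S y -> S z -> N (x - z) <= N (x - y) + N (y - z).
Proof.
move=> Sx Sy Sz; rewrite -[X in N X](_ : x - y + (y - z) = _); first exact: (sn_triangle sn (snB Sx Sy) (snB Sy Sz)).
by rewrite addrA subrK.
Qed.
Lemma sn_abs_sub x y : S x -> S y -> `|N x - N y| <= N (x - y).
Proof.
move=> Sx Sy; have := sn_triangle sn (snB Sx Sy) Sy; rewrite subrK => h1.
have := sn_triangle sn (snB Sy Sx) Sx; rewrite subrK => h2.
by rewrite (sn_dist Sy Sx) in h2; rewrite ler_norml; move: h1 h2; clear; lra.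
Qed.

Lemma tdiff_lip u t du : S (u t) -> S du -> (forall s, 0 <= s -> S (u s)) -> tdiff N u t du ->
  forall e, 0 < e -> exists2 d, 0 < d & forall s, 0 <= s -> `|s - t| < d ->
    `|N (u s) - N (u t)| <= `|s - t| * (N du + e).
Proof.
move=> Sut Sdu Su td e e0; have [d d0 hd] := td _ e0; exists d => // s s0 sd.
rewrite (le_trans (sn_abs_sub (Su _ s0) Sut))//.
have Sz : S ((s - t) *: du) by exact: snZ sn _ _ Sdu.
have := sn_triangle sn (snB (snB (Su _ s0) Sut) Sz) Sz.
rewrite subrK => /le_trans; apply; rewrite (sn_scale sn)// mulrDr addrC lerD2l.
by rewrite (le_trans (hd _ s0 sd))// mulrC.
Qed.

Lemma tdiff_gronwall (T L K : R) u du : 0 <= T -> 0 <= L -> 0 <= K ->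
  (forall t, 0 <= t -> S (u t)) -> (forall t, 0 <= t -> S (du t)) ->
  (forall t, 0 <= t <= T -> tdiff N u t (du t)) ->
  (forall t, 0 <= t <= T -> N (du t) <= L * N (u t) + K) ->
  forall t, 0 <= t <= T -> N (u t) <= (N (u 0) + K * t) * expR (L * t).
Proof.
move=> T0 L0 K0 Su Sdu td h; apply: gronwall => //.
  by move=> t /andP[t0 _]; apply: (sn_ge0 sn); exact: Su.
move=> t tT e e0; have [t0 _] := andP tT.
have [d d0 hd] := tdiff_lip (Su _ t0) (Sdu _ t0) Su (td _ tT) e0.
exists d => // s /andP[s0 _] sd; rewrite (le_trans (hd _ s0 sd))//.
by rewrite ler_wpM2l// lerD2r h.
Qed.

(** Only sequences with geometrically decreasing increments are asked to converge, at the rate given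
    by the telescoping sum; Euler polygons with halved steps produce exactly these. *)
Definition sn_complete := forall (u : nat -> W) (C : R), (forall n, S (u n)) ->
  (forall n, N (u n.+1 - u n) <= C / 2 ^+ n) ->
  exists2 x, S x & forall n, N (x - u n) <= 2 * C / 2 ^+ n.

(** * Euler polygons for a globally Lipschitz right-hand side *)

Section Euler.
Hypothesis cmpl : sn_complete.
Variables (F : W -> W) (L : R).
Hypothesis SF : forall x, S x -> S (F x).
Hypothesis L0 : 0 <= L.
Hypothesis lipF : forall x y, S x -> S y -> N (F x - F y) <= L * N (x - y).
Variables (x0 : W) (Sx0 : S x0).

(** Step size, vertices of the n-th polygon, and the bound for [F] along polygons up to time T that
    [NF] establishes by a discrete Gronwall estimate. *)
Let h (n : nat) : R := (2 ^+ n)^-1.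
Let X n i := iter i (fun x => x + h n *: F x) x0.
Let K T := expR (L * T) * N (F x0).

Let h_gt0 n : 0 < h n. Proof. by rewrite invr_gt0 exprn_gt0. Qed.
Let h_le1 n : h n <= 1. Proof. by rewrite invf_le1 ?exprn_gt0// exprn_ege1// ler1n. Qed.
Let hS n : h n = 2 * h n.+1. Proof. by rewrite /h exprS invfM mulrA divff// mul1r. Qed.
Let K_ge0 T : 0 <= K T.
Proof. by rewrite mulr_ge0 ?expR_ge0// (sn_ge0 sn)//; exact: SF. Qed.
Let K_mono s t : s <= t -> K s <= K t.
Proof.
by move=> st; rewrite ler_wpM2r ?(sn_ge0 sn)// ?ler_expR ?ler_wpM2l//; exact: SF.
Qed.
Let SX n i : S (X n i).
Proof.
by elim: i => [|i IH] //=; apply: (snD sn) => //; apply: (snZ sn); exact: SF.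
Qed.
Let SFX n i : S (F (X n i)). Proof. exact: SF. Qed.
Let XS n i : X n i.+1 = X n i + h n *: F (X n i). Proof. by []. Qed.

Let pow_exp n i T : i%:R * h n <= T -> (1 + L * h n) ^+ i <= expR (L * T).
Proof.
move=> iT; apply: (@le_trans _ _ (expR (L * h n) ^+ i)).
  by rewrite lerXn2r ?nnegrE ?expR_ge0 ?addr_ge0 ?mulr_ge0 ?(ltW (h_gt0 _))// expR_ge1Dx.
by rewrite -expRM_natl ler_expR mulrCA ler_wpM2l.
Qed.

Let NF n i T : i%:R * h n <= T -> N (F (X n i)) <= K T.
Proof.
move=> iT; apply: (@le_trans _ _ ((1 + L * h n) ^+ i * N (F x0))); last first.
  by rewrite ler_wpM2r ?pow_exp// (sn_ge0 sn)//; exact: SF.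
elim: i {iT} => [|i IH]; first by rewrite expr0 mul1r.
have -> : F (X n i.+1) = (F (X n i.+1) - F (X n i)) + F (X n i) by rewrite subrK.
rewrite (le_trans (sn_triangle sn (snB (SFX _ _) (SFX _ _)) (SFX _ _)))//.
have := lipF (SX n i.+1) (SX n i).
rewrite XS [X n i + _]addrC addrK (sn_scale sn)// ger0_norm ?(ltW (h_gt0 _))// => l1.
rewrite exprS -mulrA; move: l1 IH; set u := N (F (X n i)); set v := _ * N (F x0).
have := mulr_ge0 L0 (ltW (h_gt0 n)); rewrite [X in N (F X - _)]addrC -XS mulrA; set Lh := L * h n => Lh0 l1 IH.
exact: euler_ar1 Lh0 l1 IH.
Qed.

(** Two half steps of the finer polygon against one step of the coarser: besides the Lipschitz
    growth of the gap there is only the change of [F] over half a step, at most L K h, times h. *)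
Let step n i T : i.+1%:R * h n <= T ->
  N (X n.+1 i.+1.*2 - X n i.+1) <= (1 + L * h n) * N (X n.+1 i.*2 - X n i) + L * h n ^+ 2 * K T.
Proof.
move=> iT; rewrite doubleS 2!XS.
set y := X n.+1 i.*2; set z := X n.+1 (i.*2).+1; set x := X n i.
have Sx : S x by exact: SX. have Sy : S y by exact: SX. have Sz : S z by exact: SX.
have hS2 : h n = h n.+1 + h n.+1 by rewrite hS mulr_natl mulr2n.
have -> : y + h n.+1 *: F y + h n.+1 *: F z - (x + h n *: F x) =
   (y - x) + h n *: (F y - F x) + h n.+1 *: (F z - F y).
  by rewrite !scalerBr [h n *: F y](_ : _ = h n.+1 *: F y + h n.+1 *: F y) ?zid1// -scalerDl -hS2.
have S1 : S (y - x) by exact: snB.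
have S2 : S (h n *: (F y - F x)) by apply: (snZ sn); apply: snB; exact: SF.
have S3 : S (h n.+1 *: (F z - F y)) by apply: (snZ sn); apply: snB; exact: SF.
rewrite (le_trans (sn_triangle sn (snD sn S1 S2) S3))//.
rewrite (le_trans (lerD (sn_triangle sn S1 S2) (lexx _)))//.
rewrite !(sn_scale sn); try by apply: snB; exact: SF.
rewrite !ger0_norm ?(ltW (h_gt0 _))//.
have l1 := lipF Sy Sx; have l2 := lipF Sz Sy.
have zy : z - y = h n.+1 *: F y by rewrite /z XS -/y addrC addKr.
rewrite zy (sn_scale sn) ?ger0_norm ?(ltW (h_gt0 _))// in l2; last exact: SF.
have l3 : N (F y) <= K T.
  apply: NF; apply: le_trans iT; rewrite (hS n) mulrA -natrM muln2.
  by rewrite ler_wpM2r ?(ltW (h_gt0 _))// ler_nat leq_double.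
have hh := hS n; have h0 := h_gt0 n.+1; rewrite hh; move: l1 l2 l3 L0 h0 (K_ge0 T).
set a := N (y - x); set b := N _; set c := N _; set d := N _; set g := h _; set k := K T.
clear => l1 l2 l3 L0 h0 K0.
have := ler_wpM2l (ltW h0) l1; have := ler_wpM2l (ltW h0) l2.
have gL : 0 <= g * L * g by rewrite !mulr_ge0// ltW.
by have := ler_wpM2l gL l3; have := mulr_ge0 gL K0; nra.
Qed.

Let cmp n i T : i%:R * h n <= T ->
  N (X n.+1 i.*2 - X n i) <= expR (L * T) * (L * T * K T) * h n.
Proof.
move=> iT; have T0 : 0 <= T by rewrite (le_trans _ iT)// mulr_ge0// ltW.
apply: (@le_trans _ _ ((1 + L * h n) ^+ i * (i%:R * (L * h n ^+ 2 * K T)))).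
  elim: i iT => [|i IH] iT; first by rewrite mul0r mulr0 subrr sn_zero.
  have iT' : i%:R * h n <= T.
    by apply: le_trans iT; rewrite ler_wpM2r ?ler_nat// ltW.
  rewrite (le_trans (step iT))//; have := IH iT'.
  have Lh : 0 <= L * h n by rewrite mulr_ge0// ltW.
  have p1 : 1 <= (1 + L * h n) ^+ i.+1 by rewrite exprn_ege1// lerDl.
  have q0 : 0 <= L * h n ^+ 2 * K T by exact: mulr_ge0 (mulr_ge0 L0 (sqr_ge0 _)) (K_ge0 T).
  move: p1; rewrite -natr1 [_ ^+ i.+1]exprS => p1 IHi; exact: euler_ar2 Lh p1 q0 IHi.
have hn0 := h_gt0 n.
have -> : expR (L * T) * (L * T * K T) * h n = expR (L * T) * (T * (L * h n * K T)) by ring.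
have Lh : 0 <= L * h n by exact: mulr_ge0 L0 (ltW hn0).
apply: ler_pM; [by rewrite exprn_ge0// addr_ge0| |exact: pow_exp|].
  by apply: mulr_ge0 => //; exact: mulr_ge0 (mulr_ge0 L0 (sqr_ge0 _)) (K_ge0 T).
have -> : i%:R * (L * h n ^+ 2 * K T) = (i%:R * h n) * (L * h n * K T) by ring.
rewrite ler_wpM2r//; exact: mulr_ge0 (mulr_ge0 L0 (ltW hn0)) (K_ge0 T).
Qed.

(** Second order closeness of a polygon to its initial tangent, with constants independent of n,
    hence inherited by the limit. *)
Let incr n i j T : (i <= j)%N -> j%:R * h n <= T ->
  N (X n j - X n i - ((j - i)%N%:R * h n) *: F (X n i)) <= L * K T * ((j - i)%N%:R * h n) ^+ 2 /\
  N (X n j - X n i) <= (j - i)%N%:R * h n * K T.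
Proof.
move=> ij; have -> : j = (i + (j - i))%N by rewrite subnKC.
rewrite addKn; move: (j - i)%N => k; elim: k => [|m IH] jT.
  by rewrite addn0 mul0r scale0r subr0 subrr sn_zero expr2 !mulr0 mul0r.
have hn0 := h_gt0 n.
have jT' : (i + m)%:R * h n <= T.
  by apply: le_trans jT; rewrite ler_wpM2r ?(ltW hn0)// ler_nat addnS.
have iT : i%:R * h n <= T.
  by apply: le_trans jT'; rewrite ler_wpM2r ?(ltW hn0)// ler_nat leq_addr.
have [IH1 IH2] := IH jT'; rewrite addnS XS.
set y := X n (i + m) in IH1 IH2 *; set x := X n i in IH1 IH2 *.
have Sx : S x by exact: SX. have Sy : S y by exact: SX.
have SFx : S (F x) by exact: SF. have SFy : S (F y) by exact: SF.
have l1 := lipF Sy Sx; have l2 : N (F y) <= K T by exact: NF.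
rewrite -natr1 mulrDl mul1r; set mh := m%:R * h n in IH1 IH2 *.
have mh0 : 0 <= mh by rewrite mulr_ge0// ltW.
have K0 := K_ge0 T.
split.
  have -> : y + h n *: F y - x - (mh + h n) *: F x = (y - x - mh *: F x) + h n *: (F y - F x).
    rewrite scalerDl scalerBr opprD !addrA; congr (_ - _).
    by rewrite (addrAC y) (addrAC (y - x)).
  have S1 : S (y - x - mh *: F x) by apply: snB; [exact: snB|exact: snZ sn _ _ SFx].
  have S2 : S (F y - F x) by exact: snB.
  rewrite (le_trans (sn_triangle sn S1 (snZ sn _ S2)))// (sn_scale sn)// (ger0_norm (ltW hn0)).
  exact: euler_ar3 (ltW hn0) L0 K0 mh0 IH1 l1 IH2.
rewrite addrAC (le_trans (sn_triangle sn (snB Sy Sx) (snZ sn _ SFy)))// (sn_scale sn)//.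
rewrite (ger0_norm (ltW hn0)) mulrDl lerD//.
by rewrite ler_wpM2l// ltW.
Qed.

Let j n (t : R) : nat := Num.truncn (t * 2 ^+ n).

Let jP n t : 0 <= t -> (j n t)%:R * h n <= t /\ t - (j n t)%:R * h n <= h n.
Proof.
move=> t0; have t1 : 0 <= t * 2 ^+ n by rewrite mulr_ge0// exprn_ge0.
have /andP[a b] := truncn_itv t1; rewrite -/(j n t) in a b.
have tE : t = t * 2 ^+ n * h n by rewrite mulfK// expf_neq0.
have h0 := h_gt0 n; split.
  by rewrite [leRHS]tE ler_wpM2r// ltW.
rewrite {1}tE -mulrBl -[leRHS]mul1r ler_wpM2r ?(ltW h0)//.
by rewrite lerBlDr addrC natr1 ltW.
Qed.

(** Refinement doubles the index of the last vertex before t, up to one extra half step. *)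
Let jS n t : 0 <= t -> j n.+1 t = (j n t).*2 \/ j n.+1 t = (j n t).*2.+1.
Proof.
move=> t0; have t1 k : 0 <= t * 2 ^+ k by rewrite mulr_ge0// exprn_ge0.
have /andP[a b] := truncn_itv (t1 n); have /andP[c d] := truncn_itv (t1 n.+1).
rewrite -/(j n t) in a b; rewrite -/(j n.+1 t) in c d.
have e : t * 2 ^+ n.+1 = 2 * (t * 2 ^+ n) by rewrite exprS mulrCA.
rewrite e in c d.
have h1 : ((j n t).*2 < (j n.+1 t).+1)%N.
  rewrite -(ltr_nat R) -muln2 natrM mulrC; apply: le_lt_trans d.
  by rewrite ler_wpM2l.
have h2 : (j n.+1 t < (j n t).+1.*2)%N.
  rewrite -(ltr_nat R) -muln2 natrM mulrC; apply: (le_lt_trans c).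
  by rewrite ltr_pM2l.
move: h1 h2; rewrite doubleS ltnS leq_eqVlt => /predU1P[<- _|h1 h2]; first by left.
by right; apply/eqP; rewrite eqn_leq h1 -ltnS h2.
Qed.

Let C T := expR (L * T) * (L * T * K T) + K T.

Let C_ge0 T : 0 <= T -> 0 <= C T.
Proof. move=> T0; apply: addr_ge0 (K_ge0 T).
exact: mulr_ge0 (expR_ge0 _) (mulr_ge0 (mulr_ge0 L0 T0) (K_ge0 T)). Qed.

Let cauchy t T n : 0 <= t -> t <= T -> N (X n.+1 (j n.+1 t) - X n (j n t)) <= C T / 2 ^+ n.
Proof.
move=> t0 tT; have [a b] := jP n t0.
have aT := le_trans a tT; have hn := h_gt0 n; have hn1 := h_gt0 n.+1.
have h1 := cmp aT.
have h2 : 0 <= K T * h n by rewrite mulr_ge0// ltW.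
rewrite -/(h n) /C mulrDl; case: (jS n t0) => ->.
  by rewrite (le_trans h1)// lerDl.
have -> : X n.+1 (j n t).*2.+1 - X n (j n t) =
  (X n.+1 (j n t).*2 - X n (j n t)) + h n.+1 *: F (X n.+1 (j n t).*2).
  by rewrite XS addrAC.
rewrite (le_trans (sn_triangle sn (snB (SX _ _) (SX _ _)) (snZ sn _ (SFX _ _))))//.
rewrite lerD// (sn_scale sn)// ger0_norm ?(ltW hn1)// mulrC ler_pM ?(ltW hn1)//.
- exact: (sn_ge0 sn).
- apply: NF; apply: le_trans aT; rewrite [in leRHS]hS mulrA -natrM muln2.
  by rewrite ler_wpM2r// ltW.
- by rewrite (hS n) mulr_natl mulr2n lerDl ltW.
Qed.

Lemma euler_solution : exists Y : R -> W, [/\ Y 0 = x0, forall t, 0 <= t -> S (Y t) &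
  forall t, 0 <= t -> exists2 C : R, 0 <= C & forall s, 0 <= s -> `|s - t| <= 1 ->
    N (Y s - Y t - (s - t) *: F (Y t)) <= C * (s - t) ^+ 2].
Proof.
have ex t : exists x, S x /\ (0 <= t -> forall n, N (x - X n (j n t)) <= 2 * C t / 2 ^+ n).
  have [t0|t0] := leP 0 t; last by exists x0; split.
  have [x Sx hx] := cmpl (fun n => SX n (j n t)) (fun n => cauchy n t0 (lexx t)).
  by exists x.
have [Y0 hY0] := choice ex.
(* The limit at time 0 is determined only up to seminorm zero, so the exact initial value is put in
   by hand. *)
pose Y t := if t == 0 then x0 else Y0 t.
have SY t : S (Y t) by rewrite /Y; case: eqP => _ //; case: (hY0 t).
have YX t T n : 0 <= t -> t <= T -> N (Y t - X n (j n t)) <= 2 * C T * h n.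
  move=> t0 tT; apply: (@le_trans _ _ (2 * C t * h n)); last first.
    rewrite ler_wpM2r ?(ltW (h_gt0 n))// ler_wpM2l// /C lerD ?K_mono//.
    have T0 := le_trans t0 tT.
    apply: ler_pM; [exact: expR_ge0|exact: mulr_ge0 (mulr_ge0 L0 t0) (K_ge0 t)| |].
      by rewrite ler_expR ler_wpM2l.
    by apply: ler_pM (K_mono tT); [exact: mulr_ge0|exact: K_ge0|exact: ler_wpM2l].
  rewrite /Y; case: eqP => [->|_]; last by case: (hY0 t) => _ /(_ t0 n).
  rewrite /j mul0r truncn0 /= subrr sn_zero !mulr_ge0 ?C_ge0//.
  exact: ltW.
exists Y; split; [by rewrite /Y eqxx|by move=> t _; exact: SY|].
have KF t T : 0 <= t -> t <= T -> N (F (Y t)) <= K T.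
  move=> t0 tT; rewrite -subr_le0; apply: (@le_geom0 _ _ (L * (2 * C T))) => n.
  have [a b] := jP n t0.
  have h1 : N (F (X n (j n t))) <= K T by apply: NF; exact: le_trans tT.
  have h2 := lipF (SY t) (SX n (j n t)); have h3 := ler_wpM2l L0 (YX t T n t0 tT).
  have := sn_triangle sn (snB (SF (SY t)) (SFX n (j n t))) (SFX n (j n t)).
  rewrite subrK -/(h n); move: h1 h2 h3; lra.
(* The limit inherits [incr]: at stage n the interpolation and convergence errors are all bounded by
   multiples of 2^-n. *)
have fwd s t T : 0 <= s -> s <= t -> t <= T ->
    N (Y t - Y s - (t - s) *: F (Y s)) <= L * K T * (t - s) ^+ 2.
  move=> s0 st tT; have t0 := le_trans s0 st; have sT := le_trans st tT.
  have T0 := le_trans t0 tT.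
  rewrite -subr_le0; apply: (@le_geom0 _ _ (4 * C T + (L * K T * (2 * (t - s) + 1) + K T + (t - s) * (L * (2 * C T))))) => n.
  rewrite -/(h n); have hn := h_gt0 n; have hn1 := h_le1 n.
  have [a1 a2] := jP n s0; have [b1 b2] := jP n t0.
  set is_ := j n s in a1 a2 *; set it := j n t in b1 b2 *.
  have ij : (is_ <= it)%N.
    by apply: le_truncn; rewrite ler_wpM2r// exprn_ge0.
  set m := (it - is_)%N%:R * h n.
  have mE : m = it%:R * h n - is_%:R * h n by rewrite /m natrB// mulrBl.
  have [h1 _] := incr ij (le_trans b1 tT); rewrite -/m in h1.
  have h2 := YX s T n s0 sT; have h3 := YX t T n t0 tT; rewrite -/is_ -/it in h2 h3.
  have h4 : N (F (X n is_)) <= K T by apply: NF; exact: le_trans sT.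
  have h5 := lipF (SX n is_) (SY s).
  rewrite (sn_dist (SX n is_) (SY s)) in h5.
  set y := Y t in h3 *; set x := Y s in h2 h5 *; set v := X n it in h1 h3; set u := X n is_ in h1 h2 h4 h5.
  have Sx : S x by exact: SY. have Sy : S y by exact: SY.
  have Su : S u by exact: SX. have Sv : S v by exact: SX.
  have -> : y - x - (t - s) *: F x = (y - v) - (x - u) + (v - u - m *: F u) +
      ((m - (t - s)) *: F u + (t - s) *: (F u - F x)).
    by rewrite [(m - (t - s)) *: _]scalerBl [_ *: (F u - F x)]scalerBr; exact: zid2.
  have S1 : S (y - v) by exact: snB. have S2 : S (x - u) by exact: snB.
  have S3 : S (v - u - m *: F u) by apply: snB; [exact: snB|apply: (snZ sn); exact: SF].
  have S4 : S ((m - (t - s)) *: F u) by apply: (snZ sn); exact: SF.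
  have S5 : S (F u - F x) by apply: snB; exact: SF.
  have t1 := sn_triangle sn (snD sn (snB S1 S2) S3) (snD sn S4 (snZ sn (t - s) S5)).
  have t2 := sn_triangle sn (snB S1 S2) S3; have t3 := sn_sub S1 S2.
  have t4 := sn_triangle sn S4 (snZ sn (t - s) S5).
  rewrite !(sn_scale sn) in t4; [|exact: S5|exact: SF].
  have ts0 : 0 <= t - s by rewrite subr_ge0.
  rewrite (ger0_norm ts0) in t4.
  have mts : `|m - (t - s)| <= h n.
    by rewrite mE ler_norml; move: a1 a2 b1 b2; lra.
  have p1 := ler_pM (normr_ge0 _) (sn_ge0 sn (SF Su)) mts h4.
  have p2 := ler_wpM2l ts0 (le_trans h5 (ler_wpM2l L0 h2)).
  have m0 : 0 <= m by rewrite mulr_ge0// ltW.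
  have mle : m <= (t - s) + h n by move: mts; rewrite ler_norml; lra.
  have p3 : L * K T * m ^+ 2 <= L * K T * ((t - s) ^+ 2 + (2 * (t - s) + 1) * h n).
    apply: ler_wpM2l; first by rewrite mulr_ge0.
    apply: (@le_trans _ _ ((t - s + h n) ^+ 2)).
      by rewrite lerXn2r ?nnegrE// addr_ge0// ltW.
    have : h n * h n <= h n by rewrite ler_piMl// ltW.
    by set g := h n; set w := t - s; nra.
  move: t1 t2 t3 t4 p1 p2 p3 h1 h2 h3; rewrite -/(h n).
  set n1 := N (_ + _); set n2 := N (_ + _); set n3 := N (_ + _).
  by lra.
move=> t t0; pose T := t + 1.
have tT : t <= T by rewrite /T lerDl.
have K0 := K_ge0 T.
have c0 : 0 <= L * (K T * (1 + L)) by exact: mulr_ge0 L0 (mulr_ge0 K0 (addr_ge0 ler01 L0)).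
exists (L * K T + L * (K T * (1 + L))).
  exact: addr_ge0 (mulr_ge0 L0 K0) c0.
move=> s s0 st1; have [ts|/ltW st] := leP t s.
  have sT : s <= T by move: st1; rewrite ler_norml /T; lra.
  apply: (le_trans (fwd _ _ _ t0 ts sT)); by rewrite ler_wpM2r ?sqr_ge0// lerDl.
have h1 := fwd _ _ _ s0 st tT.
have ts0 : 0 <= t - s by rewrite subr_ge0.
have ts1 : t - s <= 1 by move: st1; rewrite ler_norml; lra.
(* A backward increment reduces to the forward estimate started at s, at the price of replacing
   [F (Y s)] by [F (Y t)]. *)
have -> : Y s - Y t - (s - t) *: F (Y t) =
   - (Y t - Y s - (t - s) *: F (Y s)) + (t - s) *: (F (Y t) - F (Y s)).
  rewrite -(opprB t s) scaleNr opprK scalerBr !opprB addrA; set a := _ *: _; set b := _ *: _.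
  by rewrite [RHS]addrAC [X in _ = X - _ + _]addrC addrK.
have S0 := SF (SY s); have S1 := SF (SY t).
have S2 : S (Y t - Y s - (t - s) *: F (Y s)).
  by apply: snB; [exact: snB|exact: snZ sn _ _ S0].
have S3 : S (F (Y t) - F (Y s)) by exact: snB.
rewrite (le_trans (sn_triangle sn (snN S2) (snZ sn _ S3)))//.
rewrite (sn_opp S2) (sn_scale sn)// (ger0_norm ts0) (_ : (s - t) ^+ 2 = (t - s) ^+ 2); last ring.
rewrite [leRHS]mulrDl lerD//.
have h2 : N (Y t - Y s) <= (t - s) * (K T * (1 + L)).
  have := sn_triangle sn S2 (snZ sn (t - s) S0).
  rewrite subrK (sn_scale sn)// (ger0_norm ts0) => /le_trans; apply.
  have := KF s T s0 (le_trans st tT) => /(ler_wpM2l ts0) h2.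
  have h3 : (t - s) ^+ 2 <= t - s by rewrite expr2 ler_piMl.
  have := ler_wpM2l (mulr_ge0 L0 K0) h3.
  by move: h1 h2; set n1 := N _; lra.
have h3 := lipF (SY t) (SY s).
have := ler_wpM2l ts0 (le_trans h3 (ler_wpM2l L0 h2)).
by move=> /le_trans; apply; rewrite le_eqVlt; apply/orP; left; apply/eqP; ring.
Qed.

End Euler.
End Theory.
End Seminormed.

(** * Square-integrable functions *)

Section L2Space.
Context {R : realType}.
Local Notation mu := (@lebesgue_measure R).
Implicit Types (f g : R -> R).

Lemma L2P f : L2 f <-> mf f /\ ig (fun x => f x ^+ 2).
Proof.
split=> [Lf|[m i]].
  split; last exact: Lfun2_integrable_sqr Lf.
  by have := sub_Lfun_mfun Lf; rewrite inE.
rewrite /L2 /inLp /in_mem/=; apply/andP; split; first by rewrite inE.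
rewrite inE/= /finite_norm; apply: (@lty_poweRy _ _ 2) => //.
rewrite powR_Lnorm//; case/integrableP : i => _; apply: le_lt_trans.
rewrite le_eqVlt; apply/orP; left; apply/eqP; apply: eq_integral => x _ /=.
by rewrite powR_mulrn// real_normK ?num_real// ger0_norm// sqr_ge0.
Qed.

Lemma L2_mf f : L2 f -> mf f. Proof. by case/L2P. Qed.

Lemma L2norm_ge0 f : 0 <= L2norm f.
Proof. by rewrite /L2norm /Lpnorm fine_ge0// Lnorm_ge0. Qed.

Lemma L2normE f : L2 f -> L2norm f ^+ 2 = It (fun x => f x ^+ 2).
Proof.
move=> Lf; have [m i] := (L2P f).1 Lf.
have fin : ('N[mu]_2%:E[EFin \o f] \is a fin_num)%E.
  rewrite ge0_fin_numE ?Lnorm_ge0//.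
  by have := sub_Lfun_finLfun Lf; rewrite inE.
have := @powR_Lnorm _ _ _ mu (EFin \o f) 2 (lt0r_neq0 (ltr0Sn R 1)).
rewrite -(fineK fin) poweR_EFin powR_mulrn ?fine_ge0 ?Lnorm_ge0// => e.
rewrite /L2norm /Lpnorm /It /Rintegral -[LHS]/(fine (_ ^+ 2)%:E) e; congr fine.
apply: eq_integral => x _ /=.
by rewrite powR_mulrn// real_normK ?num_real.
Qed.

Let le12 : (1 <= 2%:E :> \bar R)%E. Proof. by rewrite lee_fin ler1n. Qed.

Lemma L2D f g : L2 f -> L2 g ->
  L2 (fun x => f x + g x) /\ L2norm (fun x => f x + g x) <= L2norm f + L2norm g.
Proof.
move=> Lf Lg; split.
  exact: (@rpredD _ (Lfun mu 2%:E) f g Lf Lg).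
exact: (ler_LnormD (Lfun_Sub le12 Lf) (Lfun_Sub le12 Lg)).
Qed.

Lemma L2Z (a : R) f : L2 f -> L2 (fun x => a * f x) /\ L2norm (fun x => a * f x) = `|a| * L2norm f.
Proof.
move=> Lf; have [m i] := (L2P f).1 Lf.
have La : L2 (fun x => a * f x).
  apply/L2P; split; first exact: mfM (mf_cst _) m.
  by under eq_fun do rewrite exprMn; exact: igZ.
split=> //; apply: (@pexpIrn _ 2) => //; rewrite ?nnegrE ?L2norm_ge0//.
  by rewrite mulr_ge0// L2norm_ge0.
rewrite L2normE// exprMn L2normE// real_normK ?num_real// -ItZ//.
by congr It; apply/funext => x; rewrite exprMn.
Qed.

Lemma L2_le f g : mf f -> L2 g -> (forall x, `|f x| <= `|g x|) ->
  L2 f /\ L2norm f <= L2norm g.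
Proof.
move=> m Lg fg; have [mg ig2] := (L2P g).1 Lg.
have sq x : f x ^+ 2 <= g x ^+ 2.
  by rewrite -(real_normK (num_real (f x))) -(real_normK (num_real (g x))) lerXn2r ?nnegrE.
have i : ig (fun x => f x ^+ 2).
  apply: ig_le ig2; first exact: mfX.
  by move=> x; rewrite ger0_norm ?sqr_ge0.
have Lf : L2 f by apply/L2P.
split=> //; rewrite -(@ler_pXn2r _ 2) ?nnegrE ?L2norm_ge0// !L2normE//.
exact: It_le.
Qed.

Lemma L2_ae f g : L2 f -> mf g -> ae_eq mu setT f g -> L2 g /\ L2norm f = L2norm g.
Proof.
move=> Lf mg fg; have [m i] := (L2P f).1 Lf.
have [|i' e] := It_ae i (mfX 2 mg).
  by apply: aeS fg => x h _; rewrite /= h.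
have Lg : L2 g by apply/L2P.
split=> //; apply: (@pexpIrn _ 2) => //; rewrite ?nnegrE ?L2norm_ge0//.
by rewrite !L2normE.
Qed.

Lemma L2_abs f : L2 f -> L2 (fun x => `|f x|) /\ L2norm (fun x => `|f x|) = L2norm f.
Proof.
move=> Lf; have m := mf_abs (L2_mf Lf).
have [|h1 h2] := L2_le m Lf; first by move=> x; rewrite normr_id.
have [|_ h3] := L2_le (L2_mf Lf) h1; first by move=> x; rewrite normr_id.
by split=> //; apply/eqP; rewrite eq_le h2 h3.
Qed.

Lemma L2_CS f g : L2 f -> L2 g ->
  ig (fun x => f x * g x) /\ It (fun x => `|f x * g x|) <= L2norm f * L2norm g.
Proof.
move=> Lf Lg; have [m i] := (L2P f).1 Lf; have [m' i'] := (L2P g).1 Lg.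
have ifg : ig (fun x => f x * g x) by have := Lfun2_mul_Lfun1 Lf Lg; move/Lfun1_integrable.
split=> //.
have h2 : (2^-1 + 2^-1 = 1 :> R) by rewrite -[RHS](divff (lt0r_neq0 (ltr0Sn R 1))) -mulr2n mulr_natl.
have := @hoelder _ _ R mu f g 2 2 m m' ltac:(by []) ltac:(by []) h2.
rewrite Lnorm1.
have fin F : L2 F -> ('N[mu]_2%:E[EFin \o F] = (L2norm F)%:E)%E.
  move=> LF; rewrite /L2norm /Lpnorm fineK// ge0_fin_numE ?Lnorm_ge0//.
  by have := sub_Lfun_finLfun LF; rewrite inE.
rewrite !fin// -EFinM.
rewrite -lee_fin /It /Rintegral fineK; first by [].
by apply: integrable_fin_num => //; exact: ig_abs ifg.
Qed.

(** Monotone convergence along [-n, n]: the way to integrability on the line from bounds uniform in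
    the segment. *)
Lemma ig_mono f C : mf f -> (forall x, 0 <= f x) ->
  (forall n : nat, mu.-integrable `[- n%:R, n%:R]%classic (EFin \o f)) ->
  (forall n : nat, io (- n%:R) n%:R f <= C) -> ig f /\ It f <= C.
Proof.
move=> m f0 il hC.
pose fn (n : nat) x := (EFin \o (f \_ `[- n%:R, n%:R])) x.
have mfn n : measurable_fun setT (fn n).
  apply: mfE; apply/(measurable_restrictT _ _).1 => //; exact: measurable_funS m.
have fn0 n x : setT x -> (0 <= fn n x)%E.
  by move=> _; rewrite /fn/= lee_fin patchE; case: ifP.
have nd x : setT x -> {homo fn^~ x : n k / (n <= k)%N >-> (n <= k)%E}.
  move=> _ n k nk; rewrite /fn/= lee_fin !patchE !mem_setE !in_itv/=.
  have nkR : n%:R <= k%:R :> R by rewrite ler_nat.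
  case: ifPn => [/andP[a b]|_]; last by case: ifP.
  by rewrite (le_trans _ a) ?lerN2//= (le_trans b).
have := @monotone_convergence _ _ R mu setT measurableT fn mfn fn0 nd.
have -> : (\int[mu]_x (fun x0 => limn (fn^~ x0)) x = \int[mu]_x (f x)%:E)%E.
  apply: eq_integral => x _; apply: lim_near_cst => //.
  exists (Num.bound `|x|) => //= n /= hn; rewrite /fn/= patchE mem_setE in_itv/=.
  have h : `|x| <= n%:R.
    by rewrite (le_trans (ltW (archi_boundP (normr_ge0 x))))// ler_nat.
  by rewrite -ler_norml h.
move=> e; have le : (\int[mu]_x (f x)%:E <= C%:E)%E.
  rewrite e; apply: lime_le.
    apply: ereal_nondecreasing_is_cvgn => n k nk; apply: ge0_le_integral => //.
    - exact: fn0.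
    - exact: mfn.
    - exact: mfn.
    - by move=> x Dx; exact: nd.
  apply: nearW => n; have := hC n; rewrite -lee_fin; apply: le_trans.
  rewrite /io Rintegral_mkcond /Rintegral fineK//.
  have ii : ig (f \_ `[- n%:R, n%:R]).
    by rewrite /ig -restrict_EFin; apply/integrable_restrict => //=; rewrite setTI.
  exact: (integrable_fin_num measurableT ii).
have i : ig f.
  apply/integrableP; split; first exact: mfE.
  apply: le_lt_trans (ltry C); apply: le_trans le.
  by rewrite le_eqVlt; apply/orP; left; apply/eqP/eq_integral => x _ /=; rewrite ger0_norm.
split=> //; rewrite -lee_fin /It /Rintegral fineK//.
exact: integrable_fin_num.
Qed.

Lemma tonelliR (k : R * R -> R) : measurable_fun setT k -> (forall z, 0 <= k z) ->
  (forall x, ig (fun y => k (x, y))) -> mf (fun x => It (fun y => k (x, y))).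
Proof.
move=> mk k0 ik.
have mk' : measurable_fun setT (EFin \o k) by apply/measurable_EFinP.
have := @measurable_fun_fubini_tonelli_F _ _ _ _ R mu (EFin \o k) mk' (fun z => k0 z).
by move=> h; have := measurableT_comp (fine_measurable measurableT) h.
Qed.

Lemma tonelli_swap (k : R * R -> R) : measurable_fun setT k -> (forall z, 0 <= k z) ->
  (forall x, ig (fun y => k (x, y))) -> (forall y, ig (fun x => k (x, y))) ->
  ig (fun y => It (fun x => k (x, y))) ->
  ig (fun x => It (fun y => k (x, y))) /\
  It (fun x => It (fun y => k (x, y))) = It (fun y => It (fun x => k (x, y))).
Proof.
move=> mk k0 i1 i2 i3; have m1 := tonelliR mk k0 i1.
have mk' : measurable_fun setT (EFin \o k) by apply/measurable_EFinP.
have := @fubini_tonelli _ _ _ _ R mu mu (EFin \o k) mk' (fun z => k0 z).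
have e1 : (\int[mu]_x \int[mu]_y (EFin \o k) (x, y) = \int[mu]_x (It (fun y => k (x, y)))%:E)%E.
  apply: eq_integral => x _; rewrite /It /Rintegral fineK//.
  by apply: integrable_fin_num => //; exact: (i1 x).
have e2 : (\int[mu]_y \int[mu]_x (EFin \o k) (x, y) = \int[mu]_y (It (fun x => k (x, y)))%:E)%E.
  apply: eq_integral => x _; rewrite /It /Rintegral fineK//.
  by apply: integrable_fin_num => //; exact: (i2 x).
rewrite e1 e2 => e; split; last by rewrite {1}/It {1}/Rintegral e.
apply/integrableP; split; first exact: mfE.
have := integrable_fin_num measurableT i3.
rewrite -e ge0_fin_numE; last by apply: integral_ge0 => x _; rewrite lee_fin; exact: It_ge0.
apply: le_lt_trans; rewrite le_eqVlt; apply/orP; left; apply/eqP/eq_integral => x _ /=.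
by rewrite ger0_norm//; exact: It_ge0.
Qed.

End L2Space.

(** * Convolution with the exponential kernel *)

Section ExponentialKernel.
Context {R : realType}.
Local Notation mu := (@lebesgue_measure R).
Implicit Types (f g y b : R -> R).

Lemma ac_comp_exp y b : ac y b -> ac (fun x => expR (y x)) (fun x => b x * expR (y x)).
Proof.
apply: ac_chain; apply: (@quadr_der _ _ _ expR) => //.
exact: continuous_expR.
Qed.

Lemma ac_homo y b : ac y b -> (forall x, 0 <= b x) -> {homo y : s t / s <= t}.
Proof. by move=> ay b0 s t st; rewrite -subr_ge0 ay.2//; exact: io_ge0. Qed.

(** Left of [x] the integrand is the derivative of exp(y(s) - y(x)), right of it the opposite of the
    derivative of exp(y(x) - y(s)); each half contributes at most 1. The bound does not depend on
    [y], which is why y_x times a constant is harmless in P and Q. *)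
Lemma kernel_int y b x : ac y b -> (forall s, 0 <= b s) ->
  ig (fun s => expR (- `|y x - y s|) * b s) /\
  It (fun s => expR (- `|y x - y s|) * b s) <= 2.
Proof.
move=> ay b0; have hy := ac_homo ay b0; have lb := ac_li ay; have cy := ac_cont ay.
pose h s := expR (- `|y x - y s|) * b s.
have mh : mf h.
  by have my := mf_cont cy; have mb := li_mf lb; rewrite /h; mfs.
have h0 s : 0 <= h s by rewrite mulr_ge0 ?expR_ge0.
have lh : li h.
  have e1 s : expR (- `|y x - y s|) <= 1 by rewrite -[leRHS]expR0 ler_expR oppr_le0.
  by apply: (li_le mh _ lb) => s; rewrite ger0_norm// ler_piMl// e1.
have left a : a <= x -> io a x h <= 1.
  move=> ax; have := ac_comp_exp (acB ay (ac_cst (y x))).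
  move=> /proj2/(_ a x ax); rewrite subrr expR0.
  rewrite (@io_eq _ _ _ _ h) => [<-|s /andP[_ sx]].
    by rewrite gerBl expR_ge0.
  by rewrite /h subr0 mulrC ger0_norm ?subr_ge0 ?hy// opprB.
have right a : x <= a -> io x a h <= 1.
  move=> ax; have := ac_comp_exp (acB (ac_cst (y x)) ay).
  move=> aE; have := (acN aE).2 x a ax; rewrite subrr expR0.
  rewrite (@io_eq _ _ _ _ h) => [<-|s /andP[xs _]].
    by have := expR_ge0 (y x - y a); lra.
  rewrite /h sub0r mulNr opprK mulrC ler0_norm ?subr_le0 ?hy// opprK.
  by congr (expR _ * _).
apply: ig_mono => // n; first exact: lh.2.
pose A := Num.min (- n%:R) x; pose B := Num.max n%:R x.
have nn : - n%:R <= n%:R :> R by rewrite (@le_trans _ _ 0)// oppr_le0.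
have Ax : A <= x by rewrite ge_min lexx orbT.
have xB : x <= B by rewrite le_max lexx orbT.
apply: (@le_trans _ _ (io A B h)).
  by apply: io_mono => //; rewrite ?ge_min ?le_max lexx.
rewrite (io_cat lh Ax xB).
by have := left _ Ax; have := right _ xB; lra.
Qed.

Definition ek (x : R) := expR (- `|x|).
Definition cv f (x : R) := It (fun s => ek (x - s) * f s).

Lemma ek_ge0 x : 0 <= ek x. Proof. exact: expR_ge0. Qed.
Lemma ek_gt0 x : 0 < ek x. Proof. exact: expR_gt0. Qed.
Lemma ek_le1 x : ek x <= 1.
Proof. by rewrite -expR0 ler_expR oppr_le0. Qed.
Lemma ekN x : ek (- x) = ek x. Proof. by rewrite /ek normrN. Qed.
Lemma ekC x s : ek (x - s) = ek (s - x). Proof. by rewrite -opprB ekN. Qed.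
Lemma ek_tri x s : ek x <= expR `|x - s| * ek s.
Proof.
rewrite /ek -expRD ler_expR.
by have := ler_normD (s - x) x; rewrite subrK (distrC s); lra.
Qed.
Lemma ek_cont x : continuous (fun s => ek (x - s)).
Proof.
move=> s; apply: (@continuous_comp _ _ _ (fun s => - `|x - s|) expR); last exact: continuous_expR.
apply: cvgN; apply: cvg_norm; apply: cvgB; [exact: cvg_cst|exact: cvg_id].
Qed.
Lemma mf_ek x : mf (fun s => ek (x - s)). Proof. exact: (mf_cont (@ek_cont x)). Qed.

Lemma ek_int x : ig (fun s => ek (x - s)) /\ It (fun s => ek (x - s)) <= 2.
Proof.
have := kernel_int x (@ac_id R) (fun=> ler01).
have -> : (fun s => expR (- `|x - s|) * 1) = (fun s => ek (x - s)); last by [].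
by apply/funext => s; rewrite mulr1.
Qed.

Lemma ek_L2 x : L2 (fun s => ek (x - s)) /\ L2norm (fun s => ek (x - s)) <= 2.
Proof.
have m := mf_ek x; have [i h] := ek_int x.
have le s : ek (x - s) ^+ 2 <= ek (x - s) by rewrite expr2 ler_piMl ?ek_ge0// ek_le1.
have i2 : ig (fun s => ek (x - s) ^+ 2).
  by apply: (ig_le (mfX 2 m) _ i) => s; rewrite ger0_norm ?sqr_ge0.
have l2 : L2 (fun s => ek (x - s)) by apply/L2P.
split=> //; rewrite -(@ler_pXn2r _ 2) ?nnegrE ?L2norm_ge0// L2normE//.
rewrite (le_trans (It_le i2 i le))// (le_trans h)//.
by rewrite expr2 ler_peMr// ler1n.
Qed.

Lemma cv_ge0 f x : (forall s, 0 <= f s) -> 0 <= cv f x.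
Proof. by move=> f0; apply: It_ge0 => s; rewrite mulr_ge0 ?ek_ge0. Qed.

Lemma mf_ek2 : measurable_fun setT (fun z : R * R => ek (z.1 - z.2)).
Proof.
apply: (measurableT_comp (@measurable_expR R)).
apply: measurableT_comp => //; apply: measurableT_comp => //.
exact: (measurable_funB measurable_fst measurable_snd).
Qed.

Lemma cv_mf f : mf f -> (forall s, 0 <= f s) -> (forall x, ig (fun s => ek (x - s) * f s)) ->
  mf (cv f).
Proof.
move=> m f0 i; apply: (tonelliR (k := fun z => ek (z.1 - z.2) * f z.2)).
- apply: measurable_funM; [exact: mf_ek2|exact: (measurableT_comp m measurable_snd)].
- by move=> z; rewrite mulr_ge0 ?ek_ge0.
- exact: i.
Qed.

Lemma cv_ig1 f : ig f -> (forall s, 0 <= f s) ->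
  [/\ forall x, ig (fun s => ek (x - s) * f s), ig (cv f) & It (cv f) <= 2 * It f].
Proof.
move=> i f0; have m := ig_mf i.
have i1 x : ig (fun s => ek (x - s) * f s).
  apply: (ig_le (mfM (mf_ek x) m) _ i) => s.
  by rewrite ger0_norm ?mulr_ge0 ?ek_ge0// ler_piMl// ek_le1.
have i2 s : ig (fun x => ek (x - s) * f s).
  by under eq_fun do rewrite mulrC ekC; apply: igZ; exact: (ek_int s).1.
have e s : It (fun x => ek (x - s) * f s) = It (fun x => ek (s - x)) * f s.
  under eq_fun do rewrite mulrC ekC.
  by rewrite ItZ ?(ek_int s).1// mulrC.
have h s : It (fun x => ek (x - s) * f s) <= 2 * f s.
  by rewrite e ler_wpM2r// (ek_int s).2.
have mk : measurable_fun setT (fun z : R * R => ek (z.1 - z.2) * f z.2).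
  by apply: measurable_funM; [exact: mf_ek2|exact: (measurableT_comp m measurable_snd)].
have k0 (z : R * R) : 0 <= ek (z.1 - z.2) * f z.2 by rewrite mulr_ge0 ?ek_ge0.
have mk' : measurable_fun setT (fun z : R * R => ek (z.2 - z.1) * f z.1).
  under eq_fun do rewrite ekC.
  by apply: measurable_funM; [exact: mf_ek2|exact: (measurableT_comp m measurable_fst)].
have i3 : ig (fun s => It (fun x => ek (x - s) * f s)).
  apply: (@ig_le _ _ (fun s => 2 * f s)) (igZ _ i).
    apply: (tonelliR mk') => [z|s]; [by rewrite mulr_ge0 ?ek_ge0|exact: i2].
  by move=> s; rewrite ger0_norm ?h// It_ge0// => x; rewrite mulr_ge0 ?ek_ge0.
have [i4 e4] := tonelli_swap mk k0 i1 i2 i3.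
split; [exact: i1|exact: i4|rewrite /cv e4 -(ItZ 2 i)].
exact: It_le i3 (igZ _ i) h.
Qed.

Lemma cv_L2 f : L2 f -> [/\ forall x, ig (fun s => ek (x - s) * f s),
  forall x, cv (fun s => `|f s|) x <= 2 * L2norm f,
  L2 (cv (fun s => `|f s|)) & L2norm (cv (fun s => `|f s|)) <= 2 * L2norm f].
Proof.
move=> Lf; have [m i] := (L2P f).1 Lf; have [La ea] := L2_abs Lf.
have i1 x : ig (fun s => ek (x - s) * f s) by exact: (L2_CS (ek_L2 x).1 Lf).1.
have i2 x : ig (fun s => ek (x - s) * `|f s|) by exact: (L2_CS (ek_L2 x).1 La).1.
have cv0 x : 0 <= cv (fun s => `|f s|) x by exact: cv_ge0.
have [j1 j2 j3] := cv_ig1 i (fun s => sqr_ge0 (f s)).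
have mcv : mf (cv (fun s => `|f s|)) by apply: cv_mf => //; exact: mf_abs.
(* Cauchy-Schwarz with the kernel written as the square of [q], that is, Jensen's inequality for a
   kernel of mass at most 2. *)
have key x : cv (fun s => `|f s|) x ^+ 2 <= 2 * cv (fun s => f s ^+ 2) x.
  pose q s := expR (- `|x - s| / 2).
  have qq s : q s ^+ 2 = ek (x - s).
    by rewrite /q /ek expr2 -expRD -splitr.
  have mq : mf q.
    by rewrite /q; mfs.
  have Lq : L2 q.
    by apply/L2P; split=> //; under eq_fun do rewrite qq; exact: (ek_int x).1.
  have Lqf : L2 (fun s => q s * f s).
    apply/L2P; split; first exact: mfM.
    by under eq_fun do rewrite exprMn qq; exact: j1.
  have [_ h] := L2_CS Lq Lqf.
  have -> : cv (fun s => `|f s|) x = It (fun s => `|q s * (q s * f s)|).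
    congr It; apply/funext => s; rewrite mulrA -expr2 qq normrM ger0_norm//.
    exact: ek_ge0.
  apply: (@le_trans _ _ ((L2norm q * L2norm (fun s => q s * f s)) ^+ 2)).
    by rewrite ler_pXn2r ?nnegrE ?mulr_ge0 ?L2norm_ge0// It_ge0.
  rewrite exprMn !L2normE//.
  have -> : It (fun s => q s ^+ 2) = It (fun s => ek (x - s)).
    by congr It; apply/funext => s; rewrite qq.
  have -> : It (fun s => (q s * f s) ^+ 2) = cv (fun s => f s ^+ 2) x.
    by congr It; apply/funext => s; rewrite exprMn qq.
  by rewrite ler_wpM2r ?(ek_int x).2// cv_ge0// => s; exact: sqr_ge0.
have icv : ig (fun x => cv (fun s => `|f s|) x ^+ 2).
  apply: (@ig_le _ _ (fun x => 2 * cv (fun s => f s ^+ 2) x)); first exact: mfX.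
    by move=> x; rewrite ger0_norm ?sqr_ge0// key.
  exact: igZ.
have Lcv : L2 (cv (fun s => `|f s|)) by apply/L2P.
split=> // [x|].
  have [_] := L2_CS (ek_L2 x).1 La.
  rewrite ea => h; apply: (@le_trans _ _ (L2norm (fun s => ek (x - s)) * L2norm f)).
    apply: le_trans h; rewrite le_eqVlt; apply/orP; left; apply/eqP.
    by congr It; apply/funext => s; rewrite normrM normr_id (ger0_norm (ek_ge0 _)).
  by rewrite ler_wpM2r ?L2norm_ge0// (ek_L2 x).2.
rewrite -(@ler_pXn2r _ 2) ?nnegrE ?mulr_ge0 ?L2norm_ge0// L2normE// exprMn L2normE//.
rewrite (le_trans (It_le icv (igZ 2 j2) key))// ItZ//.
have -> : 2 ^+ 2 = 2 * 2 :> R by rewrite expr2.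
by rewrite -mulrA ler_wpM2l.
Qed.

(* Function norms for which convolution with exp(-|x|) is bounded, both into
   the same space and into bounded functions. *)
Record fnorm (dm : set (R -> R)) (n : (R -> R) -> R) (K : R) : Prop := Fnorm {
  fn_mf : forall f, dm f -> mf f;
  fn_D : forall f g, dm f -> dm g ->
    dm (fun x => f x + g x) /\ n (fun x => f x + g x) <= n f + n g;
  fn_Z : forall a f, dm f -> dm (fun x => a * f x) /\ n (fun x => a * f x) = `|a| * n f;
  fn_ge0 : forall f, dm f -> 0 <= n f;
  fn_le : forall f g, mf f -> dm g -> (forall x, `|f x| <= `|g x|) -> dm f /\ n f <= n g;
  fn_ig : forall f, dm f -> forall x, ig (fun s => ek (x - s) * f s);
  fn_cvx : forall f, dm f -> forall x, cv (fun s => `|f s|) x <= K * n f;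
  fn_cv : forall f, dm f -> dm (cv (fun s => `|f s|)) /\
     n (cv (fun s => `|f s|)) <= K * n f;
  fn_ek : dm ek;
  fn_K : 0 <= K }.

Lemma fnorm_L2 : fnorm (@L2 R) (@L2norm R) 2.
Proof.
split=> //.
- exact: L2_mf. - exact: L2D. - exact: L2Z.
- by move=> f _; exact: L2norm_ge0.
- exact: L2_le.
- by move=> f /cv_L2[]. - by move=> f /cv_L2[]. - by move=> f /cv_L2[].
- have := (ek_L2 0).1; congr L2; apply/funext => s.
  by rewrite sub0r ekN.
Qed.

(** The supremum is over all points, not essential: evaluation at a point is then continuous along
    solutions, and identities can be propagated in time point by point. *)
Definition bdd f := exists M : R, forall x, `|f x| <= M.
Definition supn f : R := sup (range (fun x => `|f x|)).

Lemma supn_ge f x : bdd f -> `|f x| <= supn f.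
Proof.
move=> [M h]; apply: ub_le_sup; last by exists x.
by exists M => _ [z _ <-].
Qed.
Lemma supn_le f M : (forall x, `|f x| <= M) -> supn f <= M.
Proof.
move=> h; apply: ge_sup; first by exists `|f 0|, 0.
by move=> _ [z _ <-].
Qed.
Lemma supn_ge0 f : bdd f -> 0 <= supn f.
Proof. by move=> b; exact: le_trans (normr_ge0 (f 0)) (supn_ge 0 b). Qed.
Lemma bddD f g : bdd f -> bdd g -> bdd (fun x => f x + g x).
Proof.
move=> [M h] [M' h']; exists (M + M') => x.
by rewrite (le_trans (ler_normD _ _))// lerD.
Qed.
Lemma bddZ a f : bdd f -> bdd (fun x => a * f x).
Proof. by move=> [M h]; exists (`|a| * M) => x; rewrite normrM ler_wpM2l. Qed.
Lemma supnD f g : bdd f -> bdd g -> supn (fun x => f x + g x) <= supn f + supn g.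
Proof.
move=> b b'; apply: supn_le => x.
by rewrite (le_trans (ler_normD _ _))// lerD// supn_ge.
Qed.
Lemma supnZ a f : bdd f -> supn (fun x => a * f x) = `|a| * supn f.
Proof.
move=> b; apply/eqP; rewrite eq_le; apply/andP; split.
  by apply: supn_le => x; rewrite normrM ler_wpM2l// supn_ge.
have [->|a0] := eqVneq a 0.
  by rewrite normr0 mul0r supn_ge0//; exact: bddZ.
rewrite -ler_pdivlMl ?normr_gt0//; apply: supn_le => x.
rewrite ler_pdivlMl ?normr_gt0// -normrM.
exact: (supn_ge (f := fun x => a * f x) x (bddZ a b)).
Qed.
Lemma supn_mono f g : bdd g -> (forall x, `|f x| <= `|g x|) -> bdd f /\ supn f <= supn g.
Proof.
move=> b fg; have h x : `|f x| <= supn g by rewrite (le_trans (fg x))// supn_ge.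
by split; [exists (supn g)|exact: supn_le].
Qed.

Definition L2b f := L2 f /\ bdd f.
Definition L2bn f := L2norm f + supn f.

(** The constant 4 adds the bound 2 of the convolution on L^2 and its pointwise bound by twice the
    L^2 norm. *)
Lemma fnorm_L2b : fnorm L2b L2bn 4.
Proof.
split.
- by move=> f [/L2_mf].
- move=> f g [a b] [c d]; have [h1 h2] := L2D a c; split.
    by split=> //; exact: bddD.
  by have := supnD b d; rewrite /L2bn; lra.
- move=> a f [b c]; have [h1 h2] := L2Z a b; split; first by split=> //; exact: bddZ.
  by rewrite /L2bn h2 supnZ// mulrDr.
- by move=> f [_ b]; rewrite addr_ge0 ?L2norm_ge0// supn_ge0.
- move=> f g m [a b] fg; have [h1 h2] := L2_le m a fg; have [h3 h4] := supn_mono b fg.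
  by split; [split|exact: lerD].
- by move=> f [/cv_L2[]].
- move=> f [a b] x; have [_ h _ _] := cv_L2 a.
  have := h x; rewrite /L2bn; have := supn_ge0 b; have := L2norm_ge0 f; lra.
- move=> f [a b]; have [_ h1 h2 h3] := cv_L2 a.
  have h4 x : `|cv (fun s => `|f s|) x| <= 2 * L2norm f by rewrite ger0_norm// cv_ge0.
  split; first by split=> //; exists (2 * L2norm f).
  have := supn_le h4; have := supn_ge0 b; have := L2norm_ge0 f; rewrite /L2bn; lra.
- split; first exact: fn_ek fnorm_L2.
  by exists 1 => x; rewrite ger0_norm ?ek_ge0// ek_le1.
- by [].
Qed.

(** Uniformly local L^1, with an exponential weight in place of unit intervals. *)
Definition Lu f := [/\ mf f, forall x, ig (fun s => ek (x - s) * f s) &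
  bdd (cv (fun s => `|f s|))].
Definition Lun f := supn (cv (fun s => `|f s|)).

Lemma ig_ekabs f x : ig (fun s => ek (x - s) * f s) -> ig (fun s => ek (x - s) * `|f s|).
Proof.
move=> /ig_abs; congr ig; apply/funext => s.
by rewrite normrM (ger0_norm (ek_ge0 _)).
Qed.

Lemma cv_bdd f M : (forall x, `|f x| <= M) -> mf f ->
  (forall x, ig (fun s => ek (x - s) * f s)) /\ forall x, `|cv f x| <= 2 * M.
Proof.
move=> h m.
have i x : ig (fun s => M * ek (x - s)) by apply: igZ; exact: (ek_int x).1.
have le x s : `|ek (x - s) * f s| <= M * ek (x - s).
  by rewrite normrM ger0_norm ?ek_ge0// mulrC ler_wpM2r ?ek_ge0.
have i1 x : ig (fun s => ek (x - s) * f s).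
  exact: ig_le (mfM (mf_ek x) m) (le x) (i x).
have M0 : 0 <= M by exact: le_trans (h 0).
split=> // x; rewrite (le_trans (It_normle (i1 x) (i x) (le x)))//.
by rewrite ItZ ?(ek_int x).1// mulrC ler_wpM2r// (ek_int x).2.
Qed.

Lemma fnorm_Lu : fnorm Lu Lun 2.
Proof.
have ge0 f x : 0 <= cv (fun s => `|f s|) x by exact: cv_ge0.
split.
- by move=> f [].
- move=> f g [m1 i1 b1] [m2 i2 b2].
  have i x : ig (fun s => ek (x - s) * (f s + g s)).
    by under eq_fun do rewrite mulrDr; exact: igD.
  have h x : cv (fun s => `|f s + g s|) x <= cv (fun s => `|f s|) x + cv (fun s => `|g s|) x.
    rewrite /cv -ItD; [|exact: ig_ekabs|exact: ig_ekabs].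
    apply: It_le; [exact: ig_ekabs (i x)|by apply: igD; exact: ig_ekabs|].
    by move=> s; rewrite -mulrDr ler_wpM2l ?ek_ge0// ler_normD.
  have h' x : `|cv (fun s => `|f s + g s|) x| <= Lun f + Lun g.
    rewrite ger0_norm ?(ge0 (fun s => f s + g s))// (le_trans (h x))//.
    by rewrite lerD// (le_trans (ler_norm _))//; exact: supn_ge.
  split; last exact: supn_le.
  by split=> //; [exact: mfD|exists (Lun f + Lun g)].
- move=> a f [m i b].
  have e : cv (fun s => `|a * f s|) = (fun x => `|a| * cv (fun s => `|f s|) x).
    apply/funext => x; rewrite /cv -ItZ; last exact: ig_ekabs.
    by congr It; apply/funext => s; rewrite normrM mulrCA.
  rewrite /Lun e supnZ ?normr_id//; split=> //; split; rewrite ?e.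
  + by apply: mfM => //; exact: mf_cst.
  + by move=> x; under eq_fun do rewrite mulrCA; exact: igZ.
  + exact: bddZ.
- by move=> f [_ _ b]; exact: supn_ge0.
- move=> f g m [mg i b] fg.
  have i' x : ig (fun s => ek (x - s) * f s).
    apply: (ig_le (mfM (mf_ek x) m) _ (ig_ekabs (i x))) => s.
    by rewrite normrM ger0_norm ?ek_ge0// ler_wpM2l ?ek_ge0.
  have h x : `|cv (fun s => `|f s|) x| <= `|cv (fun s => `|g s|) x|.
    rewrite !ger0_norm//; apply: It_le; [exact: ig_ekabs|exact: ig_ekabs|].
    by move=> s; rewrite ler_wpM2l ?ek_ge0.
  by have [h1 h2] := supn_mono b h; split.
- by move=> f [].
- move=> f [_ _ b] x; have := supn_ge x b; rewrite ger0_norm//.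
  by rewrite -/(Lun f) => h; have := supn_ge0 b; rewrite -/(Lun f); lra.
- move=> f [m i b].
  have mc : mf (cv (fun s => `|f s|)).
    by apply: cv_mf => [|//|x]; [exact: mf_abs|exact: ig_ekabs].
  have h x : `|cv (fun s => `|f s|) x| <= Lun f by exact: supn_ge.
  have e : (fun s => `|cv (fun s => `|f s|) s|) = cv (fun s => `|f s|).
    by apply/funext => s; rewrite ger0_norm.
  have [h1 h2] := cv_bdd h mc.
  split; last by apply: supn_le => x; rewrite e; exact: h2.
  by split=> //; rewrite e; exists (2 * Lun f).
- have mek : mf ek by rewrite /ek; mfs.
  have [h1 h2] := cv_bdd (f := ek) (M := 1) (fun x => ltac:(rewrite ger0_norm ?ek_ge0 ?ek_le1//)) mek.
  split=> //.
  exists (2 * 1) => x; have -> : (fun s => `|ek s|) = ek; last exact: h2.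
  by apply/funext => s; rewrite ger0_norm ?ek_ge0.
- by [].
Qed.

End ExponentialKernel.

(** * The kernels of P and Q *)

Section SignedKernel.
Context {R : realType}.
Local Notation mu := (@lebesgue_measure R).
Implicit Types (f g h y b : R -> R) (x s : R).

Lemma It_ind (a c : R) h : a <= c -> li h ->
  ig (fun s => (a < s <= c)%R%:R * h s) /\ It (fun s => (a < s <= c)%R%:R * h s) = io a c h.
Proof.
move=> ac_ [m il].
have e : (fun s => (a < s <= c)%R%:R * h s) = (h \_ `]a, c]).
  apply/funext => s; rewrite patchE mem_setE in_itv/=.
  by case: ifP => _; rewrite ?mul1r ?mul0r.
have il' : mu.-integrable `]a, c]%classic (EFin \o h).
  by apply: integrableS (il a c) => //; apply: subset_itvr; rewrite bnd_simp.
rewrite e; split.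
  by rewrite /ig -restrict_EFin; apply/integrable_restrict => //=; rewrite setTI.
by rewrite /It /io -Rintegral_mkcond Rintegral_itv_obnd_cbnd.
Qed.

Lemma ae_neq x : {ae mu, forall s, s != x}.
Proof.
exists [set x]; split=> //; first exact: lebesgue_measure_set1.
by move=> s /= /negP; rewrite negbK => /eqP.
Qed.

Variables (y b f : R -> R) (M : R).
Hypothesis ay : ac y b.
Hypothesis yM : forall x, `|y x - x| <= M.
Hypothesis mff : mf f.
Hypothesis fi : forall x, ig (fun s => ek (x - s) * f s).

Definition sgk x s := Num.sg (x - s) * (y x - y s).
Definition sgP x := It (fun s => expR (- sgk x s) * f s).
Definition sgQ x := It (fun s => Num.sg (x - s) * expR (- sgk x s) * f s).

Let my : mf y. Proof. exact: mf_cont (ac_cont ay). Qed.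
(** On each side of the diagonal the signed kernel is a function of [x] times a function of [s].
    [lft] and [rgt] carry the factors in [s], so that their integrals are primitives in [x]; with
    |y(x) - y(s)| in the exponent this factorization is lost for a [y] that is not monotone. *)
Let lft x s := (s <= x)%R%:R * (expR (y s) * f s).
Let rgt x s := (x < s)%R%:R * (expR (- y s) * f s).

Let mf_le x : mf (fun s => (s <= x)%R%:R).
Proof.
have -> : (fun s => (s <= x)%R%:R) = \1_(`]-oo, x]%classic) :> (R -> R).
  by apply/funext => s; rewrite indicE mem_setE in_itv.
exact: measurable_indic.
Qed.
Let mf_gt x : mf (fun s => (x < s)%R%:R).
Proof.
have -> : (fun s => (x < s)%R%:R) = (fun s => 1 - (s <= x)%R%:R) :> (R -> R).
  by apply/funext => s; rewrite ltNge; case: leP; rewrite ?subrr ?subr0.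
by apply: mfB (mf_le x); exact: mf_cst.
Qed.

Let ilft x : ig (lft x).
Proof.
have := igZ (expR (M + x)) (ig_ekabs (fi x)); apply: ig_le.
  by rewrite /lft; apply: mfM (mf_le x) _; mfs.
move=> s; rewrite /lft; case: (leP s x) => sx; last first.
  by rewrite mul0r normr0; exact: mulr_ge0 (expR_ge0 _) (mulr_ge0 (ek_ge0 _) (normr_ge0 _)).
rewrite mul1r normrM mulrA ler_wpM2r// !(ger0_norm (expR_ge0 _)) /ek -expRD ler_expR.
rewrite (ger0_norm (x := x - s)) ?subr_ge0//.
by have := yM s; rewrite ler_norml => /andP[? ?]; lra.
Qed.

Let irgt x : ig (rgt x).
Proof.
have := igZ (expR (M - x)) (ig_ekabs (fi x)); apply: ig_le.
  by rewrite /rgt; apply: mfM (mf_gt x) _; mfs.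
move=> s; rewrite /rgt; case: (ltP x s) => sx; last first.
  by rewrite mul0r normr0; exact: mulr_ge0 (expR_ge0 _) (mulr_ge0 (ek_ge0 _) (normr_ge0 _)).
rewrite mul1r normrM mulrA ler_wpM2r// !(ger0_norm (expR_ge0 _)) /ek -expRD ler_expR.
rewrite (ltr0_norm (x := x - s)) ?subr_lt0//.
by have := yM s; rewrite ler_norml => /andP[? ?]; lra.
Qed.

Let lif : li f.
Proof.
split=> // a c.
pose K := expR (`|a| + `|c|).
apply: (@le_integrable _ _ _ mu _ (measurable_itv _) _ (EFin \o (fun s => K * (ek (0 - s) * f s)))).
- by apply: measurable_funS (mfE mff).
- move=> s /=; rewrite in_itv/= => /andP[as_ sc]; rewrite lee_fin mulrA [leRHS]normrM ler_peMl//.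
  rewrite ger0_norm ?mulr_ge0 ?expR_ge0// /K /ek -expRD -[leLHS]expR0 ler_expR sub0r normrN.
  rewrite subr_ge0 ler_norml; have := ler_norm c; have := ler_norm (- a); rewrite normrN.
  by have := normr_ge0 a; have := normr_ge0 c; move=> *; apply/andP; split; lra.
- apply: (@integrableZl _ _ _ mu _ (measurable_itv _) K (EFin \o (fun s => ek (0 - s) * f s))).
  exact: integrableS (fi 0).
Qed.

Let cey : continuous (fun s => expR (y s)).
Proof. exact: ac_cont (ac_comp_exp ay). Qed.
Let ceyN : continuous (fun s => expR (- y s)).
Proof. exact: ac_cont (ac_comp_exp (acN ay)). Qed.

Let lmul g : continuous g -> li (fun s => g s * f s).
Proof.
move=> cg; under eq_fun do rewrite mulrC.
by apply: liM => //; [exact: mf_cont|exact: cont_lbd].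
Qed.

Let aL : ac (fun x => It (lft x)) (fun s => expR (y s) * f s).
Proof.
have lh := lmul cey; split=> // a c ac_.
have [i e] := It_ind ac_ lh; rewrite -e -(ItB (ilft c) (ilft a)); congr It; apply/funext => s.
rewrite /lft -mulrBl; congr (_ * _); have [as_|sa] := ltP a s.
  by rewrite subr0.
by rewrite (le_trans sa ac_)/= subrr.
Qed.

Let aR : ac (fun x => It (rgt x)) (fun s => - (expR (- y s) * f s)).
Proof.
have lh := lmul ceyN; split=> [|a c ac_]; first exact: liN.
have -> : io a c (fun s => - (expR (- y s) * f s)) = - io a c (fun s => expR (- y s) * f s).
  by rewrite -mulN1r -ioZ//; apply: io_eq => s _; rewrite mulN1r.
have [i e] := It_ind ac_ lh; rewrite -e -(ItN i) -(ItB (irgt c) (irgt a)); congr It; apply/funext => s.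
rewrite /rgt -mulrBl -mulNr; congr (_ * _); have [as_|sa] := ltP a s.
  by rewrite /= ltNge; case: leP; rewrite /= ?sub0r ?subrr ?oppr0.
by rewrite ltNge (le_trans sa ac_)/= subrr oppr0.
Qed.

Let PE x : sgP x = expR (- y x) * It (lft x) + expR (y x) * It (rgt x).
Proof.
rewrite -(ItZ _ (ilft x)) -(ItZ _ (irgt x)) -(ItD (igZ _ (ilft x)) (igZ _ (irgt x))).
congr It; apply/funext => s; rewrite /lft /rgt /sgk.
have [sx|xs] := leP s x.
  rewrite !mul0r mulr0 addr0 mul1r mulrA -expRD; congr (expR _ * _).
  move: sx; rewrite le_eqVlt => /predU1P[->|sx]; first by rewrite !subrr mulr0 oppr0 addrC subrr.
  by rewrite gtr0_sg ?subr_gt0// mul1r opprB addrC.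
rewrite mul0r mulr0 add0r mul1r mulrA -expRD; congr (expR _ * _).
by rewrite ltr0_sg ?subr_lt0// mulN1r opprK.
Qed.

Let QE x : sgQ x = expR (- y x) * It (lft x) - expR (y x) * It (rgt x).
Proof.
rewrite -(ItZ _ (ilft x)) -(ItZ _ (irgt x)) -(ItB (igZ _ (ilft x)) (igZ _ (irgt x))).
have i : ig (fun s => expR (- y x) * lft x s - expR (y x) * rgt x s).
  by apply: igB; [exact: igZ (ilft x)|exact: igZ (irgt x)].
apply/esym; apply: (It_ae i _ _).2; first by rewrite /sgk; mfs.
apply: aeS (ae_neq x) => s sx _; rewrite /lft /rgt /sgk.
have [sx'|xs] := leP s x.
  have {sx sx'} sx : s < x by rewrite lt_neqAle sx.
  rewrite !mul0r mulr0 subr0 mul1r mulrA -expRD.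
  by rewrite gtr0_sg ?subr_gt0// !mul1r opprB addrC.
rewrite mul0r mulr0 sub0r mul1r mulrA -expRD.
by rewrite ltr0_sg ?subr_lt0// !mulN1r opprK mulNr.
Qed.

Lemma ac_sgP : ac sgP (fun x => - b x * sgQ x).
Proof.
have -> : sgP = (fun x => expR (- y x) * It (lft x) + expR (y x) * It (rgt x)).
  by apply/funext => x; exact: PE.
have := acD (ac_mul (ac_comp_exp (acN ay)) aL) (ac_mul (ac_comp_exp ay) aR).
congr ac; apply/funext => x; rewrite QE.
have := expRxMexpNx_1 (y x); set E := expR _; set E' := expR _.
move=> e; rewrite (mulrA E') (mulrC E') e.
by rewrite mulrN (mulrA E) e; move: (It (lft x)) (It (rgt x)) => p q; ring.
Qed.

(** The sign jumps at s = x: the derivatives of the two one-sided integrals contribute [f] twice,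
    whereas in [sgP] they cancel. *)
Lemma ac_sgQ : ac sgQ (fun x => 2 * f x - b x * sgP x).
Proof.
have -> : sgQ = (fun x => expR (- y x) * It (lft x) - expR (y x) * It (rgt x)).
  by apply/funext => x; exact: QE.
have := acB (ac_mul (ac_comp_exp (acN ay)) aL) (ac_mul (ac_comp_exp ay) aR).
congr ac; apply/funext => x; rewrite PE.
have := expRxMexpNx_1 (y x); set E := expR _; set E' := expR _.
move=> e; rewrite (mulrA E') (mulrC E') e.
by rewrite mulrN (mulrA E) e; move: (It (lft x)) (It (rgt x)) => p q; ring.
Qed.

End SignedKernel.

Lemma sum4_le (R : realFieldType) (a b c d : R) : 0 <= a -> 0 <= b -> 0 <= c -> 0 <= d ->
  let t := 2 * a + b + c + d in
  [/\ a <= t, b <= t, c <= t & d <= t /\ 2 * a + d <= t].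
Proof. by move=> ? ? ? ? /=; split; [| | |split]; lra. Qed.

(** * The profile g attached to the cutoff *)

Section Profile.
Context {R : realType}.
Local Notation mu := (@lebesgue_measure R).

Lemma ac_dr (F f : R -> R) : ac F f -> continuous f -> dr F f.
Proof.
move=> aF cf x; have lf := ac_li aF.
have x1 : x - 1 < x by rewrite gtrBl.
have x2 : x < x + 1 by rewrite ltrDl.
have [d1 d2] := continuous_FTC1_closed x2 (lf.2 (x - 1) (x + 1)) x1 (cf x).
pose G := fun z => F (x - 1) + \int[mu]_(t in `[x - 1, z]) f t.
have dG : is_derive x 1 G (f x).
  rewrite -[f x]add0r; apply: is_deriveD.
  by have := DeriveDef d1 erefl; rewrite -derive1E d2.
apply: near_eq_is_derive dG.
exists 1 => //= z /=; rewrite ltr_norml => /andP[_ h].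
have xz : x - 1 <= z by move: h; clear; lra.
by rewrite /G -/(io (x - 1) z f) -aF.2// addrC subrK.
Qed.

Variables (chi : R -> R) (chiP : cutoff chi).
Local Notation chi' := (derive1 chi).
Local Notation chi'' := (derive1 (derive1 chi)).

(** [ddchi2] is (chi^2)''. [pfun] is g - chi^2, the decaying solution of p - p'' = (chi^2)'', [qfun]
    is its derivative and [gder] is g'. As a consequence g'' is [pfun] itself. *)
Definition ddchi2 z := 2 * chi' z ^+ 2 + 2 * chi z * chi'' z.
Definition pfun x := 2^-1 * It (fun z => expR (- `|x - z|) * ddchi2 z).
Definition qfun x := - 2^-1 * sgQ (fun z => z) ddchi2 x.
Definition gder x := 2 * chi x * chi' x + qfun x.

Let s0 := chi_smooth chiP.
Let s1 := smooth_derive s0.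
Let s2 := smooth_derive s1.
Let d0 := smooth_dr s0.
Let d1 := smooth_dr s1.
Let d2 := smooth_dr s2.

Lemma dnchi_decay n : exists2 C, 0 <= C & forall x, `|derive1n n.+1 chi x| <= C * ek x.
Proof.
have c : continuous (derive1n n.+1 chi).
  by apply: (@dr_cont _ _ (derive1 (derive1n n.+1 chi))); apply: dr_derivable => z; exact: s0.
have [K hK] := cont_lbd c 0 1; exists (`|K| * expR 1).
  by rewrite mulr_ge0// expR_ge0.
move=> x; have [x0|x0] := leP x 0.
  by rewrite dn_chi_out ?normr0 ?mulr_ge0 ?expR_ge0 ?ek_ge0//; left.
have [x1|x1] := leP 1 x.
  by rewrite dn_chi_out ?normr0 ?mulr_ge0 ?expR_ge0 ?ek_ge0//; right.
have h : `|derive1n n.+1 chi x| <= K by apply: hK; rewrite !ltW.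
rewrite (le_trans h)// (le_trans (ler_norm K))// -mulrA ler_peMr//.
rewrite /ek -expRD -[leLHS]expR0 ler_expR gtr0_norm//.
by rewrite subr_ge0 ltW.
Qed.

Lemma ddchi2E : dr (fun z => 2 * chi z * chi' z) ddchi2.
Proof.
move=> x; have := drM (drM (@dr_cst R 2) d0) d1 x; rewrite /ddchi2.
by move: (chi x) (chi' x) (chi'' x) => u v w /is_derive_eq; apply; ring.
Qed.

Lemma ddchi2_cont : continuous ddchi2.
Proof.
apply: (@dr_cont _ _ (fun x => 4 * chi' x * chi'' x + 2 * (chi' x * chi'' x + chi x * derive1 chi'' x))).
move=> x.
have := drD (drM (@dr_cst R 2) (drM d1 d1)) (drM (drM (@dr_cst R 2) d0) d2) x.
have -> : (fun x0 => 2 * (chi' x0 * chi' x0) + 2 * chi x0 * chi'' x0) = ddchi2.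
  by apply/funext => z; rewrite /ddchi2 expr2.
by move: (chi x) (chi' x) (chi'' x) (derive1 chi'' x) => u v w z /is_derive_eq; apply; ring.
Qed.

Lemma ddchi2_out x : x <= 0 \/ 1 <= x -> ddchi2 x = 0.
Proof.
move=> h; have := dn_chi_out chiP 0 h; have := dn_chi_out chiP 1 h.
by rewrite derive1nS !derive1n1 /ddchi2 => -> ->; rewrite expr2 !mulr0 addr0.
Qed.

Lemma ddchi2_ig : ig ddchi2.
Proof.
have m := mf_cont ddchi2_cont.
have [K hK] := cont_lbd ddchi2_cont 0 1.
apply: (ig_le m _ (igZ (`|K| * expR 1) (ek_int 0).1)) => x; rewrite sub0r ekN.
have [x0|x0] := leP x 0.
  by rewrite ddchi2_out ?normr0 ?mulr_ge0 ?expR_ge0 ?ek_ge0//; left.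
have [x1|x1] := leP 1 x.
  by rewrite ddchi2_out ?normr0 ?mulr_ge0 ?expR_ge0 ?ek_ge0//; right.
have h : `|ddchi2 x| <= K by apply: hK; rewrite !ltW.
rewrite (le_trans h)// (le_trans (ler_norm K))// -mulrA ler_peMr//.
rewrite /ek -expRD -[leLHS]expR0 ler_expR gtr0_norm//.
by rewrite subr_ge0 ltW.
Qed.

Let mi x : ig (fun s => ek (x - s) * ddchi2 s).
Proof.
apply: (ig_le _ _ (ig_abs ddchi2_ig)).
  by apply: mfM (mf_ek x) _; exact: mf_cont ddchi2_cont.
by move=> s; rewrite normrM ger0_norm ?ek_ge0// ler_piMl// ek_le1.
Qed.

Let id0 : forall x : R, `|x - x| <= 0. Proof. by move=> x; rewrite subrr normr0. Qed.

Lemma pfunE x : pfun x = 2^-1 * sgP (fun z => z) ddchi2 x.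
Proof.
congr (_ * It _); apply/funext => s; congr (expR (- _) * _).
by rewrite /sgk -normrEsg.
Qed.

Let aP := ac_sgP (@ac_id R) id0 (mf_cont ddchi2_cont) mi.
Let aQ := ac_sgQ (@ac_id R) id0 (mf_cont ddchi2_cont) mi.

Lemma dr_pfun : dr pfun qfun.
Proof.
have -> : pfun = (fun x => 2^-1 * sgP (fun z => z) ddchi2 x) by apply/funext => x; exact: pfunE.
apply: ac_dr.
  have := acZ 2^-1 aP; congr ac; apply/funext => x; rewrite /qfun; ring.
by move=> x; apply: (@cvgM _ _ _ _ _ _ _ (sgQ _ _ x)); [exact: cvg_cst|exact: (ac_cont aQ)].
Qed.

Lemma pd_cont : continuous (fun x => pfun x - ddchi2 x).
Proof.
by move=> x; apply: (@cvgB _ _ _ _ _ _ _ (pfun x) (ddchi2 x)); [exact: (dr_cont dr_pfun)|exact: ddchi2_cont].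
Qed.

Lemma dr_qfun : dr qfun (fun x => pfun x - ddchi2 x).
Proof.
apply: ac_dr.
  have := acZ (- 2^-1) aQ; congr ac; apply/funext => x; by rewrite pfunE; field.
exact: pd_cont.
Qed.

Lemma gfunE : gfun chi = (fun x => chi x ^+ 2 + pfun x).
Proof. by []. Qed.

Lemma dr_gfun : dr (gfun chi) gder.
Proof.
rewrite gfunE => x; have := drD (drM d0 d0) dr_pfun x.
have -> : (fun x0 => chi x0 * chi x0 + pfun x0) = (fun x0 => chi x0 ^+ 2 + pfun x0).
  by apply/funext => z; rewrite expr2.
by move/is_derive_eq; apply; rewrite /gder; ring.
Qed.

Lemma derive1_gfun : derive1 (gfun chi) = gder.
Proof. exact: dr_derive1 dr_gfun. Qed.

Lemma dr_gder : dr gder pfun.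
Proof.
move=> x; have := drD ddchi2E dr_qfun x.
by move/is_derive_eq; apply; ring.
Qed.

Lemma quadr_gder : quadr gder pfun.
Proof. exact: quadr_der dr_gder dr_pfun (dr_cont dr_qfun). Qed.
Lemma quadr_gfun : quadr (gfun chi) gder.
Proof. exact: quadr_der dr_gfun dr_gder (dr_cont dr_pfun). Qed.
Lemma quadr_pfun : quadr pfun qfun.
Proof. exact: quadr_der dr_pfun dr_qfun pd_cont. Qed.

(** The source [ddchi2] lives on [0, 1], where exp(-|x - s|) is at most e times exp(-|x|). *)
Lemma pq_decay : exists2 C, 0 <= C & forall x, `|pfun x| <= C * ek x /\ `|qfun x| <= C * ek x.
Proof.
pose C := expR 1 * It (fun z => `|ddchi2 z|).
have C0 : 0 <= C by rewrite mulr_ge0 ?expR_ge0// It_ge0.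
have i := ig_abs ddchi2_ig.
have key x (k : R -> R) : mf k -> (forall s, `|k s| <= expR (- `|x - s|)) ->
    `|It (fun s => k s * ddchi2 s)| <= C * ek x.
  move=> mk hk.
  have le s : `|k s * ddchi2 s| <= expR 1 * ek x * `|ddchi2 s|.
    rewrite normrM; have [h|h] := boolP ((s <= 0) || (1 <= s)).
      by rewrite ddchi2_out ?normr0 ?mulr0//; apply/orP.
    rewrite ler_wpM2r// (le_trans (hk s))// /ek -expRD ler_expR.
    move: h; rewrite negb_or -!ltNge => /andP[sp s1'].
    have := ler_normD (x - s) s; rewrite subrK (gtr0_norm sp).
    move: s1'; lra.
  have m : mf (fun s => k s * ddchi2 s) by apply: mfM => //; exact: mf_cont ddchi2_cont.
  rewrite (le_trans (It_normle (ig_le m le (igZ _ i)) (igZ _ i) le))//.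
  by rewrite ItZ// /C mulrAC.
exists C => // x; split.
  rewrite /pfun normrM ger0_norm ?invr_ge0//.
  have := key x (fun s => expR (- `|x - s|)) ltac:(mfs) (fun s => ltac:(rewrite ger0_norm ?expR_ge0//)).
  by have := mulr_ge0 C0 (ek_ge0 x); lra.
have sk s : expR (- sgk (fun z => z) x s) = expR (- `|x - s|) by rewrite /sgk -normrEsg.
rewrite /qfun mulNr normrN normrM (ger0_norm (x := 2^-1)) ?invr_ge0//.
have := key x (fun s => Num.sg (x - s) * expR (- sgk (fun z => z) x s)).
rewrite -/(sgQ (fun z => z) ddchi2 x) => h.
have := h ltac:(rewrite /sgk; mfs).
have hs s : `|Num.sg (x - s) * expR (- sgk (fun z => z) x s)| <= expR (- `|x - s|).
  rewrite sk normrM (ger0_norm (expR_ge0 _)) ler_piMl ?expR_ge0//.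
  by rewrite normr_sg lern1; case: (_ == _).
move=> /(_ hs); have := mulr_ge0 C0 (ek_ge0 x); lra.
Qed.

Definition chi_const (C : R) := 0 <= C /\ forall x,
  [/\ `|chi' x| <= C * ek x, `|chi'' x| <= C * ek x, `|derive1 chi'' x| <= C * ek x &
  [/\ `|pfun x| <= C * ek x, `|qfun x| <= C * ek x & `|gder x| <= C * ek x]].

Lemma chi_constP : exists C, chi_const C.
Proof.
have [C1 c1 h1] := dnchi_decay 0; have [C2 c2 h2] := dnchi_decay 1.
have [C3 c3 h3] := dnchi_decay 2; have [C4 c4 h4] := pq_decay.
exists (2 * C1 + C2 + C3 + C4); split; first by move: c1 c2 c3 c4; lra.
move=> x; have [h5 h6] := h4 x.
have := h1 x; have := h2 x; have := h3 x; rewrite !derive1nS !derive1n0 => h7 h8 h9.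
have e0 := ek_ge0 x.
have [t1 [t2 [t3 t4]]] : [/\ 0 <= C1 * ek x, 0 <= C2 * ek x & 0 <= C3 * ek x /\ 0 <= C4 * ek x].
  by rewrite !mulr_ge0.
have h10 : `|gder x| <= 2 * (C1 * ek x) + C4 * ek x.
  rewrite /gder (le_trans (ler_normD _ _))// lerD// !normrM normr_nat -mulrA ler_wpM2l//.
  apply: le_trans h9; rewrite ler_piMl//.
  by have /andP[u v] := chi_01 chiP x; rewrite ger0_norm.
rewrite 3!mulrDl -mulrA; have [l1 l2 l3 [l4 l5]] := sum4_le t1 t2 t3 t4.
by split; [exact: le_trans l1|exact: le_trans l2|exact: le_trans l3|split; [exact: le_trans l4|exact: le_trans l4|exact: le_trans l5]].
Qed.

(** Every point between [u] and [v] lies within M of [x], so measuring the decay at [x] costs a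
    factor exp(M). *)
Lemma decay_lip (F f : R -> R) C M x u v : ac F f -> (forall z, `|f z| <= C * ek z) -> 0 <= C ->
  `|u - x| <= M -> `|v - x| <= M -> `|F u - F v| <= C * expR M * ek x * `|u - v|.
Proof.
move=> aF hf C0 ux vx; wlog vu : u v ux vx / v <= u.
  move=> H; have [vu|/ltW uv] := leP v u; first exact: H.
  by rewrite distrC (distrC u); apply: H.
rewrite aF.2// (ger0_norm (x := u - v)) ?subr_ge0// -io_cst//.
apply: io_normle; [exact: ac_li aF|exact: li_cst|].
move=> z /andP[vz zu]; rewrite (le_trans (hf z))// -mulrA ler_wpM2l//.
rewrite (le_trans (ek_tri z x))// ler_wpM2r ?ek_ge0// ler_expR.
by move: ux vx vz zu; rewrite !ler_norml; lra.
Qed.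

End Profile.

(* States (zeta, U - c chi, zeta', (U - c chi)', h, r - k, c, k): in these
   coordinates the vector space structure of E is the pointwise one. *)
Definition st (R : realType) : Type :=
  ((R -> R^o) * (R -> R^o) * (R -> R^o) * (R -> R^o) * (R -> R^o) * (R -> R^o) * R^o * R^o)%type.
HB.instance Definition _ (R : realType) := GRing.Lmodule.on (st R).

(** * State space and rates *)

Section State.
Context {R : realType}.
Implicit Types (z : st R) (x s : R).

Definition ze z : R -> R := z.1.1.1.1.1.1.1.
Definition uh z : R -> R := z.1.1.1.1.1.1.2.
Definition ww z : R -> R := z.1.1.1.1.1.2.
Definition vh z : R -> R := z.1.1.1.1.2.
Definition hh z : R -> R := z.1.1.1.2.
Definition rh z : R -> R := z.1.1.2.
Definition cc z : R := z.1.2.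
Definition kk z : R := z.2.
Definition mkst (a b c d e f : R -> R) (g h : R) : st R :=
  ((((((((a : R -> R^o), (b : R -> R^o)), (c : R -> R^o)), (d : R -> R^o)), (e : R -> R^o)),
    (f : R -> R^o)), (g : R^o)), (h : R^o)).

Lemma zeD z z' : ze (z + z') = (fun x => ze z x + ze z' x). Proof. by []. Qed.
Lemma zeZ (a : R) z : ze (a *: z) = (fun x => a * ze z x). Proof. by []. Qed.
Lemma zeB z z' : ze (z - z') = (fun x => ze z x - ze z' x). Proof. by []. Qed.
Lemma uhD z z' : uh (z + z') = (fun x => uh z x + uh z' x). Proof. by []. Qed.
Lemma uhZ (a : R) z : uh (a *: z) = (fun x => a * uh z x). Proof. by []. Qed.
Lemma uhB z z' : uh (z - z') = (fun x => uh z x - uh z' x). Proof. by []. Qed.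
Lemma wwD z z' : ww (z + z') = (fun x => ww z x + ww z' x). Proof. by []. Qed.
Lemma wwZ (a : R) z : ww (a *: z) = (fun x => a * ww z x). Proof. by []. Qed.
Lemma wwB z z' : ww (z - z') = (fun x => ww z x - ww z' x). Proof. by []. Qed.
Lemma vhD z z' : vh (z + z') = (fun x => vh z x + vh z' x). Proof. by []. Qed.
Lemma vhZ (a : R) z : vh (a *: z) = (fun x => a * vh z x). Proof. by []. Qed.
Lemma vhB z z' : vh (z - z') = (fun x => vh z x - vh z' x). Proof. by []. Qed.
Lemma hhD z z' : hh (z + z') = (fun x => hh z x + hh z' x). Proof. by []. Qed.
Lemma hhZ (a : R) z : hh (a *: z) = (fun x => a * hh z x). Proof. by []. Qed.
Lemma hhB z z' : hh (z - z') = (fun x => hh z x - hh z' x). Proof. by []. Qed.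
Lemma rhD z z' : rh (z + z') = (fun x => rh z x + rh z' x). Proof. by []. Qed.
Lemma rhZ (a : R) z : rh (a *: z) = (fun x => a * rh z x). Proof. by []. Qed.
Lemma rhB z z' : rh (z - z') = (fun x => rh z x - rh z' x). Proof. by []. Qed.
Lemma ccD z z' : cc (z + z') = cc z + cc z'. Proof. by []. Qed.
Lemma ccZ (a : R) z : cc (a *: z) = a * cc z. Proof. by []. Qed.
Lemma ccB z z' : cc (z - z') = cc z - cc z'. Proof. by []. Qed.
Lemma kkD z z' : kk (z + z') = kk z + kk z'. Proof. by []. Qed.
Lemma kkZ (a : R) z : kk (a *: z) = a * kk z. Proof. by []. Qed.
Lemma kkB z z' : kk (z - z') = kk z - kk z'. Proof. by []. Qed.
Definition stD := (zeD, uhD, wwD, vhD, hhD, rhD, ccD, kkD).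
Definition stZ := (zeZ, uhZ, wwZ, vhZ, hhZ, rhZ, ccZ, kkZ).
Definition stB := (zeB, uhB, wwB, vhB, hhB, rhB, ccB, kkB).

Section Norm.
Variables (dm : set (R -> R)) (n : (R -> R) -> R) (K : R).
Hypothesis fn : fnorm dm n K.

(** Here [ww] and [vh] are free entries; that they are the derivatives of [ze] and [uh] is added in
    [SA]. *)
Definition SS z := [/\ mf (ze z) /\ bdd (ze z), dm (uh z) /\ bdd (uh z), dm (ww z), dm (vh z) &
  dm (hh z) /\ dm (rh z)].
Definition NS z := supn (ze z) + supn (uh z) + n (uh z) + n (ww z) + n (vh z) + n (hh z) +
  n (rh z) + `|cc z| + `|kk z|.

Lemma sn_arith (a1 a2 a3 a4 a5 a6 a7 a8 a9 b1 b2 b3 b4 b5 b6 b7 b8 b9 c1 c2 c3 c4 c5 c6 c7 c8 c9 : R) :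
  a1 <= b1 + c1 -> a2 <= b2 + c2 -> a3 <= b3 + c3 -> a4 <= b4 + c4 -> a5 <= b5 + c5 ->
  a6 <= b6 + c6 -> a7 <= b7 + c7 -> a8 <= b8 + c8 -> a9 <= b9 + c9 ->
  a1 + a2 + a3 + a4 + a5 + a6 + a7 + a8 + a9 <=
  b1 + b2 + b3 + b4 + b5 + b6 + b7 + b8 + b9 + (c1 + c2 + c3 + c4 + c5 + c6 + c7 + c8 + c9).
Proof. lra. Qed.

Lemma dm0 : dm (fun=> 0).
Proof.
have := (fn_Z fn 0 (fn_ek fn)).1; congr dm; apply/funext => x; by rewrite mul0r.
Qed.

Lemma sn_st : seminormed SS NS.
Proof.
have b0 : bdd (fun=> 0 : R) by exists 0 => x; rewrite normr0.
split.
- by split; [split=> //; exact: mf_cst|split=> //; exact: dm0|exact: dm0|exact: dm0|split; exact: dm0].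
- move=> x y [[a1 a2] [a3 a4] a5 a6 [a7 a8]] [[b1 b2] [b3 b4] b5 b6 [b7 b8]].
  rewrite /SS !stD; split; [split; [exact: mfD|exact: bddD]|split; [exact: (fn_D fn a3 b3).1|exact: bddD]|..].
  + exact: (fn_D fn a5 b5).1. + exact: (fn_D fn a6 b6).1.
  + by split; [exact: (fn_D fn a7 b7).1|exact: (fn_D fn a8 b8).1].
- move=> a x [[a1 a2] [a3 a4] a5 a6 [a7 a8]].
  rewrite /SS !stZ; split; [split; [by apply: mfM => //; exact: mf_cst|exact: bddZ]|split; [exact: (fn_Z fn a a3).1|exact: bddZ]|..].
  + exact: (fn_Z fn a a5).1. + exact: (fn_Z fn a a6).1.
  + by split; [exact: (fn_Z fn a a7).1|exact: (fn_Z fn a a8).1].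
- move=> x [[a1 a2] [a3 a4] a5 a6 [a7 a8]].
  by rewrite /NS !addr_ge0 ?supn_ge0 ?(fn_ge0 fn).
- move=> x y [[a1 a2] [a3 a4] a5 a6 [a7 a8]] [[b1 b2] [b3 b4] b5 b6 [b7 b8]].
  rewrite /NS !stD; apply: sn_arith.
  + exact: (supnD a2 b2). + exact: (supnD a4 b4). + exact: (fn_D fn a3 b3).2.
  + exact: (fn_D fn a5 b5).2. + exact: (fn_D fn a6 b6).2. + exact: (fn_D fn a7 b7).2.
  + exact: (fn_D fn a8 b8).2. + exact: ler_normD. + exact: ler_normD.
- move=> a x [[a1 a2] [a3 a4] a5 a6 [a7 a8]]; rewrite /NS.
  rewrite !stZ (supnZ a a2) (supnZ a a4) !normrM.
  rewrite (fn_Z fn a a3).2 (fn_Z fn a a5).2 (fn_Z fn a a6).2 (fn_Z fn a a7).2 (fn_Z fn a a8).2.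
  by rewrite -!mulrDr.
Qed.

Lemma dm_abs f : dm f -> dm (fun x => `|f x|) /\ n (fun x => `|f x|) <= n f.
Proof.
move=> df; apply: (fn_le fn) => //; first exact: mf_abs (fn_mf fn df).
by move=> x; rewrite normr_id.
Qed.

(** Pointwise majorants: [DD] for the entries that belong to the function space, [GG] with exp(-|x|)
    added to dominate the profile terms built from the cutoff. *)
Definition DD z x := `|uh z x| + `|ww z x| + `|vh z x| + `|hh z x| + `|rh z x|.
Definition GG z x := DD z x + ek x.

Lemma DD_ge0 z x : 0 <= DD z x. Proof. by rewrite !addr_ge0. Qed.
Lemma GG_ge0 z x : 0 <= GG z x. Proof. by rewrite addr_ge0 ?DD_ge0 ?ek_ge0. Qed.

Lemma NS_parts z : SS z ->
  [/\ supn (ze z) <= NS z, supn (uh z) <= NS z, `|cc z| <= NS z, `|kk z| <= NS z &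
   n (uh z) + n (ww z) + n (vh z) + n (hh z) + n (rh z) <= NS z].
Proof.
move=> [[a1 a2] [a3 a4] a5 a6 [a7 a8]].
have := supn_ge0 a2; have := supn_ge0 a4; have := normr_ge0 (cc z); have := normr_ge0 (kk z).
have := fn_ge0 fn a3; have := fn_ge0 fn a5; have := fn_ge0 fn a6; have := fn_ge0 fn a7.
have := fn_ge0 fn a8; rewrite /NS.
by move: (supn _) (supn _) (n _) (n _) (n _) (n _) (n _) `|_| `|_|; clear; move=> *; split; lra.
Qed.

Lemma dm_DD z : SS z -> dm (DD z) /\ n (DD z) <= NS z.
Proof.
move=> sz; have [_ _ _ _ h] := NS_parts sz.
move: sz => [[a1 a2] [a3 a4] a5 a6 [a7 a8]].
have [d1 e1] := dm_abs a3; have [d2 e2] := dm_abs a5; have [d3 e3] := dm_abs a6.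
have [d4 e4] := dm_abs a7; have [d5 e5] := dm_abs a8.
have [d6 e6] := fn_D fn d1 d2; have [d7 e7] := fn_D fn d6 d3.
have [d8 e8] := fn_D fn d7 d4; have [d9 e9] := fn_D fn d8 d5.
split; first exact: d9.
rewrite (le_trans _ h)// (le_trans e9)// lerD// (le_trans e8)// lerD// (le_trans e7)// lerD//.
by rewrite (le_trans e6)// lerD.
Qed.

Lemma dm_GG z : SS z -> dm (GG z) /\ n (GG z) <= NS z + n ek.
Proof.
move=> sz; have [d e] := dm_DD sz; have [d1 e1] := fn_D fn d (fn_ek fn).
by split=> //; rewrite (le_trans e1)// lerD2r.
Qed.

End Norm.
End State.

Section ExpLip.
Context {R : realType}.
Implicit Types (a b E : R).

Lemma expN_lip a b E : expR (- a) <= E -> expR (- b) <= E ->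
  `|expR (- a) - expR (- b)| <= `|a - b| * E.
Proof.
wlog ab : a b / a <= b.
  move=> H h1 h2; have [ab|/ltW ba] := leP a b; first exact: H.
  by rewrite distrC (distrC a); exact: H.
move=> h1 _; rewrite ger0_norm ?subr_ge0 ?ler_expR ?lerN2//.
rewrite ler0_norm ?subr_le0// opprB.
have -> : expR (- b) = expR (- a) * expR (a - b) by rewrite -expRD addKr.
have := expR_ge1Dx (a - b) => h.
rewrite -{1}[expR (- a)]mulr1 -mulrBr mulrC.
have h3 : 1 - expR (a - b) <= b - a by lra.
apply: (le_trans (ler_wpM2r (expR_ge0 _) h3)).
by rewrite ler_wpM2l// subr_ge0.
Qed.
End ExpLip.

Lemma sum6_le (R : realFieldType) (c1 c2 c3 c4 c5 c6 c7 L x1 x2 x3 x4 x5 x6 W : R) :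
  x1 <= c1 * W -> x2 <= (c6 * L + c7) * W -> x3 <= c2 * L * W ->
  x4 <= c3 * L * W -> x5 <= c4 * L * W -> x6 <= c5 * L * W ->
  x1 + x2 + x3 + x4 + x5 + x6 + 0 + 0 + 0 <= (c1 + (c6 * L + c7) + (c2 + c3 + c4 + c5) * L) * W.
Proof. by move=> *; rewrite !addr0; lra. Qed.

(** * The right-hand side and its estimates *)

Section Rates.
Context {R : realType}.
Variables (chi : R -> R) (sgd : bool).
Implicit Types (z : st R) (x s : R) (y : R -> R).
Local Notation chi' := (derive1 chi).

Definition yS z x := x + ze z x.
Definition US z x := uh z x + cc z * chi x.
Definition vS z x := vh z x + cc z * chi' x.
Definition UbS z x := uh z x + cc z * (chi x - chi (yS z x)).
(** This is U^2 - c^2 chi(y)^2, factored so that one factor belongs to the function space and the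
    other is bounded. *)
Definition aS z x := UbS z x * (US z x + cc z * chi (yS z x)).
Definition rbS z x := rh z x - kk z * ww z x.
Definition fS z x := 2 * (aS z x + aS z x * ww z x) + 2 * (kk z * rbS z x) + hh z x.
(* On nondecreasing y both kernels agree; the signed one makes the rates below
   consistent with zeta' = w and (U - c chi)' = v for arbitrary y. *)
Definition kap y x s := if sgd then expR (- sgk y x s) else expR (- `|y x - y s|).
Definition PbS z x := 4^-1 * It (fun s => kap (yS z) x s * fS z s).
Definition QbS z x := - 4^-1 * It (fun s => Num.sg (x - s) * kap (yS z) x s * fS z s).
(** This is U^2 + k^2/2 - P after cancellation of the constants at infinity: since g = chi^2 + p,
    only p survives from the profile. [AE] records the identity for the signed kernel. *)
Definition AS z x := aS z x - cc z * (cc z * pfun chi (yS z x)) - PbS z x.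
Definition QS z x := QbS z x + cc z * (cc z * gder chi (yS z x)).
(** The fourth entry is minus the derivative of Q as computed from [ac_sgQ] and g'' = p, with 1 +
    [ww] for y_x. The rate of [rh] is 0 because rbar_t = - k U_x cancels against (k y_x)_t = k
    U_x. *)
Definition FS z : st R := mkst (US z) (fun x => - QS z x) (vS z)
  (fun x => 2^-1 * hh z x + kk z * rbS z x + (AS z x + AS z x * ww z x))
  (fun x => 2 * (AS z x * vS z x)) (fun=> 0) 0 0.

Section Types.
Variables (dm : set (R -> R)) (n : (R -> R) -> R) (K : R) (fn : fnorm dm n K).
(** The relation allows two readings of the same estimates: pairs of states bounded in the full norm
    give Lipschitz bounds, and equal pairs with only the sup norms, the constants and A bounded give
    linear growth. *)
Variables (M : R) (rel : st R -> st R -> Prop).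
Hypothesis M0 : 0 <= M.
Hypothesis relC : forall z1 z2, rel z1 z2 -> rel z2 z1.
Hypothesis relS : forall z1 z2, rel z1 z2 -> SS dm z1.
Hypothesis relM : forall z1 z2, rel z1 z2 ->
  [/\ supn (ze z1) <= M, supn (uh z1) <= M, `|cc z1| <= M & `|kk z1| <= M].

Definition dd z1 z2 := NS n (z1 - z2).

(** A quantity has type (H, B) if it is O(H) and its difference between related states is O(B).
    Condition [gd], by which a distance times H is absorbed in B, is what makes the Leibniz rule
    [ty_M] close. *)
Definition ty (H : st R -> R -> R) (B : st R -> st R -> R -> R) (q : st R -> R -> R) :=
  exists2 C, 0 <= C & forall z1 z2, rel z1 z2 -> forall x,
    `|q z1 x| <= C * H z1 x /\ `|q z1 x - q z2 x| <= C * B z1 z2 x.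

Definition gd (H : st R -> R -> R) (B : st R -> st R -> R -> R) :=
  forall z1 z2, rel z1 z2 -> forall x, 0 <= H z1 x /\ dd z1 z2 * H z2 x <= B z1 z2 x.

Let relS2 z1 z2 : rel z1 z2 -> SS dm z2. Proof. by move=> /relC/relS. Qed.
Let dd_ge0 z1 z2 : rel z1 z2 -> 0 <= dd z1 z2.
Proof.
move=> r; apply: (sn_ge0 (sn_st fn)); apply: (snB (sn_st fn)); [exact: relS r|exact: relS2 r].
Qed.

Lemma gd_ge0 H B z1 z2 x : gd H B -> rel z1 z2 -> 0 <= H z1 x /\ 0 <= B z1 z2 x.
Proof.
move=> g r; have [h1 h2] := g _ _ r x; split=> //; apply: le_trans h2.
by apply: mulr_ge0 (dd_ge0 r) _; have [] := g _ _ (relC r) x.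
Qed.

Lemma ty_D H B q q' : gd H B -> ty H B q -> ty H B q' -> ty H B (fun z x => q z x + q' z x).
Proof.
move=> g [C c h] [C' c' h']; exists (C + C'); first exact: addr_ge0.
move=> z1 z2 r x; have [h1 h2] := h _ _ r x; have [h3 h4] := h' _ _ r x.
rewrite !mulrDl; split; first by rewrite (le_trans (ler_normD _ _))// lerD.
by rewrite opprD addrACA (le_trans (ler_normD _ _))// lerD.
Qed.

Lemma ty_Z H B k q : ty H B q -> ty H B (fun z x => k * q z x).
Proof.
move=> [C c h]; exists (`|k| * C); first exact: mulr_ge0.
move=> z1 z2 r x; have [h1 h2] := h _ _ r x.
by rewrite -mulrBr !normrM -!mulrA; split; rewrite ler_wpM2l.
Qed.

Lemma ty_ext H B q q' : (forall z x, q z x = q' z x) -> ty H B q -> ty H B q'.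
Proof. by move=> e [C c h]; exists C => // z1 z2 r x; rewrite -!e; exact: h. Qed.

Lemma ty_B H B q q' : gd H B -> ty H B q -> ty H B q' -> ty H B (fun z x => q z x - q' z x).
Proof.
move=> g h /(ty_Z (-1)) h'; apply: ty_ext (ty_D g h h') => z x; by rewrite mulN1r.
Qed.

Lemma ty_sub H B H' B' q : (forall z1 z2, rel z1 z2 -> forall x, H z1 x <= H' z1 x /\
  B z1 z2 x <= B' z1 z2 x) -> ty H B q -> ty H' B' q.
Proof.
move=> s [C c h]; exists C => // z1 z2 r x; have [h1 h2] := h _ _ r x.
have [s1 s2] := s _ _ r x; split.
  by rewrite (le_trans h1)// ler_wpM2l.
by rewrite (le_trans h2)// ler_wpM2l.
Qed.

(** Five sizes: bounded ([T1]), exponentially decaying ([Te]), dominated by the state ([T0]), by the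
    convolution of that majorant ([Tc]), or by the sum of the last two ([T2]). *)
Definition H1_ (z : st R) (x : R) : R := 1.
Definition B1_ z1 z2 (x : R) : R := dd z1 z2.
Definition He z x : R := ek x.
Definition Be z1 z2 x : R := dd z1 z2 * ek x.
Definition B0 z1 z2 x := DD (z1 - z2) x + dd z1 z2 * (GG z1 x + GG z2 x).
Definition Hc z := cv (GG z).
Definition Bc z1 z2 := cv (B0 z1 z2).
Definition H2_ z x := GG z x + Hc z x.
Definition B2 z1 z2 x := B0 z1 z2 x + Bc z1 z2 x.

Notation T1 := (ty H1_ B1_).
Notation Te := (ty He Be).
Notation T0 := (ty (@GG R) B0).
Notation Tc := (ty Hc Bc).
Notation T2 := (ty H2_ B2).

Lemma ty_M H B q q' : gd H B -> T1 q -> ty H B q' -> ty H B (fun z x => q z x * q' z x).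
Proof.
move=> g [C c h] [C' c' h']; exists (2 * (C * C')); first by rewrite !mulr_ge0.
move=> z1 z2 r x; have [h1 h2] := h _ _ r x; have [h3 h4] := h' _ _ r x.
have [h5 _] := h' _ _ (relC r) x; have [g1 g2] := g _ _ r x; have [g3 g4] := gd_ge0 x g r.
rewrite /H1_ mulr1 in h1; rewrite /B1_ in h2.
have cc0 := mulr_ge0 c c'.
have e1 : `|q z1 x * q' z1 x| <= C * C' * H z1 x by rewrite normrM -mulrA ler_pM.
split.
  by rewrite (le_trans e1)// -[leRHS]mulrA [leRHS]mulrDl mul1r lerDl; exact: mulr_ge0.
have -> : q z1 x * q' z1 x - q z2 x * q' z2 x = q z1 x * (q' z1 x - q' z2 x) + (q z1 x - q z2 x) * q' z2 x.
  by rewrite mulrBr mulrBl addrA subrK.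
rewrite (le_trans (ler_normD _ _))// !normrM -mulrA mulrDl mul1r lerD//.
  by rewrite -mulrA ler_pM.
rewrite (le_trans (ler_pM _ _ h2 h5))// mulrACA ler_wpM2l//.
Qed.

Lemma gd1 : gd H1_ B1_.
Proof. by move=> z1 z2 r x; rewrite /H1_ /B1_ mulr1 ler01. Qed.
Lemma gde : gd He Be.
Proof. by move=> z1 z2 r x; rewrite /He /Be ek_ge0. Qed.
Lemma gd0 : gd (@GG R) B0.
Proof.
move=> z1 z2 r x; split; first exact: GG_ge0.
by rewrite /B0 [dd z1 z2 * (_ + GG z2 x)]mulrDr addrA lerDr addr_ge0 ?DD_ge0//; exact: mulr_ge0 (dd_ge0 r) (GG_ge0 _ _).
Qed.

Lemma dm_B0 z1 z2 : rel z1 z2 -> dm (B0 z1 z2) /\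
  n (B0 z1 z2) <= dd z1 z2 + dd z1 z2 * (NS n z1 + n (@ek R) + (NS n z2 + n (@ek R))).
Proof.
move=> r; have s1 := relS r; have s2 := relS2 r.
have [a1 b1] := dm_DD fn (snB (sn_st fn) s1 s2).
have [a2 b2] := dm_GG fn s1; have [a3 b3] := dm_GG fn s2.
have [a4 b4] := fn_D fn a2 a3; have [a5 b5] := fn_Z fn (dd z1 z2) a4.
have [a6 b6] := fn_D fn a1 a5; split; first exact: a6.
rewrite (le_trans b6)// lerD// b5 ger0_norm ?dd_ge0// ler_wpM2l ?dd_ge0//.
by rewrite (le_trans b4)// lerD.
Qed.

Lemma B0_ge0 z1 z2 x : rel z1 z2 -> 0 <= B0 z1 z2 x.
Proof. by move=> r; have [] := gd_ge0 x gd0 r. Qed.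

Lemma cv_le f g x : (forall s, 0 <= f s) -> (forall s, f s <= g s) -> mf f -> dm g -> cv f x <= cv g x.
Proof.
move=> f0 fg m dg; have i := fn_ig fn dg x; apply: It_le => //.
  apply: (ig_le _ _ i); first by apply: mfM m; exact: mf_ek.
  by move=> s; rewrite normrM !ger0_norm ?ek_ge0// ler_wpM2l ?ek_ge0.
by move=> s; rewrite ler_wpM2l ?ek_ge0.
Qed.

Lemma cvZ k f x : ig (fun s => ek (x - s) * f s) -> cv (fun s => k * f s) x = k * cv f x.
Proof.
by move=> i; rewrite /cv -ItZ//; congr It; apply/funext => s; rewrite mulrCA.
Qed.

Lemma gdc : gd Hc Bc.
Proof.
move=> z1 z2 r x; split; first by apply: cv_ge0 => s; exact: GG_ge0.
have [a b] := dm_GG fn (relS2 r).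
rewrite /Hc -(cvZ (dd z1 z2) (fn_ig fn a x)).
apply: cv_le.
- by move=> s; rewrite mulr_ge0 ?GG_ge0// dd_ge0.
- by move=> s; have [_] := gd0 r s.
- by apply: mfM; [exact: mf_cst|exact: (fn_mf fn a)].
- by have [] := dm_B0 r.
Qed.

Lemma gd2 : gd H2_ B2.
Proof.
move=> z1 z2 r x; have [a b] := gd0 r x; have [c d] := gdc r x.
by rewrite addr_ge0// mulrDr lerD.
Qed.

Lemma te_t1 q : Te q -> T1 q.
Proof.
apply: ty_sub => z1 z2 r x; rewrite /He /H1_ /Be /B1_ ek_le1; split=> //.
by rewrite ler_piMr ?ek_le1// dd_ge0.
Qed.
Lemma te_t0 q : Te q -> T0 q.
Proof.
apply: ty_sub => z1 z2 r x; have eG z : ek x <= GG z x by rewrite /GG lerDr DD_ge0.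
split; first exact: eG.
have [_] := gd0 r x; apply: le_trans.
by rewrite /Be ler_wpM2l ?dd_ge0.
Qed.
Lemma t0_t2 q : T0 q -> T2 q.
Proof.
apply: ty_sub => z1 z2 r x; have [a b] := gdc r x; have [c d] := gd_ge0 x gdc r.
by rewrite /H2_ /B2 !lerDl.
Qed.
Lemma tc_t2 q : Tc q -> T2 q.
Proof.
apply: ty_sub => z1 z2 r x; have [a b] := gd0 r x; have [c d] := gd_ge0 x gd0 r.
by rewrite /H2_ /B2 !lerDr.
Qed.

Lemma t1_cst (q : R -> R) : bdd q -> T1 (fun _ x => q x).
Proof.
move=> [C h]; exists `|C| => // z1 z2 r x; rewrite subrr normr0 /H1_ /B1_ mulr1; split.
  exact: le_trans (h x) (ler_norm C).
by rewrite mulr_ge0// dd_ge0.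
Qed.

Let dparts z1 z2 : rel z1 z2 ->
  [/\ forall x, `|ze z1 x - ze z2 x| <= dd z1 z2, forall x, `|uh z1 x - uh z2 x| <= dd z1 z2,
   `|cc z1 - cc z2| <= dd z1 z2 & `|kk z1 - kk z2| <= dd z1 z2].
Proof.
move=> r; have s := snB (sn_st fn) (relS r) (relS2 r).
have [a b c d _] := NS_parts fn s; case: s => [[_ b1] [_ b2] _ _ _].
rewrite zeB in a b1; rewrite uhB in b b2.
by split; [move=> x; apply: le_trans a; exact: (supn_ge x b1)|move=> x; apply: le_trans b; exact: (supn_ge x b2)|exact: c|exact: d].
Qed.
Let bparts z1 z2 : rel z1 z2 ->
  [/\ forall x, `|ze z1 x| <= M, forall x, `|uh z1 x| <= M, `|cc z1| <= M & `|kk z1| <= M].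
Proof.
move=> r; have [a b c d] := relM r; have [[_ b1] [_ b2] _ _ _] := relS r.
split=> // x; [exact: le_trans (supn_ge x b1) a|exact: le_trans (supn_ge x b2) b].
Qed.

Let mk1 q : (forall z1 z2, rel z1 z2 -> forall x, `|q z1 x| <= M /\ `|q z1 x - q z2 x| <= dd z1 z2) ->
  T1 q.
Proof.
move=> h; exists (M + 1) => [|z1 z2 r x]; first exact: addr_ge0.
have [a b] := h _ _ r x; rewrite /H1_ /B1_ mulr1; split; first by rewrite (le_trans a)// lerDl.
by rewrite (le_trans b)// mulrDl mul1r lerDr mulr_ge0// dd_ge0.
Qed.
Lemma t1_uh : T1 (@uh R).
Proof. by apply: mk1 => z1 z2 r x; have [_ a _ _] := bparts r; have [_ b _ _] := dparts r; split. Qed.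
Lemma t1_cc : T1 (fun z _ => cc z).
Proof. by apply: mk1 => z1 z2 r x; have [_ _ a _] := bparts r; have [_ _ b _] := dparts r; split. Qed.
Lemma t1_kk : T1 (fun z _ => kk z).
Proof. by apply: mk1 => z1 z2 r x; have [_ _ _ a] := bparts r; have [_ _ _ b] := dparts r; split. Qed.

Let mk0 q : (forall z x, `|q z x| <= DD z x) -> (forall z1 z2 x, q z1 x - q z2 x = q (z1 - z2) x) -> T0 q.
Proof.
move=> h e; exists 1 => // z1 z2 r x; rewrite !mul1r e; split.
  by rewrite (le_trans (h _ _))// /GG lerDl ek_ge0.
rewrite (le_trans (h _ _))// /B0 lerDl; exact: mulr_ge0 (dd_ge0 r) (addr_ge0 (GG_ge0 _ _) (GG_ge0 _ _)).
Qed.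
Let le5 (a b c d e : R) : 0 <= a -> 0 <= b -> 0 <= c -> 0 <= d -> 0 <= e ->
  [/\ a <= a+b+c+d+e, b <= a+b+c+d+e, c <= a+b+c+d+e & d <= a+b+c+d+e /\ e <= a+b+c+d+e].
Proof. by move=> *; split; [| | |split]; lra. Qed.
Let dd5 z x := le5 (normr_ge0 (uh z x)) (normr_ge0 (ww z x)) (normr_ge0 (vh z x)) (normr_ge0 (hh z x))
  (normr_ge0 (rh z x)).
Lemma t0_uh : T0 (@uh R). Proof. by apply: mk0 => // z x; have [] := dd5 z x. Qed.
Lemma t0_ww : T0 (@ww R). Proof. by apply: mk0 => // z x; have [] := dd5 z x. Qed.
Lemma t0_vh : T0 (@vh R). Proof. by apply: mk0 => // z x; have [] := dd5 z x. Qed.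
Lemma t0_hh : T0 (@hh R). Proof. by apply: mk0 => // z x; have [_ _ _ []] := dd5 z x. Qed.
Lemma t0_rh : T0 (@rh R). Proof. by apply: mk0 => // z x; have [_ _ _ []] := dd5 z x. Qed.

Let yM z1 z2 x : rel z1 z2 -> `|yS z1 x - x| <= M.
Proof. by move=> r; have [a _ _ _] := bparts r; rewrite /yS addrC addKr. Qed.
Let yd z1 z2 x : rel z1 z2 -> `|yS z1 x - yS z2 x| <= dd z1 z2.
Proof.
by move=> r; have [a _ _ _] := dparts r; rewrite /yS opprD addrACA subrr add0r.
Qed.

Lemma te_dec (F f : R -> R) C : 0 <= C -> ac F f -> (forall x, `|F x| <= C * ek x) ->
  (forall x, `|f x| <= C * ek x) -> Te (fun z x => F (yS z x)).
Proof.
move=> C00 aF hF hf; have eM := expR_ge0 M.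
exists (C * expR M); first exact: mulr_ge0.
move=> z1 z2 r x; split.
  rewrite (le_trans (hF _))// -mulrA ler_wpM2l// (le_trans (ek_tri _ x))// ler_wpM2r ?ek_ge0//.
  by rewrite ler_expR (yM _ r).
rewrite (le_trans (decay_lip aF hf C00 (yM x r) (yM x (relC r))))//.
rewrite /Be mulrA mulrAC ler_wpM2r ?ek_ge0// ler_wpM2l ?mulr_ge0//.
exact: yd r.
Qed.

Hypothesis chiP : cutoff chi.
Variable C0 : R.
Hypothesis hC0 : chi_const chi C0.

Let c00 : 0 <= C0. Proof. by case: hC0. Qed.
Let qd := dr_qfun chiP.

Lemma bdd_chi : bdd chi.
Proof. by exists 1 => x; have /andP[a b] := chi_01 chiP x; rewrite ger0_norm. Qed.

Lemma te_dchi : Te (fun _ => chi').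
Proof.
exists C0 => // z1 z2 r x; rewrite subrr normr0; have [h _ _ _] := hC0.2 x; split=> //.
by rewrite mulr_ge0// /Be mulr_ge0 ?ek_ge0// dd_ge0.
Qed.
Lemma te_p : Te (fun z x => pfun chi (yS z x)).
Proof.
apply: (te_dec c00 (quadr_ac (quadr_pfun chiP))) => x.
  by have [_ _ _ []] := hC0.2 x.
by have [_ _ _ []] := hC0.2 x.
Qed.
Lemma te_g : Te (fun z x => gder chi (yS z x)).
Proof.
apply: (te_dec c00 (quadr_ac (quadr_gder chiP))) => x.
  by have [_ _ _ []] := hC0.2 x.
by have [_ _ _ []] := hC0.2 x.
Qed.
Lemma te_chiB : Te (fun z x => chi x - chi (yS z x)).
Proof.
have h x : `|chi' x| <= C0 * ek x by have [] := hC0.2 x.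
exists (C0 * expR M * (M + 1)); first by rewrite !mulr_ge0 ?expR_ge0 ?addr_ge0.
have C1 : 0 <= C0 * expR M by rewrite mulr_ge0 ?expR_ge0.
move=> z1 z2 r x; have := yM x r; have := yM x (relC r) => y2 y1.
have y0 : `|x - x| <= M by rewrite subrr normr0.
split.
  rewrite (le_trans (decay_lip (ac_chi chiP) h c00 y0 y1))// /He mulrAC ler_wpM2r ?ek_ge0//.
  by rewrite ler_wpM2l// distrC (le_trans y1)// lerDl.
have -> : chi x - chi (yS z1 x) - (chi x - chi (yS z2 x)) = chi (yS z2 x) - chi (yS z1 x).
  by rewrite opprB addrC addrA subrK.
rewrite (le_trans (decay_lip (ac_chi chiP) h c00 y2 y1))// /Be.
rewrite mulrAC -[leRHS]mulrA mulrA [leRHS]mulrA ler_wpM2r ?ek_ge0// -mulrA ler_wpM2l//.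
by rewrite distrC (le_trans (yd x r))// mulrDl mul1r lerDr mulr_ge0// dd_ge0.
Qed.
Lemma t1_chiy : T1 (fun z x => chi (yS z x)).
Proof.
apply: ty_ext (ty_B gd1 (t1_cst bdd_chi) (te_t1 te_chiB)) => z x.
by rewrite opprB addrC subrK.
Qed.

Lemma t1_U : T1 US.
Proof. exact: ty_D gd1 t1_uh (ty_M gd1 t1_cc (t1_cst bdd_chi)). Qed.
Lemma t0_v : T0 vS.
Proof. exact: ty_D gd0 t0_vh (ty_M gd0 t1_cc (te_t0 te_dchi)). Qed.
Lemma t0_Ub : T0 UbS.
Proof. exact: ty_D gd0 t0_uh (ty_M gd0 t1_cc (te_t0 te_chiB)). Qed.
Lemma t1_Ub : T1 UbS.
Proof. exact: ty_D gd1 t1_uh (ty_M gd1 t1_cc (te_t1 te_chiB)). Qed.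
Lemma t1_UU : T1 (fun z x => US z x + cc z * chi (yS z x)).
Proof. exact: ty_D gd1 t1_U (ty_M gd1 t1_cc t1_chiy). Qed.
Lemma t1_a : T1 aS.
Proof. exact: ty_M gd1 t1_Ub t1_UU. Qed.
Lemma t0_a : T0 aS.
Proof. by apply: ty_ext (ty_M gd0 t1_UU t0_Ub) => z x; rewrite mulrC. Qed.
Lemma t0_rb : T0 rbS.
Proof. exact: ty_B gd0 t0_rh (ty_M gd0 t1_kk t0_ww). Qed.
Lemma t0_f : T0 fS.
Proof.
apply: ty_D gd0 (ty_D gd0 _ _) t0_hh.
  exact: ty_Z (ty_D gd0 t0_a (ty_M gd0 t1_a t0_ww)).
exact: ty_Z (ty_M gd0 t1_kk t0_rb).
Qed.

Let relkap x s z1 z2 : rel z1 z2 -> 0 <= kap (yS z1) x s <= expR (2 * M) * ek (x - s) /\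
  `|kap (yS z1) x s - kap (yS z2) x s| <= 2 * expR (2 * M) * (dd z1 z2 * ek (x - s)).
Proof.
move=> r; pose th z := if sgd then sgk (yS z) x s else `|yS z x - yS z s|.
have kE z : kap (yS z) x s = expR (- th z) by rewrite /kap /th; case: (sgd).
have yE z : yS z x - yS z s = x - s + (ze z x - ze z s) by rewrite /yS opprD addrACA.
have sg1 : `|Num.sg (x - s)| <= 1 by rewrite normr_sg lern1; case: (_ == _).
have low z3 z4 : rel z3 z4 -> kap (yS z3) x s <= expR (2 * M) * ek (x - s).
  move=> r'; rewrite kE /ek -expRD ler_expR; have [a _ _ _] := bparts r'.
  have a2 : `|ze z3 x - ze z3 s| <= 2 * M.
    by rewrite (le_trans (ler_normB _ _))// mulrDl mul1r lerD.
  have : `|x - s| - 2 * M <= th z3; last lra.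
  rewrite /th; case: (sgd); last first.
    rewrite yE; have := lerB_normD (x - s) (ze z3 x - ze z3 s); lra.
  rewrite /sgk yE mulrDr -normrEsg; have : `|Num.sg (x - s) * (ze z3 x - ze z3 s)| <= 2 * M.
    by rewrite normrM (le_trans _ a2)// ler_piMl.
  by rewrite ler_norml => /andP[u _]; lra.
have l1 := low _ _ r; have l2 := low _ _ (relC r).
split; first by rewrite l1 kE expR_ge0.
have tl : `|th z1 - th z2| <= 2 * dd z1 z2.
  have [a _ _ _] := dparts r.
  have a2 : `|yS z1 x - yS z1 s - (yS z2 x - yS z2 s)| <= 2 * dd z1 z2.
    have -> : yS z1 x - yS z1 s - (yS z2 x - yS z2 s) = (ze z1 x - ze z2 x) - (ze z1 s - ze z2 s).
      by rewrite !yE; ring.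
    by rewrite (le_trans (ler_normB _ _))// mulrDl mul1r lerD.
  rewrite /th; case: (sgd).
    by rewrite /sgk -mulrBr normrM (le_trans _ a2)// ler_piMl.
  exact: le_trans (ler_dist_dist _ _) a2.
rewrite !kE in l1 l2 *; rewrite (le_trans (expN_lip l1 l2))//.
have -> : 2 * expR (2 * M) * (dd z1 z2 * ek (x - s)) = 2 * dd z1 z2 * (expR (2 * M) * ek (x - s)) by ring.
by rewrite ler_wpM2r// mulr_ge0 ?expR_ge0 ?ek_ge0.
Qed.

(* A kernel operator maps pairs controlled by (G, B0) to pairs controlled by
   their convolutions with exp(-|.|). *)
Lemma tc_int (kp : st R -> R -> R -> R) (q : st R -> R -> R) C : 0 <= C ->
  (forall z x, SS dm z -> mf (kp z x)) -> (forall z, SS dm z -> mf (q z)) ->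
  (forall x s z1 z2, rel z1 z2 -> `|kp z1 x s| <= C * ek (x - s) /\
     `|kp z1 x s - kp z2 x s| <= C * (dd z1 z2 * ek (x - s))) ->
  T0 q -> Tc (fun z x => It (fun s => kp z x s * q z s)).
Proof.
move=> c mk mq hk [C' c' hq]; exists (2 * (C * C')); first by rewrite !mulr_ge0.
have Cc := mulr_ge0 c c'.
have key z1 z2 x : rel z1 z2 -> ig (fun s => kp z1 x s * q z1 s) /\
    `|It (fun s => kp z1 x s * q z1 s)| <= C * C' * Hc z1 x.
  move=> r; have sz := relS r; have [dg _] := dm_GG fn sz.
  have le s : `|kp z1 x s * q z1 s| <= C * C' * (ek (x - s) * GG z1 s).
    have [h1 _] := hk x s _ _ r; have [h2 _] := hq _ _ r s.
    by rewrite normrM (le_trans (ler_pM _ _ h1 h2))// mulrACA.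
  have ii := igZ (C * C') (fn_ig fn dg x).
  have i : ig (fun s => kp z1 x s * q z1 s).
    by apply: (ig_le _ le ii); apply: mfM; [exact: mk|exact: mq].
  split=> //; rewrite (le_trans (It_normle i ii le))// ItZ//; exact: (fn_ig fn dg x).
move=> z1 z2 r x; have [i1 h1] := key _ _ x r; have [i2 _] := key _ _ x (relC r).
have [g1 g2] := gdc r x; have [g3 g4] := gd_ge0 x gdc r.
split.
  by rewrite (le_trans h1)// -[leRHS]mulrA [leRHS]mulrDl mul1r lerDl; exact: mulr_ge0.
have [db _] := dm_B0 r; have ib := fn_ig fn db x.
rewrite -ItB// /Bc /cv -ItZ//; apply: It_normle; [exact: igB|exact: igZ|].
move=> s; have [k1 k2] := hk x s _ _ r; have [q1 q2] := hq _ _ r s.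
have [q3 _] := hq _ _ (relC r) s.
have -> : kp z1 x s * q z1 s - kp z2 x s * q z2 s =
  kp z1 x s * (q z1 s - q z2 s) + (kp z1 x s - kp z2 x s) * q z2 s by ring.
rewrite (le_trans (ler_normD _ _))// !normrM.
have -> : 2 * (C * C') * (ek (x - s) * B0 z1 z2 s) =
  C * ek (x - s) * (C' * B0 z1 z2 s) + C * ek (x - s) * (C' * B0 z1 z2 s) by ring.
apply: lerD; first exact: ler_pM.
rewrite (le_trans (ler_pM _ _ k2 q3))//.
have -> : C * (dd z1 z2 * ek (x - s)) * (C' * GG z2 s) =
  C * ek (x - s) * (C' * (dd z1 z2 * GG z2 s)) by ring.
rewrite ler_wpM2l//; first exact: mulr_ge0 c (ek_ge0 _).
by rewrite ler_wpM2l//; have [] := gd0 r s.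
Qed.

Let mzS z : SS dm z -> [/\ mf (ze z), mf (uh z), mf (ww z), mf (vh z) & mf (hh z) /\ mf (rh z)].
Proof. by move=> [[a _] [b _] c d [e f]]; do ?split => //; apply: (fn_mf fn). Qed.
Let mchi : mf chi. Proof. exact: mf_cont (chi_cont chiP). Qed.
Let mchi' : mf chi'. Proof. exact: mf_cont (dr_cont (smooth_dr (smooth_derive (chi_smooth chiP)))). Qed.
Let my z : SS dm z -> mf (yS z).
Proof. by move=> /mzS[a _ _ _ _]; apply: mfD => //; exact: mf_id. Qed.
Let mchiy z : SS dm z -> mf (fun x => chi (yS z x)).
Proof. by move=> s; exact: mf_comp mchi (my s). Qed.
Let mU z : SS dm z -> mf (US z).
Proof. by move=> /mzS[_ a _ _ _]; apply: mfD => //; apply: mfM => //; exact: mf_cst. Qed.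
Let mUb z : SS dm z -> mf (UbS z).
Proof.
move=> s; have [_ a _ _ _] := mzS s; apply: mfD => //; apply: mfM; first exact: mf_cst.
by apply: mfB => //; exact: mchiy.
Qed.
Let ma z : SS dm z -> mf (aS z).
Proof.
move=> s; apply: mfM; first exact: mUb.
by apply: mfD; [exact: mU|apply: mfM; [exact: mf_cst|exact: mchiy]].
Qed.
Let mrb z : SS dm z -> mf (rbS z).
Proof. by move=> /mzS[_ _ a _ [_ b]]; apply: mfB => //; apply: mfM => //; exact: mf_cst. Qed.
Lemma mf_fS z : SS dm z -> mf (fS z).
Proof.
move=> s; have [_ _ a _ [b _]] := mzS s; have c := ma s; have d := mrb s.
by rewrite /fS; mfs.
Qed.
Lemma mf_kap z x : SS dm z -> mf (kap (yS z) x).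
Proof. by move=> s; have a := my s; rewrite /kap; case: (sgd); rewrite ?/sgk; mfs. Qed.

Lemma mf_kint (g : R -> R) z : SS dm z -> mf g -> (forall x, `|g x| <= 1) -> rel z z ->
  mf (fun x => It (fun s => g (x - s) * kap (yS z) x s * fS z s)).
Proof.
move=> sz mg g1 r; have [C c hf] := t0_f.
have [dg _] := dm_GG fn sz; pose D := expR (2 * M) * C.
have D0 : 0 <= D by rewrite mulr_ge0 ?expR_ge0.
have leD x s : `|g (x - s) * kap (yS z) x s * fS z s| <= D * (ek (x - s) * GG z s).
  have [/andP[a b] _] := relkap x s r; have [h _] := hf _ _ r s.
  rewrite !normrM -mulrA (le_trans (ler_piMl _ (g1 _)))//.
  by rewrite (ger0_norm a) (le_trans (ler_pM _ _ b h))// mulrACA.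
have iD x := igZ D (fn_ig fn dg x).
have mfz := mf_fS sz; have myz := my sz.
have ik x : ig (fun s => g (x - s) * kap (yS z) x s * fS z s).
  apply: (ig_le _ (leD x) (iD x)); apply: mfM => //; apply: mfM; last exact: mf_kap.
  by apply: mf_comp mg _; mfs.
(* Tonelli asks for a nonnegative integrand: [D] times the majorant is added here, and its
   convolution is subtracted at the end. *)
pose k1 (p : R * R) := g (p.1 - p.2) * kap (yS z) p.1 p.2 * fS z p.2 + D * (ek (p.1 - p.2) * GG z p.2).
have m1 : measurable_fun setT (fun p : R * R => p.1 : R) by exact: measurable_fst.
have m2 : measurable_fun setT (fun p : R * R => p.2 : R) by exact: measurable_snd.
have m12 : measurable_fun setT (fun p : R * R => p.1 - p.2) by exact: measurable_funB.
have my1 : measurable_fun setT (fun p : R * R => yS z p.1) by exact: (measurableT_comp myz m1).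
have my2 : measurable_fun setT (fun p : R * R => yS z p.2) by exact: (measurableT_comp myz m2).
have my12 : measurable_fun setT (fun p : R * R => yS z p.1 - yS z p.2) by exact: measurable_funB.
have mk : measurable_fun setT (fun p : R * R => kap (yS z) p.1 p.2).
  rewrite /kap; case: (sgd); apply: (measurableT_comp (@measurable_expR R)).
    rewrite /sgk; apply: (measurableT_comp (mfN (@mf_id R))); apply: measurable_funM => //.
    exact: (measurableT_comp (mf_sg (@mf_id R)) m12).
  apply: (measurableT_comp (mfN (@mf_id R))); exact: (measurableT_comp (mf_abs (@mf_id R)) my12).
have mkk : measurable_fun setT k1.
  apply: measurable_funD.
    apply: measurable_funM; last exact: (measurableT_comp mfz m2).
    by apply: measurable_funM => //; exact: (measurableT_comp mg m12).
  apply: measurable_funM; first exact: measurable_cst.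
  apply: measurable_funM; first exact: mf_ek2.
  exact: (measurableT_comp (fn_mf fn dg) m2).
have k10 p : 0 <= k1 p.
  by have := leD p.1 p.2; rewrite ler_norml /k1 => /andP[h _]; rewrite -lerBlDr sub0r.
have := mfB (tonelliR mkk k10 (fun x => igD (ik x) (iD x)))
  (mfM (mf_cst D) (fn_mf fn (fn_cv fn dg).1)).
congr mf; apply/funext => x; rewrite /k1/= ItD// ItZ; last exact: (fn_ig fn dg x).
have -> : cv (fun s => `|GG z s|) x = It (fun s => ek (x - s) * GG z s).
  by congr It; apply/funext => s; rewrite ger0_norm ?GG_ge0.
by rewrite addrK.
Qed.

Lemma tc_Pb : Tc PbS.
Proof.
apply: ty_Z; apply: (@tc_int (fun z x s => kap (yS z) x s) fS (2 * expR (2 * M))).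
- by rewrite mulr_ge0 ?expR_ge0.
- by move=> z x; exact: mf_kap.
- exact: mf_fS.
- move=> x s z1 z2 r; have [/andP[a b] c] := relkap x s r; split=> //.
  rewrite ger0_norm// (le_trans b)// ler_wpM2r ?ek_ge0// ler_peMl ?expR_ge0 ?ler1n//.
- exact: t0_f.
Qed.

Lemma tc_Qb : Tc QbS.
Proof.
apply: ty_Z; apply: (@tc_int (fun z x s => Num.sg (x - s) * kap (yS z) x s) fS (2 * expR (2 * M))).
- by rewrite mulr_ge0 ?expR_ge0.
- by move=> z x sz; apply: mfM; [mfs|exact: mf_kap].
- exact: mf_fS.
- move=> x s z1 z2 r; have [/andP[a b] c] := relkap x s r.
  have sg1 : `|Num.sg (x - s)| <= 1 by rewrite normr_sg lern1; case: (_ == _).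
  rewrite -mulrBr !normrM; split.
    rewrite (ger0_norm a) (le_trans (ler_piMl a sg1))// (le_trans b)// ler_wpM2r ?ek_ge0//.
    by rewrite ler_peMl ?expR_ge0 ?ler1n.
  by rewrite (le_trans (ler_piMl _ sg1)).
- exact: t0_f.
Qed.

Lemma t2_A : T2 AS.
Proof.
apply: ty_B gd2 (t0_t2 _) (tc_t2 tc_Pb); apply: ty_B gd0 t0_a (ty_M gd0 t1_cc (ty_M gd0 t1_cc (te_t0 te_p))).
Qed.
Lemma te_cg : Te (fun z x => cc z * (cc z * gder chi (yS z x))).
Proof. exact: ty_M gde t1_cc (ty_M gde t1_cc te_g). Qed.
Lemma t2_Q : T2 QS.
Proof. exact: ty_D gd2 (tc_t2 tc_Qb) (t0_t2 (te_t0 te_cg)). Qed.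

Lemma mf_Pb z : SS dm z -> rel z z -> mf (PbS z).
Proof.
move=> sz r; apply: mfM; first exact: mf_cst.
have := mf_kint sz (mf_cst 1) (fun=> ltac:(by rewrite normr1)) r; congr mf; apply/funext => x.
by congr It; apply/funext => s; rewrite mul1r.
Qed.
Lemma mf_Qb z : SS dm z -> rel z z -> mf (QbS z).
Proof.
move=> sz r; apply: mfM; first exact: mf_cst.
apply: (mf_kint sz (mf_sg (@mf_id R))) r => x; rewrite normr_sg lern1; by case: (_ == _).
Qed.
Lemma mf_A z : SS dm z -> rel z z -> mf (AS z).
Proof.
move=> sz r; apply: mfB; last exact: mf_Pb.
apply: mfB; first exact: ma.
do 2! (apply: mfM; first exact: mf_cst).
by apply: mf_comp (my sz); exact: mf_cont (dr_cont (dr_pfun chiP)).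
Qed.
Lemma mf_Q z : SS dm z -> rel z z -> mf (QS z).
Proof.
move=> sz r; apply: mfD; first exact: mf_Qb.
do 2! (apply: mfM; first exact: mf_cst).
by apply: mf_comp (my sz); exact: mf_cont (dr_cont (dr_gder chiP)).
Qed.

Hypothesis relr : forall z1 z2, rel z1 z2 -> rel z1 z1.

Lemma n_ty H B q : (forall z, SS dm z -> rel z z -> mf (q z)) -> gd H B ->
  (forall z1 z2, rel z1 z2 -> dm (H z1) /\ dm (B z1 z2)) -> ty H B q ->
  exists2 C, 0 <= C & forall z1 z2, rel z1 z2 ->
    [/\ dm (q z1), n (q z1) <= C * n (H z1) & n (fun x => q z1 x - q z2 x) <= C * n (B z1 z2)].
Proof.
move=> mq g hd [C c hq]; exists C => // z1 z2 r.
have [d1 d2] := hd _ _ r; have r1 := relr r; have r2 := relr (relC r).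
have m1 := mq _ (relS r) r1; have m2 := mq _ (relS2 r) r2.
have [d3 e3] := fn_Z fn C d1; have [d4 e4] := fn_Z fn C d2.
have [a1 b1] : dm (q z1) /\ n (q z1) <= n (fun x => C * H z1 x).
  apply: (fn_le fn) => // x; have [h _] := hq _ _ r x; rewrite (le_trans h)// ler_norm//.
have [a2 b2] : dm (fun x => q z1 x - q z2 x) /\ n (fun x => q z1 x - q z2 x) <= n (fun x => C * B z1 z2 x).
  apply: (fn_le fn) => //; first exact: mfB.
  by move=> x; have [_ h] := hq _ _ r x; rewrite (le_trans h)// ler_norm.
by split=> //; [rewrite (le_trans b1)// e3 ger0_norm|rewrite (le_trans b2)// e4 ger0_norm].
Qed.

Lemma dm_H2 z1 z2 : rel z1 z2 -> dm (H2_ z1) /\ n (H2_ z1) <= (1 + K) * (NS n z1 + n (@ek R)).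
Proof.
move=> r; have [a b] := dm_GG fn (relS r); have [c d] := fn_cv fn a.
have e : cv (fun s => `|GG z1 s|) = Hc z1.
  by apply/funext => x; congr It; apply/funext => s; rewrite ger0_norm ?GG_ge0.
rewrite e in c d; have [f g] := fn_D fn a c; split; first exact: f.
rewrite (le_trans g)// mulrDl mul1r lerD// (le_trans d)// ler_wpM2l//; exact: (fn_K fn).
Qed.
Lemma dm_B2 z1 z2 : rel z1 z2 -> dm (B2 z1 z2) /\
  n (B2 z1 z2) <= (1 + K) * (dd z1 z2 * (1 + (NS n z1 + n (@ek R) + (NS n z2 + n (@ek R))))).
Proof.
move=> r; have [a b] := dm_B0 r; have [c d] := fn_cv fn a.
have e : cv (fun s => `|B0 z1 z2 s|) = Bc z1 z2.
  by apply/funext => x; congr It; apply/funext => s; rewrite ger0_norm ?(B0_ge0 _ r).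
rewrite e in c d; have [f g] := fn_D fn a c; split; first exact: f.
have b' : n (B0 z1 z2) <= dd z1 z2 * (1 + (NS n z1 + n (@ek R) + (NS n z2 + n (@ek R)))).
  by rewrite mulrDr mulr1.
rewrite (le_trans g)// mulrDl mul1r lerD// (le_trans d)// ler_wpM2l//; exact: (fn_K fn).
Qed.

Lemma sup_c z1 z2 x : rel z1 z2 -> Hc z1 x <= K * (NS n z1 + n (@ek R)) /\
  Bc z1 z2 x <= K * (dd z1 z2 * (1 + (NS n z1 + n (@ek R) + (NS n z2 + n (@ek R))))).
Proof.
move=> r; have [a b] := dm_GG fn (relS r); have [a' b'] := dm_B0 r.
have h1 := fn_cvx fn a x; have h2 := fn_cvx fn a' x.
have e : cv (fun s => `|B0 z1 z2 s|) x = Bc z1 z2 x.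
  by congr It; apply/funext => s; rewrite ger0_norm ?(B0_ge0 _ r).
have e' : cv (fun s => `|GG z1 s|) x = Hc z1 x.
  by congr It; apply/funext => s; rewrite ger0_norm ?GG_ge0.
rewrite e in h2; rewrite e' in h1; have K0 := fn_K fn; split.
  by rewrite (le_trans h1)// ler_wpM2l.
by rewrite (le_trans h2)// ler_wpM2l// mulrDr mulr1.
Qed.

(** The pointwise bound of a convolution by the norm makes A bounded when the whole norm is. The
    growth estimate takes the bound on A as a hypothesis instead, since there it comes from the
    energy. *)
Lemma t1_AN : (forall z1 z2, rel z1 z2 -> NS n z1 <= M) -> T1 AS.
Proof.
have aux (a e m : R) : 0 <= m -> a <= m -> 0 <= e -> a + e <= 1 + 2 * (m + e) by lra.
have aux2 (a b e m : R) : a <= m -> b <= m -> 0 <= e -> 1 + (a + e + (b + e)) <= 1 + 2 * (m + e) by lra.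
move=> relN; have ek0 := fn_ge0 fn (fn_ek fn); have K0 := fn_K fn.
apply: ty_B gd1 (ty_B gd1 t1_a (ty_M gd1 t1_cc (ty_M gd1 t1_cc (te_t1 te_p)))) _.
have [c c_ h] := tc_Pb; pose L := K * (1 + 2 * (M + n (@ek R))).
have L0 : 0 <= L by rewrite mulr_ge0// addr_ge0// mulr_ge0// addr_ge0.
exists (c * L) => [|z1 z2 r x]; first exact: mulr_ge0.
have [h1 h2] := h _ _ r x; have [h3 h4] := sup_c x r.
have n1 := relN _ _ r; have n2 := relN _ _ (relC r); have d0 := dd_ge0 r.
rewrite /H1_ /B1_ mulr1 -mulrA; split.
  rewrite (le_trans h1)// ler_wpM2l// (le_trans h3)//; by apply: (ler_wpM2l K0); exact: aux.
rewrite (le_trans h2)// ler_wpM2l// (le_trans h4)// /L -mulrA ler_wpM2l// mulrC ler_wpM2r//; exact: aux2.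
Qed.

Hypothesis t1_A : T1 AS.
Lemma t2_vr : T2 (fun z x => 2^-1 * hh z x + kk z * rbS z x + (AS z x + AS z x * ww z x)).
Proof.
apply: ty_D gd2 (t0_t2 (ty_D gd0 (ty_Z _ t0_hh) (ty_M gd0 t1_kk t0_rb))) _.
exact: ty_D gd2 t2_A (t0_t2 (ty_M gd0 t1_A t0_ww)).
Qed.
Lemma t0_hr : T0 (fun z x => 2 * (AS z x * vS z x)).
Proof. exact: ty_Z (ty_M gd0 t1_A t0_v). Qed.

Let n0 : n (fun=> 0) = 0.
Proof.
rewrite (_ : (fun=> 0) = (fun x => 0 * ek x)); last by apply/funext => x; rewrite mul0r.
by rewrite (fn_Z fn 0 (fn_ek fn)).2 normr0 mul0r.
Qed.

Let NS_ge0 z : SS dm z -> 0 <= NS n z. Proof. exact: (sn_ge0 (sn_st fn)). Qed.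

(** Both convolution bounds of [fnorm] are consumed: the pointwise one for the sup norm of the rate
    of [uh], the one inside the space for the remaining norms. *)
Lemma rate_gen : exists2 C, 0 <= C & forall z1 z2, rel z1 z2 ->
  [/\ SS dm (FS z1), NS n (FS z1) <= C * (1 + NS n z1) &
   NS n (FS z1 - FS z2) <= C * (dd z1 z2 * (1 + (NS n z1 + NS n z2)))].
Proof.
have ek0 := fn_ge0 fn (fn_ek fn); have K0 := fn_K fn.
pose L := (1 + K) * (1 + 2 * n (@ek R)).
have L0 : 0 <= L by apply: mulr_ge0; move: K0 ek0; lra.
have hd z1 z2 : rel z1 z2 -> dm (H2_ z1) /\ dm (B2 z1 z2).
  by move=> r; split; [have [] := dm_H2 r|have [] := dm_B2 r].
have [c1 c10 h1] := t1_U.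
have t2q : T2 (fun z x => - QS z x).
  by apply: ty_ext (ty_Z (-1) t2_Q) => z x; rewrite mulN1r.
have mq z : SS dm z -> rel z z -> mf (fun x => - QS z x).
  by move=> sz r; exact: mfN (mf_Q sz r).
have mv z : SS dm z -> mf (vS z).
  by move=> sz; have [_ _ _ a _] := mzS sz; apply: mfD => //; apply: mfM => //; exact: mf_cst.
have mv2 (z : st R) : SS dm z -> rel z z -> mf (vS z) by move=> sz _; exact: mv.
have mvr z : SS dm z -> rel z z -> mf (fun x => 2^-1 * hh z x + kk z * rbS z x + (AS z x + AS z x * ww z x)).
  move=> sz r; have [_ _ a _ [b _]] := mzS sz; have c := mf_A sz r; have d := mrb sz; by mfs.
have mhr z : SS dm z -> rel z z -> mf (fun x => 2 * (AS z x * vS z x)).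
  move=> sz r; have c := mf_A sz r; have d := mv _ sz; by mfs.
have [c2 c20 h2] := n_ty mq gd2 hd t2q.
have [c3 c30 h3] := n_ty mv2 gd2 hd (t0_t2 t0_v).
have [c4 c40 h4] := n_ty mvr gd2 hd t2_vr.
have [c5 c50 h5] := n_ty mhr gd2 hd (t0_t2 t0_hr).
have [c6 c60 h6] := tc_Qb; have [c7 c70 h7] := te_t1 te_cg.
exists (c1 + (c6 * L + c7) + (c2 + c3 + c4 + c5) * L).
  by rewrite !addr_ge0// mulr_ge0// !addr_ge0.
move=> z1 z2 r; have NS1 := NS_ge0 (relS r); have NS2 := NS_ge0 (relS2 r).
have d0 := dd_ge0 r.
pose W1 := 1 + NS n z1; pose W2 := dd z1 z2 * (1 + (NS n z1 + NS n z2)).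
have w1 : 1 <= W1 by rewrite /W1 lerDl.
have w2 : dd z1 z2 <= W2 by rewrite /W2 ler_peMr// lerDl addr_ge0.
have W10 : 0 <= W1 by rewrite (le_trans ler01).
have W20 : 0 <= W2 by rewrite (le_trans d0).
have aux (a b p : R) : 0 <= p -> 0 <= a -> p + a <= (1 + 2 * p) * (1 + a).
  by move=> ? ?; have := mulr_ge0 (_ : 0 <= p) (_ : 0 <= a); lra.
have aux2 : NS n z1 + n (@ek R) <= (1 + 2 * n (@ek R)) * W1 by rewrite addrC; exact: aux.
have aux3 : dd z1 z2 * (1 + (NS n z1 + n (@ek R) + (NS n z2 + n (@ek R)))) <= (1 + 2 * n (@ek R)) * W2.
  rewrite /W2 mulrCA ler_wpM2l//; have := mulr_ge0 ek0 NS1; have := mulr_ge0 ek0 NS2; lra.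
have nH : n (H2_ z1) <= L * W1.
  have [_ e] := dm_H2 r; rewrite (le_trans e)// /L -mulrA ler_wpM2l// addr_ge0//.
have nB : n (B2 z1 z2) <= L * W2.
  have [_ e] := dm_B2 r; rewrite (le_trans e)// /L -mulrA ler_wpM2l// addr_ge0//.
have sH x : Hc z1 x <= L * W1.
  have [e _] := sup_c x r; rewrite (le_trans e)// /L -mulrA.
  apply: (le_trans (ler_wpM2l K0 aux2)); rewrite ler_wpM2r ?lerDr// mulr_ge0//; lra.
have sB x : Bc z1 z2 x <= L * W2.
  have [_ e] := sup_c x r; rewrite (le_trans e)// /L -mulrA.
  apply: (le_trans (ler_wpM2l K0 aux3)); rewrite ler_wpM2r ?lerDr// mulr_ge0//; lra.
have [q1 q2 q3] := h2 _ _ r; have [v1 v2 v3] := h3 _ _ r.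
have [a1 a2 a3] := h4 _ _ r; have [b1 b2 b3] := h5 _ _ r.
have Us x : `|US z1 x| <= c1 * W1.
  have [h _] := h1 _ _ r x; rewrite (le_trans h)// ler_wpM2l//.
have Ud x : `|US z1 x - US z2 x| <= c1 * W2.
  have [_ h] := h1 _ _ r x; rewrite (le_trans h)// ler_wpM2l//.
have Qs x : `|- QS z1 x| <= (c6 * L + c7) * W1.
  have [h _] := h6 _ _ r x; have [h' _] := h7 _ _ r x.
  rewrite normrN (le_trans (ler_normD _ _))// mulrDl lerD//.
    by rewrite (le_trans h)// -mulrA ler_wpM2l.
  by rewrite (le_trans h')// ler_wpM2l.
have Qd x : `|- QS z1 x - - QS z2 x| <= (c6 * L + c7) * W2.
  have [_ h] := h6 _ _ r x; have [_ h'] := h7 _ _ r x.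
  rewrite -opprD normrN /QS opprD addrACA (le_trans (ler_normD _ _))// mulrDl lerD//.
    by rewrite (le_trans h)// -mulrA ler_wpM2l.
  by rewrite (le_trans h')// ler_wpM2l.
have sc c (nn W : R) N' : 0 <= c -> nn <= c * N' -> N' <= L * W -> nn <= c * L * W.
  by move=> c' e e'; rewrite (le_trans e)// -mulrA ler_wpM2l.
have arith := @sum6_le R c1 c2 c3 c4 c5 c6 c7 L.
have e0 : `|0 : R| = 0 by rewrite normr0.
split.
- split; [split; [exact: mU (relS r)|by exists (c1 * W1)]|split=> //; by exists ((c6 * L + c7) * W1)|..] => //.
  by split=> //; exact: dm0 fn.
- rewrite /NS (_ : rh (FS z1) = (fun=> 0))// (_ : cc (FS z1) = 0)// (_ : kk (FS z1) = 0)// n0 normr0.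
  apply: arith; [exact: supn_le|exact: supn_le|..].
  + exact: sc q2 nH. + exact: sc v2 nH. + exact: sc a2 nH. + exact: sc b2 nH.
- rewrite /NS !stB.
  have -> : (fun x => rh (FS z1) x - rh (FS z2) x) = (fun=> 0) by apply/funext => x; exact: subrr.
  rewrite n0 (_ : cc (FS z1) - cc (FS z2) = 0); last exact: subrr.
  rewrite normr0.
  apply: arith; [exact: supn_le|exact: supn_le|..].
  + exact: sc q3 nB. + exact: sc v3 nB. + exact: sc a3 nB. + exact: sc b3 nB.
Qed.

End Types.

Section Conclusions.
Variables (dm : set (R -> R)) (n : (R -> R) -> R) (K : R) (fn : fnorm dm n K).
Hypothesis chiP : cutoff chi.

Lemma rate_lip M : 0 <= M -> exists2 C, 0 <= C & forall z1 z2, SS dm z1 -> SS dm z2 ->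
  NS n z1 <= M -> NS n z2 <= M ->
  SS dm (FS z1) /\ NS n (FS z1 - FS z2) <= C * NS n (z1 - z2).
Proof.
move=> M0; have [C0 hC0] := chi_constP chiP.
pose rel z1 z2 := [/\ SS dm z1, SS dm z2, NS n z1 <= M & NS n z2 <= M].
have relC z1 z2 : rel z1 z2 -> rel z2 z1 by case.
have relS z1 z2 : rel z1 z2 -> SS dm z1 by case.
have relM z1 z2 : rel z1 z2 ->
  [/\ supn (ze z1) <= M, supn (uh z1) <= M, `|cc z1| <= M & `|kk z1| <= M].
  case=> s1 _ n1 _; have [a b c d _] := NS_parts fn s1.
  by split; apply: le_trans n1.
have relr z1 z2 : rel z1 z2 -> rel z1 z1 by case.
have t1A : ty rel H1_ (B1_ n) AS.
  by apply: (t1_AN fn M0 relC relS relM chiP hC0) => z1 z2 [].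
have [C c h] := rate_gen fn M0 relC relS relM chiP hC0 relr t1A.
exists (C * (1 + 2 * M)) => [|z1 z2 s1 s2 n1 n2]; first by rewrite mulr_ge0// addr_ge0// mulr_ge0.
have [a _ b] := h z1 z2 (And4 s1 s2 n1 n2); split=> //.
have d0 : 0 <= NS n (z1 - z2) := sn_ge0 (sn_st fn) (snB (sn_st fn) s1 s2).
rewrite (le_trans b)// -mulrA ler_wpM2l// mulrC ler_wpM2r//.
lra.
Qed.

(** The rates are linear in the unknowns that are not assumed bounded. Hence bounds on [ze], [uh],
    c, k and A alone exclude blow-up of the derivatives. *)
Lemma rate_growth M : 0 <= M -> exists2 C, 0 <= C & forall z, SS dm z ->
  supn (ze z) <= M -> supn (uh z) <= M -> `|cc z| <= M -> `|kk z| <= M ->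
  (forall x, `|AS z x| <= M) -> NS n (FS z) <= C * (1 + NS n z).
Proof.
move=> M0; have [C0 hC0] := chi_constP chiP.
pose rel z1 z2 := z1 = z2 /\ [/\ SS dm z1, supn (ze z1) <= M, supn (uh z1) <= M,
  `|cc z1| <= M /\ `|kk z1| <= M & forall x, `|AS z1 x| <= M].
have relC z1 z2 : rel z1 z2 -> rel z2 z1 by case=> ->.
have relS z1 z2 : rel z1 z2 -> SS dm z1 by case=> _ [].
have relM z1 z2 : rel z1 z2 ->
  [/\ supn (ze z1) <= M, supn (uh z1) <= M, `|cc z1| <= M & `|kk z1| <= M].
  by case=> _ [_ a b [c d] _].
have relr z1 z2 : rel z1 z2 -> rel z1 z1 by case=> ->.
have t1A : ty rel H1_ (B1_ n) AS.
  exists M => // z1 z2 [-> [s _ _ _ h]] x; rewrite /H1_ mulr1 subrr normr0; split=> //.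
  apply: mulr_ge0 => //; exact: (sn_ge0 (sn_st fn) (snB (sn_st fn) s s)).
have [C c h] := rate_gen fn M0 relC relS relM chiP hC0 relr t1A.
by exists C => // z sz a b d e f; have [] := h z z (conj erefl (And5 sz a b (conj d e) f)).
Qed.
End Conclusions.
End Rates.

(** * Truncated solutions *)

Section Telescope.
Context {R : realType}.

Lemma sn_fn (dm : set (R -> R)) n K : fnorm dm n K ->
  seminormed (W := R -> R^o) dm n.
Proof.
move=> fn; split.
- exact: dm0 fn. - by move=> x y dx dy; exact: (fn_D fn dx dy).1.
- by move=> a x dx; exact: (fn_Z fn a dx).1. - exact: (fn_ge0 fn).
- by move=> x y dx dy; exact: (fn_D fn dx dy).2.
- by move=> a x dx; exact: (fn_Z fn a dx).2.
Qed.

Lemma sn_telescope (W : lmodType R) (S : set W) N : seminormed S N ->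
  forall (u : nat -> W) (C : R), (forall n, S (u n)) ->
  (forall n, N (u n.+1 - u n) <= C / 2 ^+ n) ->
  forall j n, N (u (n + j)%N - u n) <= 2 * C / 2 ^+ n.
Proof.
move=> sn u C Su hu j n.
have C0 : 0 <= C.
  by have := le_trans (sn_ge0 sn (snB sn (Su 1%N) (Su 0%N))) (hu 0%N); rewrite expr0 divr1.
suff : N (u (n + j)%N - u n) <= 2 * C / 2 ^+ n - 2 * C / 2 ^+ (n + j).
  by move/le_trans; apply; rewrite gerBl divr_ge0// mulr_ge0.
elim: j => [|j IH]; first by rewrite addn0 !subrr (sn_zero sn).
rewrite addnS (le_trans (sn_tri sn (Su _) (Su (n + j)%N) (Su _)))//.
have h := hu (n + j)%N; rewrite (le_trans (lerD h IH))// exprS.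
have e : (2 ^+ (n + j) : R) != 0 by rewrite expf_neq0.
have -> : 2 * C / (2 * 2 ^+ (n + j)) = C / 2 ^+ (n + j) by field.
have -> : 2 * C / 2 ^+ (n + j) = C / 2 ^+ (n + j) + C / 2 ^+ (n + j) by field.
by move: (C / _) (2 * C / _) => a b; rewrite le_eqVlt; apply/orP; left; apply/eqP; ring.
Qed.

(** The limit is the supremum of the lower bounds [a m - 2 * C / 2 ^+ m], none of which exceeds an
    upper bound [a n + 2 * C / 2 ^+ n]. *)
Lemma fastR (a : nat -> R) (C : R) : (forall n, `|a n.+1 - a n| <= C / 2 ^+ n) ->
  exists l, forall n, `|l - a n| <= 2 * C / 2 ^+ n.
Proof.
move=> h; have sn : seminormed (W := R^o) setT Num.norm.
  by split => //; [move=> x y _ _; exact: ler_normD|move=> b x _; exact: normrM].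
have t j n : `|a (n + j)%N - a n| <= 2 * C / 2 ^+ n by exact: (sn_telescope sn).
have t2 m n : a m - 2 * C / 2 ^+ m <= a n + 2 * C / 2 ^+ n.
  have C0 k : 0 <= 2 * C / 2 ^+ k by exact: le_trans (normr_ge0 _) (t 0%N k).
  have [mn|/ltnW nm] := leqP m n.
    have := t (n - m)%N m; rewrite subnKC// ler_norml => /andP[u _]; have := C0 n.
    by move: u; move: (_ / _) (_ / _) (a m) (a n); clear => *; lra.
  have := t (m - n)%N n; rewrite subnKC// ler_norml => /andP[_ u]; have := C0 m.
  by move: u; move: (_ / _) (_ / _) (a m) (a n); clear => *; lra.
exists (sup [set a m - 2 * C / 2 ^+ m | m in setT]) => n.
rewrite ler_norml lerBlDr lerBrDr; apply/andP; split.
  rewrite addrC; apply: ub_le_sup; last by exists n.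
  by exists (a 0%N + 2 * C / 2 ^+ 0) => _ [m _ <-].
rewrite addrC; apply: ge_sup; first by exists (a 0%N - 2 * C / 2 ^+ 0), 0%N.
by move=> _ [m _ <-].
Qed.

Lemma geom_cvg0 (C : R) : (fun n => C / 2 ^+ n) @ \oo --> 0.
Proof.
rewrite -(mulr0 C); apply: cvgMr; under eq_fun do rewrite -exprVn.
by apply: cvg_expr; rewrite ger0_norm ?invr_ge0// invf_lt1// ltr1n.
Qed.

Lemma mf_lim (f : nat -> R -> R) g (C : R) : (forall n, mf (f n)) ->
  (forall n x, `|g x - f n x| <= C / 2 ^+ n) -> mf g.
Proof.
move=> mfn h; apply: (measurable_fun_cvg (h := f)) => // x _.
apply/cvgrPdist_le => e e0; have /cvgrPdist_le/(_ _ e0) := geom_cvg0 C.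
apply: filterS => n; rewrite sub0r normrN => hn.
exact: le_trans (h n x) (le_trans (ler_norm _) hn).
Qed.

Lemma ac_lim (F f : nat -> R -> R) G g (C : R) : (forall n, ac (F n) (f n)) ->
  (forall n x, `|G x - F n x| <= C / 2 ^+ n) -> (forall n x, `|g x - f n x| <= C / 2 ^+ n) ->
  ac G g.
Proof.
move=> a hG hg; have mg : mf g by apply: mf_lim hg => n; exact: li_mf (ac_li (a n)).
have lg : li g.
  have ld : li (fun x => g x - f 0%N x).
    by apply: li_le (hg 0%N) (li_cst _); apply: mfB => //; exact: li_mf (ac_li (a 0%N)).
  have := liD ld (ac_li (a 0%N)); congr li; apply/funext => x; exact: subrK.
split=> // x y xy; apply/eqP; rewrite -subr_eq0 -normr_le0.
apply: (@le_geom0 _ _ (C * 2 + C * (y - x))) => n.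
have e := (a n).2 _ _ xy; have lf := ac_li (a n).
have -> : G y - G x - io x y g = (G y - F n y) - (G x - F n x) - io x y (fun z => g z - f n z).
  by rewrite ioB// -e; ring.
have h1 := hG n y; have h2 := hG n x.
have h3 : `|io x y (fun z => g z - f n z)| <= C / 2 ^+ n * (y - x).
  by rewrite -io_cst//; apply: io_normle; [exact: liB|exact: li_cst|move=> z _; exact: hg].
rewrite (le_trans (ler_normB _ _))// mulrDl mulrAC lerD//; last by rewrite mulrAC.
by rewrite (le_trans (ler_normB _ _))// mulrDr mulr1 lerD.
Qed.

(** The limit is taken at every point, the increments being uniformly small. Its L^2 bound is
    obtained on [-k, k], where uniform convergence controls the squares, and extended to the line by
    monotone convergence. *)
Lemma L2b_fast (f : nat -> R -> R) (C : R) : (forall n, L2b (f n)) ->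
  (forall n, L2bn (fun x => f n.+1 x - f n x) <= C / 2 ^+ n) ->
  exists g, [/\ L2b g, forall n x, `|g x - f n x| <= 2 * C / 2 ^+ n &
    forall n, L2bn (fun x => g x - f n x) <= 4 * C / 2 ^+ n].
Proof.
have sqa (u v w b : R) : u ^+ 2 <= w ^+ 2 -> u * v <= w * b ->
    (u + v) ^+ 2 <= v ^+ 2 + (2 * b * w + w ^+ 2).
  move=> h1 h2; have -> : (u + v) ^+ 2 = v ^+ 2 + (2 * (u * v) + u ^+ 2) by ring.
  by rewrite lerD2l -[2 * b * w]mulrA lerD// ler_wpM2l// (mulrC b).
move=> Lf hf; have sn := sn_fn (@fnorm_L2b R); have sn2 := sn_fn (@fnorm_L2 R).
have Lff n : L2 (f n) by case: (Lf n).
have bd n k : bdd (fun x => f n x - f k x).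
  by have [] : L2b (fun x => f n x - f k x) := snB sn (Lf n) (Lf k).
have dL n k : L2 (fun x => f n x - f k x) := snB sn2 (Lff n) (Lff k).
have C0 : 0 <= C.
  by have := le_trans (sn_ge0 sn (snB sn (Lf 1%N) (Lf 0%N))) (hf 0%N); rewrite expr0 divr1.
have hs n x : `|f n.+1 x - f n x| <= C / 2 ^+ n.
  rewrite (le_trans _ (hf n))// (le_trans (supn_ge x (bd n.+1 n)))// lerDr.
  exact: L2norm_ge0.
have h2 n : L2norm (fun x => f n.+1 x - f n x) <= C / 2 ^+ n.
  by rewrite (le_trans _ (hf n))// lerDl supn_ge0.
have /boolp.choice[g hg] : forall x, exists l, forall n, `|l - f n x| <= 2 * C / 2 ^+ n.
  by move=> x; apply: fastR.
have t2 : forall j n, L2norm (fun x => f (n + j)%N x - f n x) <= 2 * C / 2 ^+ n :=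
  sn_telescope sn2 Lff h2.
have mg : mf g by apply: (mf_lim (f := f) (C := 2 * C)) => [n|n x]; [exact: L2_mf (Lff n)|exact: hg].
have p2 n : 0 < (2 ^+ n : R) by rewrite exprn_gt0.
have key n : L2 (fun x => g x - f n x) /\ L2norm (fun x => g x - f n x) <= 2 * C / 2 ^+ n.
  have m := mfB mg (L2_mf (Lff n)).
  have m2 : mf (fun x => (g x - f n x) ^+ 2) by exact: mfX.
  have B0 : 0 <= 2 * C / 2 ^+ n by rewrite divr_ge0 ?mulr_ge0// ltW.
  have lib : li (fun x => (g x - f n x) ^+ 2).
    apply: (li_le m2 _ (li_cst ((2 * C / 2 ^+ n) ^+ 2))) => x.
    by rewrite normrX ler_pXn2r ?nnegrE.
  have [i le] : ig (fun x => (g x - f n x) ^+ 2) /\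
      It (fun x => (g x - f n x) ^+ 2) <= (2 * C / 2 ^+ n) ^+ 2.
    apply: ig_mono => //; [by move=> x; exact: sqr_ge0|by move=> k; exact: lib.2|].
    move=> k; rewrite -subr_le0.
    pose D := 2 * k%:R * (2 * C / 2 ^+ n * (2 * (2 * C)) + (2 * C) ^+ 2).
    have e2 : 0 <= (2 * C) ^+ 2 by exact: sqr_ge0.
    apply: (@le_geom0 _ _ (D / 2 ^+ n + D)) => j.
    pose ep := 2 * C / 2 ^+ (n + j).
    have ep0 : 0 <= ep by rewrite divr_ge0 ?mulr_ge0// ltW.
    pose d x := f (n + j)%N x - f n x.
    have bdx x : `|d x| <= 2 * C / 2 ^+ n.
      have := fun m => sn_telescope (W := R^o) (S := setT) (N := Num.norm)
        ltac:(by split => //; [move=> ? ? _ _; exact: ler_normD|move=> b' ? _; exact: normrM])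
        (u := fun m => f m x) (C := C) (fun=> I) (fun m => hs m x) j m.
      exact.
    have id : ig (fun x => d x ^+ 2) by have [] := (L2P _).1 (dL (n + j)%N n).
    pose q := 2 * (2 * C / 2 ^+ n) * ep + ep ^+ 2.
    have pt x : (g x - f n x) ^+ 2 <= d x ^+ 2 + q.
      have e1 : `|g x - f (n + j)%N x| <= ep by exact: hg.
      have -> : g x - f n x = (g x - f (n + j)%N x) + d x by rewrite /d addrA subrK.
      have s1 : `|g x - f (n + j)%N x| ^+ 2 <= ep ^+ 2 by rewrite ler_pXn2r ?nnegrE.
      have s2 : `|g x - f (n + j)%N x| * `|d x| <= ep * (2 * C / 2 ^+ n) by exact: ler_pM.
      rewrite real_normK ?num_real// in s1; rewrite -normrM in s2.
      have s3 := le_trans (ler_norm _) s2.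
      exact: sqa s1 s3.
    have lid := ig_li id.
    have q1 : io (- k%:R) k%:R (fun x => (g x - f n x) ^+ 2) <=
        io (- k%:R) k%:R (fun x => d x ^+ 2 + q).
      by apply: io_le => //; exact: liD lid (li_cst q).
    have kk0 : - (k%:R : R) <= k%:R by rewrite (@le_trans _ _ 0)// oppr_le0.
    rewrite ioD// ?io_cst// in q1; last exact: li_cst.
    have q2 : io (- k%:R) k%:R (fun x => d x ^+ 2) <= (2 * C / 2 ^+ n) ^+ 2.
      rewrite (le_trans (io_le_It _ _ id (fun x => sqr_ge0 _)))// -L2normE; last exact: dL.
      by rewrite ler_pXn2r ?nnegrE// ?L2norm_ge0//; exact: t2.
    have q3 : q * (k%:R - - k%:R) <= D / 2 ^+ j.
      have E : ep <= 2 * C / 2 ^+ j.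
        rewrite /ep exprD ler_wpM2l ?mulr_ge0// lef_pV2 ?posrE ?mulr_gt0//.
        by rewrite ler_peMl ?(ltW (p2 j))// exprn_ege1// ler1n.
      have E2 : ep ^+ 2 <= (2 * C) ^+ 2 / 2 ^+ j.
        rewrite expr2 (le_trans (ler_pM ep0 ep0 (_ : ep <= 2 * C) E))//.
          by rewrite (le_trans E)// ler_pdivrMr// ler_peMr ?mulr_ge0// exprn_ege1// ler1n.
        by rewrite [in leRHS]expr2 -[leRHS]mulrA.
      have E3 : 2 * (2 * C / 2 ^+ n) * ep <= 2 * (2 * C / 2 ^+ n) * (2 * C / 2 ^+ j).
        by rewrite ler_wpM2l// mulr_ge0.
      rewrite opprK /q /D; have kR : 0 <= (k%:R + k%:R : R) by rewrite addr_ge0.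
      rewrite (le_trans (ler_wpM2r kR (lerD E3 E2)))// le_eqVlt; apply/orP; left; apply/eqP; ring.
    rewrite lerBlDr (le_trans q1)//.
    have D0 : 0 <= D by rewrite mulr_ge0// addr_ge0// !mulr_ge0.
    have -> : (D / 2 ^+ n + D) / 2 ^+ j + (2 * C / 2 ^+ n) ^+ 2 = (2 * C / 2 ^+ n) ^+ 2 + (D / 2 ^+ j + D / 2 ^+ n / 2 ^+ j) by ring.
    apply: lerD q2 (le_trans q3 _); rewrite lerDl divr_ge0 ?(ltW (p2 j))// divr_ge0// ltW//.
  have L : L2 (fun x => g x - f n x) by apply/L2P.
  by split=> //; rewrite -(@ler_pXn2r _ 2) ?nnegrE ?L2norm_ge0// L2normE.
exists g; split=> //; last first.
- move=> n; have [l1 l2] := key n.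
  have -> : 4 * C / 2 ^+ n = 2 * C / 2 ^+ n + 2 * C / 2 ^+ n by ring.
  by apply: lerD => //; exact: supn_le.
- split.
    have [l1 _] := key 0%N; have := (L2D l1 (Lff 0%N)).1; congr L2; apply/funext => x; exact: subrK.
  have [M hM] := (Lf 0%N).2; exists (2 * C / 2 ^+ 0 + M) => x.
  by rewrite -[g x](subrK (f 0%N x)) (le_trans (ler_normD _ _))// lerD.
Qed.

End Telescope.

(** * Radial truncation *)

Section Retraction.
Context {R : realType} (W : lmodType R) (S : set W) (N : W -> R).
Hypothesis sn : seminormed S N.

Definition retr (M : R) (z : W) : W := if N z <= M then z else (M / N z) *: z.

Lemma retr_S M z : S z -> S (retr M z).
Proof. by move=> Sz; rewrite /retr; case: ifP => // _; exact: (snZ sn). Qed.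

Lemma retr_N M z : 0 <= M -> S z -> N (retr M z) <= M.
Proof.
move=> M0 Sz; rewrite /retr; case: ifPn => //; rewrite -ltNge => h.
have n0 : 0 < N z by exact: le_lt_trans M0 h.
by rewrite (sn_scale sn)// ger0_norm ?divr_ge0 ?(ltW n0)// divfK// gt_eqF.
Qed.

(** With [z] the element of larger norm, scale the difference by the factor of [z]; what is left is
    the change of factor acting on [z'], which costs at most [N z - N z']. Each part is at most the
    distance. *)
Lemma retr_lip M z z' : 0 < M -> S z -> S z' -> N (retr M z - retr M z') <= 2 * N (z - z').
Proof.
have aux2 (a : R) : 0 <= a -> a <= 2 * a by move=> a0; rewrite ler_peMl// ler1n.
move=> M0 Sz Sz'; 
wlog le : z z' Sz Sz' / N z' <= N z.
  move=> H; have [h|/ltW h] := leP (N z') (N z); first exact: H.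
  by rewrite (sn_dist sn (retr_S _ _) (retr_S _ _))// (sn_dist sn Sz)//; exact: H.
have d0 : 0 <= N (z - z') by exact: (sn_ge0 sn (snB sn Sz Sz')).
have dz := sn_abs_sub sn Sz Sz'; rewrite ger0_norm ?subr_ge0// in dz.
rewrite /retr; case: ifPn => h1.
  rewrite ifT; last exact: le_trans le h1.
  exact: aux2.
rewrite -ltNge in h1; have n0 : 0 < N z by exact: lt_trans M0 h1.
have l1 : M / N z <= 1 by rewrite ler_pdivrMr// mul1r ltW.
have l0 : 0 <= M / N z by rewrite divr_ge0// ltW.
pose a := if N z' <= M then 1 else M / N z'.
have -> : (if N z' <= M then z' else (M / N z') *: z') = a *: z'.
  by rewrite /a; case: ifP; rewrite ?scale1r.
have -> : (M / N z) *: z - a *: z' = (M / N z) *: (z - z') + (M / N z - a) *: z'.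
  by rewrite scalerBr scalerBl addrA subrK.
rewrite (le_trans (sn_triangle sn (snZ sn _ (snB sn Sz Sz')) (snZ sn _ Sz')))//.
rewrite (sn_scale sn _ (snB sn Sz Sz')) (sn_scale sn _ Sz').
rewrite mulrDl mul1r lerD//; first by rewrite ger0_norm// ler_piMl.
have N'0 := sn_ge0 sn Sz'.
have e : M / N z * N z = M by rewrite divfK// gt_eqF.
rewrite /a; case: ifPn => h2.
  rewrite ler0_norm ?subr_le0// opprB mulrBl mul1r.
  have : M / N z * N z' <= M / N z * N z by rewrite ler_wpM2l.
  rewrite e => h3; apply: le_trans dz.
  have h4 : M / N z * N z - M / N z * N z' <= N z - N z'.
    by rewrite -mulrBr ler_piMl// subr_ge0.
  by move: h4 h2; rewrite e; move: (M / N z * N z') (N z) (N z'); clear => *; lra.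
rewrite -ltNge in h2; have n1 : 0 < N z' by exact: lt_trans M0 h2.
have e' : M / N z' * N z' = M by rewrite divfK// gt_eqF.
rewrite ler0_norm; last first.
  by rewrite subr_le0 ler_pM2l// lef_pV2 ?posrE.
rewrite opprB mulrBl e'; apply: le_trans dz.
have h4 : M / N z * N z - M / N z * N z' <= N z - N z'.
  by rewrite -mulrBr ler_piMl// subr_ge0.
by rewrite e in h4.
Qed.

End Retraction.

(** * Completeness of the state space and the truncated equation *)

Section Existence.
Context {R : realType}.
Variables (chi : R -> R) (chiP : cutoff chi).
Local Notation F := (FS chi true).
Local Notation N := (NS (@L2bn R)).

Definition SA (z : st R) := SS (@L2b R) z /\ ac (ze z) (ww z) /\ ac (uh z) (vh z).

Lemma sn_SA : seminormed SA N.
Proof.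
have sn := sn_st (@fnorm_L2b R); split.
- split; first exact: (sn0 sn).
  by split; exact: (ac_cst 0).
- move=> x y [sx [a1 a2]] [sy [b1 b2]]; split; first exact: (snD sn).
  by rewrite !stD; split; exact: acD.
- move=> a x [sx [a1 a2]]; split; first exact: (snZ sn).
  by rewrite !stZ; split; exact: acZ.
- by move=> x [sx _]; exact: (sn_ge0 sn).
- by move=> x y [sx _] [sy _]; exact: (sn_triangle sn).
- by move=> a x [sx _]; exact: (sn_scale sn).
Qed.

Lemma sup_fast (f : nat -> R -> R) (C : R) : (forall n, mf (f n) /\ bdd (f n)) ->
  (forall n, supn (fun x => f n.+1 x - f n x) <= C / 2 ^+ n) ->
  exists g, [/\ mf g, bdd g & forall n x, `|g x - f n x| <= 2 * C / 2 ^+ n].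
Proof.
move=> hf hs.
have h1 n x : `|f n.+1 x - f n x| <= C / 2 ^+ n.
  rewrite (le_trans _ (hs n))//; apply: (supn_ge x (f := fun x => f n.+1 x - f n x)).
  apply: bddD; first exact: (hf _).2.
  by have := bddZ (-1) (hf n).2; congr bdd; apply/funext => z; rewrite mulN1r.
have /boolp.choice[g hg] : forall x, exists l, forall n, `|l - f n x| <= 2 * C / 2 ^+ n.
  by move=> x; apply: fastR.
exists g; split=> //.
  by apply: (mf_lim (f := f) (C := 2 * C)) => [n|n x]; [exact: (hf n).1|exact: hg].
have [M hM] := (hf 0%N).2; exists (2 * C / 2 ^+ 0 + M) => x.
by rewrite -[g x](subrK (f 0%N x)) (le_trans (ler_normD _ _))// lerD.
Qed.

Lemma sum9_le (x1 x2 x3 x4 x5 x6 x7 x8 x9 c q : R) : x1 <= 2 * c * q -> x2 <= 2 * c * q ->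
  x3 <= 4 * c * q -> x4 <= 4 * c * q -> x5 <= 4 * c * q -> x6 <= 4 * c * q -> x7 <= 4 * c * q ->
  x8 <= 2 * c * q -> x9 <= 2 * c * q ->
  x1 + x2 + x3 + x4 + x5 + x6 + x7 + x8 + x9 <= 28 * c * q.
Proof. lra. Qed.

Lemma SA_complete : sn_complete SA N.
Proof.
move=> u C Su hu; have fb := @fnorm_L2b R; have sn := sn_SA.
have dS n := snB (sn_st fb) (Su n.+1).1 (Su n).1.
have prt n := NS_parts fb (dS n).
have up (a b c d e f : R) : 0 <= a -> 0 <= b -> 0 <= c -> 0 <= d -> 0 <= e -> a + b + c + d + e <= f ->
    [/\ a <= f, b <= f, c <= f & d <= f /\ e <= f].
  by clear; move=> *; split; [| | |split]; lra.
have prt2 n : [/\ L2bn (uh (u n.+1 - u n)) <= C / 2 ^+ n, L2bn (ww (u n.+1 - u n)) <= C / 2 ^+ n,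
   L2bn (vh (u n.+1 - u n)) <= C / 2 ^+ n & L2bn (hh (u n.+1 - u n)) <= C / 2 ^+ n /\
   L2bn (rh (u n.+1 - u n)) <= C / 2 ^+ n].
  have [_ _ _ _ h] := prt n; have [_ [b _] c d [e f]] := dS n.
  apply: (up _ _ _ _ _ _ _ _ _ _ _ (le_trans h (hu n))); exact: (fn_ge0 fb).
have tr n (a : R) : a <= N (u n.+1 - u n) -> a <= C / 2 ^+ n.
  by move=> h; exact: le_trans h (hu n).
have [zt [mz bz hz]] := sup_fast (f := fun n => ze (u n)) (C := C)
  (fun n => let: And5 a _ _ _ _ := (Su n).1 in a)
  (fun n => tr n _ (let: And5 a _ _ _ _ := prt n in a)).
have [ut [lu pu hu2]] := L2b_fast (f := fun n => uh (u n)) (fun n => let: And5 _ a _ _ _ := (Su n).1 in a.1)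
  (fun n => let: And4 a _ _ _ := prt2 n in a).
have [wt [lw pw hw]] := L2b_fast (f := fun n => ww (u n)) (fun n => let: And5 _ _ a _ _ := (Su n).1 in a)
  (fun n => let: And4 _ a _ _ := prt2 n in a).
have [vt [lv pv hv]] := L2b_fast (f := fun n => vh (u n)) (fun n => let: And5 _ _ _ a _ := (Su n).1 in a)
  (fun n => let: And4 _ _ a _ := prt2 n in a).
have [ht [lh _ hh2]] := L2b_fast (f := fun n => hh (u n)) (fun n => let: And5 _ _ _ _ a := (Su n).1 in a.1)
  (fun n => let: And4 _ _ _ a := prt2 n in a.1).
have [rt [lr _ hr]] := L2b_fast (f := fun n => rh (u n)) (fun n => let: And5 _ _ _ _ a := (Su n).1 in a.2)
  (fun n => let: And4 _ _ _ a := prt2 n in a.2).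
have [ct hc] := fastR (a := fun n => cc (u n)) (fun n => tr n _ (let: And5 _ _ a _ _ := prt n in a)).
have [kt hk] := fastR (a := fun n => kk (u n)) (fun n => tr n _ (let: And5 _ _ _ a _ := prt n in a)).
pose x := mkst zt ut wt vt ht rt ct kt.
have Sx : SA x.
  split; first by split=> //; split=> //; case: lu.
  split; [apply: (ac_lim (F := fun n => ze (u n)) (f := fun n => ww (u n)) (C := 2 * C))|
          apply: (ac_lim (F := fun n => uh (u n)) (f := fun n => vh (u n)) (C := 2 * C))] => // n.
    exact: (Su n).2.1.
  exact: (Su n).2.2.
(* The nine summands of the norm converge with constants 2 (four of them) and 4 (five), in all 28.
   This loss is taken only at index n + j, and j grows; up to that index the telescoping sum gives
   the required constant 2. *)
exists x => // n; rewrite -subr_le0; apply: (@le_geom0 _ _ (28 * C / 2 ^+ n)) => j.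
rewrite lerBlDr (le_trans (sn_tri sn Sx (Su (n + j)%N) (Su n)))// lerD//; last exact: (sn_telescope sn Su hu).
have -> : 28 * C / 2 ^+ n / 2 ^+ j = 28 * C * (2 ^+ (n + j))^-1 by rewrite exprD invfM mulrA.
rewrite /NS !stB; apply: sum9_le; [exact: supn_le|exact: supn_le|exact: hu2|exact: hw|exact: hv|
  exact: hh2|exact: hr|exact: hc|exact: hk].
Qed.

Lemma SS_fS (dm : set (R -> R)) n K (fn : fnorm dm n K) sgd z : SS dm z ->
  [/\ dm (fS chi z), SS dm (FS chi sgd z) & exists M : R, forall x, `|yS z x - x| <= M].
Proof.
move=> sz; have [C0 hC0] := chi_constP chiP.
pose rel (z1 z2 : st R) := z1 = z /\ z2 = z.
have NSz := sn_ge0 (sn_st fn) sz.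
have relC z1 z2 : rel z1 z2 -> rel z2 z1 by case.
have relS z1 z2 : rel z1 z2 -> SS dm z1 by case=> ->.
have relM z1 z2 : rel z1 z2 ->
  [/\ supn (ze z1) <= NS n z, supn (uh z1) <= NS n z, `|cc z1| <= NS n z & `|kk z1| <= NS n z].
  by case=> -> _; have [] := NS_parts fn sz.
have rz : rel z z by [].
split.
- have [C c h] := t0_f fn NSz relC relS relM chiP hC0.
  have [a b] := dm_GG fn sz.
  have := (fn_le fn (mf_fS fn chiP sz) (fn_Z fn C a).1 _).1; apply => x.
  by have [h1 _] := h _ _ rz x; rewrite (le_trans h1)// ler_norm.
- have [C c h] := rate_lip (chi := chi) sgd fn chiP NSz.
  exact: (h z z sz sz _ _).1.
- have [[_ [M hM]] _ _ _ _] := sz; exists M => x; by rewrite /yS addrC addKr.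
Qed.

(** The derivative of the signed Q is given by the formula in [FS] for every [y]. The truncated
    flow, which does not know that [y] is nondecreasing, therefore stays among consistent states. *)
Lemma FS_ac (dm : set (R -> R)) n K (fn : fnorm dm n K) z : SS dm z -> ac (ze z) (ww z) ->
  ac (uh (F z)) (vh (F z)).
Proof.
move=> sz a1; have [df sF [M hM]] := SS_fS fn true sz.
have ay : ac (yS z) (fun x => 1 + ww z x) by exact: acD (@ac_id R) a1.
have aQ := ac_sgQ ay hM (fn_mf fn df) (fun x => fn_ig fn df x).
have ag := ac_chain (quadr_gder chiP) ay.
have := acN (acD (acZ (- 4^-1) aQ) (acZ (cc z) (acZ (cc z) ag))).
apply: (_ : forall f g, f = uh (F z) -> g = vh (F z) -> ac f g -> _) => [f g -> ->//|//|].
apply/funext => x.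
rewrite /F/= /vh/= /AS /PbS /fS /kap -/(sgP (yS z) (fS chi z) x).
by move: (sgP _ _ _) (pfun _ _) => P p; field.
Qed.

Lemma SA_FS z : SA z -> SA (F z).
Proof.
move=> [sz [a1 a2]]; have fb := @fnorm_L2b R; have [_ sF _] := SS_fS fb true sz.
by split=> //; split; [exact: acD a2 (acZ (cc z) (ac_chi chiP))|exact: FS_ac fb _ sz a1].
Qed.

Definition qd (X : R -> st R) (t : R) (v : st R) := exists2 C, 0 <= C &
  forall s, 0 <= s -> `|s - t| <= 1 -> N (X s - X t - (s - t) *: v) <= C * (s - t) ^+ 2.

Lemma truncated_solution M z0 : 0 < M -> SA z0 -> exists Y : R -> st R,
  [/\ Y 0 = z0, forall t, 0 <= t -> SA (Y t) &
   forall t, 0 <= t -> qd Y t (F (retr N M (Y t)))].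
Proof.
move=> M0 S0; have fb := @fnorm_L2b R.
have [L L0 hL] := rate_lip (chi := chi) true fb chiP (ltW M0).
apply: (euler_solution sn_SA SA_complete (F := fun z => F (retr N M z)) (L := L * 2)) => //.
- by move=> x Sx; exact: SA_FS (retr_S sn_SA M Sx).
- by rewrite mulr_ge0.
- move=> x y Sx Sy; have Sx' := retr_S sn_SA M Sx; have Sy' := retr_S sn_SA M Sy.
  have [_ h] := hL _ _ Sx'.1 Sy'.1 (retr_N sn_SA (ltW M0) Sx) (retr_N sn_SA (ltW M0) Sy).
  by rewrite (le_trans h)// -mulrA ler_wpM2l//; exact: (retr_lip sn_SA).
Qed.

End Existence.

(** * Derivatives along curves *)

Section Calculus.
Context {R : realType}.

Lemma tdiff_lin (W W2 : lmodType R) (S : set W) (N : W -> R) (N2 : W2 -> R) (L : W -> W2) C X t d :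
  seminormed S N ->
  (forall s, 0 <= s -> S (X s)) -> S (X t) -> S d -> 0 <= C ->
  (forall a x y z, L (x - y - a *: z) = L x - L y - a *: L z) ->
  (forall x, S x -> N2 (L x) <= C * N x) ->
  tdiff N X t d -> tdiff N2 (fun s => L (X s)) t (L d).
Proof.
move=> sn SX Xt Sd C0 lin le td e e0.
have C1 : 0 < C + 1 by rewrite ltr_wpDl.
have [r r0 h] := td (e / (C + 1)) (divr_gt0 e0 C1); exists r => // s s0 st.
have Sx := snB sn (snB sn (SX _ s0) Xt) (snZ sn (s - t) Sd).
rewrite -lin (le_trans (le _ Sx))//.
have N0 := sn_ge0 sn Sx.
rewrite (@le_trans _ _ ((C + 1) * N (X s - X t - (s - t) *: d)))//.
  by rewrite ler_wpM2r// lerDl.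
rewrite (le_trans (ler_wpM2l (ltW C1) (h _ s0 st)))//.
by rewrite mulrA mulrCA divff ?mulr1// gt_eqF.
Qed.

Section Bilinear.
Variables (W1 W2 W3 : lmodType R) (S1 : set W1) (N1 : W1 -> R) (S2 : set W2) (N2 : W2 -> R).
Variables (S3 : set W3) (N3 : W3 -> R) (B : W1 -> W2 -> W3).
Hypothesis (sn1 : seminormed S1 N1) (sn2 : seminormed S2 N2) (sn3 : seminormed S3 N3).
Hypothesis BS : forall x y, S1 x -> S2 y -> S3 (B x y) /\ N3 (B x y) <= N1 x * N2 y.
(** The exact second order expansion of a bilinear map, required only on the subspaces because the
    integral of a product is bilinear only where the products are integrable. *)
Hypothesis Bid : forall a x x0 d y y0 e, S1 x -> S1 x0 -> S1 d -> S2 y -> S2 y0 -> S2 e ->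
  B x y - B x0 y0 - a *: (B d y0 + B x0 e) =
  B (x - x0 - a *: d) y + B x0 (y - y0 - a *: e) + a *: B d (y - y0).

Lemma tdiff_bil X Y t d e : (forall s, 0 <= s -> S1 (X s)) -> (forall s, 0 <= s -> S2 (Y s)) ->
  0 <= t -> S1 d -> S2 e -> tdiff N1 X t d -> tdiff N2 Y t e ->
  tdiff N3 (fun s => B (X s) (Y s)) t (B d (Y t) + B (X t) e).
Proof.
move=> SX SY t0 Sd Se tX tY ep ep0.
have SXt := SX _ t0; have SYt := SY _ t0.
pose a := N1 (X t); pose b := N2 (Y t); pose d' := N1 d; pose e' := N2 e.
have a0 : 0 <= a := sn_ge0 sn1 SXt. have b0 : 0 <= b := sn_ge0 sn2 SYt.
have d0 : 0 <= d' := sn_ge0 sn1 Sd. have e0 : 0 <= e' := sn_ge0 sn2 Se.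
(* The coefficient of the three remainders in [Bid], once the norm of [Y s] is at most b + 1 for s
   near t. *)
pose D := a + b + 1 + d' * (e' + 1).
have D0 : 0 < D by rewrite /D; have := mulr_ge0 d0 (addr_ge0 e0 ler01); lra.
pose q := Num.min (ep / D) 1.
have q0 : 0 < q by rewrite /q lt_min divr_gt0// ltr01.
have q1 : q <= 1 by rewrite /q ge_min lexx orbT.
have qD : q * D <= ep.
  have : q <= ep / D by rewrite /q ge_min lexx.
  by rewrite ler_pdivlMr.
clearbody q.
have [r1 r10 h1] := tX _ q0; have [r2 r20 h2] := tY _ q0.
have [r3 r30 h3] := tdiff_lip sn2 SYt Se SY tY ltr01.
have e1 : 0 < e' + 1 by rewrite ltr_wpDl.
exists (Num.min (Num.min r1 r2) (Num.min r3 (Num.min (e' + 1)^-1 q))).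
  by rewrite !lt_min r10 r20 r30 q0 invr_gt0 e1.
move=> s s0; rewrite !lt_min => /andP[/andP[l1 l2] /andP[l3 /andP[l4 l5]]].
have SXs := SX _ s0; have SYs := SY _ s0.
have {h1} h1 := h1 _ s0 l1; have {h2} h2' := h2 _ s0 l2; have {h3} h3 := h3 _ s0 l3.
rewrite Bid//.
have Sr1 := snB sn1 (snB sn1 SXs SXt) (snZ sn1 (s - t) Sd).
have Sr2 := snB sn2 (snB sn2 SYs SYt) (snZ sn2 (s - t) Se).
have Sr3 := snB sn2 SYs SYt.
have [B1 n1] := BS Sr1 SYs; have [B2 n2] := BS SXt Sr2; have [B3 n3] := BS Sd Sr3.
rewrite (le_trans (sn_triangle sn3 (snD sn3 B1 B2) (snZ sn3 _ B3)))//.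
rewrite (le_trans (lerD (sn_triangle sn3 B1 B2) (lexx _)))// (sn_scale sn3)//.
have Ys : N2 (Y s) <= b + 1.
  have h4 : `|N2 (Y s) - N2 (Y t)| <= 1.
    by rewrite (le_trans h3)// -ler_pdivlMr// ?div1r ltW.
  by rewrite -lerBlDl; exact: le_trans (ler_norm _) h4.
have dY : N2 (Y s - Y t) <= `|s - t| * (e' + 1).
  rewrite -[Y s - Y t](subrK ((s - t) *: e)).
  rewrite (le_trans (sn_triangle sn2 Sr2 (snZ sn2 _ Se)))// (sn_scale sn2)//.
  rewrite addrC mulrDr mulr1 lerD// (le_trans h2')// ler_piMl//.
apply: le_trans (lerD (lerD (le_trans n1 _) (le_trans n2 _)) (ler_wpM2l (normr_ge0 _) (le_trans n3 _))) _.
- exact: (ler_pM (sn_ge0 sn1 Sr1) (sn_ge0 sn2 SYs) h1 Ys).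
- exact: (ler_wpM2l a0 h2').
- exact: (ler_wpM2l d0 dY).
apply: (@le_trans _ _ (q * D * `|s - t|)); last by rewrite ler_wpM2r.
have h5 : `|s - t| * (d' * (`|s - t| * (e' + 1))) <= q * (d' * (`|s - t| * (e' + 1))).
  by rewrite ler_wpM2r ?(ltW l5)// !mulr_ge0// ltW.
apply: (le_trans (lerD (lexx _) h5)); rewrite /D.
by rewrite le_eqVlt; apply/orP; left; apply/eqP; ring.
Qed.
End Bilinear.

Local Notation L2b := (@L2b R).
Local Notation L2bn := (@L2bn R).
Let fb := @fnorm_L2b R.
Let snb : seminormed (W := R -> R^o) L2b L2bn := sn_fn fb.

Lemma sn_R : seminormed (W := R^o) setT Num.norm.
Proof. by split => //; [move=> x y _ _; exact: ler_normD|move=> b x _; exact: normrM]. Qed.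

Lemma L2b_parts f : L2b f -> [/\ L2 f, bdd f, L2norm f <= L2bn f & forall x, `|f x| <= L2bn f].
Proof.
move=> [l b]; split=> //; first by rewrite lerDl supn_ge0.
by move=> x; rewrite (le_trans (supn_ge x b))// lerDr L2norm_ge0.
Qed.

Lemma L2b_mul f g : L2b f -> L2b g -> L2b (fun x => f x * g x) /\
  L2bn (fun x => f x * g x) <= L2bn f * L2bn g.
Proof.
move=> Lf Lg; have [_ _ _ b] := L2b_parts Lf.
have [a e] := fn_Z fb (L2bn f) Lg.
have n0 := fn_ge0 fb Lf.
have := fn_le fb (mfM (fn_mf fb Lf) (fn_mf fb Lg)) a.
rewrite e (ger0_norm n0); apply => x; rewrite !normrM (ger0_norm n0).
by rewrite ler_wpM2r.
Qed.

Lemma tdiff_mul (f g : R -> R -> R) t f' g' : (forall s, 0 <= s -> L2b (f s)) ->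
  (forall s, 0 <= s -> L2b (g s)) -> 0 <= t -> L2b f' -> L2b g' ->
  tdiff (W := R -> R^o) L2bn f t f' -> tdiff (W := R -> R^o) L2bn g t g' ->
  tdiff (W := R -> R^o) L2bn (fun s x => f s x * g s x) t (fun x => f' x * g t x + f t x * g' x).
Proof.
move=> Sf Sg t0 Sf' Sg' tf tg.
apply: (@tdiff_bil (R -> R^o) (R -> R^o) (R -> R^o) L2b L2bn L2b L2bn L2b L2bn
  (fun u v x => u x * v x) snb snb snb) => //.
- by move=> x y; exact: L2b_mul.
- move=> a x x0 d y y0 e _ _ _ _ _ _; apply/funext => z.
  by rewrite !fctE /GRing.scale/=; ring.
Qed.

Lemma tdiff_It (f g : R -> R -> R) t f' g' : (forall s, 0 <= s -> L2b (f s)) ->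
  (forall s, 0 <= s -> L2b (g s)) -> 0 <= t -> L2b f' -> L2b g' ->
  tdiff (W := R -> R^o) L2bn f t f' -> tdiff (W := R -> R^o) L2bn g t g' ->
  tdiff (W := R^o) Num.norm (fun s => It (fun x => f s x * g s x)) t
    (It (fun x => f' x * g t x) + It (fun x => f t x * g' x)).
Proof.
move=> Sf Sg t0 Sf' Sg' tf tg.
apply: (@tdiff_bil (R -> R^o) (R -> R^o) R^o L2b L2bn L2b L2bn setT Num.norm
  (fun u v => It (fun x => u x * v x)) snb snb sn_R) => //.
- move=> x y Lx Ly; split=> //; have [a _ a1 _] := L2b_parts Lx; have [b _ b1 _] := L2b_parts Ly.
  have [i h] := L2_CS a b; rewrite (le_trans (It_norm i))// (le_trans h)//.
  by rewrite ler_pM ?L2norm_ge0.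
- move=> a x x0 d y y0 e Lx Lx0 Ld Ly Ly0 Le.
  have ii u v : L2b u -> L2b v -> ig (fun x => u x * v x).
    by move=> [lu _] [lv _]; exact: (L2_CS lu lv).1.
  have LA := snB snb (snB snb Lx Lx0) (snZ snb a Ld).
  have LB := snB snb (snB snb Ly Ly0) (snZ snb a Le).
  have LC := snB snb Ly Ly0.
  rewrite -ItB ?ii// -ItD ?ii// /GRing.scale/= -ItZ; last by apply: igD; exact: ii.
  rewrite -ItB; [|by apply: igB; exact: ii|by apply: igZ; apply: igD; exact: ii].
  rewrite -ItD ?ii// -ItZ ?ii// -ItD; [|by apply: igD; exact: ii|by apply: igZ; exact: ii].
  congr It; apply/funext => z.
  have e1 : (x - x0 - a *: d) z = x z - x0 z - a * d z by [].
  have e2 : (y - y0 - a *: e) z = y z - y0 z - a * e z by [].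
  have e3 : (y - y0) z = y z - y0 z by [].
  by rewrite e1 e2 e3; ring.
Qed.

Lemma tdiff_mulR (f g : R -> R) t f' g' : 0 <= t ->
  tdiff (W := R^o) Num.norm f t f' -> tdiff (W := R^o) Num.norm g t g' ->
  tdiff (W := R^o) Num.norm (fun s => f s * g s) t (f' * g t + f t * g').
Proof.
move=> t0 tf tg.
apply: (@tdiff_bil R^o R^o R^o setT Num.norm setT Num.norm setT Num.norm
  (fun u v => u * v) sn_R sn_R sn_R) => //.
- by move=> x y _ _; split=> //; rewrite normrM.
- by move=> a x x0 d y y0 e _ _ _ _ _ _; rewrite /GRing.scale/=; ring.
Qed.

Lemma tdiff_add (W : lmodType R) (S : set W) (N : W -> R) X Y t d e : seminormed S N ->
  (forall s, 0 <= s -> S (X s)) -> (forall s, 0 <= s -> S (Y s)) -> 0 <= t -> S d -> S e ->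
  tdiff N X t d -> tdiff N Y t e -> tdiff N (fun s => X s + Y s) t (d + e).
Proof.
move=> sn SX SY t0 Sd Se tX tY ep ep0; have e2 : 0 < ep / 2 by rewrite divr_gt0.
have [r1 r10 h1] := tX _ e2; have [r2 r20 h2] := tY _ e2.
exists (Num.min r1 r2) => [|s s0]; first by rewrite lt_min r10 r20.
rewrite lt_min => /andP[l1 l2].
have -> : X s + Y s - (X t + Y t) - (s - t) *: (d + e) =
    (X s - X t - (s - t) *: d) + (Y s - Y t - (s - t) *: e).
  by rewrite scalerDr !opprD !addrA [LHS](ACl (1*3*5*2*4*6))%AC.
have S1 := snB sn (snB sn (SX _ s0) (SX _ t0)) (snZ sn (s - t) Sd).
have S2 := snB sn (snB sn (SY _ s0) (SY _ t0)) (snZ sn (s - t) Se).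
rewrite (le_trans (sn_triangle sn S1 S2))// [ep]splitr mulrDl lerD//; [exact: h1|exact: h2].
Qed.

Lemma tdiff_ext (W : lmodType R) (N : W -> R) X Y t d e : (forall s, 0 <= s -> X s = Y s) ->
  0 <= t -> d = e -> tdiff N X t d -> tdiff N Y t e.
Proof.
move=> XY t0 <- h ep ep0; have [r r0 hr] := h _ ep0.
by exists r => // s s0 st; rewrite -!XY//; exact: hr.
Qed.

Lemma tdiff_cst (W : lmodType R) (S : set W) (N : W -> R) x t : seminormed S N ->
  tdiff N (fun=> x) t 0.
Proof.
move=> sn ep ep0; exists 1 => // s _ _.
by rewrite subrr sub0r scaler0 oppr0 (sn_zero sn) mulr_ge0// ltW.
Qed.

Lemma tdiff_scale (W : lmodType R) (S : set W) (N : W -> R) X t d (k : R) : seminormed S N ->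
  (forall s, 0 <= s -> S (X s)) -> 0 <= t -> S d -> tdiff N X t d ->
  tdiff N (fun s => k *: X s) t (k *: d).
Proof.
move=> sn SX t0 Sd; apply: (tdiff_lin (S := S) (C := `|k|) sn SX (SX _ t0) Sd) => //.
- by move=> a x y z; rewrite !scalerBr !scalerA (mulrC k).
- by move=> x Sx; rewrite (sn_scale sn).
Qed.

Lemma ek_L2b (q : R -> R) C : mf q -> (forall x, `|q x| <= C * ek x) -> L2b q /\ L2bn q <= C * L2bn (@ek R).
Proof.
move=> mq h; have [a e] := fn_Z fb C (fn_ek fb).
have C0 : 0 <= C by have := le_trans (normr_ge0 _) (h 0); rewrite pmulr_lge0// ek_gt0.
have := fn_le fb mq a; rewrite e ger0_norm//; apply => x.
by rewrite (le_trans (h x))// ler_norm.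
Qed.

Lemma taylor_decay (F f g : R -> R) C M x a b : ac F f -> ac f g ->
  (forall z, `|g z| <= C * ek z) -> 0 <= C -> `|a - x| <= M -> `|b - x| <= M ->
  `|F b - F a - f a * (b - a)| <= C * expR M * ek x * (b - a) ^+ 2.
Proof.
move=> aF af hg C0 ha hb; pose A := C * expR M.
have Ae : 0 <= A * ek x by rewrite !mulr_ge0 ?expR_ge0 ?ek_ge0.
have key c d z : c <= z <= d -> (c = a /\ d = b) \/ (c = b /\ d = a) ->
    `|f z - f a| <= A * ek x * (d - c).
  move=> /andP[cz zd] h.
  have zx : `|z - x| <= M.
    move: ha hb cz zd; rewrite !ler_norml; clear -h; move=> /andP[u1 u2] /andP[u3 u4] cz zd.
    by case: h => -[? ?]; subst; apply/andP; split; lra.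
  rewrite (le_trans (decay_lip af hg C0 zx ha))// ler_wpM2l//.
  by rewrite ler_norml; move: cz zd; clear -h => cz zd; case: h => -[? ?]; subst; apply/andP; split; lra.
have lf := ac_li aF.
have [ab|/ltW ba] := leP a b.
  rewrite aF.2// -io_cst// -ioB//; last exact: li_cst.
  rewrite (_ : C * expR M * ek x * (b - a) ^+ 2 = io a b (fun=> A * ek x * (b - a))); last first.
    by rewrite io_cst// expr2 mulrA.
  apply: io_normle; [exact: liB lf (li_cst _)|exact: li_cst|].
  by move=> z zab; apply: (key a b) => //; left.
have -> : F b - F a - f a * (b - a) = - (io b a f - io b a (fun=> f a)).
  by rewrite -aF.2// io_cst//; ring.
rewrite normrN -ioB//; last exact: li_cst.
rewrite (_ : C * expR M * ek x * (b - a) ^+ 2 = io b a (fun=> A * ek x * (a - b))); last first.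
  by rewrite io_cst// /A; ring.
apply: io_normle; [exact: liB lf (li_cst _)|exact: li_cst|].
by move=> z zab; apply: (key b a) => //; right.
Qed.

(** The curve [zt] is differentiable only in the sup norm, yet the composition is differentiable in
    L^2: the decay of the derivatives of [F] supplies the integrability. Subtracting [F x] brings
    the composition itself into the space. *)
Lemma tdiff_chain (F f g : R -> R) C (zt : R -> R -> R) u t : 0 <= t -> 0 <= C ->
  ac F f -> ac f g -> (forall x, `|f x| <= C * ek x) -> (forall x, `|g x| <= C * ek x) ->
  (forall s, 0 <= s -> mf (zt s) /\ bdd (zt s)) -> mf u /\ bdd u ->
  tdiff (W := R -> R^o) (@supn R) zt t u ->
  tdiff (W := R -> R^o) L2bn (fun s x => F (x + zt s x) - F x) t (fun x => f (x + zt t x) * u x).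
Proof.
move=> t0 C0 aF af hf hg Szt [mu_ [V hV]] tz e e0.
have sns : seminormed (W := R -> R^o) [set q | mf q /\ bdd q] (@supn R).
  split.
  - by split; [exact: mf_cst|exists 0 => x; rewrite normr0].
  - by move=> x y [a b] [c d]; split; [exact: mfD|exact: bddD].
  - by move=> a x [m b]; split; [apply: mfM => //; exact: mf_cst|exact: bddZ].
  - by move=> x [_ b]; exact: supn_ge0.
  - by move=> x y [_ b] [_ d]; exact: supnD.
  - by move=> a x [_ b]; exact: supnZ.
have [mt [M0 hM0]] := Szt _ t0; pose M := `|M0| + 1.
have M0' : 0 <= M by rewrite addr_ge0.
pose V1 := `|V| + 1; have V10 : 0 < V1 by rewrite ltr_wpDl.
pose A := C * expR M; have A0 : 0 <= A by rewrite mulr_ge0 ?expR_ge0.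
have nk := fn_ge0 fb (fn_ek fb).
pose D := (A * (V1 * V1 + 1)) * L2bn (@ek R) + 1.
have D0 : 0 < D.
  by rewrite /D ltr_wpDl// mulr_ge0// mulr_ge0// addr_ge0// mulr_ge0 ?(ltW V10).
pose q := Num.min (e / D) 1.
have q0 : 0 < q by rewrite /q lt_min divr_gt0// ltr01.
have q1 : q <= 1 by rewrite /q ge_min lexx orbT.
have qD : q * D <= e.
  have : q <= e / D by rewrite /q ge_min lexx.
  by rewrite ler_pdivlMr.
clearbody q.
have [r r0 hr] := tz _ q0.
exists (Num.min r (Num.min q V1^-1)) => [|s s0]; first by rewrite !lt_min r0 q0 invr_gt0.
rewrite !lt_min => /and3P[l1 l2 l3]; have {hr} hr := hr _ s0 l1.
have [ms bs] := Szt _ s0.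
have Sd : [set q | mf q /\ bdd q] (zt s - zt t - (s - t) *: (u : R -> R^o)).
  by apply: (snB sns (snB sns _ _) (snZ sns _ _)); [exact: Szt|exact: Szt|split=> //; exists V].
have pt x : `|zt s x - zt t x - (s - t) * u x| <= q * `|s - t|.
  exact: le_trans (supn_ge x Sd.2) hr.
have uV x : `|u x| <= `|V| by rewrite (le_trans (hV x))// ler_norm.
have dz x : `|zt s x - zt t x| <= V1 * `|s - t|.
  rewrite -[zt s x - zt t x](subrK ((s - t) * u x)) (le_trans (ler_normD _ _))//.
  rewrite /V1 [leRHS]mulrDl mul1r addrC lerD//; first by rewrite normrM mulrC ler_wpM2r.
  by rewrite (le_trans (pt x))// ler_piMl.
have dz1 x : `|zt s x - zt t x| <= 1.
  by rewrite (le_trans (dz x))// mulrC -ler_pdivlMr// div1r ltW.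
have yt x : `|x + zt t x - x| <= M.
  by rewrite addrC addKr (le_trans (hM0 x))// (le_trans (ler_norm _))// lerDl.
have ys x : `|x + zt s x - x| <= M.
  rewrite addrC addKr -[zt s x](subrK (zt t x)) addrC (le_trans (ler_normD _ _))// lerD//.
  by rewrite (le_trans (hM0 x))// ler_norm.
have chain a b x := @taylor_decay F f g C M x a b aF af hg C0.
have ptw x : `|F (x + zt s x) - F x - (F (x + zt t x) - F x) - (s - t) * (f (x + zt t x) * u x)| <=
    A * (V1 * V1 + 1) * (q * `|s - t|) * ek x.
  set a := x + zt t x; set b := x + zt s x.
  have ba : b - a = zt s x - zt t x by rewrite /a /b opprD addrACA subrr add0r.
  have -> : F b - F x - (F a - F x) - (s - t) * (f a * u x) =
    (F b - F a - f a * (b - a)) + f a * (zt s x - zt t x - (s - t) * u x) by rewrite ba; ring.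
  rewrite (le_trans (ler_normD _ _))// normrM.
  have fa : `|f a| <= A * ek x.
    rewrite (le_trans (hf a))// -mulrA ler_wpM2l// (le_trans (ek_tri a x))// ler_wpM2r ?ek_ge0//.
    by rewrite ler_expR; exact: yt.
  have h1 := chain a b x (yt x) (ys x).
  have Ae : 0 <= A * ek x by rewrite mulr_ge0// ek_ge0.
  have h2 : (b - a) ^+ 2 <= V1 * V1 * (q * `|s - t|).
    rewrite -real_normK ?num_real// ba expr2 (le_trans (ler_pM _ _ (dz x) (dz x)))//.
    rewrite mulrACA ler_wpM2l ?mulr_ge0 ?(ltW V10)// ler_wpM2r// ltW//.
  have h3 := ler_wpM2l Ae h2.
  have h4 := ler_pM (normr_ge0 _) (normr_ge0 _) fa (pt x).
  rewrite (le_trans (lerD (le_trans h1 h3) h4))//.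
  by rewrite le_eqVlt; apply/orP; left; apply/eqP; ring.
have mF : mf F := mf_cont (ac_cont aF).
have mff : mf f := mf_cont (ac_cont af).
have m1 z : mf z -> mf (fun x => F (x + z x) - F x).
  by move=> mz; apply: mfB => //; apply: mf_comp mF _; apply: mfD => //; exact: mf_id.
have m2 : mf (fun x => f (x + zt t x) * u x).
  by apply: mfM => //; apply: mf_comp mff _; apply: mfD => //; exact: mf_id.
have [_ h] := ek_L2b (q := (fun x => F (x + zt s x) - F x - (F (x + zt t x) - F x) - (s - t) * (f (x + zt t x) * u x)))
  (mfB (mfB (m1 _ ms) (m1 _ mt)) (mfM (mf_cst _) m2)) ptw.
apply: (le_trans h).
apply: (@le_trans _ _ (q * D * `|s - t|)); last by rewrite ler_wpM2r.
rewrite /D [q * (_ + 1)]mulrDr mulr1 mulrDl.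
rewrite (_ : _ * L2bn (@ek R) = q * (A * (V1 * V1 + 1) * L2bn (@ek R)) * `|s - t|); last by ring.
by rewrite lerDl mulr_ge0// ltW.
Qed.

End Calculus.

(** * The energy *)

Section Parts.
Context {R : realType}.
Implicit Types (z : st R) (x s t : R).

Lemma sum9_parts (a1 a2 a3 a4 a5 a6 a7 a8 a9 : R) : 0 <= a1 -> 0 <= a2 -> 0 <= a3 -> 0 <= a4 ->
  0 <= a5 -> 0 <= a6 -> 0 <= a7 -> 0 <= a8 -> 0 <= a9 ->
  let t := a1 + a2 + a3 + a4 + a5 + a6 + a7 + a8 + a9 in
  [/\ a3 <= t, a4 <= t, a5 <= t, a6 <= t & a7 <= t].
Proof. by rewrite /=; move=> *; split; lra. Qed.

Lemma NS_each (dm : set (R -> R)) n K (fn : fnorm dm n K) z : SS dm z ->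
  [/\ n (uh z) <= NS n z, n (ww z) <= NS n z, n (vh z) <= NS n z, n (hh z) <= NS n z &
   n (rh z) <= NS n z].
Proof.
move=> [[_ b1] [a1 b2] a2 a3 [a4 a5]].
exact: (sum9_parts (supn_ge0 b1) (supn_ge0 b2) (fn_ge0 fn a1) (fn_ge0 fn a2) (fn_ge0 fn a3)
  (fn_ge0 fn a4) (fn_ge0 fn a5) (normr_ge0 _) (normr_ge0 _)).
Qed.

Definition sd (f : R -> R) t (f' : R) := tdiff (W := R^o) Num.norm f t f'.

Lemma sd_D f g t f' g' : 0 <= t -> sd f t f' -> sd g t g' -> sd (fun s => f s + g s) t (f' + g').
Proof. by move=> t0; apply: (tdiff_add sn_R). Qed.
Lemma sd_M f g t f' g' : 0 <= t -> sd f t f' -> sd g t g' ->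
  sd (fun s => f s * g s) t (f' * g t + f t * g').
Proof. exact: tdiff_mulR. Qed.
Lemma sd_cst (k t : R) : sd (fun=> k) t 0.
Proof. exact: (tdiff_cst k t sn_R). Qed.
Lemma sd_Z k f t f' : 0 <= t -> sd f t f' -> sd (fun s => k * f s) t (k * f').
Proof. by move=> t0; apply: (tdiff_scale k sn_R). Qed.
Lemma sd_N f t f' : 0 <= t -> sd f t f' -> sd (fun s => - f s) t (- f').
Proof. 
move=> t0 /(sd_Z (-1) t0); rewrite mulN1r; apply: tdiff_ext => // s _; exact: mulN1r.
Qed.
Lemma sd_B f g t f' g' : 0 <= t -> sd f t f' -> sd g t g' -> sd (fun s => f s - g s) t (f' - g').
Proof. by move=> t0 h1 h2; apply: (sd_D t0 h1 (sd_N t0 h2)). Qed.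

Lemma sd_lip f t f' : sd f t f' -> forall e, 0 < e -> exists2 d, 0 < d &
  forall s, 0 <= s -> `|s - t| < d -> `|f s - f t| <= `|s - t| * (`|f'| + e).
Proof.
move=> h e e0; have [d d0 hd] := h _ e0; exists d => // s s0 st.
have {}hd := hd _ s0 st.
rewrite -[f s - f t](subrK ((s - t) * f')) (le_trans (ler_normD _ _))// mulrDr addrC.
by apply: lerD; [rewrite normrM|rewrite [leRHS]mulrC; exact: hd].
Qed.

Lemma sd_gronwall f (f' : R -> R) (T L K : R) : 0 <= T -> 0 <= L -> 0 <= K ->
  (forall t, 0 <= t <= T -> sd f t (f' t)) ->
  (forall t, 0 <= t <= T -> `|f' t| <= L * `|f t| + K) ->
  forall t, 0 <= t <= T -> `|f t| <= (`|f 0| + K * t) * expR (L * t).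
Proof.
move=> T0 L0 K0 df h t tT.
apply: (gronwall (phi := fun t => `|f t|) T0 L0 K0 _ _ tT) => // {t tT} t tT e e0.
have [d d0 hd] := sd_lip (df _ tT) e0; exists d => // s /andP[s0 _] st.
rewrite (le_trans (ler_dist_dist _ _))// (le_trans (hd _ s0 st))// ler_wpM2l// lerD2r.
exact: h.
Qed.

Lemma sd_const f (T : R) : 0 <= T -> (forall t, 0 <= t <= T -> sd f t 0) ->
  forall t, 0 <= t <= T -> f t = f 0.
Proof.
move=> T0 h t tT; apply/eqP; rewrite -subr_eq0 -normr_le0.
have := sd_gronwall (f := fun s => f s - f 0) (f' := fun=> 0) T0 (lexx 0) (lexx 0) _ _ tT.
rewrite subrr normr0 mul0r addr0 mul0r; apply => s sT.
  by have := sd_B (proj1 (andP sT)) (h _ sT) (sd_cst (f 0) s); rewrite subrr.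
by rewrite ?normr0 mul0r addr0.
Qed.

Lemma sd_bound f (f' : R -> R) (T K : R) : 0 <= T -> 0 <= K ->
  (forall t, 0 <= t <= T -> sd f t (f' t)) -> (forall t, 0 <= t <= T -> `|f' t| <= K) ->
  forall t, 0 <= t <= T -> `|f t| <= `|f 0| + K * T.
Proof.
move=> T0 K0 df h t tT; have := sd_gronwall T0 (lexx 0) K0 df _ tT.
rewrite mul0r expR0 mulr1 => h1; rewrite (le_trans (h1 _))//.
  by move=> s sT; rewrite mul0r add0r; exact: h.
by rewrite lerD2l ler_wpM2l//; case/andP: tT.
Qed.

(** A zero at time t would propagate back to time 0 by Gronwall's inequality in reversed time;
    without zeros, continuity keeps the sign. *)
Lemma sd_positive f (f' : R -> R) (T L : R) : 0 <= T -> 0 <= L ->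
  (forall t, 0 <= t <= T -> sd f t (f' t)) ->
  (forall t, 0 <= t <= T -> `|f' t| <= L * `|f t|) -> 0 < f 0 ->
  forall t, 0 <= t <= T -> 0 < f t.
Proof.
move=> T0 L0 df h f0.
have nz t : 0 <= t <= T -> f t != 0.
  move=> tT; apply/eqP => ft; have /andP[t0 t1] := tT.
  have g := gronwall (phi := fun s => `|f (t - s)|) t0 L0 (lexx 0).
  have : `|f (t - t)| <= (`|f (t - 0)| + 0 * t) * expR (L * t).
    apply: g; [by []| |by rewrite t0 lexx].
    move=> s /andP[s0 st] e e0.
    have tsT : 0 <= t - s <= T by rewrite subr_ge0 st/= (le_trans _ t1)// gerBl.
    have [d d0 hd] := sd_lip (df _ tsT) e0; exists d => // r /andP[r0 rt] rs.
    have tr0 : 0 <= t - r by rewrite subr_ge0.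
    have e1 : t - r - (t - s) = s - r by ring.
    rewrite (le_trans (ler_dist_dist _ _))// (le_trans (hd _ tr0 _)) ?e1 1?distrC//.
    by rewrite (distrC r) ler_wpM2l// addr0 lerD2r; exact: h.
  by rewrite subrr subr0 ft normr0 !mul0r addr0 mul0r normr_le0 gt_eqF.
have ct t : 0 <= t <= T -> forall e, 0 < e -> exists2 d, 0 < d &
    forall s, 0 <= s -> `|s - t| < d -> `|f s - f t| < e.
  move=> tT e e0; have [d d0 hd] := sd_lip (df _ tT) ltr01.
  have D0 : 0 < `|f' t| + 1 by rewrite ltr_wpDl.
  exists (Num.min d (e / (`|f' t| + 1))) => [|s s0]; first by rewrite lt_min d0 divr_gt0.
  rewrite lt_min => /andP[l1 l2]; rewrite (le_lt_trans (hd _ s0 l1))//.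
  by rewrite -ltr_pdivlMr.
apply: real_ind => //.
- move=> t /andP[t0 tT] hs; have ft : 0 < f t by apply: hs; rewrite t0 lexx.
  have tT' : 0 <= t <= T by rewrite t0 ltW.
  have [d d0 hd] := ct _ tT' _ ft; exists (d / 2) => [|s /andP[ts sd] sT].
    by rewrite divr_gt0.
  have s0 : 0 <= s by exact: le_trans ts.
  have : `|s - t| < d by rewrite ger0_norm ?subr_ge0// ltrBlDl (le_lt_trans sd)// ltrD2l ltr_pdivrMr// ltr_pMr// ltr1n.
  by move/(hd _ s0); rewrite ltr_norml => /andP[u _]; move: u; clear; lra.
- move=> t /andP[t0 tT] hs; have tT' : 0 <= t <= T by rewrite (ltW t0).
  rewrite lt_neqAle eq_sym nz//= leNgt; apply/negP => ft.
  have ft' : 0 < - f t by rewrite oppr_gt0.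
  have [d d0 hd] := ct _ tT' _ ft'.
  pose s := Num.max 0 (t - d / 2); have s0 : 0 <= s by rewrite /s le_max lexx.
  have st : s < t by rewrite /s gt_max t0 ltrBlDr ltrDl divr_gt0.
  have := hs s; rewrite s0 st => /(_ isT) fs.
  have : `|s - t| < d.
    rewrite ltr0_norm ?subr_lt0// opprB ltrBlDr -ltrBlDl.
    rewrite /s lt_max; apply/orP; right; rewrite ltrD2l ltrN2 ltr_pdivrMr// ltr_pMr// ltr1n//.
  by move/(hd _ s0); rewrite ltr_norml => /andP[_ u]; move: u fs ft; clear; lra.
Qed.

Lemma It_tail (I : R -> R) e : ig I -> 0 < e -> exists n : R, forall a b, a <= - n -> n <= b ->
  `|It I - io a b I| <= e.
Proof.
move=> iI e0; have ia := ig_abs iI; have la := ig_li ia; have lI := ig_li iI.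
have [n hn] : exists n : nat, It (fun x => `|I x|) - e < io (- n%:R) n%:R (fun x => `|I x|).
  apply: contrapT => h.
  have hle (n : nat) : io (- n%:R) n%:R (fun x => `|I x|) <= It (fun x => `|I x|) - e.
    by rewrite leNgt; apply/negP => hn; apply: h; exists n.
  have [_] := ig_mono (ig_mf ia) (fun=> normr_ge0 _) (fun n => la.2 _ _) hle.
  by rewrite lerBrDr gerDl leNgt e0.
exists n%:R => a b an nb.
have nn : - (n%:R : R) <= n%:R by rewrite (@le_trans _ _ 0)// oppr_le0.
have h1 : io (- n%:R) n%:R (fun x => `|I x|) <= io a b (fun x => `|I x|) by exact: io_mono.
have h2 : io a b (fun x => `|I x| + I x) <= It (fun x => `|I x| + I x).
  by apply: io_le_It => [|x]; [exact: igD|have := ler_norm (- I x); rewrite normrN; lra].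
have h3 : io a b (fun x => `|I x| - I x) <= It (fun x => `|I x| - I x).
  by apply: io_le_It => [|x]; [exact: igB|rewrite subr_ge0 ler_norm].
rewrite ItD// ioD// in h2; rewrite ItB// ioB// in h3.
rewrite ler_norml; move: h1 h2 h3 hn.
move: (It _) (It _) (io _ _ _) (io _ _ _) (io _ _ _); clear => *; apply/andP; split; lra.
Qed.

(** A square-integrable function need not tend to 0, but it is small at some points arbitrarily far
    out on each side; these serve as endpoints when integrating an exact derivative. *)
Lemma small_far (f : R -> R) e n : L2 f -> 0 < e -> 
  (exists2 b, n <= b & `|f b| <= e) /\ (exists2 a, a <= n & `|f a| <= e).
Proof.
move=> /L2P[m i] e0; have l := ig_li i.
have key a (k : nat) : (forall x, a <= x <= a + k%:R -> e < `|f x|) -> k%:R * e ^+ 2 <= It (fun x => f x ^+ 2).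
  move=> h; apply: le_trans (io_le_It a (a + k%:R) i (fun x => sqr_ge0 _)).
  have -> : k%:R * e ^+ 2 = io a (a + k%:R) (fun=> e ^+ 2).
    by rewrite io_cst ?lerDl// addrC addKr mulrC.
  apply: io_le => //; first exact: li_cst.
  move=> x xa; rewrite -[f x ^+ 2]real_normK ?num_real// ler_pXn2r ?nnegrE ?(ltW e0)//.
  exact: ltW (h _ xa).
have e2 : 0 < e ^+ 2 by rewrite exprn_gt0.
have [k hk] : exists k : nat, It (fun x => f x ^+ 2) < k%:R * e ^+ 2.
  have := archi_boundP (divr_ge0 (It_ge0 (fun x => sqr_ge0 (f x))) (ltW e2)).
  by rewrite ltr_pdivrMr//; move=> ?; eexists; eassumption.
split; apply: contrapT => h; have := hk; rewrite ltNge.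
  case/negP; apply: (key n) => x /andP[nx _]; rewrite ltNge; apply/negP => fx.
  by apply: h; exists x.
case/negP; apply: (key (n - k%:R)) => x /andP[_ nx]; rewrite ltNge; apply/negP => fx.
by apply: h; exists x => //; rewrite subrK in nx.
Qed.

End Parts.

Lemma C1_arith (R : realFieldType) (m E : R) : 0 <= m -> 0 <= E ->
  4 * E + m * E + (2 * m ^+ 2 + m) * 2 <= 4 * ((5 + 3 * m + 4 * m ^+ 2) * (1 + E)).
Proof.
by move=> m0 E0; have := mulr_ge0 m0 E0; have := mulr_ge0 (sqr_ge0 m) E0; have := sqr_ge0 m; lra.
Qed.

Section EnergyArith.
Variable R : realFieldType.
Implicit Types a b c d h k m u r A K : R.
Lemma en_ar1 c d m : d * c <= d * m -> 2 * (d * c) <= d ^+ 2 + m ^+ 2.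
Proof. by move=> h1; have := sqr_ge0 (d - m); rewrite sqrrB; lra. Qed.
Lemma en_ar2 b h r : r <= b * h -> r <= (2^-1 * (b + h)) ^+ 2.
Proof. by move=> h1; have := sqr_ge0 (b - h); rewrite sqrrB; lra. Qed.
Lemma en_ar3 A K b h m u : A * b <= (2 * u + m ^+ 2) * b -> K <= m * (2^-1 * (b + h)) ->
  0 <= b -> 0 <= h -> 2 * (A * b) + 2 * K + h <=
  4 * (u * b + h) + m * (u * b + h) + (2 * m ^+ 2 + m) * b - (3 * h + m * (u * b)).
Proof. by move=> h1 h2 b0 h0; lra. Qed.
Lemma en_ar4 u h m : 0 <= u -> 0 <= m * u -> 0 <= m * h -> 0 <= h ->
  0 <= 4 * (u + h) + m * (u + h) - (3 * h + m * u).
Proof. by move=> *; lra. Qed.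
Lemma en_ar5 k u b h m : k * (4 * (u + h) + m * (u + h) - (3 * h + m * u)) <=
    4 * (u + h) + m * (u + h) - (3 * h + m * u) -> 0 <= h -> 0 <= m * u ->
  k * (4 * (u + h) + m * (u + h) + (2 * m ^+ 2 + m) * b - (3 * h + m * u)) <=
  4 * (u + h) + m * (u + h) + (2 * m ^+ 2 + m) * (k * b).
Proof. by move=> *; lra. Qed.
End EnergyArith.

(** * The energy and the bounds it gives for P and Q *)

Section Energy.
Context {R : realType}.
Variables (chi : R -> R) (chiP : cutoff chi).
Implicit Types (z : st R) (x s t : R).
Local Notation chi' := (derive1 chi).
Local Notation F := (FS chi true).
Local Notation A := (AS chi true).
Local Notation Q := (QS chi true).
Local Notation L2b := (@L2b R).
Local Notation L2bn := (@L2bn R).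
Local Notation N := (NS L2bn).
Let fb := @fnorm_L2b R.
Variables (C0 : R) (hC0 : chi_const chi C0).
Let c00 : 0 <= C0. Proof. by case: hC0. Qed.

(* Imposed at every point, not almost everywhere, so that the pointwise ODEs
   preserve these conditions. *)
Definition GE z := forall x, [/\ 0 <= 1 + ww z x, 0 <= hh z x, 0 < 1 + ww z x + hh z x &
  (1 + ww z x) * hh z x = vS chi z x ^+ 2 + rbS z x ^+ 2].

Definition PS z x := PbS chi true z x + cc z ^+ 2 * gfun chi (yS z x) + 2^-1 * kk z ^+ 2.

Lemma AE z x : A z x = US chi z x ^+ 2 + 2^-1 * kk z ^+ 2 - PS z x.
Proof. by rewrite /AS /PS /aS /UbS /US gfunE; ring. Qed.

Lemma ac_y z : SA z -> ac (yS z) (fun x => 1 + ww z x).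
Proof. by move=> [_ [a _]]; exact: acD (@ac_id R) a. Qed.

Lemma ac_US z : SA z -> ac (US chi z) (vS chi z).
Proof. by move=> [_ [_ a]]; exact: acD a (acZ (cc z) (ac_chi chiP)). Qed.

Lemma ac_Ub z : SA z -> ac (UbS chi z) (fun x => vS chi z x - cc z * (chi' (yS z x) * (1 + ww z x))).
Proof.
move=> sz; have h := ac_chain (smooth_quadr (chi_smooth chiP)) (ac_y sz).
have := acB (ac_US sz) (acZ (cc z) h).
apply: (_ : forall f g f' g', f = f' -> g = g' -> ac f g -> ac f' g').
  by move=> ? ? ? ? -> ->.
- by apply/funext => x; rewrite /US /UbS; ring.
- by apply/funext => x; rewrite (mulrC (chi' _)).
Qed.

Lemma ac_PS z : SA z -> ac (PS z) (fun x => Q z x * (1 + ww z x)).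
Proof.
move=> sz; have [df _ [M hM]] := SS_fS chiP fb true sz.1; have ay := ac_y sz.
have aP := ac_sgP ay hM (fn_mf fb df) (fun x => fn_ig fb df x).
have := acD (acD (acZ 4^-1 aP) (acZ (cc z ^+ 2) (ac_chain (quadr_gfun chiP) ay))) (ac_cst (2^-1 * kk z ^+ 2)).
congr ac; apply/funext => x; rewrite /QS /QbS /kap -/(sgQ (yS z) (fS chi z) x).
by move: (sgQ _ _ _) (gder _ _) => q p; field.
Qed.

Lemma chiy_L2b z : SS L2b z -> L2b (fun x => chi x - chi (yS z x)).
Proof.
move=> [[m [M hM]] _ _ _ _]; have mc := mf_cont (chi_cont chiP).
apply: (ek_L2b (C := C0 * expR `|M| * `|M|) _ _).1.
  by apply: mfB => //; apply: mf_comp mc _; apply: mfD => //; exact: mf_id.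
move=> x; have h w : `|chi' w| <= C0 * ek w by have [] := hC0.2 w.
have hx : `|x - x| <= `|M| by rewrite subrr normr0.
have hy : `|yS z x - x| <= `|M| by rewrite /yS addrC addKr (le_trans (hM x))// ler_norm.
rewrite (le_trans (decay_lip (ac_chi chiP) h c00 hx hy))// [leRHS]mulrAC.
rewrite ler_wpM2l ?mulr_ge0 ?expR_ge0 ?ek_ge0//; by rewrite distrC.
Qed.

Lemma ek_fun_L2b z (f : R -> R) : SS L2b z -> mf f -> (forall w, `|f w| <= C0 * ek w) ->
  L2b (fun x => f (yS z x)).
Proof.
move=> [[m [M hM]] _ _ _ _] mfx h; apply: (ek_L2b (C := C0 * expR `|M|) _ _).1.
  by apply: mf_comp mfx _; apply: mfD => //; exact: mf_id.
move=> x; rewrite (le_trans (h _))// -mulrA ler_wpM2l// (le_trans (ek_tri _ x))// ler_wpM2r ?ek_ge0//.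
by rewrite ler_expR /yS addrC addKr (le_trans (hM x))// ler_norm.
Qed.

Let D f g : L2b f -> L2b g -> L2b (fun x => f x + g x). Proof. by move=> a b; exact: (fn_D fb a b).1. Qed.
Let Z k f : L2b f -> L2b (fun x => k * f x). Proof. by move=> a; exact: (fn_Z fb k a).1. Qed.
Let Nn f : L2b f -> L2b (fun x => - f x).
Proof. by move=> /(Z (-1)); congr L2b; apply/funext => x; rewrite mulN1r. Qed.
Let B f g : L2b f -> L2b g -> L2b (fun x => f x - g x). Proof. by move=> a /Nn; exact: D. Qed.
Let Mu f g : L2b f -> L2b g -> L2b (fun x => f x * g x). Proof. by move=> a b; exact: (L2b_mul a b).1. Qed.

Lemma Ub_L2b z : SS L2b z -> L2b (UbS chi z).
Proof. by move=> sz; have [_ [a _] _ _ _] := sz; exact: D a (Z _ (chiy_L2b sz)). Qed.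
Lemma dchi_L2b : L2b chi'.
Proof.
apply: (ek_L2b (C := C0) _ _).1; last by move=> x; have [] := hC0.2 x.
exact: mf_cont (dr_cont (smooth_dr (smooth_derive (chi_smooth chiP)))).
Qed.
Lemma v_L2b z : SS L2b z -> L2b (vS chi z).
Proof. by move=> sz; have [_ _ _ a _] := sz; exact: D a (Z _ dchi_L2b). Qed.
Lemma rb_L2b z : SS L2b z -> L2b (rbS z).
Proof. by move=> [_ _ a _ [_ b]]; exact: B b (Z _ a). Qed.
Lemma U_bdd z : SS L2b z -> mf (US chi z) /\ bdd (US chi z).
Proof.
move=> [_ [a b] _ _ _]; split.
  by apply: mfD; [exact: fn_mf fb _ a|apply: mfM; [exact: mf_cst|exact: mf_cont (chi_cont chiP)]].
apply: bddD b (bddZ _ _); exists 1 => x; have /andP[u w] := chi_01 chiP x; by rewrite ger0_norm.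
Qed.
Lemma bM f g : bdd f -> mf f -> L2b g -> L2b (fun x => f x * g x).
Proof.
move=> [K hK] mff lg; have a := Z `|K| lg.
apply: (fn_le fb (mfM mff (fn_mf fb lg)) a _).1 => x; rewrite !normrM normr_id.
by rewrite ler_wpM2r// (le_trans (hK x))// ler_norm.
Qed.
Lemma FS_L2b z : SA z -> L2b (Q z) /\ L2b (vh (F z)).
Proof.
move=> sz; have [_ sF _] := SS_fS chiP fb true sz.1; have [_ [a _] _ b _] := sF; split=> //.
by have := Nn a; congr L2b; apply/funext => x; rewrite opprK.
Qed.

Definition en z := It (fun x => UbS chi z x ^+ 2 * (1 + ww z x) + hh z x).
(** The energy after writing h = y_x h - w h and replacing y_x h by v^2 + rbar^2. Each summand is
    now the integral of a product of two L^2 functions, hence differentiable along a curve of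
    states, which is not apparent for the integral of h. *)
Definition en2 z := It (fun x => UbS chi z x * UbS chi z x) +
  It (fun x => UbS chi z x * (UbS chi z x * ww z x)) + It (fun x => vS chi z x * vS chi z x) +
  It (fun x => rbS z x * rbS z x) - It (fun x => ww z x * hh z x).

Let ii f g : L2b f -> L2b g -> ig (fun x => f x * g x).
Proof. by move=> [a _] [b _]; exact: (L2_CS a b).1. Qed.

Lemma en_en2 z : SS L2b z -> GE z -> ig (fun x => UbS chi z x ^+ 2 * (1 + ww z x) + hh z x) /\ en z = en2 z.
Proof.
move=> sz gz; have u := Ub_L2b sz; have v := v_L2b sz; have r := rb_L2b sz.
have [_ _ w _ [h _]] := sz; have uw := Mu u w.
have i1 := igD (ii u u) (ii u uw); have i2 := igD i1 (ii v v); have i3 := igD i2 (ii r r).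
have i4 := igB i3 (ii w h).
have e : (fun x => UbS chi z x ^+ 2 * (1 + ww z x) + hh z x) =
  (fun x => UbS chi z x * UbS chi z x + UbS chi z x * (UbS chi z x * ww z x) + vS chi z x * vS chi z x +
     rbS z x * rbS z x - ww z x * hh z x).
  apply/funext => x; have [_ _ _ g] := gz x.
  have -> : hh z x = (1 + ww z x) * hh z x - ww z x * hh z x by ring.
  by rewrite [X in _ + (X - _) = _]g; ring.
rewrite e; split=> //; rewrite /en e ItB ?ii// ItD ?ii// ItD ?ii// ItD ?ii//.
Qed.

(** Chosen by [C1_arith] so that 4 (1 + E) times it majorizes the integral of the bound [g] used in
    [PQ_bound]; the 4 is the one in front of the integrals in P and Q. *)
Definition C1 (m : R) := 5 + 3 * m + 4 * m ^+ 2.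

Lemma kap_homo (y : R -> R) x s : {homo y : a b / a <= b} -> kap true y x s = kap false y x s.
Proof.
move=> mono; rewrite /kap /sgk; congr (expR (- _)); have [xs|sx|->] := ltgtP x s.
- by rewrite ltr0_sg ?subr_lt0// mulN1r ler0_norm// subr_le0 mono// ltW.
- by rewrite gtr0_sg ?subr_gt0// mul1r ger0_norm// subr_ge0 mono// ltW.
- by rewrite !subrr sgr0 mul0r normr0.
Qed.

(** Since rbar^2 is at most y_x h, the term 2 k rbar is at most m (y_x + h), and a y_x is at most (2
    Ubar^2 + m^2) y_x. Multiples of the energy density are integrated with the kernel bounded by 1,
    multiples of y_x against the kernel by [kernel_int]. *)
Lemma PQ_bound z m : SA z -> GE z -> `|cc z| <= m -> `|kk z| <= m -> 
  0 <= en z /\ forall x, `|PbS chi true z x| <= C1 m * (1 + en z) /\ `|QbS chi true z x| <= C1 m * (1 + en z).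
Proof.
move=> sz gz cm km; have [ie _] := en_en2 sz.1 gz.
have m0 : 0 <= m := le_trans (normr_ge0 _) cm.
have b0 x : 0 <= 1 + ww z x by have [] := gz x.
have e0 x : 0 <= UbS chi z x ^+ 2 * (1 + ww z x) + hh z x.
  by have [_ h _ _] := gz x; rewrite addr_ge0// mulr_ge0// sqr_ge0.
have E0 : 0 <= en z by exact: It_ge0.
split=> // x; have ay := ac_y sz.
have mono := ac_homo ay b0.
have ke s : kap true (yS z) x s = expR (- `|yS z x - yS z s|) := kap_homo x s mono.
have [ik kint] := kernel_int x ay b0.
have [df _ [M hM]] := SS_fS chiP fb true sz.1.
pose g s := 4 * (UbS chi z s ^+ 2 * (1 + ww z s) + hh z s) + m * (UbS chi z s ^+ 2 * (1 + ww z s) + hh z s) +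
  (2 * m ^+ 2 + m) * (expR (- `|yS z x - yS z s|) * (1 + ww z s)).
have ig_g : ig g by apply: igD; [apply: igD; exact: igZ|exact: igZ].
have It_g : It g <= 4 * (C1 m * (1 + en z)).
  rewrite /g ItD; [|by apply: igD; exact: igZ|exact: igZ].
  rewrite ItD; [|exact: igZ|exact: igZ].
  rewrite !ItZ// -/(en z).
  have h1 : (2 * m ^+ 2 + m) * It (fun s => expR (- `|yS z x - yS z s|) * (1 + ww z s)) <= (2 * m ^+ 2 + m) * 2.
    by rewrite ler_wpM2l// addr_ge0// mulr_ge0// sqr_ge0.
  apply: (le_trans (lerD (lexx _) h1)); rewrite /C1.
  exact: C1_arith.
have le s : `|expR (- `|yS z x - yS z s|) * fS chi z s| <= g s.
  have [_ h _ gg] := gz s; have bs := b0 s.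
  set k := expR _; have k1 : k <= 1 by rewrite /k -expR0 ler_expR oppr_le0.
  have k0 : 0 <= k by exact: expR_ge0.
  rewrite normrM (ger0_norm k0) /g -/k.
  set u := UbS chi z s; set b := 1 + ww z s.
  have fb1 : `|fS chi z s| <= 4 * (u ^+ 2 * b + hh z s) + m * (u ^+ 2 * b + hh z s) + (2 * m ^+ 2 + m) * b - (3 * hh z s + m * (u ^+ 2 * b)).
    have chi1 : `|chi (yS z s)| <= 1 by have /andP[c d] := chi_01 chiP (yS z s); rewrite ger0_norm.
    have cchi : `|cc z * chi (yS z s)| <= m by rewrite normrM (le_trans (ler_piMr _ chi1)).
    have ha : `|aS chi z s| <= 2 * u ^+ 2 + m ^+ 2.
      have -> : aS chi z s = u * u + 2 * (u * (cc z * chi (yS z s))) by rewrite /aS /US /u /UbS; ring.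
      rewrite (le_trans (ler_normD _ _))// !normrM normr_nat.
      have -> : 2 * u ^+ 2 + m ^+ 2 = `|u| * `|u| + (`|u| ^+ 2 + m ^+ 2).
        by rewrite -[u ^+ 2]real_normK ?num_real//; ring.
      rewrite lerD2l -normrM -/(_ * _).
      have h1 : `|u| * `|cc z * chi (yS z s)| <= `|u| * m by rewrite ler_wpM2l.
      exact: en_ar1.
    have hr : `|rbS z s| <= 2^-1 * (b + hh z s).
      have : rbS z s ^+ 2 <= b * hh z s by rewrite gg lerDr sqr_ge0.
      have bh0 : 0 <= 2^-1 * (b + hh z s).
        by apply: mulr_ge0; [rewrite invr_ge0|exact: addr_ge0 bs h].
      move=> h2; rewrite -(@ler_pXn2r _ 2) ?nnegrE//.
      by rewrite real_normK ?num_real//; exact: en_ar2.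
    have -> : fS chi z s = 2 * (aS chi z s * b) + 2 * (kk z * rbS z s) + hh z s by rewrite /fS /b; ring.
    move: (aS chi z s) ha => aa ha.
    rewrite (le_trans (ler_normD _ _))// (ger0_norm h).
    apply: (le_trans (lerD (ler_normD _ _) (lexx _))); rewrite !normrM !normr_nat (ger0_norm bs).
    have h1 := ler_wpM2r bs ha; have h2 := ler_pM (normr_ge0 _) (normr_ge0 _) km hr.
    have := en_ar3 h1 h2 bs h; rewrite -/b; apply.
  have ub := mulr_ge0 (sqr_ge0 u) bs; have mu_ := mulr_ge0 m0 ub.
  have mh := mulr_ge0 m0 h; have mm : 0 <= (2 * m ^+ 2 + m) * b.
    by rewrite mulr_ge0// addr_ge0// mulr_ge0// sqr_ge0.
  have h3 := ler_wpM2l k0 fb1; rewrite (le_trans h3)//.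
  have p1 : 0 <= 4 * (u ^+ 2 * b + hh z s) + m * (u ^+ 2 * b + hh z s) - (3 * hh z s + m * (u ^+ 2 * b)).
    exact: en_ar4 ub mu_ mh h.
  have p2 := ler_piMl p1 k1.
  exact: en_ar5 p2 h mu_.
have q4 : `|4^-1 : R| = 4^-1 by rewrite ger0_norm.
have kf s : kap true (yS z) x s * fS chi z s = expR (- `|yS z x - yS z s|) * fS chi z s by rewrite ke.
have my : mf (yS z) := mf_cont (ac_cont ay); have mff := fn_mf fb df.
have i1 : ig (fun s => expR (- `|yS z x - yS z s|) * fS chi z s).
  by apply: (ig_le _ le ig_g); mfs.
split.
  rewrite /PbS (_ : (fun s => _) = (fun s => expR (- `|yS z x - yS z s|) * fS chi z s)); last first.
    exact/funext.
  rewrite normrM q4 ler_pdivrMl// (le_trans _ It_g)//; exact: It_normle.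
rewrite /QbS (_ : (fun s => _) = (fun s => Num.sg (x - s) * (expR (- `|yS z x - yS z s|) * fS chi z s))); last first.
  by apply/funext => s; rewrite -mulrA kf.
have le2 s : `|Num.sg (x - s) * (expR (- `|yS z x - yS z s|) * fS chi z s)| <= g s.
  rewrite normrM (le_trans _ (le s))// ler_piMl// normr_sg lern1; by case: (_ == _).
rewrite normrM normrN q4 ler_pdivrMl// (le_trans _ It_g)//; apply: It_normle => //.
by apply: (ig_le _ le2 ig_g); mfs.
Qed.

End Energy.

(** * A priori bounds *)

Section RateArith.
Variable R : realFieldType.
Implicit Types m c u p q : R.

Lemma rate_ar1 m c u p q (x : R) : `|c| <= m -> 0 <= x <= 1 -> `|p| <= q ->
  `|- 2 * p + u ^+ 2 - 2 * u * (u + c * x)| <= 2 * q + m ^+ 2 + 2 * u ^+ 2.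
Proof.
move=> cm /andP[x0 x1] pq; have m0 := le_trans (normr_ge0 _) cm.
have cx : `|c * x| <= m by rewrite normrM (ger0_norm x0) (le_trans (ler_piMr _ x1)).
have h : `|2 * (u * (c * x))| <= u ^+ 2 + m ^+ 2.
  rewrite normrM normr_nat normrM -(@real_normK _ u) ?num_real//.
  apply: en_ar1; exact: ler_wpM2l.
have -> : - 2 * p + u ^+ 2 - 2 * u * (u + c * x) = - (2 * p) - u ^+ 2 - 2 * (u * (c * x)) by ring.
rewrite (le_trans (ler_normB _ _))// (le_trans (lerD (ler_normB _ _) (lexx _)))//.
rewrite normrN normrM normr_nat (ger0_norm (sqr_ge0 u)); lra.
Qed.

Lemma rate_ar2 m U u p k q : 0 <= m -> `|U| <= m + 1 -> `|k| <= m -> `|u| <= 1 -> `|p| * `|u| <= 1 ->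
  `|2 / 3 * (U * (U * U)) + k ^+ 2 * U - 2 * (p * u) + 3^-1 * (u * (u * u))| <=
  (m + 1) ^+ 3 + m ^+ 2 * (m + 1) + 3.
Proof.
move=> m0 hU hk hu hp.
have m1 : 0 <= m + 1 by rewrite addr_ge0.
have h1 : `|U * (U * U)| <= (m + 1) ^+ 3.
  rewrite !normrM exprS expr2; apply: ler_pM => //; exact: ler_pM.
have h2 : `|k ^+ 2 * U| <= m ^+ 2 * (m + 1).
  by rewrite normrM normrX ler_pM// ler_pXn2r ?nnegrE.
have h3 : `|u * (u * u)| <= 1.
  rewrite !normrM -[leRHS]mulr1; apply: ler_pM => //; rewrite -[leRHS]mulr1; exact: ler_pM.
have p3 : 0 <= (m + 1) ^+ 3 by rewrite exprn_ge0.
rewrite (le_trans (ler_normD _ _))// (le_trans (lerD (ler_normB _ _) (lexx _)))//.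
rewrite (le_trans (lerD (lerD (ler_normD _ _) (lexx _)) (lexx _)))//.
have n1 : `|2 / 3 : R| = 2 / 3 by rewrite ger0_norm// divr_ge0.
have n2 : `|3^-1 : R| = 3^-1 by rewrite ger0_norm// invr_ge0.
rewrite [`|2 / 3 * _|]normrM n1 [`|2 * (p * u)|]normrM [`|3^-1 * _|]normrM n2 normr_nat (normrM p).
lra.
Qed.
End RateArith.

Lemma sum4_le0 (R : realFieldType) (a b c d : R) : 0 <= a -> 0 <= b -> 0 <= c -> 0 <= d ->
  [/\ a <= a + b + c + d, b <= a + b + c + d, c <= a + b + c + d & d <= a + b + c + d].
Proof. by move=> *; split; lra. Qed.

Section Dynamics.
Context {R : realType}.
Variables (chi : R -> R) (chiP : cutoff chi).
Implicit Types (z : st R) (x s t : R).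
Local Notation chi' := (derive1 chi).
Local Notation F := (FS chi true).
Local Notation A := (AS chi true).
Local Notation Q := (QS chi true).
Local Notation L2b := (@L2b R).
Local Notation L2bn := (@L2bn R).
Local Notation N := (NS L2bn).
Let fb := @fnorm_L2b R.
Let snb : seminormed (W := R -> R^o) L2b L2bn := sn_fn fb.
Variables (C0 : R) (hC0 : chi_const chi C0).
Let c00 : 0 <= C0. Proof. by case: hC0. Qed.
Let ii f g : L2b f -> L2b g -> ig (fun x => f x * g x).
Proof. by move=> [a _] [b _]; exact: (L2_CS a b).1. Qed.

Definition Ubt z x := - Q z x - cc z * (chi' (yS z x) * US chi z x).
(** [IS] is the time derivative of the energy density Ubar^2 y_x + h along the flow, [Phi] the flux
    whose space derivative it is up to [LS], and [LS] the remainder carrying the factor chi'(y)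
    y_x. *)
Definition IS z x := 2 * UbS chi z x * Ubt z x * (1 + ww z x) + UbS chi z x ^+ 2 * vS chi z x +
  2 * (A z x * vS chi z x).
Definition LS z x := cc z * (chi' (yS z x) * (1 + ww z x)) *
  (- 2 * PS chi z x + UbS chi z x ^+ 2 - 2 * UbS chi z x * US chi z x).
Definition Phi z x := 2 / 3 * (US chi z x * (US chi z x * US chi z x)) + kk z ^+ 2 * US chi z x -
  2 * (PS chi z x * UbS chi z x) + 3^-1 * (UbS chi z x * (UbS chi z x * UbS chi z x)).

Lemma ac_Phi z : SA z -> ac (Phi z) (fun x => IS z x - LS z x).
Proof.
move=> sz; have aU := ac_US chiP sz; have aP := ac_PS chiP sz; have au := ac_Ub chiP sz.
have := acD (acB (acD (acZ (2 / 3) (ac_mul aU (ac_mul aU aU))) (acZ (kk z ^+ 2) aU))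
  (acZ 2 (ac_mul aP au))) (acZ 3^-1 (ac_mul au (ac_mul au au))).
congr ac; apply/funext => x; rewrite /IS /LS /Ubt AE.
move: (Q z x) (PS chi z x) (chi' (yS z x)) (vS chi z x) (ww z x) => q p d v w.
by move: (US chi z x) (UbS chi z x) (cc z) (kk z) => U u c k; field.
Qed.

Lemma Ubt_L2b z : SA z -> L2b (Ubt z).
Proof.
move=> sz; have [q _] := FS_L2b chiP sz; have [mU bU] := U_bdd chiP sz.1.
have md : mf chi' := mf_cont (dr_cont (smooth_dr (smooth_derive (chi_smooth chiP)))).
have hd x : `|chi' x| <= C0 * ek x by have [] := hC0.2 x.
have d := ek_fun_L2b hC0 sz.1 md hd.
have du := bM bU mU d.
have := snB snb (snN snb q) (snZ snb (cc z) du); congr L2b; apply/funext => x.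
by rewrite !fctE /GRing.scale/= /Ubt (mulrC (chi' _)).
Qed.

(** The product A v is not visibly integrable. It is recovered from v times the rate of [vh] and w
    times the rate of [hh], both products of L^2 functions, in which the terms A v w cancel. *)
Lemma ig_IS z : SA z -> ig (IS z).
Proof.
move=> sz; have u := Ub_L2b chiP hC0 sz.1; have ut := Ubt_L2b sz; have v := v_L2b chiP hC0 sz.1.
have [_ _ w _ [h _]] := sz.1; have r := rb_L2b sz.1; have [_ vh'] := FS_L2b chiP sz.
have uw := (L2b_mul u w).1; have uv := (L2b_mul u v).1.
have i1 := igD (igZ 2 (ii u ut)) (igZ 2 (ii uw ut)).
have i2 := igD i1 (ii u uv).
have i3 := igD i2 (igZ 2 (ii v vh')).
have [_ sF _] := SS_fS chiP fb true sz.1; have [_ _ _ _ [hF _]] := sF.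
have i4 := igB (igB (igB i3 (ii v h)) (igZ (2 * kk z) (ii v r))) (ii w hF).
move: i4; congr ig; apply/funext => x; 
have e1 : vh (F z) x = 2^-1 * hh z x + kk z * rbS z x + (A z x + A z x * ww z x) by [].
have e2 : hh (F z) x = 2 * (A z x * vS chi z x) by [].
by rewrite /IS e1 e2; field.
Qed.

(** Between endpoints where Ubar is small the flux terms are bounded independently of the energy. In
    [LS] the bound of P, affine in the energy, multiplies the integral of chi'(y) y_x, which is an
    increment of chi(y) and so at most 1; the part with Ubar^2 is at most a multiple of the energy
    because chi' is bounded. *)
Lemma energy_rate m : exists2 K, 0 <= K & forall z, SA z -> GE chi z -> `|cc z| <= m -> `|kk z| <= m ->
  `|It (IS z)| <= K * en chi z + K.
Proof.
(* The flux at two endpoints, the two contributions of [LS], and 1 for the tail of the integral. The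
   expression is affine in E, so [K 1 + K 0] can serve both as slope and as intercept. *)
pose K (E : R) := 2 * ((m + 1) ^+ 3 + m ^+ 2 * (m + 1) + 3) +
  m * (2 * (C1 m * (1 + E) + m ^+ 2 * (1 + C0) + m ^+ 2) + m ^+ 2) + 2 * m * C0 * E + 1.
have [m0|m0] := leP 0 m; last first.
  by exists 0 => // z _ _ cm _; have := le_lt_trans (le_trans (normr_ge0 _) cm) m0; rewrite ltxx.
have C1m : 0 <= C1 m by rewrite /C1 !addr_ge0// mulr_ge0// sqr_ge0.
exists (K 1 + K 0).
  by rewrite /K !addr_ge0 ?mulr_ge0 ?addr_ge0 ?mulr_ge0 ?addr_ge0 ?exprn_ge0 ?addr_ge0 ?mulr_ge0 ?addr_ge0 ?mulr_ge0 ?addr_ge0.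
move=> z sz gz cm km; have [E0 pq] := PQ_bound chiP hC0 sz gz cm km.
suff h : `|It (IS z)| <= K (en chi z).
  apply: (le_trans h); pose k1 := 2 * m * C1 m + 2 * m * C0.
  have k10 : 0 <= k1 by rewrite addr_ge0// !mulr_ge0.
  have e1 : K (en chi z) = K 0 + k1 * en chi z by rewrite /K /k1; ring.
  have e2 : K 1 = K 0 + k1 by rewrite /K /k1; ring.
  have K00 : 0 <= K 0.
    by rewrite /K !addr_ge0 ?mulr_ge0 ?addr_ge0 ?mulr_ge0 ?addr_ge0 ?exprn_ge0 ?addr_ge0 ?mulr_ge0 ?addr_ge0 ?mulr_ge0 ?addr_ge0.
  rewrite e1 e2 -subr_ge0.
  have -> : (K 0 + k1 + K 0) * en chi z + (K 0 + k1 + K 0) - (K 0 + k1 * en chi z) =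
    2 * (K 0 * en chi z) + (k1 + K 0) by ring.
  exact: addr_ge0 (mulr_ge0 (ler0n _ 2) (mulr_ge0 K00 E0)) (addr_ge0 k10 K00).
pose E := en chi z; pose Pe := C1 m * (1 + E) + m ^+ 2 * (1 + C0) + m ^+ 2.
have hP x : `|PS chi z x| <= Pe.
  have [h1 _] := pq x; rewrite /PS /Pe.
  rewrite (le_trans (ler_normD _ _))// lerD//.
    rewrite (le_trans (ler_normD _ _))// lerD// normrM normrX ler_pM ?exprn_ge0//.
      by rewrite ler_pXn2r ?nnegrE.
    rewrite gfunE (le_trans (ler_normD _ _))// lerD//.
      have /andP[a b] := chi_01 chiP (yS z x).
      by rewrite normrX expr2 -[leRHS]mulr1 ler_pM// ger0_norm.
    have [_ _ _ [h _ _]] := hC0.2 (yS z x); by rewrite (le_trans h)// ler_piMr// ek_le1.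
  rewrite normrM normrX ger0_norm ?invr_ge0// ler_pdivrMl//.
  rewrite (@le_trans _ _ (m ^+ 2))//; first by rewrite ler_pXn2r ?nnegrE.
  by rewrite ler_peMl ?sqr_ge0// ler1n.
have Pe0 : 0 <= Pe := le_trans (normr_ge0 _) (hP 0).
have iI := ig_IS sz.
have [n hn] := It_tail iI ltr01.
(* Makes the product of P and Ubar in the flux at most 1 at the endpoints, whatever the energy. *)
pose ep := (1 + Pe)^-1.
have p1 : 0 < 1 + Pe by rewrite ltr_pwDl.
have ep0 : 0 < ep by rewrite invr_gt0.
have ep1 : ep <= 1 by rewrite invf_le1// lerDl.
have lu := (Ub_L2b chiP hC0 sz.1).1.
have [[b nb ub] _] := small_far (Num.max n 0) lu ep0.
have [_ [a na ua]] := small_far (- Num.max n 0) lu ep0.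
have hb : n <= b by apply: le_trans nb; rewrite le_max lexx.
have ha : a <= - n by rewrite (le_trans na)// lerN2 le_max lexx.
have ab : a <= b.
  rewrite (le_trans na)// (le_trans _ nb)// (@le_trans _ _ 0)// ?oppr_le0 le_max lexx ?orbT//.
have aPhi := ac_Phi sz.
have lI := ig_li iI.
have ePhi := aPhi.2 _ _ ab.
have lL : li (LS z).
  have := liB lI (ac_li aPhi); congr li; apply/funext => x; ring.
rewrite ioB// in ePhi.
have bPhi x : `|UbS chi z x| <= ep -> `|Phi z x| <= (m + 1) ^+ 3 + m ^+ 2 * (m + 1) + 3.
  move=> hu; have u1 := le_trans hu ep1; apply: rate_ar2 => //.
  - have -> : US chi z x = cc z * chi (yS z x) + UbS chi z x by rewrite /US /UbS; ring.
    rewrite (le_trans (ler_normD _ _))// lerD// normrM.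
    by have /andP[c d] := chi_01 chiP (yS z x); rewrite (ger0_norm c) (le_trans (ler_piMr _ d)).
  - rewrite (le_trans (ler_pM _ _ (hP x) hu))// /ep ler_pdivrMr// mul1r lerDr//.
have ay := ac_y sz; have ach := ac_chain (smooth_quadr (chi_smooth chiP)) ay.
have b0 x : 0 <= 1 + ww z x by have [] := gz x.
have [ie _] := en_en2 chiP hC0 sz.1 gz.
pose gL x := m * (2 * Pe + m ^+ 2) * ((1 + ww z x) * chi' (yS z x)) +
  2 * m * C0 * (UbS chi z x ^+ 2 * (1 + ww z x) + hh z x).
have lg : li gL by apply: liD; [exact: liZ (ac_li ach)|exact: liZ (ig_li ie)].
have leL x : `|LS z x| <= gL x.
  have d0 := dchi_ge0 chiP (yS z x); have [dC _ _ _] := hC0.2 (yS z x).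
  rewrite ger0_norm// in dC; have {}dC := le_trans dC (ler_piMr c00 (ek_le1 _)).
  have eU : US chi z x = UbS chi z x + cc z * chi (yS z x) by rewrite /US /UbS; ring.
  have db0 : 0 <= chi' (yS z x) * (1 + ww z x) by rewrite mulr_ge0.
  rewrite /LS /gL eU normrM normrM (ger0_norm db0).
  have h1 := rate_ar1 (UbS chi z x) cm (chi_01 chiP (yS z x)) (hP x).
  have h2 : `|cc z| * (chi' (yS z x) * (1 + ww z x)) <= m * (chi' (yS z x) * (1 + ww z x)).
    by rewrite ler_wpM2r.
  rewrite (le_trans (ler_pM _ _ h2 h1))//; first by rewrite mulr_ge0.
  have -> : m * (chi' (yS z x) * (1 + ww z x)) * (2 * Pe + m ^+ 2 + 2 * UbS chi z x ^+ 2) =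
    m * (2 * Pe + m ^+ 2) * ((1 + ww z x) * chi' (yS z x)) +
    2 * m * chi' (yS z x) * (UbS chi z x ^+ 2 * (1 + ww z x)) by ring.
  have [_ h _ _] := gz x; have ub0 : 0 <= UbS chi z x ^+ 2 * (1 + ww z x) by rewrite mulr_ge0 ?sqr_ge0.
  by rewrite lerD2l ler_pM ?lerDl// ?mulr_ge0// ler_wpM2l// mulr_ge0.
have ioL : `|io a b (LS z)| <= m * (2 * Pe + m ^+ 2) + 2 * m * C0 * E.
  rewrite (le_trans (io_normle lL lg (fun x _ => leL x)))// /gL.
  rewrite ioD; [|exact: liZ (ac_li ach)|exact: liZ (ig_li ie)].
  rewrite !ioZ; [|exact: ig_li ie|exact: ac_li ach].
  rewrite lerD// ?ler_wpM2l ?mulr_ge0//.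
    rewrite -[leRHS]mulr1 ler_wpM2l ?mulr_ge0 ?addr_ge0 ?mulr_ge0 ?sqr_ge0// -ach.2//.
    have /andP[c d] := chi_01 chiP (yS z a); have /andP[c' d'] := chi_01 chiP (yS z b); lra.
  apply: io_le_It => // x; have [_ h _ _] := gz x; by rewrite addr_ge0// mulr_ge0// sqr_ge0.
have hI := hn a b ha hb.
have eI : io a b (IS z) = Phi z b - Phi z a + io a b (LS z) by rewrite ePhi subrK.
have := bPhi _ ub; have := bPhi _ ua => h1 h2.
rewrite -[It (IS z)](subrK (io a b (IS z))) (le_trans (ler_normD _ _))// addrC /K lerD//.
rewrite eI -[leRHS]addrA; apply: le_trans (ler_normD _ _) (lerD _ ioL).
by apply: le_trans (ler_normB _ _) _; rewrite [leRHS]mulrDl mul1r lerD.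
Qed.

Section Curve.
Variables (Y : R -> st R) (t : R).
Hypothesis t0 : 0 <= t.
Hypothesis SY : forall s, 0 <= s -> SA (Y s).
Hypothesis dt : tdiff N Y t (F (Y t)).
Let SYt := SY t0.
Let SF := SA_FS chiP SYt.

Let cmp (W : lmodType R) (N2 : W -> R) (L : st R -> W) :
  (forall (a : R) (x y z : st R), L (x - y - a *: z) = L x - L y - a *: L z) ->
  (forall z, SA z -> N2 (L z) <= N z) -> tdiff N2 (fun s => L (Y s)) t (L (F (Y t))).
Proof.
move=> lin le; apply: (tdiff_lin sn_SA SY SYt SF ler01 lin _ dt) => z sz.
by rewrite mul1r; exact: le.
Qed.

Let le5 z : SA z -> [/\ L2bn (uh z) <= N z, L2bn (ww z) <= N z, L2bn (vh z) <= N z, L2bn (hh z) <= N z &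
   L2bn (rh z) <= N z].
Proof. by move=> [sz _]; exact: NS_each fb _ sz. Qed.

Lemma d_uh : tdiff (W := R -> R^o) L2bn (fun s => uh (Y s)) t (fun x => - Q (Y t) x).
Proof. by apply: (@cmp (R -> R^o) L2bn (@uh R)) => // z /le5[]. Qed.
Lemma d_ww : tdiff (W := R -> R^o) L2bn (fun s => ww (Y s)) t (vS chi (Y t)).
Proof. by apply: (@cmp (R -> R^o) L2bn (@ww R)) => // z /le5[]. Qed.
Lemma d_vh : tdiff (W := R -> R^o) L2bn (fun s => vh (Y s)) t (vh (F (Y t))).
Proof. by apply: (@cmp (R -> R^o) L2bn (@vh R)) => // z /le5[]. Qed.
Lemma d_hh : tdiff (W := R -> R^o) L2bn (fun s => hh (Y s)) t (hh (F (Y t))).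
Proof. by apply: (@cmp (R -> R^o) L2bn (@hh R)) => // z /le5[]. Qed.
Lemma d_rh : tdiff (W := R -> R^o) L2bn (fun s => rh (Y s)) t (fun=> 0).
Proof. by apply: (@cmp (R -> R^o) L2bn (@rh R)) => // z /le5[]. Qed.
Lemma d_ze : tdiff (W := R -> R^o) (@supn R) (fun s => ze (Y s)) t (US chi (Y t)).
Proof. by apply: (@cmp (R -> R^o) (@supn R) (@ze R)) => // z [sz _]; have [] := NS_parts fb sz. Qed.
Lemma d_cc : sd (fun s => cc (Y s)) t 0.
Proof. by apply: (@cmp R^o Num.norm (@cc R)) => // z [sz _]; have [] := NS_parts fb sz. Qed.
Lemma d_kk : sd (fun s => kk (Y s)) t 0.
Proof. by apply: (@cmp R^o Num.norm (@kk R)) => // z [sz _]; have [] := NS_parts fb sz. Qed.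

Lemma tdiff_scl (a : R -> R) (f : R -> R -> R) a' f' : (forall s, 0 <= s -> L2b (f s)) -> L2b f' ->
  sd a t a' -> tdiff (W := R -> R^o) L2bn f t f' ->
  tdiff (W := R -> R^o) L2bn (fun s x => a s * f s x) t (fun x => a' * f t x + a t * f' x).
Proof.
move=> Sf Sf' da df.
apply: (@tdiff_bil R R^o (R -> R^o) (R -> R^o) setT Num.norm L2b L2bn L2b L2bn
  (fun u v x => u * v x) sn_R snb snb) => //.
- by move=> x y _ Ly; have [h1 h2] := fn_Z fb x Ly; split=> //; rewrite h2.
- by move=> b x x0 d y y0 e _ _ _ _ _ _; apply/funext => z; rewrite !fctE /GRing.scale/=; ring.
Qed.

Let uL s : 0 <= s -> L2b (uh (Y s)). Proof. by move=> /SY[[_ []]]. Qed.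
Let wL s : 0 <= s -> L2b (ww (Y s)). Proof. by move=> /SY[[]]. Qed.
Let vL s : 0 <= s -> L2b (vh (Y s)). Proof. by move=> /SY[[]]. Qed.
Let hL s : 0 <= s -> L2b (hh (Y s)). Proof. by move=> /SY[[_ _ _ _ []]]. Qed.
Let rL s : 0 <= s -> L2b (rh (Y s)). Proof. by move=> /SY[[_ _ _ _ []]]. Qed.
Arguments uL : clear implicits.
Arguments wL : clear implicits.
Arguments vL : clear implicits.
Arguments hL : clear implicits.
Arguments rL : clear implicits.
Let L0 : L2b (fun=> 0 : R). Proof. exact: dm0 fb. Qed.
Let vFL : L2b (vh (F (Y t))). Proof. by case: SF => -[]. Qed.
Let hFL : L2b (hh (F (Y t))). Proof. by case: SF => -[_ _ _ _ []]. Qed.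
Let vSL s : 0 <= s -> L2b (vS chi (Y s)). Proof. by move=> /SY[sz _]; exact: (v_L2b chiP hC0 sz). Qed.
Let rbL s : 0 <= s -> L2b (rbS (Y s)). Proof. by move=> /SY[sz _]; exact: rb_L2b. Qed.
Let UbL_ s : 0 <= s -> L2b (UbS chi (Y s)). Proof. by move=> /SY[sz _]; exact: (Ub_L2b chiP hC0 sz). Qed.
Arguments vSL : clear implicits.
Arguments rbL : clear implicits.
Arguments UbL_ : clear implicits.
Let QL_ : L2b (fun x => - Q (Y t) x). Proof. by case: SF => -[_ []]. Qed.

Lemma d_vS : tdiff (W := R -> R^o) L2bn (fun s => vS chi (Y s)) t (vh (F (Y t))).
Proof.
have d1 : tdiff (W := R -> R^o) L2bn (fun s x => cc (Y s) * chi' x) t (fun x => 0 * chi' x + cc (Y t) * 0).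
  apply: (tdiff_scl (f := fun _ => chi')) => //.
  - by move=> s _; exact: (dchi_L2b chiP hC0). - exact: d_cc. - exact: (tdiff_cst _ t snb).
have h : L2b (fun x => 0 * chi' x + cc (Y t) * 0).
  by move: L0; congr L2b; apply/funext => x; rewrite mul0r mulr0 addr0.
have := tdiff_add snb vL (fun s hs => snZ snb (cc (Y s)) (dchi_L2b chiP hC0)) t0 vFL h d_vh d1.
by apply: tdiff_ext => //; apply/funext => x; rewrite !fctE mul0r mulr0 !addr0.
Qed.

Lemma d_rb : tdiff (W := R -> R^o) L2bn (fun s => rbS (Y s)) t (fun x => - kk (Y t) * vS chi (Y t) x).
Proof.
have d1 := tdiff_scl wL (vSL t t0) d_kk d_ww.
have h1 : L2b (fun x => 0 * ww (Y t) x + kk (Y t) * vS chi (Y t) x).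
  exact: (snD snb (snZ snb 0 (wL t t0)) (snZ snb (kk (Y t)) (vSL t t0))).
have d2 := tdiff_scale (-1) snb (fun s hs => snZ snb (kk (Y s)) (wL s hs)) t0 h1 d1.
have := tdiff_add snb rL (fun s hs => snZ snb (-1) (snZ snb (kk (Y s)) (wL s hs))) t0 L0 (snZ snb (-1) h1) d_rh d2.
apply: tdiff_ext => // [s s0|]; apply/funext => x; rewrite !fctE /GRing.scale/= /rbS; ring.
Qed.

Lemma d_chiB (G f g : R -> R) : ac G f -> ac f g ->
  (forall x, `|f x| <= C0 * ek x) -> (forall x, `|g x| <= C0 * ek x) ->
  tdiff (W := R -> R^o) L2bn (fun s x => G (yS (Y s) x) - G x) t (fun x => f (yS (Y t) x) * US chi (Y t) x).
Proof.
move=> aG af hf hg; apply: (tdiff_chain t0 c00 aG af hf hg _ _ d_ze).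
  by move=> s /SY[[]].
by have [] := U_bdd chiP SYt.1.
Qed.

Let hd1 x : `|chi' x| <= C0 * ek x. Proof. by have [] := hC0.2 x. Qed.
Let hd2 x : `|derive1 chi' x| <= C0 * ek x. Proof. by have [_ h _ _] := hC0.2 x; exact: h. Qed.
Let hd3 x : `|derive1 (derive1 chi') x| <= C0 * ek x. Proof. by have [_ _ h _] := hC0.2 x; exact: h. Qed.
Let ac1 := quadr_ac (smooth_quadr (smooth_derive (chi_smooth chiP))).
Let ac2 := quadr_ac (smooth_quadr (smooth_derive (smooth_derive (chi_smooth chiP)))).

Let dchiU : L2b (fun x => chi' (yS (Y t) x) * US chi (Y t) x).
Proof.
have [mU bU] := U_bdd chiP SYt.1.
have := bM bU mU (ek_fun_L2b hC0 SYt.1 (mf_cont (ac_cont ac1)) hd1).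
by congr L2b; apply/funext => x; rewrite mulrC.
Qed.

Lemma d_Ub : tdiff (W := R -> R^o) L2bn (fun s => UbS chi (Y s)) t (Ubt (Y t)).
Proof.
have dG := d_chiB (ac_chi chiP) ac1 hd1 hd2.
have Lc s : 0 <= s -> L2b (fun x => chi (yS (Y s) x) - chi x).
  move=> /SY[sz _]; have := snN snb (chiy_L2b chiP hC0 sz); congr L2b; apply/funext => x.
  by rewrite !fctE opprB.
have d1 := tdiff_scl Lc dchiU d_cc dG.
have h1 : L2b (fun x => 0 * (chi (yS (Y t) x) - chi x) + cc (Y t) * (chi' (yS (Y t) x) * US chi (Y t) x)).
  exact: (snD snb (snZ snb 0 (Lc _ t0)) (snZ snb (cc (Y t)) dchiU)).
have d2 := tdiff_scale (-1) snb (fun s hs => snZ snb (cc (Y s)) (Lc s hs)) t0 h1 d1.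
have := tdiff_add snb uL (fun s hs => snZ snb (-1) (snZ snb (cc (Y s)) (Lc s hs))) t0 QL_ (snZ snb (-1) h1) d_uh d2.
apply: tdiff_ext => // [s s0|]; apply/funext => x; rewrite !fctE /GRing.scale/= /UbS /Ubt; ring.
Qed.

Lemma d_en2 : sd (fun s => en2 chi (Y s)) t (It (IS (Y t))).
Proof.
have LUt := Ubt_L2b SYt; have Lu := UbL_ t t0; have Lw := wL t t0; have Lv := vSL t t0; have Lr := rbL t t0.
have Lh := hL t t0; have Lkv := snZ snb (- kk (Y t)) Lv.
have Luw s hs := (L2b_mul (UbL_ s hs) (wL s hs)).1.
have h1 : L2b (fun x => Ubt (Y t) x * ww (Y t) x + UbS chi (Y t) x * vS chi (Y t) x).
  exact: (snD snb (L2b_mul LUt Lw).1 (L2b_mul Lu Lv).1).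
have e1 := tdiff_It UbL_ UbL_ t0 LUt LUt d_Ub d_Ub.
have e2 := tdiff_It UbL_ Luw t0 LUt h1 d_Ub (tdiff_mul UbL_ wL t0 LUt Lv d_Ub d_ww).
have e3 := tdiff_It vSL vSL t0 vFL vFL d_vS d_vS.
have e4 := tdiff_It rbL rbL t0 Lkv Lkv d_rb d_rb.
have e5 := tdiff_It wL hL t0 Lv hFL d_ww d_hh.
have := sd_B t0 (sd_D t0 (sd_D t0 (sd_D t0 e1 e2) e3) e4) e5.
apply: tdiff_ext => //.
have Luwt := Luw _ t0.
have i1 := igD (ii LUt Lu) (ii Lu LUt); have i2 := igD (ii LUt Luwt) (ii Lu h1).
have i3 := igD (ii vFL Lv) (ii Lv vFL); have i4 := igD (ii Lkv Lr) (ii Lr Lkv).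
have i5 := igD (ii Lv Lh) (ii Lw hFL).
rewrite -(ItD (ii LUt Lu) (ii Lu LUt)) -(ItD (ii LUt Luwt) (ii Lu h1)).
rewrite -(ItD (ii vFL Lv) (ii Lv vFL)) -(ItD (ii Lkv Lr) (ii Lr Lkv)) -(ItD (ii Lv Lh) (ii Lw hFL)).
rewrite -(ItD i1 i2) -(ItD (igD i1 i2) i3) -(ItD (igD (igD i1 i2) i3) i4).
rewrite -(ItB (igD (igD (igD i1 i2) i3) i4) i5).
congr It; apply/funext => x.
have f1 : vh (F (Y t)) x = 2^-1 * hh (Y t) x + kk (Y t) * rbS (Y t) x + (A (Y t) x + A (Y t) x * ww (Y t) x) by [].
have f2 : hh (F (Y t)) x = 2 * (A (Y t) x * vS chi (Y t) x) by [].
by rewrite /IS f1 f2 !fctE /GRing.scale/=; field.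
Qed.

Lemma d_pt x : [/\ sd (fun s => ww (Y s) x) t (vS chi (Y t) x),
  sd (fun s => vS chi (Y s) x) t (vh (F (Y t)) x), sd (fun s => hh (Y s) x) t (hh (F (Y t)) x),
  sd (fun s => rbS (Y s) x) t (- kk (Y t) * vS chi (Y t) x) &
  sd (fun s => ze (Y s) x) t (US chi (Y t) x) /\ sd (fun s => uh (Y s) x) t (- Q (Y t) x)].
Proof.
have ev (f : R -> R -> R) f' : (forall s, 0 <= s -> L2b (f s)) -> L2b f' ->
    tdiff (W := R -> R^o) L2bn f t f' -> sd (fun s => f s x) t (f' x).
  move=> Sf Sf'; apply: (tdiff_lin (L := fun g : R -> R^o => g x : R^o) (C := 1) snb Sf (Sf _ t0) Sf') => //.
  by move=> g Lg; rewrite mul1r; have [_ _ _ h] := L2b_parts Lg; exact: h.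
split; [exact: ev wL (vSL t t0) d_ww|exact: ev vSL vFL d_vS|exact: ev hL hFL d_hh|
  exact: ev rbL (snZ snb _ (vSL t t0)) d_rb|split; last exact: ev uL QL_ d_uh].
by apply: (@cmp R^o Num.norm (fun z => ze z x)) => // z [sz _]; have [h _ _ _ _] := NS_parts fb sz;
  apply: le_trans h; have [[_ b] _ _ _ _] := sz; exact: (supn_ge x b).
Qed.

End Curve.
Lemma A_bdd M : 0 <= M -> exists2 C, 0 <= C & forall z, SS L2b z -> N z <= M -> forall x, `|A z x| <= C.
Proof.
move=> M0; pose rel (z1 z2 : st R) := [/\ SS L2b z1, SS L2b z2, N z1 <= M & N z2 <= M].
have relC z1 z2 : rel z1 z2 -> rel z2 z1 by case.
have relS z1 z2 : rel z1 z2 -> SS L2b z1 by case.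
have relM z1 z2 : rel z1 z2 ->
  [/\ supn (ze z1) <= M, supn (uh z1) <= M, `|cc z1| <= M & `|kk z1| <= M].
  case=> s1 _ n1 _; have [a b c d _] := NS_parts fb s1.
  by split; apply: le_trans n1.
have [C c h] := t1_AN (chi := chi) true fb M0 relC relS relM chiP hC0 (fun z1 z2 r => let: And4 _ _ a _ := r in a).
exists C => // z sz nz x; have [h1 _] := h z z (And4 sz sz nz nz) x.
by rewrite /H1_ mulr1 in h1.
Qed.

Lemma SS_L2 z : SS L2b z -> SS (@L2 R) z.
Proof. by move=> [[a1 a2] [[a3 a3'] a4] [a5 _] [a6 _] [[a7 _] [a8 _]]]. Qed.

(** After the constraint has removed h, every term of the energy density is quadratic in L^2
    quantities, the cubic one having a bounded factor Ubar. Hence the initial energy is controlled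
    without the sup norms of the derivatives. *)
Lemma en0_bound m : 0 <= m -> exists2 E0, 0 <= E0 & forall z, SS L2b z -> GE chi z ->
  NS (@L2norm R) z <= m -> en chi z <= E0.
Proof.
move=> m0; have f2 := @fnorm_L2 R.
pose rel (z1 z2 : st R) := z1 = z2 /\ SS (@L2 R) z1 /\ NS (@L2norm R) z1 <= m.
have relC z1 z2 : rel z1 z2 -> rel z2 z1 by case=> ->.
have relS z1 z2 : rel z1 z2 -> SS (@L2 R) z1 by case=> _ [].
have relM z1 z2 : rel z1 z2 ->
  [/\ supn (ze z1) <= m, supn (uh z1) <= m, `|cc z1| <= m & `|kk z1| <= m].
  case=> _ [s1 n1]; have [a b c d _] := NS_parts f2 s1.
  by split; apply: le_trans n1.
have [Cu u0 hu] := t0_Ub f2 m0 relC relS relM chiP hC0.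
have [Cu' u0' hu'] := t1_Ub f2 m0 relC relS relM chiP hC0.
have [Cv v0 hv] := t0_v f2 m0 relC relS relM hC0.
have [Cr r0 hr] := t0_rb f2 m0 relC relS relM.
have [Cw w0 hw] := t0_ww f2 relC relS.
have [Ch h0 hh_] := t0_hh f2 relC relS.
pose K := Cu * Cu + Cu' * (Cu * Cw) + Cv * Cv + Cr * Cr + Cw * Ch.
have K0 : 0 <= K by rewrite !addr_ge0// !mulr_ge0.
exists (K * (m + L2norm (@ek R)) ^+ 2) => [|z sz gz nz].
  by rewrite mulr_ge0// sqr_ge0.
have s2 := SS_L2 sz; have r : rel z z by [].
have [dg ng] := dm_GG f2 s2.
have [m2 i2] := (L2P _).1 dg.
have [ie _] := en_en2 chiP hC0 sz gz.
have G0 x := GG_ge0 z x.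
have le x : `|UbS chi z x ^+ 2 * (1 + ww z x) + hh z x| <= K * GG z x ^+ 2.
  have [_ _ _ g] := gz x.
  have -> : UbS chi z x ^+ 2 * (1 + ww z x) + hh z x =
    UbS chi z x * UbS chi z x + UbS chi z x * (UbS chi z x * ww z x) + vS chi z x * vS chi z x +
     rbS z x * rbS z x - ww z x * hh z x.
    have -> : hh z x = (1 + ww z x) * hh z x - ww z x * hh z x by ring.
    by rewrite [X in _ + (X - _) = _]g; ring.
  have [a1 _] := hu _ _ r x; have [a2 _] := hu' _ _ r x; have [a3 _] := hv _ _ r x.
  have [a4 _] := hr _ _ r x; have [a5 _] := hw _ _ r x; have [a6 _] := hh_ _ _ r x.
  rewrite /H1_ mulr1 in a2.
  have pr (a b c d : R) : `|a| <= c * GG z x -> `|b| <= d * GG z x -> `|a * b| <= c * d * GG z x ^+ 2.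
    by move=> h1 h2; rewrite normrM (le_trans (ler_pM _ _ h1 h2))// expr2 mulrACA.
  have -> : K * GG z x ^+ 2 = Cu * Cu * GG z x ^+ 2 + Cu' * (Cu * Cw * GG z x ^+ 2) +
    Cv * Cv * GG z x ^+ 2 + Cr * Cr * GG z x ^+ 2 + Cw * Ch * GG z x ^+ 2 by rewrite /K; ring.
  apply: le_trans (ler_normB _ _) (lerD _ (pr _ _ _ _ a5 a6)).
  apply: le_trans (ler_normD _ _) (lerD _ (pr _ _ _ _ a4 a4)).
  apply: le_trans (ler_normD _ _) (lerD _ (pr _ _ _ _ a3 a3)).
  apply: le_trans (ler_normD _ _) (lerD (pr _ _ _ _ a1 a1) _).
  by rewrite normrM; apply: ler_pM => //; exact: pr.
rewrite (le_trans (ler_norm _))// (le_trans (It_normle ie (igZ K i2) le))// ItZ//.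
rewrite ler_wpM2l// -L2normE// ler_pXn2r ?nnegrE ?L2norm_ge0 ?addr_ge0 ?L2norm_ge0//.
by rewrite (le_trans ng)// lerD2r.
Qed.

Section Invariance.
Variables (Y : R -> st R) (T Mx : R).
Hypothesis T0 : 0 <= T.
Hypothesis SY : forall s, 0 <= s -> SA (Y s).
Hypothesis dY : forall t, 0 <= t <= T -> tdiff N Y t (F (Y t)).
Hypothesis NM : forall t, 0 <= t <= T -> N (Y t) <= Mx.
Hypothesis G0 : GE chi (Y 0).

Let Mx0 : 0 <= Mx.
Proof.
have h : 0 <= (0 : R) <= T by rewrite lexx.
apply: le_trans (NM h).
by apply: (sn_ge0 (@sn_SA R)); apply: SY.
Qed.

(** As [D] stays 0, the arithmetic-geometric mean inequality gives |v| at most y_x + h. The rate of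
    y_x + h is v + 2 A v, so this sum obeys a linear inequality and cannot reach 0. A nonnegative
    product with positive sum then has nonnegative factors. *)
Lemma GE_inv t : 0 <= t <= T -> GE chi (Y t).
Proof.
move=> tT x; have [CA CA0 hA] := A_bdd Mx0.
have pt s (sT : 0 <= s <= T) := d_pt (proj1 (andP sT)) SY (dY sT) x.
pose D s := (1 + ww (Y s) x) * hh (Y s) x - (vS chi (Y s) x * vS chi (Y s) x + rbS (Y s) x * rbS (Y s) x).
pose sg s := 1 + ww (Y s) x + hh (Y s) x.
have DE s : 0 <= s <= T -> D s = 0.
  move=> sT; have -> : 0 = D 0.
    by have [_ _ _ e] := G0 x; rewrite /D e -!expr2 subrr.
  apply: (sd_const T0 _ sT) => r rT; have r0 := proj1 (andP rT).
  have [d1 d2 d3 d4 _] := pt _ rT.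
  have := sd_B r0 (sd_M r0 (sd_D r0 (sd_cst 1 r) d1) d3) (sd_D r0 (sd_M r0 d2 d2) (sd_M r0 d4 d4)).
  apply: tdiff_ext => //.
  have f1 : vh (F (Y r)) x = 2^-1 * hh (Y r) x + kk (Y r) * rbS (Y r) x + (A (Y r) x + A (Y r) x * ww (Y r) x) by [].
  have f2 : hh (F (Y r)) x = 2 * (A (Y r) x * vS chi (Y r) x) by [].
  by rewrite f1 f2; field.
have sgp s : 0 <= s <= T -> 0 < sg s.
  apply: (@sd_positive _ sg (fun s => 0 + vS chi (Y s) x + 2 * (A (Y s) x * vS chi (Y s) x)) T (1 + 2 * CA)) => //.
  - by rewrite addr_ge0// mulr_ge0.
  - move=> r rT; have r0 := proj1 (andP rT); have [d1 _ d3 _ _] := pt _ rT.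
    exact: (sd_D r0 (sd_D r0 (sd_cst 1 r) d1) d3).
  - move=> r rT; have r0 := proj1 (andP rT).
    have vs : `|vS chi (Y r) x| <= `|sg r|.
      rewrite -(@ler_pXn2r _ 2) ?nnegrE// !real_normK ?num_real//.
      have := DE _ rT; rewrite /D /sg; have := sqr_ge0 (1 + ww (Y r) x - hh (Y r) x).
      have := sqr_ge0 (rbS (Y r) x); have := sqr_ge0 (1 + ww (Y r) x + hh (Y r) x).
      move: (vS _ _ _) (rbS _ _) (1 + ww (Y r) x) (hh (Y r) x) => v rr b h; nra.
    have h1 := hA _ (SY r0).1 (NM rT) x.
    rewrite add0r -[X in X + _]mul1r mulrA -mulrDl normrM; apply: ler_pM => //.
    by rewrite (le_trans (ler_normD _ _))// normr1 lerD2l normrM normr_nat ler_wpM2l.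
  - by have [_ _ h _] := G0 x.
have s1 := sgp _ tT; have := DE _ tT; rewrite /D => /eqP; rewrite subr_eq0 => /eqP e.
have p0 : 0 <= (1 + ww (Y t) x) * hh (Y t) x by rewrite e addr_ge0// -expr2 sqr_ge0.
rewrite -!expr2 in e; move: p0 s1 e; rewrite /sg.
move: (1 + ww (Y t) x) (hh (Y t) x) => b h p0 s1 e.
have [hp|hn] := ltP 0 h.
  by split=> //; [move: p0; rewrite pmulr_lge0|exact: ltW].
have bp : 0 < b by move: s1 hn; lra.
by split=> //; [exact: ltW|move: p0; rewrite pmulr_rge0].
Qed.

End Invariance.

(** [Mx] is a qualitative bound, used only to know that the constraints persist. [B] is chosen
    before it and depends on T and on the L^2-type norm of the data, which is what both continuation
    and the final Lipschitz constant require. *)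
Lemma apriori T m : 0 <= T -> 0 <= m -> exists2 B, 0 <= B & forall Y Mx S, 0 <= S <= T ->
  (forall s, 0 <= s -> SA (Y s)) -> (forall t, 0 <= t <= S -> tdiff N Y t (F (Y t))) ->
  (forall t, 0 <= t <= S -> N (Y t) <= Mx) -> GE chi (Y 0) -> NS (@L2norm R) (Y 0) <= m ->
  forall t, 0 <= t <= S -> [/\ GE chi (Y t), supn (ze (Y t)) <= B, supn (uh (Y t)) <= B,
    `|cc (Y t)| <= B /\ `|kk (Y t)| <= B & forall x, `|A (Y t) x| <= B].
Proof.
move=> T0 m0; have [E0 E00 hE0] := en0_bound m0; have [K K0 hK] := energy_rate m.
(* Energy by Gronwall, from it P and Q, from Q the bound of [uh], from this [ze], and finally A:
   each constant feeds the next. *)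
pose Et := (E0 + K * T) * expR (K * T).
have Et0 : 0 <= Et by rewrite mulr_ge0 ?expR_ge0// addr_ge0// mulr_ge0.
pose P1 := C1 m * (1 + Et); pose Q1 := P1 + m * (m * C0).
have C1m : 0 <= C1 m by rewrite /C1 !addr_ge0// mulr_ge0// sqr_ge0.
have P10 : 0 <= P1 by rewrite mulr_ge0// addr_ge0.
have Q10 : 0 <= Q1 by rewrite addr_ge0// !mulr_ge0.
pose U1 := m + Q1 * T; have U10 : 0 <= U1 by rewrite addr_ge0// mulr_ge0.
pose Z1 := m + (U1 + m) * T; have Z10 : 0 <= Z1 by rewrite addr_ge0// mulr_ge0// addr_ge0.
pose A1 := (U1 + m) * (U1 + 2 * m) + m * (m * C0) + P1.
have A10 : 0 <= A1 by exact: (addr_ge0 (addr_ge0 (mulr_ge0 (addr_ge0 U10 m0) (addr_ge0 U10 (mulr_ge0 (ler0n _ 2) m0))) (mulr_ge0 m0 (mulr_ge0 m0 c00))) P10).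
exists (Z1 + U1 + m + A1); first exact: (addr_ge0 (addr_ge0 (addr_ge0 Z10 U10) m0) A10).
move=> Y Mx Tf /andP[Tf0 TfT] SY dY NM G0 n0 t tT.
have z0T : 0 <= (0 : R) <= Tf by rewrite lexx Tf0.
have gY s sT := @GE_inv Y Tf Mx Tf0 SY dY NM G0 s sT.
have [za zb zc zd _] := NS_parts (@fnorm_L2 R) (SS_L2 (SY _ (lexx 0)).1).
have ccst s : 0 <= s <= Tf -> cc (Y s) = cc (Y 0).
  by apply: (sd_const (f := fun s => cc (Y s))) => // r rT; apply: (d_cc (proj1 (andP rT)) SY (dY _ rT)).
have kcst s : 0 <= s <= Tf -> kk (Y s) = kk (Y 0).
  by apply: (sd_const (f := fun s => kk (Y s))) => // r rT; apply: (d_kk (proj1 (andP rT)) SY (dY _ rT)).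
have cm s : 0 <= s <= Tf -> `|cc (Y s)| <= m by move=> sT; rewrite ccst// (le_trans zc).
have km s : 0 <= s <= Tf -> `|kk (Y s)| <= m by move=> sT; rewrite kcst// (le_trans zd).
have S s sT := SY s (proj1 (andP (sT : 0 <= s <= Tf))).
have eE s : 0 <= s <= Tf -> en2 chi (Y s) = en chi (Y s).
  by move=> sT; rewrite (en_en2 chiP hC0 (S _ sT).1 (gY _ sT)).2.
have PQ s sT := PQ_bound chiP hC0 (S s sT) (gY s sT) (cm s sT) (km s sT).
have eb s : 0 <= s <= Tf -> en chi (Y s) <= Et.
  move=> sT; have := sd_gronwall (f := fun r => en2 chi (Y r)) (f' := fun r => It (IS (Y r))) Tf0 K0 K0 _ _ sT.
  have [E0s _] := PQ _ sT; have [E00' _] := PQ _ z0T.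
  rewrite !eE// !ger0_norm// => h; apply: (le_trans (h _ _)).
  - move=> r rT; exact: (d_en2 (proj1 (andP rT)) SY (dY _ rT)).
  - move=> r rT; have [Er _] := PQ _ rT; rewrite eE// (ger0_norm Er).
    exact: hK (S _ rT) (gY _ rT) (cm _ rT) (km _ rT).
  - have /andP[s0 sT'] := sT; apply: ler_pM; rewrite ?expR_ge0 ?addr_ge0 ?mulr_ge0//.
      by apply: lerD; [apply: hE0 => //; exact: (S _ z0T).1|rewrite ler_wpM2l// (le_trans sT')].
    by rewrite ler_expR ler_wpM2l// (le_trans sT').
have Pb s (sT : 0 <= s <= Tf) x : `|PbS chi true (Y s) x| <= P1 /\ `|QbS chi true (Y s) x| <= P1.
  have [_ h] := PQ s sT; have [h1 h2] := h x.
  have e : C1 m * (1 + en chi (Y s)) <= P1 by rewrite ler_wpM2l// lerD2l eb.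
  by split; apply: le_trans e.
have dec s (sT : 0 <= s <= Tf) f x : (forall w, `|f w| <= C0 * ek w) ->
    `|cc (Y s) * (cc (Y s) * f (yS (Y s) x))| <= m * (m * C0).
  move=> hf; rewrite !normrM; apply: ler_pM => //; first exact: cm.
  apply: ler_pM => //; first exact: cm.
  by rewrite (le_trans (hf _))// ler_piMr// ek_le1.
have Qb s (sT : 0 <= s <= Tf) x : `|- Q (Y s) x| <= Q1.
  rewrite normrN (le_trans (ler_normD _ _))// lerD//; first by have [] := Pb s sT x.
  by apply: dec => // w; have [_ _ _ [_ _ h]] := hC0.2 w.
have Ub s : 0 <= s <= Tf -> forall x, `|uh (Y s) x| <= U1.
  move=> sT x; have := sd_bound (f := fun r => uh (Y r) x) (f' := fun r => - Q (Y r) x) Tf0 Q10 _ _ sT.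
  move=> h; apply: le_trans (h _ _) _.
  - by move=> r rT; have [_ _ _ _ []] := d_pt (proj1 (andP rT)) SY (dY _ rT) x.
  - by move=> r rT; exact: Qb.
  - have [_ [_ b] _ _ _] := (S _ z0T).1.
    by apply: lerD; [rewrite (le_trans (supn_ge x b))// (le_trans zb)|rewrite ler_wpM2l].
have chi1 w : `|chi w| <= 1 by have /andP[a b] := chi_01 chiP w; rewrite ger0_norm.
have Ubs s (sT : 0 <= s <= Tf) x : `|US chi (Y s) x| <= U1 + m.
  rewrite (le_trans (ler_normD _ _))// lerD//; first exact: Ub.
  by rewrite normrM (le_trans (ler_piMr _ (chi1 _)))// cm.
have Zb s : 0 <= s <= Tf -> forall x, `|ze (Y s) x| <= Z1.
  move=> sT x; have := sd_bound (f := fun r => ze (Y r) x) (f' := fun r => US chi (Y r) x) Tf0 (addr_ge0 U10 m0) _ _ sT.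
  move=> h; apply: le_trans (h _ _) _.
  - by move=> r rT; have [_ _ _ _ []] := d_pt (proj1 (andP rT)) SY (dY _ rT) x.
  - by move=> r rT; exact: Ubs.
  - have [[_ b] _ _ _ _] := (S _ z0T).1.
    by apply: lerD; [rewrite (le_trans (supn_ge x b))// (le_trans za)|rewrite ler_wpM2l// addr_ge0].
have Ab x : `|A (Y t) x| <= A1.
  rewrite /AS (le_trans (ler_normB _ _))// lerD//; last by have [] := Pb t tT x.
  rewrite (le_trans (ler_normB _ _))// lerD//; last first.
    by apply: dec => // w; have [_ _ _ [h _ _]] := hC0.2 w.
  rewrite normrM; apply: ler_pM => //.
    rewrite (le_trans (ler_normD _ _))// lerD//; first exact: Ub.
    rewrite normrM (le_trans (ler_piMr _ _))//; last exact: cm.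
    have /andP[a b] := chi_01 chiP x; have /andP[a' b'] := chi_01 chiP (yS (Y t) x).
    by rewrite ler_norml; apply/andP; split; lra.
  rewrite (le_trans (ler_normD _ _))// mulrDl mul1r addrA lerD//; first exact: Ubs.
  by rewrite normrM (le_trans (ler_piMr _ (chi1 _)))// cm.
have sm := sum4_le0 Z10 U10 m0 A10; have [l1 l2 l3 l4] := sm.
split; first exact: gY.
- by apply: supn_le => x; exact: le_trans (Zb _ tT x) l1.
- by apply: supn_le => x; exact: le_trans (Ub _ tT x) l2.
- by split; [exact: le_trans (cm _ tT) l3|exact: le_trans (km _ tT) l3].
- by move=> x; exact: le_trans (Ab x) l4.
Qed.

(** Used with the bounded L^2 norm to continue solutions, and with the L^2 norm to bound them by the
    E-norm of the data. *)
Lemma apriori_norm T m dm n K (fn : fnorm dm n K) : 0 <= T -> 0 <= m ->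
  (forall f, L2b f -> dm f /\ n f <= L2bn f) ->
  exists2 B, 0 <= B & forall Y Mx S, 0 <= S <= T ->
  (forall s, 0 <= s -> SA (Y s)) -> (forall t, 0 <= t <= S -> tdiff N Y t (F (Y t))) ->
  (forall t, 0 <= t <= S -> N (Y t) <= Mx) -> GE chi (Y 0) -> NS (@L2norm R) (Y 0) <= m ->
  forall t, 0 <= t <= S -> NS n (Y t) <= (NS n (Y 0) + B) * B.
Proof.
move=> T0 m0 sub; have [B B0 hB] := apriori T0 m0.
have [C C0' hC] := rate_growth (chi := chi) true fn chiP B0.
exists (C * T + expR (C * T)) => [|Y Mx Tf TfT SY dY NM G0 n0 t tT].
  by rewrite addr_ge0 ?expR_ge0// mulr_ge0.
have SSn z : SA z -> SS dm z.
  by move=> [[a [b c] d e [f g]] _]; split => //; [split => //|..|split]; apply: (sub _ _).1.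
have snn := sn_st fn.
have le z : SA z -> NS n z <= N z.
  move=> [[a [b c] d e [f g]] _].
  have [_ h1] := sub _ b; have [_ h2] := sub _ d; have [_ h3] := sub _ e; have [_ h4] := sub _ f.
  by have [_ h5] := sub _ g; rewrite /NS !lerD.
have dY' s : 0 <= s <= Tf -> tdiff (NS n) Y s (F (Y s)).
  move=> /[dup] sT /andP[s0 _].
  apply: (tdiff_lin (L := id) (C := 1) sn_SA SY (SY _ s0) (SA_FS chiP (SY _ s0))) => //; last exact: dY.
  by move=> z sz; rewrite mul1r; exact: le.
have gr := tdiff_gronwall (N := NS n) snn (proj1 (andP TfT)) C0' C0' (u := Y) (du := fun s => F (Y s)).
have := gr (fun s hs => SSn _ (SY s hs)) (fun s hs => SSn _ (SA_FS chiP (SY s hs))) dY' _ t tT.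
move=> h; apply: (le_trans (h _)).
  move=> s sT; have [_ a b [c d] e] := hB Y Mx Tf TfT SY dY NM G0 n0 s sT.
  have s0 := proj1 (andP sT).
  by have := hC _ (SSn _ (SY s s0)) a b c d e; rewrite mulrDr mulr1 addrC.
have N0 : 0 <= NS n (Y 0) := sn_ge0 snn (SSn _ (SY 0 (lexx 0))).
have /andP[t0 t1'] := tT; have t1 := le_trans t1' (proj2 (andP TfT)); apply: (ler_pM (addr_ge0 N0 (mulr_ge0 C0' t0)) (expR_ge0 _)).
  by rewrite lerD2l (@le_trans _ _ (C * T)) ?ler_wpM2l// lerDl expR_ge0.
by rewrite (@le_trans _ _ (expR (C * T))) ?ler_expR ?ler_wpM2l// lerDr mulr_ge0.
Qed.

End Dynamics.

(** * Global solutions *)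

Section Global.
Context {R : realType}.
Variables (chi : R -> R) (chiP : cutoff chi).
Implicit Types (z : st R).
Local Notation F := (FS chi true).
Local Notation L2b := (@L2b R).
Local Notation L2bn := (@L2bn R).
Local Notation N := (NS L2bn).
Let fb := @fnorm_L2b R.

(** [GE] is asked at time 0 only; [gsol_GE] propagates it. *)
Definition gsol (Y : R -> st R) := [/\ forall s, 0 <= s -> SA (Y s),
  forall t, 0 <= t -> qd Y t (F (Y t)) & GE chi (Y 0)].

Lemma qd_tdiff (Y : R -> st R) t v : qd Y t v -> tdiff N Y t v.
Proof.
move=> [C C0 h] e e0; have C1 : 0 < C + 1 by rewrite ltr_wpDl.
exists (Num.min 1 (e / (C + 1))) => [|s s0]; first by rewrite lt_min ltr01 divr_gt0.
rewrite lt_min => /andP[l1 l2]; rewrite (le_trans (h s s0 (ltW l1)))//.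
rewrite -real_normK ?num_real// expr2 mulrA ler_wpM2r//.
rewrite ltr_pdivlMr// in l2; rewrite (le_trans _ (ltW l2))// mulrC ler_wpM2l// lerDl//.
Qed.

Lemma gsol_tdiff Y t : gsol Y -> 0 <= t -> tdiff N Y t (F (Y t)).
Proof. by move=> [_ h _] t0; exact: qd_tdiff (h _ t0). Qed.

(** The sup norms see every point, so distance zero is equality of tuples and not just almost
    everywhere. This is what allows gluing solutions. *)
Lemma st_eq z z' : SS L2b z -> SS L2b z' -> N (z - z') <= 0 -> z = z'.
Proof.
move=> sz sz' n0; have sd := snB (sn_st fb) sz sz'.
have [a b c d _] := NS_parts fb sd; have [e1 e2 e3 e4 e5] := NS_each fb sd.
have [[_ ba] [lb bb] lw lv [lh lr]] := sd.
rewrite zeB in a ba; rewrite uhB in e1 lb; rewrite wwB in e2 lw; rewrite vhB in e3 lv.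
rewrite hhB in e4 lh; rewrite rhB in e5 lr; rewrite ccB in c; rewrite kkB in d.
have z0 (f : R -> R) : (forall x, `|f x| <= 0) -> f = fun=> 0.
  by move=> h; apply/funext => x; apply/eqP; rewrite -normr_le0.
have zs (f g : R -> R) : (fun x => f x - g x) = (fun=> 0) -> f = g.
  by move=> h; apply/funext => x; apply/eqP; rewrite -subr_eq0; apply/eqP; exact: (congr1 (@^~ x) h).
have sp (f : R -> R) : L2b f -> L2bn f <= N (z - z') -> f = fun=> 0.
  move=> lf h; apply: z0 => x; have [_ _ _ q] := L2b_parts lf.
  exact: le_trans (q x) (le_trans h n0).
have Ez : ze z = ze z'.
  by apply: zs; apply: z0 => x; exact: le_trans (supn_ge x ba) (le_trans a n0).
have Eu := zs _ _ (sp _ lb e1); have Ew := zs _ _ (sp _ lw e2); have Ev := zs _ _ (sp _ lv e3).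
have Eh := zs _ _ (sp _ lh e4); have Er := zs _ _ (sp _ lr e5).
have Ec : cc z = cc z' by apply/eqP; rewrite -subr_eq0 -normr_le0; exact: le_trans c n0.
have Ek : kk z = kk z' by apply/eqP; rewrite -subr_eq0 -normr_le0; exact: le_trans d n0.
move: Ez Eu Ew Ev Eh Er Ec Ek; clear.
by case: z => -[] [] [] [] [] [] a b c d e f g h; case: z' => -[] [] [] [] [] [] a' b' c' d' e' f' g' h';
  rewrite /ze /uh /ww /vh /hh /rh /cc /kk/= => -> -> -> -> -> -> -> ->.
Qed.

Lemma tdiff_sub (Y Z : R -> st R) t v w : 0 <= t -> (forall s, 0 <= s -> SA (Y s)) ->
  (forall s, 0 <= s -> SA (Z s)) -> SA v -> SA w ->
  tdiff N Y t v -> tdiff N Z t w -> tdiff N (fun s => Y s - Z s) t (v - w).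
Proof.
move=> t0 SY SZ Sv Sw dY dZ; have sn := @sn_SA R.
have h := tdiff_scale (-1) sn SZ t0 Sw dZ.
have := tdiff_add sn SY (fun r hr => snZ sn (-1) (SZ r hr)) t0 Sv (snZ sn (-1) Sw) dY h.
by apply: tdiff_ext => // [s _|]; rewrite scaleN1r.
Qed.

Section Lipschitz.
Variables (dm : set (R -> R)) (n : (R -> R) -> R) (K : R) (fn : fnorm dm n K).
Hypothesis sub : forall f, L2b f -> dm f /\ n f <= L2bn f.

Lemma sub_SS z : SA z -> SS dm z.
Proof.
by move=> [[a [b c] d e [f g]] _]; split => //; [split => //|..|split]; apply: (sub _).1.
Qed.

Lemma sub_NS z : SA z -> NS n z <= N z.
Proof.
move=> [[a [b c] d e [f g]] _].
have [_ h1] := sub b; have [_ h2] := sub d; have [_ h3] := sub e; have [_ h4] := sub f.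
by have [_ h5] := sub g; rewrite /NS !lerD.
Qed.

Lemma sub_tdiff Y t v : 0 <= t -> (forall s, 0 <= s -> SA (Y s)) -> SA v ->
  tdiff N Y t v -> tdiff (NS n) Y t v.
Proof.
move=> t0 SY Sv; apply: (tdiff_lin (L := id) (C := 1) (@sn_SA R) SY (SY _ t0) Sv) => //.
by move=> z sz; rewrite mul1r; exact: sub_NS.
Qed.

Lemma lip_on M T : 0 <= M -> 0 <= T -> exists2 C, 0 <= C & forall Y Z T', 0 <= T' <= T ->
  (forall s, 0 <= s -> SA (Y s)) -> (forall s, 0 <= s -> SA (Z s)) ->
  (forall t, 0 <= t <= T' -> tdiff N Y t (F (Y t))) ->
  (forall t, 0 <= t <= T' -> tdiff N Z t (F (Z t))) ->
  (forall t, 0 <= t <= T' -> NS n (Y t) <= M) -> (forall t, 0 <= t <= T' -> NS n (Z t) <= M) ->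
  forall t, 0 <= t <= T' -> NS n (Y t - Z t) <= C * NS n (Y 0 - Z 0).
Proof.
move=> M0 T0; have [L L0 hL] := rate_lip (chi := chi) true fn chiP M0.
exists (expR (L * T)) => [|Y Z T' /andP[T'0 T'T] SY SZ dY dZ nY nZ t tT]; first exact: expR_ge0.
have snn := sn_st fn.
have SF z := @SA_FS _ _ chiP z.
have := tdiff_gronwall (N := NS n) snn T'0 L0 (lexx 0) (u := fun s => Y s - Z s)
  (du := fun s => F (Y s) - F (Z s)) _ _ _ _ tT.
move=> h; apply: (le_trans (h _ _ _ _)).
- by move=> s s0; apply: (snB snn); apply: sub_SS; [exact: SY|exact: SZ].
- by move=> s s0; apply: (snB snn); apply: sub_SS; apply: SF; [exact: SY|exact: SZ].
- move=> s /[dup] sT /andP[s0 _]; apply: sub_tdiff => //.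
  + by move=> r r0; apply: (snB (@sn_SA R)); [exact: SY|exact: SZ].
  + by apply: (snB (@sn_SA R)); apply: SF; [exact: SY|exact: SZ].
  + by apply: tdiff_sub => //; [apply: SF; exact: SY|apply: SF; exact: SZ|exact: dY|exact: dZ].
- move=> s /[dup] sT /andP[s0 _]; rewrite addr0.
  exact: (hL _ _ (sub_SS (SY _ s0)) (sub_SS (SZ _ s0)) (nY _ sT) (nZ _ sT)).2.
- have N0 : 0 <= NS n (Y 0 - Z 0).
    by apply: (sn_ge0 snn); apply: (snB snn); apply: sub_SS; [exact: SY|exact: SZ].
  rewrite mul0r addr0 mulrC ler_wpM2r// ler_expR ler_wpM2l//.
  by case/andP: tT => _ /le_trans; apply.
Qed.
End Lipschitz.

Let subb f : L2b f -> L2b f /\ L2bn f <= L2bn f. Proof. by []. Qed.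
Lemma sub2 f : L2b f -> L2 f /\ L2norm f <= L2bn f.
Proof. by move=> /L2b_parts[]. Qed.

(** The truncation radius exceeds the a priori bound [D]. While the solution stays in the ball it
    solves the untruncated equation and so is bounded by [D]; the bootstrap then keeps the
    truncation inactive up to T. *)
Lemma local_sol z0 T : SA z0 -> GE chi z0 -> 0 <= T -> exists Y, [/\ Y 0 = z0,
  forall s, 0 <= s -> SA (Y s), forall t, 0 <= t <= T -> qd Y t (F (Y t)) &
  exists M, forall t, 0 <= t <= T -> N (Y t) <= M].
Proof.
move=> S0 G0 T0; have [C0 hC0] := chi_constP chiP.
pose m := NS (@L2norm R) z0.
have m0 : 0 <= m := sn_ge0 (sn_st (@fnorm_L2 R)) (SS_L2 S0.1).
have [B B0 hB] := apriori_norm chiP hC0 fb T0 m0 subb.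
pose D := (N z0 + B) * B; pose M := Num.max (N z0) D + 1.
have N0 : 0 <= N z0 := sn_ge0 (@sn_SA R) S0.
have mx0 : 0 <= Num.max (N z0) D by rewrite le_max N0.
have M0 : 0 < M by rewrite ltr_wpDl.
have [Y [Y0 SY dY]] := truncated_solution chiP M0 S0.
have eqF t : 0 <= t -> N (Y t) <= M -> qd Y t (F (Y t)).
  by move=> t0 h; have := dY t t0; rewrite /retr h.
have key : forall t, 0 <= t <= T -> N (Y t) <= D.
  apply: (bootstrap (M := M)) => //.
  - by rewrite /M (@le_lt_trans _ _ (Num.max (N z0) D)) ?ltrDl// le_max lexx orbT.
  - by rewrite Y0 /M (@le_trans _ _ (Num.max (N z0) D)) ?lerDl// le_max lexx.
  - move=> t /andP[t0 tT] e e0.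
    have SF : SA (F (retr N M (Y t))) by apply: (SA_FS chiP); apply: (retr_S (@sn_SA R)); exact: SY.
    have [d d0 hd] := tdiff_lip (@sn_SA R) (SY _ t0) SF SY (qd_tdiff (dY _ t0)) ltr01.
    have q0 : 0 < N (F (retr N M (Y t))) + 1 by rewrite ltr_wpDl// (sn_ge0 (@sn_SA R)).
    exists (Num.min d (e / (N (F (retr N M (Y t))) + 1))) => [|s /andP[s0 _]].
      by rewrite lt_min d0 divr_gt0.
    rewrite lt_min => /andP[l1 l2]; rewrite (le_trans (hd _ s0 l1))//.
    by rewrite -ler_pdivlMr// ltW.
  - move=> t /andP[t0 tT] hM.
    have tt : 0 <= t <= t by rewrite t0 lexx.
    have := hB Y M t _ SY _ hM _ _ t tt; rewrite Y0; apply => //; first by rewrite t0.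
    by move=> s sT; apply: qd_tdiff; apply: eqF; [case/andP: sT|exact: hM].
have DM : D <= M by rewrite /M (@le_trans _ _ (Num.max (N z0) D)) ?lerDl// le_max lexx orbT.
exists Y; split => //; last by exists D.
by move=> t /[dup] tT /andP[t0 _]; apply: eqF => //; exact: le_trans (key _ tT) DM.
Qed.

Lemma uniq_on Y Z T : 0 <= T -> (forall s, 0 <= s -> SA (Y s)) -> (forall s, 0 <= s -> SA (Z s)) ->
  (forall t, 0 <= t <= T -> qd Y t (F (Y t))) -> (forall t, 0 <= t <= T -> qd Z t (F (Z t))) ->
  (exists M, forall t, 0 <= t <= T -> N (Y t) <= M) -> (exists M, forall t, 0 <= t <= T -> N (Z t) <= M) ->
  Y 0 = Z 0 -> forall t, 0 <= t <= T -> Y t = Z t.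
Proof.
move=> T0 SY SZ dY dZ [M1 h1] [M2 h2] e0 t tT; pose M := Num.max (Num.max M1 M2) 0.
have M0 : 0 <= M by rewrite /M le_max lexx orbT.
have [C C0' h] := lip_on fb subb M0 T0.
have t0 := proj1 (andP tT).
apply: st_eq; [exact: (SY _ t0).1|exact: (SZ _ t0).1|].
have := h Y Z T; rewrite e0 subrr (sn_zero (@sn_SA R)) mulr0; apply => //.
- by rewrite T0 lexx. - by move=> s sT; apply: qd_tdiff; exact: dY.
- by move=> s sT; apply: qd_tdiff; exact: dZ.
- by move=> s sT; rewrite (le_trans (h1 _ sT))// /M !le_max lexx.
- by move=> s sT; rewrite (le_trans (h2 _ sT))// /M !le_max lexx orbT.
Qed.

Lemma gsol_exists z0 : SA z0 -> GE chi z0 -> exists2 Y, gsol Y & Y 0 = z0.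
Proof.
move=> S0 G0.
have /boolp.choice[Ys hY] : forall k : nat, exists Y, [/\ Y 0 = z0,
    forall s, 0 <= s -> SA (Y s), forall t, 0 <= t <= k%:R -> qd Y t (F (Y t)) &
    exists M, forall t, 0 <= t <= k%:R -> N (Y t) <= M].
  by move=> k; exact: local_sol.
have agree (k l : nat) t : 0 <= t <= k%:R -> 0 <= t <= l%:R -> Ys k t = Ys l t.
  wlog kl : k l / (k <= l)%N.
    move=> H hk hl; have [|/ltnW] := leqP k l; first by move=> ?; exact: H.
    by move=> ?; apply/esym; exact: H.
  move=> tk _; have [a1 b1 c1 [M1 d1]] := hY k; have [a2 b2 c2 [M2 d2]] := hY l.
  have kl' s : 0 <= s <= k%:R -> 0 <= s <= l%:R.
    by move=> /andP[-> /le_trans]; apply; rewrite ler_nat.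
  apply: (@uniq_on (Ys k) (Ys l) k%:R) => //.
  - by move=> s /kl'; exact: c2. - by exists M1. - by exists M2 => s /kl'; exact: d2.
  - by rewrite a1 a2.
(* The value at t is read off a solution with an integer horizon beyond t; by uniqueness all these
   solutions agree. *)
pose Y t := Ys (Num.bound t) t.
have YE (k : nat) t : 0 <= t <= k%:R -> Y t = Ys k t.
  move=> /andP[t0 tk]; apply: agree; last by rewrite t0.
  by rewrite t0/= ltW// archi_boundP.
have Y0 : Y 0 = z0 by rewrite (YE 0%N) ?lexx//; case: (hY 0%N).
exists Y => //; split; last by rewrite Y0.
- move=> s s0; rewrite (YE (Num.bound s)); last by rewrite s0 ltW// archi_boundP.
  by have [_ h _ _] := hY (Num.bound s); exact: h.
(* [qd] looks at times up to distance 1 from t, hence the horizon t + 1. *)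
- move=> t t0; pose k := Num.bound (t + 1).
  have kt : t + 1 <= k%:R by rewrite ltW// archi_boundP// addr_ge0.
  have tk : 0 <= t <= k%:R by rewrite t0 (le_trans _ kt)// lerDl.
  have [_ _ h _] := hY k; have [C C0' hC] := h t tk; exists C => // s s0 st.
  have sk : 0 <= s <= k%:R.
    rewrite s0 (le_trans _ kt)//; move: st; rewrite ler_norml => /andP[_]; rewrite lerBlDr addrC//.
  by rewrite (YE _ _ sk) (YE _ _ tk); exact: hC.
Qed.

(** Boundedness on [0, t] is borrowed from the local solution with the same initial state.
    Uniqueness itself presupposes a bound, which the bootstrap supplies with one unit of slack. *)
Lemma gsol_bdd X t : gsol X -> 0 <= t -> exists M, forall s, 0 <= s <= t -> N (X s) <= M.
Proof.
move=> [SX dX GX] t0; have [Z0 [z0 SZ0 dZ0 [M hM]]] := local_sol (SX _ (lexx 0)) GX t0.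
have cont s : 0 <= s <= t -> forall e, 0 < e -> exists2 d, 0 < d & forall r, 0 <= r <= t -> `|r - s| < d -> `|N (X r) - N (X s)| <= e.
  move=> /andP[s0 _] e' e'0.
  have SF : SA (F (X s)) by apply: (SA_FS chiP); exact: SX.
  have [d d0 hd] := tdiff_lip (@sn_SA R) (SX _ s0) SF SX (qd_tdiff (dX _ s0)) ltr01.
  have q0 : 0 < N (F (X s)) + 1 by rewrite ltr_wpDl// (sn_ge0 (@sn_SA R)).
  exists (Num.min d (e' / (N (F (X s)) + 1))) => [|r /andP[r0 _]].
    by rewrite lt_min d0 divr_gt0.
  rewrite lt_min => /andP[l1 l2]; rewrite (le_trans (hd _ r0 l1))//.
  by rewrite -ler_pdivlMr// ltW.
have M00 : N (X 0) <= M by rewrite -z0; apply: hM; rewrite lexx t0.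
exists M => s sT; apply: (bootstrap (T := t) (M := M + 1) (B := M) (phi := fun s => N (X s))) => //.
- by rewrite ltrDl. - by rewrite (le_trans M00)// lerDl.
- move=> r /andP[r0 rt] hr; suff -> : X r = Z0 r by apply: hM; rewrite r0.
  apply: (@uniq_on X Z0 r) => //.
  + by move=> q /andP[q0 _]; exact: dX. + by move=> q /andP[q0 qr]; apply: dZ0; rewrite q0 (le_trans qr).
  + by exists (M + 1). + by exists M => q /andP[q0 qr]; apply: hM; rewrite q0 (le_trans qr).
  + by rewrite r0 lexx.
Qed.

Lemma gsol_GE Y t : gsol Y -> 0 <= t -> GE chi (Y t).
Proof.
move=> gY t0; have [SY dY GY] := gY; have [M hM] := gsol_bdd gY t0.
have [C0 hC0] := chi_constP chiP.
apply: (GE_inv chiP hC0 t0 SY _ hM GY); last by rewrite t0 lexx.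
by move=> s /andP[s0 _]; exact: gsol_tdiff.
Qed.

(** The a priori bound in the L^2 norm places both solutions in one ball, where the rate is
    Lipschitz in that same norm; the constant therefore depends on [m] and [T] alone. *)
Lemma gsol_lip m T : 0 <= m -> 0 <= T -> exists2 C, 0 <= C & forall Y Z, gsol Y -> gsol Z ->
  NS (@L2norm R) (Y 0) <= m -> NS (@L2norm R) (Z 0) <= m -> forall t, 0 <= t <= T ->
  NS (@L2norm R) (Y t) <= C /\ NS (@L2norm R) (Y t - Z t) <= C * NS (@L2norm R) (Y 0 - Z 0).
Proof.
move=> m0 T0; have f2 := @fnorm_L2 R; have [C0 hC0] := chi_constP chiP.
have [B B0 hB] := apriori_norm chiP hC0 f2 T0 m0 sub2.
pose M := (m + B) * B; have M0 : 0 <= M by rewrite mulr_ge0// addr_ge0.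
have [C C0' hC] := lip_on f2 sub2 M0 T0.
exists (M + C) => [|Y Z gY gZ nY nZ t tT]; first exact: addr_ge0.
have TT : 0 <= T <= T by rewrite T0 lexx.
have bnd X : gsol X -> NS (@L2norm R) (X 0) <= m -> forall t, 0 <= t <= T -> NS (@L2norm R) (X t) <= M.
  move=> gX nX s sT; have [SX dX GX] := gX; have [Mx hM] := gsol_bdd gX T0.
  have := hB X Mx T TT SX _ hM GX nX s sT => h; apply: (le_trans (h _)).
    by move=> r /andP[r0 _]; exact: gsol_tdiff.
  by rewrite ler_wpM2r// lerD2r.
split; first by rewrite (le_trans (bnd _ gY nY _ tT))// lerDl.
have [SY _ _] := gY; have [SZ _ _] := gZ.
have N0 : 0 <= NS (@L2norm R) (Y 0 - Z 0).
  by apply: (sn_ge0 (sn_st f2)); apply: (snB (sn_st f2)); apply: (sub_SS sub2); [exact: SY|exact: SZ].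
have := hC Y Z T TT SY SZ _ _ (bnd _ gY nY) (bnd _ gZ nZ) t tT => h.
apply: (le_trans (h _ _)); last by rewrite ler_wpM2r// lerDr.
- by move=> r /andP[r0 _]; exact: gsol_tdiff.
- by move=> r /andP[r0 _]; exact: gsol_tdiff.
Qed.

Lemma gsol_shift Y r : gsol Y -> 0 <= r -> gsol (fun s => Y (r + s)).
Proof.
move=> gY r0; have [SY dY GY] := gY; split; last by rewrite addr0; exact: gsol_GE.
- by move=> s s0; apply: SY; exact: addr_ge0.
- move=> t t0; have [C C0' hC] := dY _ (addr_ge0 r0 t0); exists C => // s s0 st.
  have e : r + s - (r + t) = s - t by rewrite opprD addrACA subrr add0r.
  by have := hC _ (addr_ge0 r0 s0); rewrite e; apply.
Qed.

End Global.

Lemma En_arith (R : realFieldType) (a b c d e f g p q s : R) : 0 <= s -> p <= s -> q <= s -> s <= p + q ->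
  b <= p + q -> 0 <= p -> 0 <= q -> 0 <= a -> 0 <= b -> 0 <= c -> 0 <= d -> 0 <= e -> 0 <= f -> 0 <= g ->
  a + c + (s + f) + d + (e + g) <= (a + b + p + c + q + d + e + f + g) /\ (a + b + p + c + q + d + e + f + g) <= 4 * (a + c + (s + f) + d + (e + g)).
Proof. by move=> *; split; lra. Qed.

(** * Lagrangian coordinates *)

Section Spaces.
Context {R : realType}.
Local Notation mu := (@lebesgue_measure R).
Implicit Types (f g : R -> R).

Let mu0 : (0 < mu [set: R])%E.
Proof.
have := @lebesgue_measure_itv R `[0, 1]%R; rewrite /= lte_fin ltr01 => e.
apply: (@lt_le_trans _ _ (mu `[(0:R), 1]%classic)).
  by rewrite e sube0 lte_fin ltr01.
by apply: le_measure; rewrite ?inE.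
Qed.

Let LooE f : Lpnorm +oo f = fine (ess_sup mu (abse \o (EFin \o f))).
Proof. by rewrite /Lpnorm unlock /Lnorm mu0. Qed.

Lemma LooP f : Loo f <-> mf f /\ exists M, {ae mu, forall x, `|f x| <= M}.
Proof.
split=> [Lf|[m [M hM]]].
  have m : mf f by have := sub_Lfun_mfun Lf; rewrite inE.
  split=> //; have : finite_norm mu +oo f by have := sub_Lfun_finLfun Lf; rewrite inE.
  rewrite /finite_norm unlock /Lnorm mu0 => fin.
  have e0 : (0 <= ess_sup mu (abse \o (EFin \o f)))%E by apply: ess_sup_gee => //; apply: aeW => x; exact: abse_ge0.
  exists (fine (ess_sup mu (abse \o (EFin \o f)))).
  have := ess_sup_ge mu (abse \o (EFin \o f)); apply: aeS => x /=.
  by rewrite -[X in (_ <= X)%E]fineK ?lee_fin// ge0_fin_numE.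
rewrite /Loo /inLp /in_mem/=; apply/andP; split; first by rewrite inE.
rewrite inE/= /finite_norm unlock /Lnorm mu0.
apply: (@le_lt_trans _ _ M%:E); last exact: ltry.
by apply/ess_supP; apply: aeS hM => x /=; rewrite lee_fin.
Qed.

Lemma Loonorm_ge f : Loo f -> {ae mu, forall x, `|f x| <= Loonorm f}.
Proof.
move=> Lf; have : finite_norm mu +oo f by have := sub_Lfun_finLfun Lf; rewrite inE.
rewrite /Loonorm LooE /finite_norm unlock /Lnorm mu0 => fin.
have e0 : (0 <= ess_sup mu (abse \o (EFin \o f)))%E by apply: ess_sup_gee => //; apply: aeW => x; exact: abse_ge0.
have := ess_sup_ge mu (abse \o (EFin \o f)); apply: aeS => x /=.
by rewrite -[X in (_ <= X)%E]fineK ?lee_fin// ge0_fin_numE.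
Qed.

Lemma Loonorm_le f M : {ae mu, forall x, `|f x| <= M} -> Loonorm f <= M.
Proof.
move=> h; rewrite /Loonorm LooE.
have e0 : (0 <= ess_sup mu (abse \o (EFin \o f)))%E by apply: ess_sup_gee => //; apply: aeW => x; exact: abse_ge0.
have e1 : (ess_sup mu (abse \o (EFin \o f)) <= M%:E)%E.
  by apply/ess_supP; apply: aeS h => x /=; rewrite lee_fin.
by rewrite -lee_fin fineK// ge0_fin_numE// (le_lt_trans e1)// ltry.
Qed.

Lemma cont_ae_le f M : continuous f -> {ae mu, forall x, `|f x| <= M} -> forall x, `|f x| <= M.
Proof.
move=> cf [A [mA A0 sub]] x; rewrite leNgt; apply/negP => fx.
have e0 : 0 < `|f x| - M by rewrite subr_gt0.
have [d d0 hd] := cont_eps x cf e0.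
have s : `]x - d, x + d[%classic `<=` A.
  move=> y /=; rewrite in_itv/= => /andP[y1 y2]; apply: sub => /= hy.
  have : `|y - x| < d by rewrite ltr_norml ltrBrDr ltrBlDr addrC y1 addrC.
  move=> /hd; rewrite ltNge => /negP; apply.
  have := ler_distD (f y) (f x) 0; rewrite !subr0 (distrC (f x)) => h; lra.
have : mu `]x - d, x + d[%classic = 0%E by apply: (subset_measure0 _ mA s A0); exact: measurable_itv.
have lt : x - d < x + d by rewrite ltrD2l gt0_cp.
rewrite lebesgue_measure_itv/= lte_fin lt -EFinD => -[h].
by move: lt; rewrite -subr_gt0 h ltxx.
Qed.

Lemma Loonorm_cont f : continuous f -> bdd f -> Loo f /\ Loonorm f = supn f.
Proof.
move=> cf [M hM]; have b : bdd f by exists M.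
have Lf : Loo f by apply/LooP; split; [exact: mf_cont|exists M; exact: aeW].
split=> //; apply/eqP; rewrite eq_le; apply/andP; split.
  by apply: Loonorm_le; apply: aeW => x; exact: supn_ge.
by apply: supn_le; exact: cont_ae_le (Loonorm_ge Lf).
Qed.

Lemma Loo_cont_bdd f : continuous f -> Loo f -> bdd f.
Proof. by move=> cf Lf; exists (Loonorm f); exact: cont_ae_le (Loonorm_ge Lf). Qed.

(** Integrate (f^2)' from [x] to a far point where [f] is small: f(x)^2 is at most twice the product
    of the two L^2 norms. *)
Lemma H1_sup f g x : ac f g -> L2 f -> L2 g -> `|f x| <= L2norm f + L2norm g.
Proof.
move=> a Lf Lg; have [i h] := L2_CS Lf Lg.
have n0 := L2norm_ge0 f; have n1 := L2norm_ge0 g.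
rewrite -(@ler_pXn2r _ 2) ?nnegrE ?addr_ge0//.
apply/ler_addgt0Pl => e e0.
pose e1 := Num.min 1 e; have e10 : 0 < e1 by rewrite lt_min ltr01.
have [[b xb fb] _] := small_far x Lf e10.
have ac2 := ac_mul a a.
have := ac2.2 _ _ xb => E.
have l := ac_li ac2.
have i2 := igZ 2 (ig_abs i).
have : `|io x b (fun x => g x * f x + f x * g x)| <= 2 * (L2norm f * L2norm g).
  apply: (@le_trans _ _ (io x b (fun x => 2 * `|f x * g x|))).
    apply: io_normle => //; first exact: ig_li.
    by move=> y _; rewrite (mulrC (g y)) -mulr2n normrMn mulr_natl.
  apply: le_trans (io_le_It x b i2 _) _ => [y|]; first by rewrite mulr_ge0.
  rewrite ItZ; [by rewrite ler_wpM2l|exact: ig_abs].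
rewrite -E distrC => h2; have h3 := le_trans (ler_norm _) h2.
have fb2 : f b * f b <= e.
  rewrite -expr2 -real_normK ?num_real// (le_trans (_ : _ <= e1 ^+ 2))//.
    by rewrite ler_pXn2r ?nnegrE// ltW.
  have l1 : e1 <= 1 by rewrite /e1 ge_min lexx.
  have l2 : e1 <= e by rewrite /e1 ge_min lexx orbT.
  by rewrite expr2; apply: le_trans l2; rewrite ger_pMl.
rewrite real_normK ?num_real// expr2.
have := mulr_ge0 n0 n0; have := mulr_ge0 n1 n1.
move: h3 fb2; rewrite sqrrD; move: (f x * f x) (f b * f b) (L2norm f) (L2norm g) => A B p q.
clear; move=> *; rewrite !expr2 -mulr_natl; lra.
Qed.

Lemma L2_cst k : L2 (fun=> k : R) -> k = 0.
Proof.
move=> L; apply/eqP; apply: contraT => k0; have e0 : 0 < `|k| / 2 by rewrite divr_gt0// normr_gt0.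
have [[b _ h] _] := small_far 0 L e0.
by move: h; rewrite ler_pdivlMr// ger_pMr ?normr_gt0// leNgt ltr1n.
Qed.

(** * Correspondence between elements of E and states *)

Section Chi.
Variables (chi : R -> R) (chiP : cutoff chi).

Lemma weak_wD f g : continuous f -> weak_deriv f g -> ac f (wD f) /\ ae_eq mu setT (wD f) g.
Proof. by move=> cf w; exact: (wD_ac chiP (weak_ac chiP cf w)). Qed.

Lemma wD_L2 f g : continuous f -> weak_deriv f g -> L2 g -> ac f (wD f) /\ L2 (wD f).
Proof.
move=> cf w Lg; have [a e] := weak_wD cf w; split=> //.
apply: (L2_ae Lg (li_mf (ac_li a)) _).1; exact: ae_eq_sym.
Qed.

Lemma ac_wD_norm f g : ac f g -> L2 g -> L2 (wD f) /\ L2norm (wD f) = L2norm g.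
Proof.
move=> a Lg; have [a' e] := wD_ac chiP a.
by have [l <-] := L2_ae Lg (li_mf (ac_li a')) (ae_eq_sym e).
Qed.

Lemma H1P f g : ac f g -> L2 f -> L2 g -> H1 f /\ H1norm f = Num.sqrt (L2norm f ^+ 2 + L2norm g ^+ 2).
Proof.
move=> a Lf Lg; split.
  by split=> //; [exact: ac_cont a|exists g => //; exact: ac_weak].
by rewrite /H1norm (ac_wD_norm a Lg).2.
Qed.

Lemma H1_ac f : H1 f -> [/\ ac f (wD f), L2 f & L2 (wD f)].
Proof. by move=> [cf Lf [g w Lg]]; have [a l] := wD_L2 cf w Lg. Qed.

Lemma L2_chi c : L2 (fun x => c * chi x) -> c = 0.
Proof.
move=> L; apply/eqP; apply: contraT => k0; have e0 : 0 < `|c| / 2 by rewrite divr_gt0// normr_gt0.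
have [[b b1 h] _] := small_far 1 L e0.
by move: h; rewrite (chi_ge1 chiP b1) mulr1 ler_pdivlMr// ger_pMr ?normr_gt0// leNgt ltr1n.
Qed.

(** Two admissible constants differ by some c with c chi in L^2, and chi is 1 on a half-line. *)
Lemma cst_H0ooE v c : H1 (fun x => v x - c * chi x) -> cst_H0oo chi v = c.
Proof.
move=> h; rewrite /cst_H0oo; set c' := xget _ _.
have h' : H1 (fun x => v x - c' * chi x).
  have : [set c | H1 (fun x => v x - c * chi x)] c' by apply: (xgetPex 0); exists c.
  by [].
have [_ l1 _] := H1_ac h; have [_ l2 _] := H1_ac h'.
have := snB (sn_fn (@fnorm_L2 R)) l1 l2 => l.
apply/eqP; rewrite -subr_eq0; apply/eqP/L2_chi; move: l; congr L2; apply/funext => x.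
by rewrite !fctE; ring.
Qed.

Lemma cst_L2constE (rho : R -> R) k : L2 (fun x => rho x - k) -> cst_L2const rho = k.
Proof.
move=> h; rewrite /cst_L2const; set k' := xget _ _.
have h' : L2 (fun x => rho x - k').
  have : [set k | L2 (fun x => rho x - k)] k' by apply: (xgetPex 0); exists k.
  by [].
have := snB (sn_fn (@fnorm_L2 R)) h h' => l.
apply/eqP; rewrite -subr_eq0; apply/eqP/L2_cst; move: l; congr L2; apply/funext => x.
by rewrite !fctE; ring.
Qed.

(** [X] and [z] describe the same element of E. The last two components agree only almost
    everywhere, which leaves room to choose a state satisfying the constraints at every point. *)
Definition lifts (X : lag R) (z : st R) := [/\ SS (@L2 R) z, ac (ze z) (ww z) /\ ac (uh z) (vh z),
  zetaL X = ze z, UL X = (fun x => uh z x + cc z * chi x) &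
  (mf (hL X) /\ ae_eq mu setT (hL X) (hh z)) /\
  (mf (rL X) /\ ae_eq mu setT (rL X) (fun x => rh z x + kk z))].

Definition En z : R := supn (ze z) + L2norm (ww z) + (Num.sqrt (L2norm (uh z) ^+ 2 + L2norm (vh z) ^+ 2) + `|cc z|) +
  L2norm (hh z) + (L2norm (rh z) + `|kk z|).

Lemma lifts_E X z : lifts X z -> [/\ Espace chi X, cL chi X = cc z, kL X = kk z & Enorm chi X = En z].
Proof.
move=> [[[m b] [lu bu] lw lv [lh lr]] [a1 a2] eZ eU [[mh eh] [mr er]]].
have cZ := ac_cont a1.
have [LZ nZ] := Loonorm_cont cZ b.
have Ub : (fun x => UL X x - cc z * chi x) = uh z by apply/funext => x; rewrite eU addrK.
have [hU nU] := H1P a2 lu lv.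
have hU' : H1 (fun x => UL X x - cc z * chi x) by rewrite Ub.
have ec := cst_H0ooE hU'.
have Lr' : L2 (fun x => rL X x - kk z) /\ L2norm (rh z) = L2norm (fun x => rL X x - kk z).
  apply: L2_ae => //; first by apply: mfB => //; exact: mf_cst.
  by apply: aeS er => x /(_ I) e _; rewrite e// addrK.
have ek := cst_L2constE Lr'.1.
have [Lh nh] := L2_ae lh mh (ae_eq_sym eh).
split=> //.
- split=> //; last by exists (kk z); exact: Lr'.1.
    by rewrite eZ; split=> //; exists (ww z) => //; exact: ac_weak.
  by exists (cc z).
- rewrite /Enorm /Vnorm /H0oonorm /L2constnorm ec ek Ub nU eZ nZ -nh -Lr'.2 /En.
  by rewrite (ac_wD_norm a1 lw).2.
Qed.

(** The only entry of [NS] without counterpart in the E-norm is the sup of [uh], controlled by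
    [H1_sup]. The H^1 norm is Euclidean in the two L^2 norms, so their sum is at most twice it, and
    a second factor 2 pays for the sup. *)
Lemma En_NS z : SS (@L2 R) z -> ac (uh z) (vh z) -> En z <= NS (@L2norm R) z /\ NS (@L2norm R) z <= 4 * En z.
Proof.
move=> [[m b] [lu bu] lw lv [lh lr]] a; rewrite /En /NS.
have su : supn (uh z) <= L2norm (uh z) + L2norm (vh z) by apply: supn_le => x; exact: H1_sup.
have := supn_ge0 b; have := supn_ge0 bu; have := L2norm_ge0 (ww z); have := L2norm_ge0 (hh z).
have := L2norm_ge0 (rh z); have := normr_ge0 (cc z); have := normr_ge0 (kk z).
have p0 := L2norm_ge0 (uh z); have q0 := L2norm_ge0 (vh z).
move: p0 q0 su; set p := L2norm (uh z); set q := L2norm (vh z) => p0 q0 su.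
pose s := Num.sqrt (p ^+ 2 + q ^+ 2).
have s0 : 0 <= s by exact: sqrtr_ge0.
have s2 : s ^+ 2 = p ^+ 2 + q ^+ 2 by rewrite sqr_sqrtr// addr_ge0// sqr_ge0.
have ps : p <= s by rewrite -(@ler_pXn2r _ 2) ?nnegrE// s2 lerDl sqr_ge0.
have qs : q <= s by rewrite -(@ler_pXn2r _ 2) ?nnegrE// s2 lerDr sqr_ge0.
have spq : s <= p + q.
  rewrite -(@ler_pXn2r _ 2) ?nnegrE ?addr_ge0// s2 sqrrD -subr_ge0.
  by rewrite (_ : _ - _ = p * q *+ 2) ?mulrn_wge0 ?mulr_ge0//; ring.
move: s0 ps qs spq su p0 q0; rewrite -/s; move=> s0 ps qs spq su p0 q0 *; exact: En_arith.
Qed.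

Lemma ae_eqB f g f' g' : ae_eq mu setT f f' -> ae_eq mu setT g g' ->
  ae_eq mu setT (fun x => f x - g x) (fun x => f' x - g' x).
Proof. by apply: aeS2 => x h1 h2 _; rewrite h1// h2. Qed.

Lemma lifts_B X Y z w : lifts X z -> lifts Y w -> lifts (X - Y) (z - w).
Proof.
move=> [sz [a1 a2] eZ eU [[mh eh] [mr er]]] [sz' [a1' a2'] eZ' eU' [[mh' eh'] [mr' er']]].
split.
- exact: (snB (sn_st (@fnorm_L2 R))).
- by rewrite !stB; split; exact: acB.
- by rewrite zeB -eZ -eZ'.
- rewrite uhB ccB; have -> : UL (X - Y) = (fun x => UL X x - UL Y x) by [].
  by rewrite eU eU'; apply/funext => x; ring.
- split; split; rewrite ?hhB ?rhB ?kkB; [exact: (mfB mh mh')|exact: (ae_eqB eh eh')|exact: (mfB mr mr')|].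
  apply: (aeS2 _ er er') => x h1 h2 _.
  have -> : rL (X - Y) x = rL X x - rL Y x by [].
  by rewrite h1// h2//; ring.
Qed.

Lemma lifts_Z X z (a : R) : lifts X z -> lifts (a *: X) (a *: z).
Proof.
move=> [sz [a1 a2] eZ eU [[mh eh] [mr er]]].
split.
- exact: (snZ (sn_st (@fnorm_L2 R))).
- by rewrite !stZ; split; exact: acZ.
- by rewrite zeZ -eZ.
- rewrite uhZ ccZ; have -> : UL (a *: X) = (fun x => a * UL X x) by [].
  by rewrite eU; apply/funext => x; ring.
- split; split; rewrite ?hhZ ?rhZ ?kkZ.
  + by apply: mfM mh; exact: mf_cst.
  + by apply: aeS eh => x h _; have -> : hL (a *: X) x = a * hL X x by []; rewrite h.
  + by apply: mfM mr; exact: mf_cst.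
  + apply: aeS er => x h _; have -> : rL (a *: X) x = a * rL X x by [].
    by rewrite h//; ring.
Qed.

Lemma lifts_exists X : Espace chi X -> exists z, lifts X z.
Proof.
move=> [[cZ LZ [gz wz Lgz]] [c hc] Lh [k Lk]].
have [a1 l1] := wD_L2 cZ wz Lgz; have [a2 l2 l3] := H1_ac hc.
exists (mkst (zetaL X) (fun x => UL X x - c * chi x) (wD (zetaL X))
  (wD (fun x => UL X x - c * chi x)) (hL X) (fun x => rL X x - k) c k).
split.
- split; [split; [exact: mf_cont|exact: Loo_cont_bdd]|split; first exact: l2|exact: l1|exact: l3|by split].
  exists (L2norm (fun x => UL X x - c * chi x) + L2norm (wD (fun x => UL X x - c * chi x))) => x.
  exact: H1_sup.
- by split; [exact: a1|exact: a2].
- by [].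
- by apply/funext => x; rewrite /uh /cc /= subrK.
- split; split; [exact: L2_mf|exact: aeW| |by apply: aeW => x _; rewrite /rh /kk /= subrK].
  have := mfD (L2_mf Lk) (mf_cst k); congr mf; apply/funext => x; exact: subrK.
Qed.

Lemma lifts_eqlag X Y z : lifts X z -> lifts Y z -> eqlag X Y.
Proof.
move=> [_ _ e1 e2 [[_ e3] [_ e4]]] [_ _ e1' e2' [[_ e3'] [_ e4']]].
split; rewrite ?e1 ?e1' ?e2 ?e2'//.
  exact: ae_eq_trans e3 (ae_eq_sym e3').
exact: ae_eq_trans e4 (ae_eq_sym e4').
Qed.

Lemma eqlag_lifts X Y z : lifts X z -> eqlag Y X -> mf (hL Y) -> mf (rL Y) -> lifts Y z.
Proof.
move=> [sz a e1 e2 [[_ e3] [_ e4]]] [f1 f2 f3 f4] mh mr; split=> //; rewrite ?f1 ?f2//.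
by split; split=> //; [exact: ae_eq_trans f3 e3|exact: ae_eq_trans f4 e4].
Qed.

Lemma Espace_mf X : Espace chi X -> mf (hL X) /\ mf (rL X).
Proof.
move=> [_ _ Lh [k Lk]]; split; first exact: L2_mf.
have := mfD (L2_mf Lk) (mf_cst k); congr mf; apply/funext => x; exact: subrK.
Qed.

Lemma lifts_wD X z : lifts X z -> [/\ ae_eq mu setT (wD (yL X)) (fun x => 1 + ww z x),
  ae_eq mu setT (wD (UL X)) (vS chi z), ae_eq mu setT (rbarL X) (rbS z) & yL X = yS z].
Proof.
move=> lX; have [_ _ ekk _] := lifts_E lX.
move: lX => [sz [a1 a2] e1 e2 [[mh e3] [mr e4]]].
have ey : yL X = yS z by apply/funext => x; rewrite /yL e1.
have [_ d1] := wD_ac chiP (acD (@ac_id R) a1); have [_ d2] := wD_ac chiP (acD a2 (acZ (cc z) (ac_chi chiP))).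
have d1' : ae_eq mu setT (wD (yL X)) (fun x => 1 + ww z x) by rewrite ey.
split=> //; first by rewrite e2.
apply: (aeS2 _ d1' e4) => x h1 h2 _; rewrite /rbarL ekk h1// h2// /rbS; ring.
Qed.

Lemma GE_Gset X z : lifts X z -> SA z -> GE chi z -> Gset chi X.
Proof.
move=> lX [[[mz bz] [[lu bu] _] [lw bw] [lv bv] [[lh bh] [lr br]]] _] gz.
have [EX _ _ _] := lifts_E lX; have [d1 d2 d3 ey] := lifts_wD lX.
move: lX => [sz [a1 a2] e1 e2 [[mh e3] [mr e4]]].
have bchi : bdd chi by exists 1 => x; have /andP[a b] := chi_01 chiP x; rewrite ger0_norm.
have aU := acD a2 (acZ (cc z) (ac_chi chiP)).
have [C0 [C00 hC0]] := chi_constP chiP.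
have bd : bdd (derive1 chi).
  by exists C0 => x; have [h _ _ _] := hC0 x; rewrite (le_trans h)// ler_piMr// ek_le1.
have Loob f : mf f -> bdd f -> Loo f by move=> m [M hM]; apply/LooP; split=> //; exists M; exact: aeW.
split=> //.
- split.
    split; first by rewrite e1; exact: Loob.
    by exists (ww z); [rewrite e1; exact: ac_weak|apply: Loob => //; exact: L2_mf].
  split; first by rewrite e2; apply: Loob (mf_cont (ac_cont aU)) (bddD bu (bddZ _ bchi)).
  exists (vS chi z); first by rewrite e2; exact: ac_weak.
  exact: Loob (li_mf (ac_li aU)) (bddD bv (bddZ _ bd)).
- split; apply/LooP; split=> //.
    by have [M hM] := bh; exists M; apply: aeS e3 => x h; rewrite h.
  have [M hM] := br; exists (M + `|kk z|); apply: aeS e4 => x h; rewrite h//.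
  by rewrite (le_trans (ler_normD _ _))// lerD2r.
- apply: (aeS2 _ (aeS2 (Q := fun x => wD (yL X) x = 1 + ww z x /\ wD (UL X) x = vS chi z x) _ d1 d2)
    (aeS2 (Q := fun x => hL X x = hh z x /\ rbarL X x = rbS z x) _ e3 d3)).
  + move=> x [h1 h2] [h3 h4]; rewrite h1 h2 h3 h4; have [? ? ? ?] := gz x; by split.
  + by move=> x h1 h2; rewrite h1// h2.
  + by move=> x h1 h2; rewrite h1// h2.
Qed.

(** All conditions hold off a measurable null set. On it the entries are reset so that y_x = 1 and
    U_x = h = rbar = 0, which satisfies the constraints there; since the resetting changes
    derivatives only on a null set, the state stays consistent, and all its entries are bounded
    everywhere. *)
Lemma Gset_lift X : Gset chi X -> exists z, [/\ lifts X z, SA z & GE chi z].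
Proof.
move=> [EX [[_ [gz wz Lgz]] [_ [gu wu Lgu]]] [Lh Lr] gX].
have [z lX] := lifts_exists EX; have [d1 d2 d3 ey] := lifts_wD lX.
move: (lX) => [[[mz bz] [lu bu] lw lv [lh lr]] [a1 a2] e1 e2 [[mh e3] [mr e4]]].
have [_ [M1 h1]] := (LooP _).1 Lgz; have [_ [M2 h2]] := (LooP _).1 Lgu.
have [_ [M3 h3]] := (LooP _).1 Lh; have [_ [M4 h4]] := (LooP _).1 Lr.
have cz := ac_cont a1; have aU := acD a2 (acZ (cc z) (ac_chi chiP)).
have w1 : ae_eq mu setT (ww z) gz by apply: (ac_ae a1); rewrite e1 in wz; exact: (weak_ac chiP cz wz).
have w2 : ae_eq mu setT (vS chi z) gu.
  by apply: (ac_ae aU); rewrite e2 in wu; exact: (weak_ac chiP (ac_cont aU) wu).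
have [C0 [C00 hC0]] := chi_constP chiP.
have bd x : `|derive1 chi x| <= C0.
  by have [h _ _ _] := hC0 x; rewrite (le_trans h)// ler_piMr// ek_le1.
pose P x := [/\ `|ww z x| <= M1, `|vS chi z x| <= M2, `|hh z x| <= M3, `|rh z x + kk z| <= M4 &
  [/\ 0 <= 1 + ww z x, 0 <= hh z x, 0 < 1 + ww z x + hh z x &
  (1 + ww z x) * hh z x = vS chi z x ^+ 2 + rbS z x ^+ 2]].
have aP : {ae mu, forall x, P x}.
  have q1 : {ae mu, forall x, `|ww z x| <= M1 /\ `|vS chi z x| <= M2}.
    apply: (aeS2 _ (aeS2 (Q := fun x => `|ww z x| <= M1) _ w1 h1) (aeS2 (Q := fun x => `|vS chi z x| <= M2) _ w2 h2)).
    - by move=> x. - by move=> x a b; rewrite a. - by move=> x a b; rewrite a.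
  have q2 : {ae mu, forall x, `|hh z x| <= M3 /\ `|rh z x + kk z| <= M4}.
    apply: (aeS2 _ (aeS2 (Q := fun x => `|hh z x| <= M3) _ e3 h3) (aeS2 (Q := fun x => `|rh z x + kk z| <= M4) _ e4 h4)).
    - by move=> x. - by move=> x a b; rewrite -a. - by move=> x a b; rewrite -a.
  have q3 : {ae mu, forall x, [/\ wD (yL X) x = 1 + ww z x, wD (UL X) x = vS chi z x, hL X x = hh z x & rbarL X x = rbS z x]}.
    apply: (aeS2 _ (aeS2 (Q := fun x => wD (yL X) x = 1 + ww z x /\ wD (UL X) x = vS chi z x) _ d1 d2)
      (aeS2 (Q := fun x => hL X x = hh z x /\ rbarL X x = rbS z x) _ e3 d3)).
    - by move=> x [a b] [c d]. - by move=> x a b; rewrite a// b. - by move=> x a b; rewrite a// b.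
  apply: (aeS2 _ (aeS2 (Q := fun x => (`|ww z x| <= M1 /\ `|vS chi z x| <= M2) /\ (`|hh z x| <= M3 /\ `|rh z x + kk z| <= M4)) _ q1 q2)
    (aeS2 (Q := fun x => [/\ 0 <= 1 + ww z x, 0 <= hh z x, 0 < 1 + ww z x + hh z x &
  (1 + ww z x) * hh z x = vS chi z x ^+ 2 + rbS z x ^+ 2]) _ q3 gX)).
  - by move=> x [[a b] [c d]] e. - by move=> x.
  - by move=> x [a b c d]; rewrite a b c d => -[].
have [A [mA A0 sA]] := aP.
pose i x : R := \1_(~` A) x.
have mi : mf i by apply: measurable_indic; exact: measurableC.
have iE x : (i x = 1 /\ P x) \/ i x = 0.
  rewrite /i indicE; have [xA|xA] := boolP (x \in ~` A); last by right.
  left; split=> //; rewrite inE in xA; apply: contrapT => nP; apply: xA; exact: sA.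
have i1 : {ae mu, forall x, i x = 1}.
  exists A; split=> // x /= h; apply: contrapT => nA; apply: h.
  by rewrite /i indicE mem_set.
pose z' := mkst (ze z) (uh z) (fun x => i x * ww z x) (fun x => i x * vS chi z x - cc z * derive1 chi x)
  (fun x => i x * hh z x) (fun x => i x * rh z x) (cc z) (kk z).
have aei f : ae_eq mu setT f (fun x => i x * f x) by apply: aeS i1 => x h _; rewrite h mul1r.
have aev : ae_eq mu setT (vh z) (vh z').
  by apply: aeS i1 => x h _; rewrite /vh /= h mul1r /vS addrK.
have mfi f : L2 f -> mf (fun x => i x * f x) by move=> l; apply: mfM mi (L2_mf l).
have mv' : mf (vh z').
  apply: mfB; first by apply: mfM mi _; exact: li_mf (ac_li aU).
  by apply: mfM; [exact: mf_cst|exact: mf_cont (dr_cont (smooth_dr (smooth_derive (chi_smooth chiP))))].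
have Lw := (L2_ae lw (mfi _ lw) (aei _)).1; have Lv := (L2_ae lv mv' aev).1.
have Lh' := (L2_ae lh (mfi _ lh) (aei _)).1; have Lr' := (L2_ae lr (mfi _ lr) (aei _)).1.
have b1 : bdd (ww z').
  exists `|M1| => x; rewrite /ww /=; case: (iE x) => [[-> [a _ _ _ _]]|->].
    by rewrite mul1r (le_trans a)// ler_norm.
  by rewrite mul0r normr0.
have b2 : bdd (vh z').
  exists (`|M2| + `|cc z| * C0) => x; rewrite /vh /= (le_trans (ler_normB _ _))// lerD//; last first.
    by rewrite normrM ler_wpM2l.
  case: (iE x) => [[-> [_ a _ _ _]]|->].
    by rewrite mul1r (le_trans a)// ler_norm.
  by rewrite mul0r normr0.
have b3 : bdd (hh z').
  exists `|M3| => x; rewrite /hh /=; case: (iE x) => [[-> [_ _ a _ _]]|->].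
    by rewrite mul1r (le_trans a)// ler_norm.
  by rewrite mul0r normr0.
have b4 : bdd (rh z').
  exists (`|M4| + `|kk z|) => x; rewrite /rh /=; case: (iE x) => [[-> [_ _ _ a _]]|->].
    rewrite mul1r -[rh z x](addrK (kk z)) (le_trans (ler_normB _ _))// lerD2r//.
    exact: le_trans a (ler_norm _).
  by rewrite mul0r normr0.
have a1' : ac (ze z') (ww z') := ac_aer a1 (mfi _ lw) (aei _).
have a2' : ac (uh z') (vh z') := ac_aer a2 mv' aev.
exists z'; split.
- split=> //; split; split=> //; first exact: ae_eq_trans e3 (aei _).
  apply: (aeS2 _ e4 i1) => x h hi _; by rewrite h// /rh /kk /= hi mul1r.
- by split=> //; split.
- move=> x.
  have ev : vS chi z' x = i x * vS chi z x by rewrite {1}/vS /vh /cc /= subrK.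
  have er : rbS z' x = i x * rbS z x by rewrite /rbS mulrBr mulrCA.
  rewrite ev er /ww /hh /=; case: (iE x) => [[-> [_ _ _ _ [g1 g2 g3 g4]]]|->].
    by rewrite !mul1r.
  by rewrite !mul0r !addr0 expr0n mulr0 addr0; split=> //; rewrite ler01.
Qed.

End Chi.
End Spaces.

(** * Time derivatives in the sense of the system *)

Section Tderiv.
Context {R : realType}.
Local Notation mu := (@lebesgue_measure R).
Implicit Types (f g : R -> R).

Lemma cvg0_within f t : f s @[s --> within [set s | 0 <= s] (nbhs t)] --> (0 : R) <->
  forall e, 0 < e -> exists2 d, 0 < d & forall s, 0 <= s -> `|s - t| < d -> `|f s| <= e.
Proof.
split=> [/cvgr0Pnorm_le h e e0|h].
  have /nbhs_ballP[d d0 hd] := h e e0; exists d => // s s0 st.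
  by apply: hd => //; rewrite /ball/= distrC.
apply/cvgr0Pnorm_le => e e0; have [d d0 hd] := h e e0; apply/nbhs_ballP; exists d => //= s.
by rewrite /ball/= distrC => st s0; exact: hd.
Qed.

Lemma cvg0_dwithin f (t : R) : f s @[s --> within [set s : R | 0 <= s] (t : R)^'] --> (0 : R) <->
  forall e, 0 < e -> exists2 d, 0 < d &
    forall s, 0 <= s -> s != t -> `|s - t| < d -> `|f s| <= e.
Proof.
split=> [/cvgr0Pnorm_le h e e0|h].
  have /nbhs_ballP[d d0 hd] := h e e0; exists d => // s s0 st sd.
  by apply: hd => //; rewrite /ball/= distrC.
apply/cvgr0Pnorm_le => e e0; have [d d0 hd] := h e e0; apply/nbhs_ballP; exists d => //= s.
by rewrite /ball/= distrC => st sn s0; exact: hd.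
Qed.

Lemma has_tderivP (W : lmodType R) (S : set W) (N : W -> R) u t du :
  has_tderiv S N u t du <-> S du /\ forall e, 0 < e -> exists2 d, 0 < d &
    forall s, 0 <= s -> s != t -> `|s - t| < d -> `|N ((s - t)^-1 *: (u s - u t) - du)| <= e.
Proof. by split=> -[h1 /cvg0_dwithin h2]. Qed.

Lemma tdiffP (W : lmodType R) (S : set W) (N : W -> R) u t du : seminormed S N -> 0 <= t ->
  (forall s, 0 <= s -> S (u s)) -> S du ->
  tdiff N u t du <-> forall e, 0 < e -> exists2 d, 0 < d &
    forall s, 0 <= s -> s != t -> `|s - t| < d -> N ((s - t)^-1 *: (u s - u t) - du) <= e.
Proof.
move=> sn t0 Su Sdu.
have Sq s : 0 <= s -> S ((s - t)^-1 *: (u s - u t) - du).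
  by move=> s0; apply: (snB sn) => //; apply: (snZ sn); apply: (snB sn); apply: Su.
have E s : 0 <= s -> s != t ->
    N (u s - u t - (s - t) *: du) = `|s - t| * N ((s - t)^-1 *: (u s - u t) - du).
  move=> s0 st; rewrite -(sn_scale sn _ (Sq s s0)); congr N.
  by rewrite (scalerBr (s - t)) scalerA mulfV ?scale1r// subr_eq0.
split=> h e e0; have [d d0 hd] := h e e0; exists d => // s s0.
  move=> st sd; have := hd s s0 sd; rewrite E// mulrC ler_pM2r//.
  by rewrite normr_gt0 subr_eq0.
move=> sd; have [->|st] := eqVneq s t; first by rewrite !subrr scale0r subrr (sn_zero sn) normr0 mulr0.
by rewrite E// mulrC ler_wpM2r// hd.
Qed.

Lemma tdiff_near (W : lmodType R) (S : set W) (N : W -> R) u t du : seminormed S N -> 0 <= t ->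
  (forall s, 0 <= s -> S (u s)) -> S du -> tdiff N u t du ->
  exists2 d, 0 < d & forall s, 0 <= s -> `|s - t| < d -> N (u s - u t) <= `|s - t| * (1 + N du).
Proof.
move=> sn t0 Su Sdu h; have [d d0 hd] := h 1 ltr01; exists d => // s s0 st.
have S1 := snB sn (Su s s0) (Su t t0); have S2 := snZ sn (s - t) Sdu.
have := sn_triangle sn (snB sn S1 S2) S2; rewrite subrK => /le_trans; apply.
by rewrite (sn_scale sn)// mulrDr lerD// mulrC; exact: hd.
Qed.

Lemma has_tderiv_tdiff (W : lmodType R) (S : set W) (N : W -> R) u t du : seminormed S N -> 0 <= t ->
  (forall s, 0 <= s -> S (u s)) -> has_tderiv S N u t du <-> S du /\ tdiff N u t du.
Proof.
move=> sn t0 Su; have Sq s : S du -> 0 <= s -> 0 <= N ((s - t)^-1 *: (u s - u t) - du).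
  by move=> Sd s0; apply: (sn_ge0 sn); apply: (snB sn) => //; apply: (snZ sn); apply: (snB sn); apply: Su.
split=> [/has_tderivP[Sd h]|[Sd /(tdiffP sn t0 Su Sd) h]].
  split=> //; apply/(tdiffP sn t0 Su Sd) => e /h[d d0 hd]; exists d => // s s0 st sd.
  exact: le_trans (ler_norm _) (hd s s0 st sd).
apply/has_tderivP; split=> // e /h[d d0 hd]; exists d => // s s0 st sd.
by rewrite ger0_norm ?Sq//; exact: hd.
Qed.

(** At each time h and rbar are tied to a state only almost everywhere, so the difference quotients
    are compared as L^2 classes. *)
Lemma L2_tderiv (u v : R -> R -> R) t (du dv : R -> R) : 0 <= t ->
  (forall s, 0 <= s -> [/\ mf (u s), L2 (v s) & ae_eq mu setT (u s) (v s)]) ->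
  mf du -> ae_eq mu setT du dv -> mf dv ->
  has_tderiv (W := R -> R^o) L2 L2norm u t du <-> L2 dv /\ tdiff (W := R -> R^o) L2norm v t dv.
Proof.
move=> t0 h mdu e mdv; have sn := sn_fn (@fnorm_L2 R).
have Lu s : 0 <= s -> L2 (u s).
  by move=> /h[m l q]; exact: (L2_ae l m (ae_eq_sym q)).1.
have Lv s : 0 <= s -> L2 (v s) by move=> /h[].
have E s : 0 <= s -> L2 du -> L2norm ((s - t)^-1 *: ((u s : R -> R^o) - u t) - du) =
    L2norm ((s - t)^-1 *: ((v s : R -> R^o) - v t) - dv).
  move=> s0 ld; have l : L2 ((s - t)^-1 *: ((u s : R -> R^o) - u t) - du).
    by apply: (snB sn) => //; apply: (snZ sn); apply: (snB sn); apply: Lu.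
  have ld' := (L2_ae ld mdv e).1.
  have l' : L2 ((s - t)^-1 *: ((v s : R -> R^o) - v t) - dv).
    by apply: (snB sn) => //; apply: (snZ sn); apply: (snB sn); apply: Lv.
  apply: (L2_ae l (L2_mf l') _).2.
  have [_ _ q1] := h s s0; have [_ _ q2] := h t t0.
  apply: (aeS2 _ (aeS2 (Q := fun x => u s x = v s x /\ u t x = v t x) _ q1 q2) e) => x.
    by move=> [a b] c _; rewrite !fctE a b c.
  by move=> a b; split; [exact: a|exact: b].
split=> [/(has_tderiv_tdiff _ sn t0 Lu)[ld dt]|[ld dt]].
  have ld' := (L2_ae ld mdv e).1; split=> //.
  apply/(tdiffP sn t0 Lv ld') => ep ep0; have /(tdiffP sn t0 Lu ld) h' := dt.
  have [d d0 hd] := h' ep ep0; exists d => // s s0 st sd; rewrite -E//; exact: hd.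
have ld' := (L2_ae ld mdu (ae_eq_sym e)).1.
apply/(has_tderiv_tdiff _ sn t0 Lu); split=> //.
apply/(tdiffP sn t0 Lu ld') => ep ep0; have /(tdiffP sn t0 Lv ld) h' := dt.
have [d d0 hd] := h' ep ep0; exists d => // s s0 st sd; rewrite E//; exact: hd.
Qed.

End Tderiv.

(** * P and Q in state coordinates *)

Section Kernel.
Context {R : realType}.
Local Notation mu := (@lebesgue_measure R).
Variables (chi : R -> R) (chiP : cutoff chi).

Lemma kap_le sgd (y : R -> R) M x s : (forall a, `|y a - a| <= M) ->
  0 <= kap sgd y x s <= expR (2 * M) * ek (x - s).
Proof.
move=> hy; have h : `|x - s| - 2 * M <= sgk y x s.
  rewrite /sgk; have := hy x; have := hy s; rewrite !ler_norml => /andP[a1 a2] /andP[b1 b2].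
  have [xs|sx|->] := ltgtP x s.
  - by rewrite ltr0_norm ?ltr0_sg ?subr_lt0//; lra.
  - by rewrite gtr0_norm ?gtr0_sg ?subr_gt0//; lra.
  - by rewrite !subrr normr0 mulr0; lra.
have h' : sgk y x s <= `|y x - y s|.
  rewrite /sgk (le_trans (ler_norm _))// normrM normr_sg ler_piMl//.
  by case: (_ != _).
have e : expR (2 * M) * ek (x - s) = expR (- (`|x - s| - 2 * M)).
  by rewrite /ek -expRD; congr expR; ring.
by rewrite e /kap; case: sgd; rewrite expR_ge0 ler_expR lerN2// (le_trans h).
Qed.

Lemma mf_kapL sgd (y : R -> R) x : mf y -> mf (kap sgd y x).
Proof.
move=> my; rewrite /kap; case: sgd.
  apply: mf_exp; apply: mfN; apply: mfM; last by apply: mfB => //; exact: mf_cst.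
  by apply: mf_sg; apply: mfB; [exact: mf_cst|exact: mf_id].
by apply: mf_exp; apply: mfN; apply: mf_abs; apply: mfB => //; exact: mf_cst.
Qed.

Lemma ig_kap sgd (y f : R -> R) M x : mf y -> mf f -> (forall a, `|y a - a| <= M) ->
  ig (fun s => ek (x - s) * f s) -> ig (fun s => kap sgd y x s * f s).
Proof.
move=> my mff hy /ig_abs/(igZ (expR (2 * M))); apply: ig_le.
  by apply: mfM => //; exact: mf_kapL.
move=> s; have /andP[k0 kl] := kap_le sgd x s hy.
by rewrite !normrM (ger0_norm k0) (ger0_norm (ek_ge0 _)) mulrA ler_wpM2r.
Qed.

Lemma lifts_source X z : lifts chi X z ->
  [/\ mf (source chi X), ae_eq mu setT (source chi X) (fS chi z) & UbarL chi X = UbS chi z].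
Proof.
move=> lX; have [_ ec ek_ _] := lifts_E chiP lX; have [d1 d2 d3 ey] := lifts_wD chiP lX.
have [sz [a1 a2] e1 e2 [[mh e3] [mr e4]]] := lX.
have eU : UbarL chi X = UbS chi z.
  by apply/funext => x; rewrite /UbarL /UbS ec e2 ey; ring.
have f2 := @fnorm_L2 R; have mU := mf_cont (ac_cont a2).
have mchi := mf_cont (chi_cont chiP).
have my : mf (yS z) by apply: mfD; [exact: mf_id|case: sz => -[]].
have mc : mf (fun x => chi (yS z x)) by exact: mf_comp.
have [aw _] := wD_ac chiP (acD (@ac_id R) a1).
have mw : mf (wD (yS z)) := li_mf (ac_li aw).
have mw' : mf (wD (yL X)) by rewrite ey.
have mUb : mf (UbarL chi X).
  rewrite eU; apply: mfD => //; apply: mfM; first exact: mf_cst.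
  exact: mfB.
split=> //.
  rewrite /source ey; apply: mfD => //; apply: mfD.
    apply: mfM => //; apply: mfD; first by apply: mfM; [exact: mf_cst|exact: mfX].
    by apply: mfM => //; apply: mfM => //; exact: mf_cst.
  by apply: mfM; [exact: mf_cst|apply: mfB => //; apply: mfM => //; exact: mf_cst].
apply: (aeS2 _ (aeS2 (Q := fun x => wD (yL X) x = 1 + ww z x /\ hL X x = hh z x) _ d1 e3) d3).
  by move=> x [a b] c _; rewrite /source /fS /aS a b c// ec ek_ eU ey /UbS /US; ring.
by move=> x a b; split; [exact: a|exact: b].
Qed.

Lemma lifts_AQ X z : lifts chi X z ->
  (forall x, UL X x ^+ 2 + 2^-1 * kL X ^+ 2 - PL chi X x = AS chi false z x) /\
  QL chi X = QS chi false z.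
Proof.
move=> lX; have [_ ec ek_ _] := lifts_E chiP lX; have [_ _ _ ey] := lifts_wD chiP lX.
have [msrc esrc _] := lifts_source lX.
have [sz [a1 a2] e1 e2 _] := lX; have f2 := @fnorm_L2 R.
have [df _ [M hM]] := SS_fS chiP f2 false sz.
have my : mf (yS z) by apply: mfD; [exact: mf_id|case: sz => -[]].
have ik x := ig_kap false my (fn_mf f2 df) hM (fn_ig f2 df x).
split=> [x|].
  rewrite /PL /AS /PbS ec ek_ ey e2.
  have -> : \int[mu]_eta (expR (- `|yS z x - yS z eta|) * source chi X eta) =
      It (fun s => kap false (yS z) x s * fS chi z s).
    have [||_ ->] := It_ae (ik x) (g := fun s => kap false (yS z) x s * source chi X s); last by [].
    - by apply: mfM => //; exact: mf_kapL.
    - by apply: aeS esrc => s h _; rewrite h.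
  by move: (It _) => I; rewrite gfunE /aS /US /UbS; field.
apply/funext => x; rewrite /QL /QS /QbS ec ey derive1_gfun//.
have -> : \int[mu]_eta (Num.sg (x - eta) * expR (- `|yS z x - yS z eta|) * source chi X eta) =
    It (fun s => Num.sg (x - s) * kap false (yS z) x s * fS chi z s).
  have ms : mf (fun s => Num.sg (x - s)).
    by apply: mf_sg; apply: mfB; [exact: mf_cst|exact: mf_id].
  have i : ig (fun s => Num.sg (x - s) * kap false (yS z) x s * fS chi z s).
    apply: ig_le (ig_abs (ik x)).
      by apply: mfM; [apply: mfM => //; exact: mf_kapL|exact: fn_mf f2 _ df].
    by move=> s; rewrite -mulrA normrM normr_sg ler_piMl//; case: (_ != _).
  have [||_ ->] := It_ae i (g := fun s => Num.sg (x - s) * kap false (yS z) x s * source chi X s); last by [].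
  - by apply: mfM => //; apply: mfM => //; exact: mf_kapL.
  - by apply: aeS esrc => s h _; rewrite h.
by rewrite expr2 -mulrA.
Qed.

Lemma FS_homo z : {homo yS z : a b / a <= b} -> [/\ FS chi true z = FS chi false z,
  QS chi true z = QS chi false z & AS chi true z = AS chi false z].
Proof.
move=> mono.
have eP : PbS chi true z = PbS chi false z.
  apply/funext => x; rewrite /PbS; congr (_ * It _); apply/funext => s.
  by rewrite (kap_homo x s mono).
have eQ : QbS chi true z = QbS chi false z.
  apply/funext => x; rewrite /QbS; congr (_ * It _); apply/funext => s.
  by rewrite (kap_homo x s mono).
have eQS : QS chi true z = QS chi false z by rewrite /QS eQ.
have eAS : AS chi true z = AS chi false z by rewrite /AS eP.
split; [by rewrite /FS eQS eAS|exact: eQS|exact: eAS].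
Qed.

End Kernel.

(** * Global states give solutions of the Lagrangian system *)

Section Solution.
Context {R : realType}.
Local Notation mu := (@lebesgue_measure R).
Variables (chi : R -> R) (chiP : cutoff chi).
Local Notation F := (FS chi true).
Local Notation N := (NS (@L2bn R)).
Local Notation N2 := (NS (@L2norm R)).
Local Notation chi' := (derive1 chi).
Let f2 := @fnorm_L2 R.
Let fb := @fnorm_L2b R.
Let snb : seminormed (W := R -> R^o) (@L2b R) (@L2bn R) := sn_fn fb.

Definition lag_of (z : st R) : lag R :=
  (((ze z, fun x => uh z x + cc z * chi x), hh z), fun x => rh z x + kk z).

Lemma lifts_lag_of z : SA z -> lifts chi (lag_of z) z.
Proof.
move=> [sz a]; have sz2 := SS_L2 sz; have [_ _ _ _ [lh lr]] := sz2.
split=> //; split; split; [exact: L2_mf|exact: aeW| |exact: aeW].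
by apply: mfD; [exact: L2_mf|exact: mf_cst].
Qed.

Lemma SA_homo z : SA z -> GE chi z -> {homo yS z : a b / a <= b}.
Proof. by move=> sz gz; apply: (ac_homo (ac_y sz)) => x; have [] := gz x. Qed.

Lemma Vspace_ac (f g : R -> R) : ac f g -> mf f /\ bdd f -> L2 g -> Vspace f /\ Vnorm f = supn f + L2norm g.
Proof.
move=> a [_ b] Lg; have cf := ac_cont a; have [Lf nf] := Loonorm_cont cf b; split.
  by split=> //; exists g => //; exact: ac_weak.
by rewrite /Vnorm nf (ac_wD_norm chiP a Lg).2.
Qed.

Lemma En_ge0 z : SS (@L2 R) z -> 0 <= En z.
Proof.
move=> [[_ b] _ _ _ _]; rewrite /En !addr_ge0// ?supn_ge0// ?L2norm_ge0// ?sqrtr_ge0//.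
Qed.

Lemma NS_ze_ww z : SS (@L2 R) z -> supn (ze z) + L2norm (ww z) <= N2 z.
Proof.
move=> [_ [_ b] _ _ _]; have := supn_ge0 b; have := L2norm_ge0 (uh z); have := L2norm_ge0 (vh z).
have := L2norm_ge0 (hh z); have := L2norm_ge0 (rh z); have := normr_ge0 (cc z); have := normr_ge0 (kk z).
rewrite /NS; move: (supn _) (supn _) (L2norm _) (L2norm _) (L2norm _) (L2norm _) (L2norm _) (`|_|) (`|_|); clear.
by move=> *; lra.
Qed.

Lemma sqrt_le_half (a b e : R) : 0 <= a -> 0 <= b -> a <= e / 2 -> b <= e / 2 -> Num.sqrt (a ^+ 2 + b ^+ 2) <= e.
Proof.
move=> a0 b0 ae be; have e0 : 0 <= e by lra.
rewrite -[leRHS]ger0_norm// -sqrtr_sqr ler_sqrt ?sqr_ge0//.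
apply: (@le_trans _ _ ((a + b) ^+ 2)); first by rewrite sqrrD lerD2r lerDl mulrn_wge0// mulr_ge0.
by rewrite ler_pXn2r ?nnegrE ?addr_ge0//; lra.
Qed.

Lemma tdiff_L2b (u : R -> R -> R) t du : (forall s, 0 <= s -> L2b (u s)) -> L2b du -> 0 <= t ->
  tdiff (W := R -> R^o) (@L2bn R) u t du -> tdiff (W := R -> R^o) (@L2norm R) u t du.
Proof.
move=> Su Sdu t0; apply: (tdiff_lin (L := id) (C := 1) snb Su (Su _ t0) Sdu) => //.
by move=> f lf; rewrite mul1r; have [_ _ h _] := L2b_parts lf.
Qed.

Lemma lifts_mf_rbar X z : lifts chi X z -> mf (rbarL X).
Proof.
move=> lX; have [_ _ _ ey] := lifts_wD chiP lX; have [_ [a1 _] _ _ [_ [mr _]]] := lX.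
have [aw _] := wD_ac chiP (acD (@ac_id R) a1).
by apply: mfB => //; rewrite ey; apply: mfM; [exact: mf_cst|exact: li_mf (ac_li aw)].
Qed.

Section SpaceDerivative.
Variables (C0 : R) (hC0 : chi_const chi C0).

(** The system asks for a time derivative of Ubar in H^1, so its space derivative [Ubx] needs one in
    L^2. [Ubxt] is at once the time derivative of [Ubx] and the space derivative of [Ubt]. *)
Definition Ubx z x := vS chi z x - cc z * (chi' (yS z x) * (1 + ww z x)).
Definition Ubxt z x := vh (F z) x -
  cc z * (derive1 chi' (yS z x) * US chi z x * (1 + ww z x) + chi' (yS z x) * vS chi z x).

Let cd1 := dr_cont (smooth_dr (smooth_derive (chi_smooth chiP))).
Let cd2 := dr_cont (smooth_dr (smooth_derive (smooth_derive (chi_smooth chiP)))).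
Let hd1 x : `|chi' x| <= C0 * ek x. Proof. by have [] := hC0.2 x. Qed.
Let hd2 x : `|derive1 chi' x| <= C0 * ek x. Proof. by have [_ h _ _] := hC0.2 x; exact: h. Qed.
Let hd3 x : `|derive1 (derive1 chi') x| <= C0 * ek x. Proof. by have [_ _ h _] := hC0.2 x; exact: h. Qed.
Let p1 z : SS (@L2b R) z -> L2b (fun x => chi' (yS z x)).
Proof. by move=> sz; exact: (ek_fun_L2b hC0 sz (mf_cont cd1) hd1). Qed.
Let p2 z : SS (@L2b R) z -> L2b (fun x => derive1 chi' (yS z x) * US chi z x).
Proof.
move=> sz; have [mU bU] := U_bdd chiP sz; have := bM bU mU (ek_fun_L2b hC0 sz (mf_cont cd2) hd2).
by congr L2b; apply/funext => x; rewrite mulrC.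
Qed.
Let pw z (q : R -> R) : SS (@L2b R) z -> L2b q -> L2b (fun x => q x * ww z x).
Proof. by move=> [_ _ lw _ _] lq; exact: (L2b_mul lq lw).1. Qed.

Lemma Ubx_L2b z : SS (@L2b R) z -> L2b (Ubx z).
Proof.
move=> sz; have h := snD snb (p1 sz) (pw sz (p1 sz)).
have := snB snb (v_L2b chiP hC0 sz) (snZ snb (cc z) h); congr L2b; apply/funext => x.
by rewrite /Ubx !fctE /GRing.scale/=; ring.
Qed.

Let q1 z : SS (@L2b R) z -> L2b (fun x => derive1 chi' (yS z x) * US chi z x +
  (derive1 chi' (yS z x) * US chi z x * ww z x + chi' (yS z x) * vS chi z x)).
Proof.
move=> sz; apply: (snD snb (p2 sz) (snD snb (pw sz (p2 sz)) _)).
exact: (L2b_mul (p1 sz) (v_L2b chiP hC0 sz)).1.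
Qed.

Lemma Ubxt_L2b z : SA z -> L2b (Ubxt z).
Proof.
move=> sz; have [_ lv] := FS_L2b chiP sz.
have := snB snb lv (snZ snb (cc z) (q1 sz.1)); congr L2b; apply/funext => x.
by rewrite /Ubxt !fctE /GRing.scale/=; ring.
Qed.

Lemma ac_Ubt z : SA z -> ac (Ubt chi z) (Ubxt z).
Proof.
move=> sz; have [_ [_ a]] := SA_FS chiP sz.
have h := ac_mul (ac_chain (smooth_quadr (smooth_derive (chi_smooth chiP))) (ac_y sz)) (ac_US chiP sz).
have := acB a (acZ (cc z) h).
by congr ac; apply/funext => x; rewrite /Ubxt; congr (_ - _ * _); ring.
Qed.

Lemma d_Ubx (Y : R -> st R) t : 0 <= t -> (forall s, 0 <= s -> SA (Y s)) -> tdiff N Y t (F (Y t)) ->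
  tdiff (W := R -> R^o) (@L2bn R) (fun s => Ubx (Y s)) t (Ubxt (Y t)).
Proof.
move=> t0 SY dt; have SYt := SY t t0.
have a1 := quadr_ac (smooth_quadr (smooth_derive (chi_smooth chiP))).
have a2 := quadr_ac (smooth_quadr (smooth_derive (smooth_derive (chi_smooth chiP)))).
have Lc := dchi_L2b chiP hC0.
have Lp s (hs : 0 <= s) := p1 (SY s hs).1.
have Lpw s (hs : 0 <= s) := pw (SY s hs).1 (Lp s hs).
have Lm s (hs : 0 <= s) := snD snb (Lp s hs) (Lpw s hs).
have Lv s (hs : 0 <= s) := v_L2b chiP hC0 (SY s hs).1.
have Lw s : 0 <= s -> L2b (ww (Y s)) by move=> /SY[[]].
have dp : tdiff (W := R -> R^o) (@L2bn R) (fun s x => chi' (yS (Y s) x)) t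
    (fun x => derive1 chi' (yS (Y t) x) * US chi (Y t) x).
  have h := d_chiB chiP hC0 t0 SY dt a1 a2 hd2 hd3.
  have := tdiff_add snb (fun s hs => snB snb (Lp s hs) Lc) (fun s _ => Lc) t0 (p2 SYt.1) (sn0 snb) h (tdiff_cst _ t snb).
  by apply: tdiff_ext => // [s s0|]; [apply/funext => x; rewrite !fctE subrK|rewrite addr0].
have dm := tdiff_add snb Lp Lpw t0 (p2 SYt.1) _ dp (tdiff_mul Lp Lw t0 (p2 SYt.1) (Lv t t0) dp (d_ww chiP t0 SY dt)).
have Lw' : L2b (fun x => derive1 chi' (yS (Y t) x) * US chi (Y t) x * ww (Y t) x + chi' (yS (Y t) x) * vS chi (Y t) x).
  exact: (snD snb (pw SYt.1 (p2 SYt.1)) (L2b_mul (p1 SYt.1) (Lv t t0)).1).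
have dc := tdiff_scl t0 Lm (q1 SYt.1) (d_cc chiP t0 SY dt) (dm Lw').
have L1 : L2b (fun x => 0 * (chi' (yS (Y t) x) + chi' (yS (Y t) x) * ww (Y t) x) + cc (Y t) *
   (derive1 chi' (yS (Y t) x) * US chi (Y t) x +
  (derive1 chi' (yS (Y t) x) * US chi (Y t) x * ww (Y t) x + chi' (yS (Y t) x) * vS chi (Y t) x))).
  exact: (snD snb (snZ snb 0 (Lm t t0)) (snZ snb (cc (Y t)) (q1 SYt.1))).
have dn := tdiff_scale (-1) snb (fun s hs => snZ snb (cc (Y s)) (Lm s hs)) t0 L1 dc.
have LF := (FS_L2b chiP SYt).2.
have := tdiff_add snb Lv (fun s hs => snZ snb (-1) (snZ snb (cc (Y s)) (Lm s hs))) t0 LF (snZ snb (-1) L1)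
  (d_vS chiP hC0 t0 SY dt) dn.
apply: tdiff_ext => // [s s0|]; apply/funext => x; rewrite !fctE /GRing.scale/= /Ubx /Ubxt; ring.
Qed.

End SpaceDerivative.

Variable Y : R -> st R.
Hypothesis gY : gsol chi Y.
Let X (t : R) := lag_of (Y t).
Let SY s : 0 <= s -> SA (Y s). Proof. by case: gY => h _ _; exact: h. Qed.
Let GY s : 0 <= s -> GE chi (Y s). Proof. exact: gsol_GE. Qed.
Let lX s : 0 <= s -> lifts chi (X s) (Y s). Proof. by move=> s0; apply: lifts_lag_of; exact: SY. Qed.
Let SFY s : 0 <= s -> SA (F (Y s)). Proof. by move=> s0; apply: (SA_FS chiP); exact: SY. Qed.
Let d2 t : 0 <= t -> tdiff N2 Y t (F (Y t)).
Proof.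
move=> t0; have h := sub_tdiff (@sub2 R) t0 SY (SFY t0) (gsol_tdiff gY t0).
exact: h.
Qed.
Let quot s t := (s - t)^-1 *: (Y s - Y t) - F (Y t).
Let Squot s t : 0 <= s -> 0 <= t -> SA (quot s t).
Proof.
by move=> s0 t0; apply: (snB (@sn_SA R)); [apply: (snZ (@sn_SA R)); apply: (snB (@sn_SA R)); exact: SY|exact: SFY].
Qed.
Let dq t : 0 <= t -> forall e, 0 < e -> exists2 d, 0 < d &
    forall s, 0 <= s -> s != t -> `|s - t| < d -> N2 (quot s t) <= e.
Proof.
move=> t0; apply/(tdiffP (sn_st f2) t0); last exact: d2.
  by move=> s s0; exact: SS_L2 (SY s0).1.
exact: SS_L2 (SFY t0).1.
Qed.

Lemma sol_C1E : C1E chi X.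
Proof.
split=> [t t0|]; first by have [] := lifts_E chiP (lX t0).
exists (fun t => lag_of (F (Y t))) => t t0; have lF := lifts_lag_of (SFY t0).
split.
  apply/has_tderivP; split; first by have [] := lifts_E chiP lF.
  move=> e e0; have [d d0 hd] := dq t0 e0; exists d => // s s0 st sd.
  have lq := lifts_B (lifts_Z (s - t)^-1 (lifts_B (lX s0) (lX t0))) lF.
  have [_ _ _ ->] := lifts_E chiP lq; have [_ a] := Squot s0 t0.
  have sq := SS_L2 (Squot s0 t0).1; have [h _] := En_NS sq a.2.
  rewrite ger0_norm; first exact: le_trans h (hd s s0 st sd).
  exact: En_ge0.
apply/cvg0_within => e e0.
(* Bounds the norm of [Y s] for all s within distance 1 of t where increments are controlled, so
   that one Lipschitz constant of the rate serves them all. *)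
pose M := N2 (Y t) + 1 + 1 * (1 + N2 (F (Y t))).
have st2 s : 0 <= s -> SS (@L2 R) (Y s) by move=> s0; exact: SS_L2 (SY s0).1.
have sF2 := SS_L2 (SFY t0).1.
have [d d0 hd] := tdiff_near (sn_st f2) t0 st2 sF2 (d2 t0).
have nY := sn_ge0 (sn_st f2) (st2 t t0); have nF := sn_ge0 (sn_st f2) sF2.
set q := 1 + N2 (F (Y t)) in M hd.
have q0 : 0 < q by rewrite /q ltr_wpDr.
have M0 : 0 <= M := addr_ge0 (addr_ge0 nY ler01) (mulr_ge0 ler01 (ltW q0)).
have [C C0 hC] := rate_lip (chi := chi) true f2 chiP M0.
have Cq : 0 < C * q + 1 by rewrite ltr_wpDl// mulr_ge0// ltW.
exists (Num.min (Num.min d 1) (e / (C * q + 1))) => [|s s0].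
  by rewrite !lt_min d0 ltr01 divr_gt0.
rewrite !lt_min => /andP[/andP[sd s1] se].
have lD := lifts_B (lifts_lag_of (SFY s0)) lF.
have [_ _ _ ->] := lifts_E chiP lD.
have SD := snB (@sn_SA R) (SFY s0) (SFY t0); have [h _] := En_NS (SS_L2 SD.1) SD.2.2.
rewrite (ger0_norm (En_ge0 (SS_L2 SD.1))).
apply: (le_trans h); have hs := hd s s0 sd.
have nYs : N2 (Y s) <= M.
  have := sn_abs_sub (sn_st f2) (st2 s s0) (st2 t t0); rewrite ler_norml => /andP[_].
  have : `|s - t| * q <= 1 * q by rewrite ler_wpM2r// ltW.
  move=> a b; have c : N2 (Y s) <= 1 * q + N2 (Y t) by rewrite -lerBlDr (le_trans b)// (le_trans hs).
  by rewrite (le_trans c)// addrC /M lerD2r lerDl.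
have nYt : N2 (Y t) <= M by rewrite /M mul1r -addrA lerDl addr_ge0// ltW.
have [_ h2] := hC _ _ (st2 s s0) (st2 t t0) nYs nYt.
apply: (le_trans h2); apply: (@le_trans _ _ (C * (`|s - t| * q))); first exact: ler_wpM2l.
have : `|s - t| * (C * q + 1) <= e by rewrite -ler_pdivlMr// ltW.
move=> b; apply: le_trans b; rewrite [leRHS](mulrDr _ (C * q) 1) mulr1 [leLHS]mulrCA lerDl.
exact: normr_ge0.
Qed.

Section At.
Variables (t : R) (t0 : 0 <= t) (C0 : R) (hC0 : chi_const chi C0).
Let LX := lX t0.
Let SYt := SY t0.
Let dt := gsol_tdiff gY t0.
Let aU := ac_US chiP SYt.

Lemma sol_zeta : has_tderiv (W := R -> R^o) Vspace (@Vnorm R) (fun s => ze (Y s)) t (US chi (Y t)).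
Proof.
apply/has_tderivP; split.
  by apply: (Vspace_ac aU (U_bdd chiP SYt.1) _).1; exact: (v_L2b chiP hC0 SYt.1).1.
move=> e e0; have [d d0 hd] := dq t0 e0; exists d; first exact: d0.
move=> s s0 st sd; have sq := Squot s0 t0; have [[bz _ lw _ _] _] := sq.
have -> : (s - t)^-1 *: ((ze (Y s) : R -> R^o) - ze (Y t)) - (US chi (Y t) : R -> R^o) = ze (quot s t).
  by rewrite /quot zeB zeZ zeB.
have v0 : 0 <= supn (ze (quot s t)) + L2norm (ww (quot s t)).
  by apply: addr_ge0 (supn_ge0 bz.2) (L2norm_ge0 _).
rewrite (Vspace_ac sq.2.1 bz lw.1).2 (ger0_norm v0).
by apply: le_trans (hd s s0 st sd); exact: (NS_ze_ww (SS_L2 sq.1)).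
Qed.

Lemma sol_Ub : has_tderiv (W := R -> R^o) (@H1 R) (@H1norm R) (fun s => UbarL chi (X s)) t (Ubt chi (Y t)).
Proof.
have acg s (hs : 0 <= s) : ac (UbS chi (Y s)) (Ubx (Y s)) := ac_Ub chiP (SY hs).
have dU := d_Ub chiP hC0 t0 SY dt; have dUx := d_Ubx hC0 t0 SY dt.
have aUt := ac_Ubt SYt; have LUt := Ubt_L2b chiP hC0 SYt; have LUx := Ubxt_L2b hC0 SYt.
have Eu s (hs : 0 <= s) : UbarL chi (X s) = UbS chi (Y s).
  by have [_ _] := lifts_source chiP (lX hs).
have hU s (hs : 0 <= s) := Ub_L2b chiP hC0 (SY hs).1.
have hg s (hs : 0 <= s) := Ubx_L2b hC0 (SY hs).1.
apply/has_tderivP; split; first exact: (H1P chiP aUt LUt.1 LUx.1).1.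
move=> e e0; have e2 : 0 < e / 2 by rewrite divr_gt0.
have [q1 hq1 h1] := (tdiffP snb t0 hU LUt).1 dU _ e2.
have [q2 hq2 h2] := (tdiffP snb t0 hg LUx).1 dUx _ e2.
exists (Num.min q1 q2); first by rewrite lt_min hq1 hq2.
move=> s s0 st; rewrite lt_min => /andP[s1 s2]; rewrite (Eu s s0) (Eu t t0).
have a1 := acB (acZ (s - t)^-1 (acB (acg s s0) (acg t t0))) aUt.
have B1 := snB snb (snZ snb (s - t)^-1 (snB snb (hU s s0) (hU t t0))) LUt.
have B2 := snB snb (snZ snb (s - t)^-1 (snB snb (hg s s0) (hg t t0))) LUx.
have [_ nH] := H1P chiP a1 B1.1 B2.1.
rewrite [H1norm _]nH (ger0_norm (sqrtr_ge0 _)).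
apply: sqrt_le_half (L2norm_ge0 _) (L2norm_ge0 _) _ _.
  by apply: le_trans (h1 s s0 st s1); have [_ _ h _] := L2b_parts B1; exact: h.
by apply: le_trans (h2 s s0 st s2); have [_ _ h _] := L2b_parts B2; exact: h.
Qed.

Lemma sol_h : has_tderiv (W := R -> R^o) L2 L2norm (fun s => hh (Y s)) t
  (fun x => 2 * AS chi true (Y t) x * wD (US chi (Y t)) x).
Proof.
have Sh s (hs : 0 <= s) : L2b (hh (Y s)) by have [[_ _ _ _ [h _]] _] := SY hs.
have [_ w2 _ _] := lifts_wD chiP LX.
have lF : L2b (hh (F (Y t))) by have [[_ _ _ _ [h _]] _] := SFY t0.
have e1 : ae_eq mu setT (fun x => 2 * AS chi true (Y t) x * wD (US chi (Y t)) x) (hh (F (Y t))).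
  by apply: aeS w2 => x h _; rewrite h// -mulrA.
have mdu : mf (fun x => 2 * AS chi true (Y t) x * wD (US chi (Y t)) x).
  apply: mfM; last by have [a _] := wD_ac chiP aU; exact: li_mf (ac_li a).
  apply: mfM; first exact: mf_cst.
  have : mf (fun x => US chi (Y t) x ^+ 2 + 2^-1 * kk (Y t) ^+ 2 - PS chi (Y t) x).
    apply: mfB; last exact: mf_cont (ac_cont (ac_PS chiP SYt)).
    by apply: mfD; [apply: mfX; exact: mf_cont (ac_cont aU)|exact: mf_cst].
  by congr mf; apply/funext => x; rewrite AE.
apply/(L2_tderiv (v := fun s => hh (Y s)) t0 _ mdu e1 (L2_mf lF.1)).
  by move=> s s0; have [l _] := Sh s s0; split; [exact: L2_mf|exact: l|exact: aeW].
by split; [exact: lF.1|exact: (tdiff_L2b Sh lF t0 (d_hh chiP t0 SY dt))].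
Qed.

Lemma sol_r : has_tderiv (W := R -> R^o) L2 L2norm (fun s => rbarL (X s)) t
  (fun x => - kk (Y t) * wD (US chi (Y t)) x).
Proof.
have [_ w2 _ _] := lifts_wD chiP LX.
have Sr s (hs : 0 <= s) : L2b (rbS (Y s)) := rb_L2b (SY hs).1.
have Ld := snZ snb (- kk (Y t)) (v_L2b chiP hC0 SYt.1).
apply/(L2_tderiv (v := fun s => rbS (Y s)) (dv := fun x => - kk (Y t) * vS chi (Y t) x) t0).
- move=> s s0; have [_ _ q3 _] := lifts_wD chiP (lX s0); have [l _] := Sr s s0.
  by split; [exact: lifts_mf_rbar (lX s0)|exact: l|exact: q3].
- by apply: mfM; [exact: mf_cst|have [a _] := wD_ac chiP aU; exact: li_mf (ac_li a)].
- by apply: aeS w2 => x h _; rewrite h.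
- exact: L2_mf Ld.1.
- by split; [exact: Ld.1|exact: (tdiff_L2b Sr Ld t0 (d_rb chiP hC0 t0 SY dt))].
Qed.

Lemma sol_ck : has_tderiv (W := R^o) setT Num.norm (fun s => cL chi (X s)) t 0 /\
  has_tderiv (W := R^o) setT Num.norm (fun s => kL (X s)) t 0.
Proof.
have cE s : 0 <= s -> cL chi (X s) = cc (Y s) /\ kL (X s) = kk (Y s).
  by move=> s0; have [_ a b _] := lifts_E chiP (lX s0).
split; apply/(has_tderiv_tdiff _ (@sn_R R) t0) => //; split=> //.
  by apply: (tdiff_ext _ t0 erefl (d_cc chiP t0 SY dt)) => s s0; have [] := cE s s0.
by apply: (tdiff_ext _ t0 erefl (d_kk chiP t0 SY dt)) => s s0; have [] := cE s s0.
Qed.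

End At.

Lemma sol_system : system chi X.
Proof.
move=> t t0; have [C0 hC0] := chi_constP chiP.
have LX := lX t0; have [_ ec ek_ _] := lifts_E chiP LX; have [_ _ _ ey] := lifts_wD chiP LX.
have [hA hQ] := lifts_AQ chiP LX.
have [_ eQ eA] := FS_homo chi (SA_homo (SY t0) (GY t0)).
have eUt : (fun xi => - QL chi (X t) xi - cL chi (X t) * chi' (yL (X t) xi) * UL (X t) xi) = Ubt chi (Y t).
  by apply/funext => x; rewrite hQ -eQ ec ey /Ubt mulrA.
have eh : (fun xi => 2 * (UL (X t) xi ^+ 2 + 2^-1 * kL (X t) ^+ 2 - PL chi (X t) xi) * wD (UL (X t)) xi) =
    (fun x => 2 * AS chi true (Y t) x * wD (US chi (Y t)) x).
  by apply/funext => x; rewrite hA eA.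
have h1 : has_tderiv (W := R -> R^o) Vspace (@Vnorm R) (fun s => zetaL (X s)) t (UL (X t)).
  exact: (sol_zeta t0 hC0).
have h2 : has_tderiv (W := R -> R^o) (@H1 R) (@H1norm R) (fun s => UbarL chi (X s)) t
    (fun xi => - QL chi (X t) xi - cL chi (X t) * chi' (yL (X t) xi) * UL (X t) xi).
  by rewrite eUt; exact: (sol_Ub t0 hC0).
have h3 : has_tderiv (W := R -> R^o) L2 L2norm (fun s => hL (X s)) t
    (fun xi => 2 * (UL (X t) xi ^+ 2 + 2^-1 * kL (X t) ^+ 2 - PL chi (X t) xi) * wD (UL (X t)) xi).
  by rewrite eh; exact: (sol_h t0).
have h4 : has_tderiv (W := R -> R^o) L2 L2norm (fun s => rbarL (X s)) t
    (fun xi => - kL (X t) * wD (UL (X t)) xi).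
  by rewrite ek_; exact: (sol_r t0 hC0).
have h5 := sol_ck t0.
by split.
Qed.

End Solution.

(** * Kernel defect of a nonmonotone y *)

Section Indicator.
Context {R : realType}.
Local Notation mu := (@lebesgue_measure R).
Implicit Types (a b : R) (q : R -> R).

Let patch_ind a b q : q \_ `[a, b] = (fun x => \1_(`[a, b]%classic) x * q x).
Proof. by apply/funext => x; rewrite patchE indicE; case: ifP => _; rewrite ?mul1r ?mul0r. Qed.

Lemma io_ind a b q : io a b q = It (fun x => \1_(`[a, b]%classic) x * q x).
Proof. by rewrite /io /It Rintegral_mkcond patch_ind. Qed.

Lemma ig_ind a b q : li q -> ig (fun x => \1_(`[a, b]%classic) x * q x).
Proof.
move=> [_ hq]; rewrite -patch_ind /ig -restrict_EFin; apply/integrable_restrict => //=.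
by rewrite setTI.
Qed.

End Indicator.

Section KernelDefect.
Local Opaque It io.
Context {R : realType}.
Local Notation mu := (@lebesgue_measure R).
Variables (ya ba y b f : R -> R) (M d Cf : R).
Hypothesis aya : ac ya ba.
Hypothesis ba0 : forall x, 0 <= ba x.
Hypothesis ay : ac y b.
Hypothesis hya : forall x, `|ya x - x| <= M.
Hypothesis hy : forall x, `|y x - x| <= M.
Hypothesis d0 : 0 < d.
Hypothesis dM : d <= 4 * M.
Hypothesis hd : forall x, `|y x - ya x| <= d.
Hypothesis mff : mf f.
Hypothesis igf : forall x, ig (fun s => ek (x - s) * f s).
Hypothesis hf : forall x, cv (fun s => `|f s|) x <= Cf.

Definition kdef x s := kap false y x s - kap true y x s.
Definition skdef x s := Num.sg (x - s) * kdef x s.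
(** The kernels can differ only where |ya(x) - ya(s)| is at most 2 d. The strip is taken twice as
    wide, so that a path leaving the bad set crosses the level 3 d while still inside it. *)
Definition near x s : R := if `|ya x - ya s| < 4 * d then 1 else 0.
Variables (E1 C1 : R).
Hypothesis eE : E1 = expR (2 * M).
Hypothesis eC : C1 = expR (18 * M).

Let homo : {homo ya : s t / s <= t}. Proof. exact: ac_homo aya ba0. Qed.
Let E10 : 0 <= E1. Proof. by rewrite eE expR_ge0. Qed.
Let C10 : 0 <= C1. Proof. by rewrite eC expR_ge0. Qed.
Let near0 x s : 0 <= near x s. Proof. by rewrite /near; case: ifP. Qed.
Let d24 : 2 * d < 4 * d. Proof. by move: d0 => h; lra. Qed.
Let d23 : 2 * d < 3 * d. Proof. by move: d0 => h; lra. Qed.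
Let d34 : 3 * d < 4 * d. Proof. by move: d0 => h; lra. Qed.
Let near1 x s : near x s <= 1. Proof. by rewrite /near; case: ifP. Qed.

(* The two kernels differ only where y fails to be nondecreasing, and there the
   nondecreasing ya is nearly constant. *)
Lemma kdef_bad x s : kdef x s != 0 -> `|ya x - ya s| <= 2 * d.
Proof.
apply: contraR; rewrite -ltNge /kdef /kap /sgk => h.
have := hd x; have := hd s; rewrite !ler_norml => /andP[s1 s2] /andP[x1 x2].
rewrite subr_eq0; apply/eqP; congr (expR (- _)); have [xs|sx|e] := ltgtP x s.
- rewrite ltr0_sg ?subr_lt0// mulN1r ler0_norm//.
  by move: h; rewrite ler0_norm ?subr_le0 ?homo ?(ltW xs)//; lra.
- rewrite gtr0_sg ?subr_gt0// mul1r ger0_norm//.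
  by move: h; rewrite ger0_norm ?subr_ge0 ?homo ?(ltW sx)//; lra.
- by rewrite e !subrr sgr0 mul0r normr0.
Qed.

Lemma kdef_le x s : `|kdef x s| <= E1 * near x s.
Proof.
have [->|/kdef_bad h] := eqVneq (kdef x s) 0; first by rewrite normr0 mulr_ge0.
have -> : near x s = 1.
  by rewrite /near ifT// (le_lt_trans h).
rewrite mulr1 /kdef; move: (kap_le false x s hy) (kap_le true x s hy); rewrite -eE => /andP[k1 k2] /andP[k3 k4].
have e1 : E1 * ek (x - s) <= E1 by rewrite ler_piMr// ek_le1.
have l1 := le_trans k2 e1; have l2 := le_trans k4 e1.
by rewrite ler_norml; apply/andP; split; lra.
Qed.

Let sh (u : R) := expR u - expR (- u).

Lemma sh_lip (u v : R) : `|u| <= 2 * M -> `|v| <= 2 * M -> `|sh u - sh v| <= 2 * E1 * `|u - v|.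
Proof.
move=> hu hv; have /andP[u1 u2] : - (2 * M) <= u <= 2 * M by rewrite -ler_norml.
have /andP[v1 v2] : - (2 * M) <= v <= 2 * M by rewrite -ler_norml.
have l (a : R) : - (2 * M) <= a -> expR (- a) <= E1 by move=> h; rewrite eE ler_expR; lra.
have h1 := expN_lip (l _ u1) (l _ v1).
have h2 := @expN_lip R (- u) (- v) E1 (l (- u) ltac:(lra)) (l (- v) ltac:(lra)).
rewrite !opprK in h2.
have -> : sh u - sh v = (expR u - expR v) - (expR (- u) - expR (- v)) by rewrite /sh; ring.
rewrite (le_trans (ler_normB _ _))// (le_trans (lerD h2 h1))//.
have e : `|- u + v| = `|u - v| by rewrite addrC distrC.
by rewrite e; lra.
Qed.

(** On one side of the diagonal the signed defect is a Lipschitz function of y(x) - y(s) that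
    vanishes where this difference has the right sign. Its variation in [x] is thereby bounded by
    that of [y]. *)
Lemma skdef_r x s : s <= x -> skdef x s = sh (Num.min 0 (y x - y s)).
Proof.
rewrite le_eqVlt => /predU1P[->|sx].
  by rewrite /skdef !subrr sgr0 mul0r minxx /sh oppr0 subrr.
rewrite /skdef /kdef /kap /sgk gtr0_sg ?subr_gt0// !mul1r /sh.
have [u0|u0] := leP 0 (y x - y s).
  by rewrite ger0_norm// oppr0 !subrr.
by rewrite ltr0_norm// opprK.
Qed.

Lemma skdef_l x s : x <= s -> skdef x s = sh (Num.max 0 (y x - y s)).
Proof.
rewrite le_eqVlt => /predU1P[->|xs].
  by rewrite /skdef !subrr sgr0 mul0r maxxx /sh oppr0 subrr.
rewrite /skdef /kdef /kap /sgk ltr0_sg ?subr_lt0// !mulN1r /sh opprK.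
have [u0|u0] := leP 0 (y x - y s).
  by rewrite ger0_norm// opprB.
by rewrite ltr0_norm// opprK !subrr oppr0 subrr.
Qed.

Let bnd x s : - (2 * M) + (x - s) <= y x - y s /\ y x - y s <= 2 * M + (x - s).
Proof.
by have := hy x; have := hy s; rewrite !ler_norml => /andP[a1 a2] /andP[b1 b2]; split; lra.
Qed.

Let M0 : 0 <= M. Proof. exact: le_trans (normr_ge0 _) (hy 0). Qed.

Let incr x1 x2 s : s <= x1 <= x2 \/ x1 <= x2 <= s -> `|skdef x2 s - skdef x1 s| <= 2 * E1 * `|y x2 - y x1|.
Proof.
have e : y x2 - y x1 = (y x2 - y s) - (y x1 - y s) by ring.
have [b1 b2] := bnd x1 s; have [b3 b4] := bnd x2 s; rewrite e.
move=> [/andP[h1 h2]|/andP[h1 h2]].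
  rewrite !skdef_r//; last exact: le_trans h2.
  have m (u : R) : - (2 * M) <= u -> `|Num.min 0 u| <= 2 * M.
    by move=> hu; rewrite ler_norml; case: (leP 0 u) => u0; apply/andP; split; move: M0; lra.
  apply: (le_trans (sh_lip (m _ _) (m _ _))); rewrite ?ler_wpM2l ?mulr_ge0//; try lra.
  move: (y x2 - y s) (y x1 - y s) => u v.
  case: (leP 0 u) => u0; case: (leP 0 v) => v0; rewrite ?subrr ?normr0// ?sub0r ?subr0 ?normrN.
    by rewrite ltr0_norm// ler_normr; apply/orP; left; lra.
  by rewrite ltr0_norm// ler_normr; apply/orP; right; lra.
rewrite !skdef_l//; last exact: le_trans h2.
have m (u : R) : u <= 2 * M -> `|Num.max 0 u| <= 2 * M.
  by move=> hu; rewrite ler_norml; case: (leP 0 u) => u0; apply/andP; split; move: M0; lra.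
apply: (le_trans (sh_lip (m _ _) (m _ _))); rewrite ?ler_wpM2l ?mulr_ge0//; try lra.
move: (y x2 - y s) (y x1 - y s) => u v.
case: (leP 0 u) => u0; case: (leP 0 v) => v0; rewrite ?subrr ?normr0// ?sub0r ?subr0 ?normrN.
  by rewrite ger0_norm// ler_normr; apply/orP; left; lra.
by rewrite ger0_norm// ler_normr; apply/orP; right; lra.
Qed.

Let lb := li_abs (ac_li ay).
Let b0 x : 0 <= `|b x|. Proof. by []. Qed.

Let incr_io x1 x2 : x1 <= x2 -> `|y x2 - y x1| <= io x1 x2 (fun x => `|b x|).
Proof. by move=> h; rewrite ay.2//; exact: io_norm (ac_li ay). Qed.

(** The formulas on the two sides of the diagonal agree at [s], where an interval containing [s] is
    cut. *)
Lemma skdef_int x1 x2 s : x1 <= x2 -> `|skdef x2 s - skdef x1 s| <= 2 * E1 * io x1 x2 (fun x => `|b x|).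
Proof.
move=> h; have two p q : p <= q -> (s <= p <= q \/ p <= q <= s) ->
    `|skdef q s - skdef p s| <= 2 * E1 * io p q (fun x => `|b x|).
  move=> pq h'; apply: (le_trans (incr h')); rewrite ler_wpM2l ?mulr_ge0//; exact: incr_io.
have [s1|s1] := leP s x1; first by apply: two => //; left; rewrite s1.
have [s2|s2] := leP x2 s; first by apply: two => //; right; rewrite h.
have -> : skdef x2 s - skdef x1 s = (skdef x2 s - skdef s s) + (skdef s s - skdef x1 s) by ring.
rewrite (io_cat lb (ltW s1) (ltW s2)) mulrDr addrC (le_trans (ler_normD _ _))// lerD//.
  by apply: two (ltW s1) _; right; rewrite (ltW s1) lexx.
by apply: two (ltW s2) _; left; rewrite lexx (ltW s2).
Qed.

Let mya := mf_cont (ac_cont aya).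

Lemma measurable_near d' (T : measurableType d') (u v : T -> R) :
  measurable_fun setT u -> measurable_fun setT v ->
  measurable_fun setT (fun p => near (u p) (v p)).
Proof.
move=> mu' mv; apply: measurable_fun_ifT; [|exact: measurable_cst|exact: measurable_cst].
apply: measurable_fun_ltr; last exact: measurable_cst.
apply: (measurableT_comp (mf_abs (@mf_id R))).
by apply: measurable_funB; [exact: (measurableT_comp mya mu')|exact: (measurableT_comp mya mv)].
Qed.

Let mnl s : mf (fun x => near x s).
Proof. by apply: measurable_near; [exact: measurable_id|exact: measurable_cst]. Qed.
Let mnr x : mf (fun s => near x s).
Proof. by apply: measurable_near; [exact: measurable_cst|exact: measurable_id]. Qed.

Let lbn s : li (fun x => `|b x| * near x s).
Proof.
apply: liM => // p q; exists 1 => x _; by rewrite ger0_norm.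
Qed.

(** If one endpoint is outside the strip, the defect vanishes there, and equally at an intermediate
    point where |ya - ya(s)| is 3 d, given by the intermediate value theorem. From that point on the
    monotone [ya] keeps the path in the strip, where [skdef_int] applies. *)
Lemma skdef_loc x1 x2 s : x1 <= x2 ->
  `|skdef x2 s - skdef x1 s| <= 2 * E1 * io x1 x2 (fun x => `|b x| * near x s).
Proof.
have nz p : 2 * d < `|ya p - ya s| -> skdef p s = 0.
  move=> h; rewrite /skdef; have [->|/kdef_bad] := eqVneq (kdef p s) 0; first by rewrite mulr0.
  by rewrite leNgt h.
have H p q : p <= q -> `|ya p - ya s| < 4 * d -> `|ya q - ya s| < 4 * d ->
    `|skdef q s - skdef p s| <= 2 * E1 * io p q (fun x => `|b x| * near x s).
  move=> pq np nq; rewrite (io_eq (g := fun x => `|b x|)); first exact: skdef_int.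
  move=> x /andP[px xq]; rewrite /near ifT ?mulr1//.
  have := homo px; have := homo xq; move: np nq; rewrite !ltr_norml.
  by move=> /andP[? ?] /andP[? ?] ? ?; apply/andP; split; lra.
have cya : continuous ya := ac_cont aya.
have E2 : 0 <= 2 * E1 by rewrite mulr_ge0.
have up p q p' q' : p <= p' -> p' <= q' -> q' <= q ->
    2 * E1 * io p' q' (fun x => `|b x| * near x s) <= 2 * E1 * io p q (fun x => `|b x| * near x s).
  by move=> h1 h2 h3; rewrite ler_wpM2l//; apply: io_mono => // x; rewrite mulr_ge0.
move=> h12; have m12 := homo h12.
have R0 : 0 <= 2 * E1 * io x1 x2 (fun x => `|b x| * near x s).
  by rewrite mulr_ge0// io_ge0// => x _; rewrite mulr_ge0.
have [f1|n1] := ltP (2 * d) `|ya x1 - ya s|.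
  rewrite (nz _ f1) subr0; have [f2|n2] := ltP (2 * d) `|ya x2 - ya s|.
    by rewrite (nz _ f2) normr0.
  have n2' : `|ya x2 - ya s| < 4 * d by exact: le_lt_trans n2 d24.
  have [n1'|f1'] := ltP `|ya x1 - ya s| (4 * d).
    by rewrite -[skdef x2 s]subr0 -(nz _ f1); exact: H.
  have l1 : ya x1 <= ya s - 4 * d.
    move: f1'; rewrite ler_normr => /orP[|]; last lra.
    by move: n2; rewrite ler_norml => /andP[? ?]; move: d0; lra.
  have [|c c12 yc] := @IVT _ ya x1 x2 (ya s - 3 * d) h12 (continuous_subspaceT cya).
    rewrite min_l// max_r//; move: n2 d0; rewrite ler_norml => /andP[? ?] ?.
    by apply/andP; split; lra.
  move: c12; rewrite in_itv/= => /andP[c1 c2].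
  have fc : `|ya c - ya s| = 3 * d.
    by rewrite yc addrAC subrr sub0r normrN ger0_norm// mulr_ge0// ltW.
  rewrite -[skdef x2 s]subr0 -(nz c); last by rewrite fc.
  apply: (le_trans (H c x2 c2 _ n2')); last exact: up.
  by rewrite fc.
have n1' : `|ya x1 - ya s| < 4 * d by exact: le_lt_trans n1 d24.
have [n2'|f2'] := ltP `|ya x2 - ya s| (4 * d); first exact: H.
have l2 : ya s + 4 * d <= ya x2.
  move: f2'; rewrite ler_normr => /orP[|]; first lra.
  by move: n1; rewrite ler_norml => /andP[? ?]; move: d0; lra.
have f2 : 2 * d < `|ya x2 - ya s| by exact: lt_le_trans d24 f2'.
have [|c c12 yc] := @IVT _ ya x1 x2 (ya s + 3 * d) h12 (continuous_subspaceT cya).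
  rewrite min_l// max_r//; move: n1 d0; rewrite ler_norml => /andP[? ?] ?.
  by apply/andP; split; lra.
move: c12; rewrite in_itv/= => /andP[c1 c2].
have fc : `|ya c - ya s| = 3 * d.
  by rewrite yc addrC addKr ger0_norm// mulr_ge0// ltW.
rewrite (nz _ f2) -(nz c); last by rewrite fc.
apply: (le_trans (H x1 c c1 n1' _)); last exact: up.
by rewrite fc.
Qed.

Definition nearf x := It (fun s => near x s * `|f s|).

Lemma near_ek x s : near x s <= C1 * ek (x - s) /\ forall x0, ek (x0 - x) * near x s <= C1 * ek (x0 - s) * near x s.
Proof.
rewrite /near; case: ifP => [h|_]; last first.
  by split=> [|x0]; rewrite ?mulr0//; exact: mulr_ge0 C10 (ek_ge0 _).
(* |x - s| is less than 4 d + 2 M, and d is at most 4 M. *)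
have xs : `|x - s| <= 18 * M.
  have := hya x; have := hya s; move: h; rewrite ltr_norml !ler_norml.
  by move=> /andP[? ?] /andP[? ?] /andP[? ?]; apply/andP; split; move: dM; lra.
split=> [|x0].
  rewrite eC /ek -expRD -[leLHS]expR0 ler_expR; lra.
rewrite !mulr1 (le_trans (ek_tri (x0 - x) (x0 - s)))// ler_wpM2r ?ek_ge0// eC ler_expR.
by rewrite opprB addrC addrA subrK distrC.
Qed.

Let ignf x : ig (fun s => near x s * `|f s|).
Proof.
apply: (ig_le (mfM (mnr x) (mf_abs mff)) _ (igZ C1 (ig_ekabs (igf x)))) => s.
by rewrite normrM normr_id ger0_norm// mulrA ler_wpM2r//; exact: (near_ek x s).1.
Qed.

Lemma nearf_le x : 0 <= nearf x <= C1 * Cf.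
Proof.
apply/andP; split; first by apply: It_ge0 => s; rewrite mulr_ge0.
apply: (@le_trans _ _ (C1 * cv (fun s => `|f s|) x)); last by rewrite ler_wpM2l.
rewrite /cv -ItZ; last exact: ig_ekabs.
apply: It_le => [//|//|s]; first by apply: igZ; exact: ig_ekabs.
by rewrite mulrA ler_wpM2r//; exact: (near_ek x s).1.
Qed.

Let mp1 : measurable_fun setT (fun p : R * R => p.1 : R). Proof. exact: measurable_fst. Qed.
Let mp2 : measurable_fun setT (fun p : R * R => p.2 : R). Proof. exact: measurable_snd. Qed.

Lemma mf_nearf : mf nearf.
Proof.
apply: (tonelliR (k := fun p => near p.1 p.2 * `|f p.2|)) => //.
  apply: measurable_funM; first exact: measurable_near.
  exact: (measurableT_comp (mf_abs mff) mp2).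
by move=> z; rewrite mulr_ge0.
Qed.

Let swap (g : R -> R) : mf g -> (forall x, 0 <= g x) -> ig g -> (forall s, ig (fun x => near x s * g x)) ->
  ig (fun s => `|f s| * It (fun x => near x s * g x)) /\
  It (fun s => `|f s| * It (fun x => near x s * g x)) = It (fun x => g x * nearf x).
Proof.
move=> mg g0 ig_ i1.
pose k (p : R * R) := near p.2 p.1 * g p.2 * `|f p.1|.
have mk : measurable_fun setT k.
  apply: measurable_funM; last exact: (measurableT_comp (mf_abs mff) mp1).
  by apply: measurable_funM; [exact: measurable_near|exact: (measurableT_comp mg mp2)].
have k0 p : 0 <= k p by rewrite !mulr_ge0.
have e1 s : It (fun x => k (s, x)) = `|f s| * It (fun x => near x s * g x).
  by rewrite /k /= -ItZ//; congr It; apply/funext => x; rewrite mulrC.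
have e2 x : It (fun s => k (s, x)) = g x * nearf x.
  by rewrite /k /nearf /= -ItZ//; congr It; apply/funext => s; rewrite mulrA (mulrC (g x)).
have [|||i e] := tonelli_swap mk k0.
- move=> s; have := igZ `|f s| (i1 s); congr ig; apply/funext => x; exact: mulrC.
- move=> x; have := igZ (g x) (ignf x); congr ig; apply/funext => s.
  by rewrite /k /= mulrA (mulrC (g x)).
- have -> : (fun x => It (fun s => k (s, x))) = (fun x => g x * nearf x) by apply/funext.
  apply: (ig_le (mfM mg mf_nearf) _ (igZ (C1 * Cf) ig_)) => x.
  have /andP[n0 n1] := nearf_le x; rewrite normrM (ger0_norm (g0 x)) (ger0_norm n0) mulrC.
  by rewrite ler_wpM2r.
split; first by move: i; congr ig; apply/funext => s; exact: e1.
by under eq_fun do rewrite -e1; rewrite e; congr It; apply/funext.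
Qed.

Let igk sgd x : ig (fun s => kap sgd y x s * f s).
Proof. exact: (ig_kap sgd (mf_cont (ac_cont ay)) mff hy (igf x)). Qed.

Let sgd_ig sgd x : ig (fun s => Num.sg (x - s) * kap sgd y x s * f s).
Proof.
apply: (ig_le _ _ (ig_abs (igk sgd x))).
  apply: mfM mff; apply: mfM; last exact: (mf_kapL sgd x (mf_cont (ac_cont ay))).
  by apply: mf_sg; apply: mfB; [exact: mf_cst|exact: mf_id].
by move=> s; rewrite -mulrA normrM normr_sg ler_piMl//; case: (_ != _).
Qed.

Lemma It_kdef x :
  `|It (fun s => kap false y x s * f s) - It (fun s => kap true y x s * f s)| <= E1 * nearf x.
Proof.
rewrite -ItB// /nearf -ItZ//; apply: It_normle; [exact: igB|exact: igZ|].
by move=> s; rewrite -mulrBl normrM mulrA ler_wpM2r//; exact: kdef_le.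
Qed.

Let D x := It (fun s => Num.sg (x - s) * kap false y x s * f s) - It (fun s => Num.sg (x - s) * kap true y x s * f s).

(** Increments are estimated, rather than values, because it is the derivative of the Q defect that
    enters the equation. Tonelli exchanges the integral over the strip with the one against |f|. *)
Lemma It_skdef x1 x2 : x1 <= x2 -> `|D x2 - D x1| <= 2 * E1 * io x1 x2 (fun x => `|b x| * nearf x).
Proof.
move=> h12; have De x : ig (fun s => skdef x s * f s) /\ D x = It (fun s => skdef x s * f s).
  have e : (fun s => skdef x s * f s) = (fun s => Num.sg (x - s) * kap false y x s * f s -
      Num.sg (x - s) * kap true y x s * f s).
    by apply/funext => s; rewrite /skdef /kdef; ring.
  by rewrite /D -ItB// e; split=> //; exact: igB.
have [[i1 e1] [i2 e2]] := (De x1, De x2).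
pose g x : R := \1_(`[x1, x2]%classic) x * `|b x|.
have ig_ : ig g by exact: ig_ind lb.
have g0 x : 0 <= g x by rewrite mulr_ge0// indicE.
have i3 s : ig (fun x => near x s * g x).
  have := ig_ind x1 x2 (lbn s); congr ig; apply/funext => x; rewrite /g; ring.
have [i4 e4] := swap (ig_mf ig_) g0 ig_ i3.
rewrite e2 e1 -ItB// io_ind.
have -> : It (fun x => \1_(`[x1, x2]%classic) x * (`|b x| * nearf x)) = It (fun x => g x * nearf x).
  by congr It; apply/funext => x; rewrite mulrA.
rewrite -e4 -ItZ//; apply: It_normle; [exact: igB|exact: igZ|] => s.
rewrite -mulrBl normrM mulrC mulrCA ler_wpM2l//.
apply: (le_trans (skdef_loc s h12)); rewrite io_ind le_eqVlt; apply/orP; left; apply/eqP; congr (_ * It _).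
by apply/funext => x; rewrite /g; ring.
Qed.

(* the ya-measure of a level strip is its height *)
Lemma strip_le s : ig (fun x => near x s * ba x) /\ It (fun x => near x s * ba x) <= 8 * d.
Proof.
have cya : continuous ya := ac_cont aya.
pose p := s - (2 * M + 4 * d); pose q := s + (2 * M + 4 * d).
have pq : p <= q by rewrite /p /q; move: M0 d0; lra.
have yp : ya p <= ya s - 4 * d.
  by have := hya p; have := hya s; rewrite !ler_norml /p => /andP[? ?] /andP[? ?]; lra.
have yq : ya s + 4 * d <= ya q.
  by have := hya q; have := hya s; rewrite !ler_norml /q => /andP[? ?] /andP[? ?]; lra.
have [|l l12 yl] := @IVT _ ya p q (ya s - 4 * d) pq (continuous_subspaceT cya).
  by rewrite min_l ?homo// max_r ?homo//; apply/andP; split; move: d0; lra.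
have [|r r12 yr] := @IVT _ ya p q (ya s + 4 * d) pq (continuous_subspaceT cya).
  by rewrite min_l ?homo// max_r ?homo//; apply/andP; split; move: d0; lra.
have lr : l <= r.
  by rewrite leNgt; apply/negP => /ltW/homo; rewrite yl yr; move: d0; lra.
have supp x : near x s != 0 -> l <= x <= r.
  rewrite /near; case: ifP => [|_]; last by rewrite eqxx.
  rewrite ltr_norml => /andP[h1 h2] _; apply/andP; split; rewrite leNgt; apply/negP => /ltW/homo.
    by rewrite yl; lra.
  by rewrite yr; lra.
have lba := ac_li aya.
have iI : ig (fun x => \1_(`[l, r]%classic) x * ba x).
  exact: ig_ind.
have le x : near x s * ba x <= \1_(`[l, r]%classic) x * ba x.
  rewrite ler_wpM2r//; have [->|/supp h] := eqVneq (near x s) 0; first by rewrite indicE.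
  by rewrite indicE mem_set.
have i : ig (fun x => near x s * ba x).
  by apply: (ig_le (mfM (mnl s) lba.1) _ iI) => x; rewrite ger0_norm// mulr_ge0.
split=> //; apply: (le_trans (It_le i iI le)).
by rewrite -io_ind -aya.2// yl yr; lra.
Qed.

(** Bound |b| by ba + |b - ba|. Against [ba], Tonelli and the measure of the strip give the factor 8
    d; against |b - ba|, [nearf] is merely bounded, but that factor is itself a difference of the
    two solutions. *)
Lemma defect_cv x0 : ig (fun x => ek (x0 - x) * ba x) -> ig (fun x => ek (x0 - x) * `|b x - ba x|) ->
  It (fun x => ek (x0 - x) * (`|b x| * nearf x)) <=
  8 * C1 * Cf * d + C1 * Cf * It (fun x => ek (x0 - x) * `|b x - ba x|).
Proof.
have nb x : nearf x <= C1 * Cf /\ 0 <= nearf x by have /andP[] := nearf_le x.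
have ign (q : R -> R) : ig q -> ig (fun x => q x * nearf x).
  move=> iq; apply: (ig_le (mfM (ig_mf iq) mf_nearf) _ (igZ (C1 * Cf) (ig_abs iq))) => x.
  by have [h1 h2] := nb x; rewrite normrM (ger0_norm h2) mulrC ler_wpM2r.
move=> i1 i2; pose g x := ek (x0 - x) * ba x.
have g0 x : 0 <= g x by rewrite mulr_ge0// ek_ge0.
have le s x : near x s * g x <= C1 * ek (x0 - s) * (near x s * ba x).
  by rewrite /g mulrCA !mulrA ler_wpM2r//; have [_ h] := near_ek x s; exact: h.
have i3 s : ig (fun x => near x s * g x).
  apply: (ig_le (mfM (mnl s) (ig_mf i1)) _ (igZ (C1 * ek (x0 - s)) (strip_le s).1)) => x.
  by rewrite ger0_norm; [exact: le|exact: mulr_ge0 (near0 _ _) (g0 x)].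
have [i4 e4] := swap (ig_mf i1) g0 i1 i3.
have t1 : It (fun x => g x * nearf x) <= 8 * C1 * Cf * d.
  rewrite -e4; apply: (@le_trans _ _ (It (fun s => C1 * (8 * d) * (ek (x0 - s) * `|f s|)))).
    apply: It_le => [//||s]; first by apply: igZ; exact: ig_ekabs.
    rewrite [leRHS]mulrA [leRHS]mulrC ler_wpM2l//.
    apply: (le_trans (It_le (i3 s) (igZ _ (strip_le s).1) (le s))); rewrite ItZ ?(strip_le s).1//.
    rewrite [leRHS]mulrAC; apply: ler_wpM2l (strip_le s).2; exact: mulr_ge0 C10 (ek_ge0 _).
  rewrite ItZ; last exact: ig_ekabs.
  have -> : 8 * C1 * Cf * d = C1 * (8 * d) * Cf by ring.
  by apply: ler_wpM2l (hf x0); exact: mulr_ge0 C10 (mulr_ge0 (ler0n _ _) (ltW d0)).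
clear le i3 i4 e4.
have igs := igD (ign _ i1) (ign _ i2).
apply: (@le_trans _ _ (It (fun x => g x * nearf x + ek (x0 - x) * `|b x - ba x| * nearf x))).
  have le2 x : ek (x0 - x) * (`|b x| * nearf x) <= g x * nearf x + ek (x0 - x) * `|b x - ba x| * nearf x.
    rewrite mulrA -mulrDl; apply: ler_wpM2r (nb x).2 _ _ _.
    rewrite -mulrDr; apply: ler_wpM2l (ek_ge0 _) _ _ _.
    by rewrite -{1}[b x](subrK (ba x)) (le_trans (ler_normD _ _))// addrC (ger0_norm (ba0 x)).
  apply: It_le => //; apply: (ig_le _ _ igs).
    by apply: mfM (mf_ek x0) _; apply: mfM mf_nearf; exact: lb.1.
  move=> x; rewrite ger0_norm; first exact: le2.
  exact: mulr_ge0 (ek_ge0 _) (mulr_ge0 (normr_ge0 _) (nb x).2).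
rewrite ItD; [|exact: ign|exact: ign]; apply: lerD; first exact: t1.
rewrite -ItZ//; apply: It_le; [exact: ign|exact: igZ|] => x.
by rewrite mulrC ler_wpM2r ?mulr_ge0 ?ek_ge0//; exact: (nb x).1.
Qed.

End KernelDefect.

(** * The derivative defect in the uniformly local norm *)

Section Defect.
Context {R : realType}.
Local Notation mu := (@lebesgue_measure R).
Implicit Types (f g : R -> R).

Lemma L2_Lu f : L2 f -> Lu f /\ Lun f <= 2 * L2norm f.
Proof.
move=> Lf; have [i h _ _] := cv_L2 Lf.
have h' x : `|cv (fun s => `|f s|) x| <= 2 * L2norm f by rewrite ger0_norm// cv_ge0.
split; last exact: supn_le.
by split; [exact: L2_mf|exact: i|exists (2 * L2norm f)].
Qed.

Lemma Lun_ae0 f : mf f -> {ae mu, forall x, f x = 0} -> Lun f <= 0.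
Proof.
move=> m h; apply: supn_le => x.
have [||_] := It_ae (@ig0 R) (g := fun s => ek (x - s) * `|f s|).
- by apply: mfM (mf_ek x) _; exact: mf_abs.
- by apply: aeS h => s -> _; rewrite normr0 mulr0.
- rewrite /cv => <-; have := ItZ 0 (@ig0 R); rewrite mul0r => e.
  by rewrite e mul0r normr0.
Qed.

Lemma Lun_eq0 f : Lu f -> Lun f <= 0 -> {ae mu, forall x, f x = 0}.
Proof.
move=> [m i b] n0; have := supn_ge 0 b; rewrite -/(Lun f) => /le_trans/(_ n0).
rewrite normr_le0 => /eqP e.
have := It0_ae (ig_ekabs (i 0)) (fun s => mulr_ge0 (ek_ge0 _) (normr_ge0 _)) e.
by apply: aeS => x /eqP; rewrite mulf_eq0 gt_eqF ?ek_gt0//= normr_eq0 => /eqP.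
Qed.

Lemma It_le_ae f g : mf f -> ig g -> (forall x, 0 <= f x) -> {ae mu, forall x, f x <= g x} -> It f <= It g.
Proof.
move=> m i f0 h; have mg := ig_mf i.
pose q x := if f x <= g x then f x else 0.
have mq : mf q.
  by apply: measurable_fun_ifT => //; exact: measurable_fun_ler.
have iq : ig q.
  apply: ig_le mq _ (ig_abs i) => x; rewrite /q; case: ifP => [le|_]; last by rewrite normr0.
  by rewrite ger0_norm// (le_trans le)// ler_norm.
have [|_ <-] := It_ae iq m; first by apply: aeS h => x le _; rewrite /q le.
rewrite -subr_ge0 -ItB//.
have p0 x : 0 <= (if f x <= g x then g x - f x else 0).
  by case: ifP => // le; rewrite subr_ge0.
have [||_ ->] := It_ae (igB i iq) (g := fun x => if f x <= g x then g x - f x else 0).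
- by apply: measurable_fun_ifT; [exact: measurable_fun_ler|exact: mfB|exact: measurable_cst].
- by apply: aeS h => x le _; rewrite /q le.
- exact: It_ge0.
Qed.

Variables (chi : R -> R) (chiP : cutoff chi).
Local Opaque It io.

(** [v] is the actual derivative of -Q with the unsigned kernel, while [vh (FS chi false z)] is the
    formula valid for nondecreasing y. With the signed kernel formula and derivative coincide by
    [FS_ac], so the gap is the kernel defect of P times y_x plus the derivative of the kernel defect
    of Q. *)
Lemma vh_defect (z za : st R) (v : R -> R) (M d Cf : R) :
  SS (@L2 R) z -> ac (ze z) (ww z) -> SA za -> GE chi za ->
  (forall x, `|ze z x| <= M) -> (forall x, `|ze za x| <= M) -> (forall x, `|ze z x - ze za x| <= d) ->
  0 < d -> d <= 4 * M -> (forall x, cv (fun s => `|fS chi z s|) x <= Cf) ->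
  ac (fun x => - QS chi false z x) v ->
  Lun (fun x => vh (FS chi false z) x - v x) <=
  expR (2 * M) * (8 * expR (18 * M) * Cf * d + expR (18 * M) * Cf * Lun (fun x => ww z x - ww za x)).
Proof.
move=> sz az Sa Ga hz hza hd d0 dM hf av; have f2 := @fnorm_L2 R.
have ay : ac (yS z) (fun x => 1 + ww z x) by exact: acD (@ac_id R) az.
have aya := ac_y Sa; have ba0 x : 0 <= 1 + ww za x by have [] := Ga x.
have hy x : `|yS z x - x| <= M by rewrite /yS addrC addKr.
have hya x : `|yS za x - x| <= M by rewrite /yS addrC addKr.
have hd' x : `|yS z x - yS za x| <= d by rewrite /yS opprD addrACA subrr add0r.
have [df _ _] := SS_fS chiP f2 false sz; have mff := fn_mf f2 df; have igf := fn_ig f2 df.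
pose B := nearf (yS za) (fS chi z) d.
have [E eE] : exists E, E = expR (2 * M) by exists (expR (2 * M)).
have [C1 eC] : exists C, C = expR (18 * M) by exists (expR (18 * M)).
rewrite -eE -eC; have E0 : 0 <= E by rewrite eE expR_ge0.
have C10 : 0 <= C1 by rewrite eC expR_ge0.
have mB : mf B := mf_nearf aya hya dM mff igf eC.
have B01 := nearf_le aya hya dM mff igf hf eC.
have K1 := It_kdef aya ba0 ay hya hy d0 dM hd' mff igf eE eC.
have K2 := It_skdef aya ba0 ay hya hy d0 dM hd' mff igf hf eE eC.
have K3 := defect_cv aya ba0 ay hya hy d0 dM mff igf hf eC.
rewrite -/B in K1 K2 K3 B01.
have B0 x : 0 <= B x by have /andP[] := B01 x.
have aT := FS_ac chiP f2 sz az.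
have lb := li_abs (ac_li ay).
have lbB : li (fun x => `|1 + ww z x| * B x).
  apply: liM lb mB _ => p q; exists (C1 * Cf) => x _; rewrite ger0_norm//; by have /andP[] := B01 x.
have r1 x : `|vh (FS chi false z) x - vh (FS chi true z) x| <= 4^-1 * E * (`|1 + ww z x| * B x).
  have -> : vh (FS chi false z) x - vh (FS chi true z) x = - (4^-1 * (It (fun s => kap false (yS z) x s * fS chi z s) -
      It (fun s => kap true (yS z) x s * fS chi z s)) * (1 + ww z x)).
    have e u : vh (FS chi u z) x = 2^-1 * hh z x + kk z * rbS z x + (AS chi u z x + AS chi u z x * ww z x) by [].
    by rewrite !e /AS /PbS; move: (It _) (It _) => *; ring.
  rewrite normrN !normrM ger0_norm// -!mulrA ler_wpM2l//.
  by rewrite [leRHS]mulrCA [leRHS]mulrC ler_wpM2r// K1.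
have a2 := acB aT av.
have r2 p q : p <= q -> `|io p q (fun x => vh (FS chi true z) x - v x)| <= 2^-1 * E * io p q (fun x => `|1 + ww z x| * B x).
  move=> pq; rewrite -(a2.2 p q pq); have := K2 p q pq.
  set D2 := (X in `|X - _|); set D1 := (X in `|_ - X|) => h.
  have -> : uh (FS chi true z) q - (- QS chi false z q) - (uh (FS chi true z) p - (- QS chi false z p)) = - 4^-1 * (D2 - D1).
    have e u : uh (FS chi true z) u = - QS chi true z u by [].
    rewrite (e q) (e p) /QS /QbS /D1 /D2; move: (It _) (It _) (It _) (It _) (cc z * _) (cc z * _).
    by clear=> *; ring.
  have p4 : 0 <= 4^-1 :> R by rewrite invr_ge0.
  rewrite normrM normrN (ger0_norm p4).
  have -> : 2^-1 * E * io p q (fun x => `|1 + ww z x| * B x) = 4^-1 * (2 * E * io p q (fun x => `|1 + ww z x| * B x)) by field.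
  exact: ler_wpM2l p4 _ _ h.
have l2 := ac_li a2; have lE := liZ (2^-1 * E) lbB.
(* A bound on the increments over all intervals is a bound on the derivative almost everywhere, by
   [io_ge0_ae] applied with both signs. *)
have r2' : {ae mu, forall x, `|vh (FS chi true z) x - v x| <= 2^-1 * E * (`|1 + ww z x| * B x)}.
  have p1 := io_ge0_ae (liB lE l2) _; have p2 := io_ge0_ae (liD lE l2) _.
  apply: (aeS2 _ (p1 _) (p2 _)) => [x q1 q2|p q pq|p q pq].
  - by rewrite ler_norml; apply/andP; split; lra.
  - rewrite (ioB p q lE l2) (ioZ p q _ lbB) subr_ge0 (le_trans (ler_norm _))//; exact: r2.
  - rewrite (ioD p q lE l2) (ioZ p q _ lbB); have := r2 p q pq.
    by rewrite ler_norml => /andP[h _]; rewrite addrC -lerBlDr sub0r.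
have rr : {ae mu, forall x, `|vh (FS chi false z) x - v x| <= E * (`|1 + ww z x| * B x)}.
  apply: aeS r2' => x h.
  have -> : vh (FS chi false z) x - v x = (vh (FS chi false z) x - vh (FS chi true z) x) + (vh (FS chi true z) x - v x).
    by rewrite addrA subrK.
  rewrite (le_trans (ler_normD _ _))// (le_trans (lerD (r1 x) h))//.
  have : 0 <= E * (`|1 + ww z x| * B x) by rewrite mulr_ge0// mulr_ge0.
  by move: (`|1 + ww z x| * B x) => q; lra.
have Lw : L2 (ww z) by have [_ _ h _ _] := sz.
have Lwa : L2 (ww za) by have [[_ _ [h _] _ _] _] := Sa.
have Ld := snB (sn_fn f2) Lw Lwa; have [[_ _ bw] _] := L2_Lu Ld.
have mv : mf v := li_mf (ac_li av).
have mvF : mf (vh (FS chi false z)) by have [_ [_ _ _ h _] _] := SS_fS chiP f2 false sz; exact: L2_mf h.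
apply: supn_le => x0; rewrite ger0_norm; last exact: cv_ge0.
have i1 : ig (fun x => ek (x0 - x) * (1 + ww za x)).
  have := igD (ek_int x0).1 (fn_ig f2 Lwa x0); congr ig; apply/funext => x; by rewrite mulrDr mulr1.
have i1' : ig (fun x => ek (x0 - x) * (1 + ww z x)).
  have := igD (ek_int x0).1 (fn_ig f2 Lw x0); congr ig; apply/funext => x; by rewrite mulrDr mulr1.
have ed : (fun x => ek (x0 - x) * `|1 + ww z x - (1 + ww za x)|) = (fun x => ek (x0 - x) * `|ww z x - ww za x|).
  by apply/funext => x; rewrite opprD addrACA subrr add0r.
have i2 : ig (fun x => ek (x0 - x) * `|1 + ww z x - (1 + ww za x)|).
  by rewrite ed; exact: ig_ekabs (fn_ig f2 Ld x0).
have iB : ig (fun x => ek (x0 - x) * (`|1 + ww z x| * B x)).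
  apply: (ig_le _ _ (igZ (C1 * Cf) (ig_ekabs i1'))).
    by apply: mfM (mf_ek x0) _; exact: li_mf lbB.
  move=> x; have /andP[b0 b1] := B01 x; rewrite ger0_norm; last exact: mulr_ge0 (ek_ge0 _) (mulr_ge0 (normr_ge0 _) b0).
  rewrite [leRHS]mulrCA; apply: ler_wpM2l (ek_ge0 _) _ _ _.
  by rewrite [leLHS]mulrC; exact: ler_wpM2r.
apply: (@le_trans _ _ (It (fun x => E * (ek (x0 - x) * (`|1 + ww z x| * B x))))).
  apply: It_le_ae; [|exact: igZ|by move=> x; exact: mulr_ge0 (ek_ge0 _) (normr_ge0 _)|].
    by apply: mfM (mf_ek x0) _; apply: mf_abs; exact: mfB.
  by apply: aeS rr => x h; rewrite [leRHS]mulrCA; exact: ler_wpM2l (ek_ge0 _) _ _ h.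
rewrite ItZ//; apply: ler_wpM2l => //; apply: (le_trans (K3 x0 i1 i2)).
have Cf0 : 0 <= C1 * Cf by have /andP[a b] := B01 0; exact: le_trans a b.
rewrite lerD2l; apply: ler_wpM2l => //; rewrite ed.
have := supn_ge x0 bw; rewrite ger0_norm; first exact; exact: cv_ge0.
Qed.

End Defect.

(** * Uniqueness and conclusion *)

Section CurveGeneral.
Context {R : realType}.
Local Notation mu := (@lebesgue_measure R).

Lemma tdiff_bdd (W : lmodType R) (S : set W) (N : W -> R) u du T : seminormed S N ->
  (forall t, 0 <= t -> S (u t)) -> (forall t, 0 <= t -> S (du t)) ->
  (forall t, 0 <= t -> tdiff N u t (du t)) -> exists M, forall t, 0 <= t <= T -> N (u t) <= M.
Proof.
move=> sn Su Sdu dt; pose f s := N (u (Num.max 0 s)).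
have m0 s : 0 <= Num.max 0 s :> R by rewrite le_max lexx.
have cf : continuous f.
  move=> s; apply/cvgrPdist_le => e e0.
  have [d d0 hd] := tdiff_lip sn (Su _ (m0 s)) (Sdu _ (m0 s)) Su (dt _ (m0 s)) ltr01.
  set q := N (du (Num.max 0 s)) + 1 in hd.
  have q0 : 0 < q by rewrite /q ltr_wpDl// (sn_ge0 sn)//; exact: Sdu.
  have dq0 : 0 < Num.min d (e / q) by rewrite lt_min d0 divr_gt0.
  apply/nbhs_ballP; exists (Num.min d (e / q)) => // r; rewrite /ball/= lt_min => /andP[r1 r2].
  have lip : `|Num.max 0 r - Num.max 0 s| <= `|s - r|.
    rewrite (distrC s); case: (leP 0 r) => hr; case: (leP 0 s) => hs; rewrite ?subrr ?normr0// ?sub0r ?subr0 ?normrN.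
      by rewrite ger0_norm// ler_normr; apply/orP; left; lra.
    by rewrite ger0_norm// ler_normr; apply/orP; right; lra.
  rewrite distrC (le_trans (hd _ (m0 r) (le_lt_trans lip r1)))//.
  rewrite (le_trans (ler_wpM2r (ltW q0) lip))//.
  by rewrite -ler_pdivlMr// ltW.
have [M hM] := cont_lbd cf 0 T; exists M => t /andP[t0 tT].
have := hM t; rewrite t0 tT => /(_ isT); rewrite /f max_r// => h.
exact: le_trans (ler_norm _) h.
Qed.

Lemma tdiff_uniq (W : lmodType R) (S : set W) (N : W -> R) u t a b : seminormed S N -> 0 <= t ->
  (forall s, 0 <= s -> S (u s)) -> S a -> S b -> tdiff N u t a -> tdiff N u t b -> N (a - b) <= 0.
Proof.
move=> sn t0 Su Sa Sb ha hb; apply/ler_addgt0Pl => e e0; rewrite addr0.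
have e2 : 0 < e / 2 by rewrite divr_gt0.
have [p p0 hp] := ha _ e2; have [q q0 hq] := hb _ e2.
have m0 : 0 < Num.min p q by rewrite lt_min p0 q0.
pose r := Num.min p q / 2; have r0 : 0 < r by rewrite divr_gt0.
have rm : r < Num.min p q by rewrite ltr_pdivrMr// ltr_pMr// ltr1n.
have s0 : 0 <= t + r by rewrite addr_ge0// ltW.
have sr : t + r - t = r by rewrite addrC addKr.
have nr : `|t + r - t| = r by rewrite sr gtr0_norm.
have := rm; rewrite lt_min => /andP[rp rq].
have h1 := hp (t + r) s0; have h2 := hq (t + r) s0; rewrite nr in h1 h2; rewrite sr in h1 h2.
have Su1 := snB sn (Su _ s0) (Su _ t0).
have S1 := snB sn Su1 (snZ sn r Sa); have S2 := snB sn Su1 (snZ sn r Sb).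
have e1 : r *: (a - b) = (u (t + r) - u t - r *: b) - (u (t + r) - u t - r *: a).
  by move: (u (t + r) - u t) => U; rewrite scalerBr opprB [RHS]addrC addrA subrK.
have := sn_sub sn S2 S1; rewrite -e1 (sn_scale sn _ (snB sn Sa Sb)) gtr0_norm// => h3.
rewrite -(ler_pM2l r0) (le_trans h3)// (le_trans (lerD (h2 rq) (h1 rp)))//.
by rewrite -mulrDl -splitr mulrC.
Qed.

Lemma sd_chain (F f g : R -> R) t g' : quadr F f -> sd g t g' -> sd (fun s => F (g s)) t (f (g t) * g').
Proof.
move=> q dg e e0; have [C hC] := q (`|g t| + 1).
have n0 := normr_ge0 (f (g t)); have n1 := normr_ge0 g'; have n2 := normr_ge0 C.
pose m := `|g'| + 1; have m0 : 0 < m by rewrite /m ltr_wpDl.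
pose A := `|C| * m ^+ 2 + 1; have A0 : 0 < A by rewrite /A ltr_wpDl// mulr_ge0// sqr_ge0.
pose B := `|f (g t)| + 1; have B0 : 0 < B by rewrite /B ltr_wpDl.
have e2 : 0 < e / 2 by rewrite divr_gt0.
have [d1 d10 h1] := dg _ (divr_gt0 e2 B0); have [d2 d20 h2] := sd_lip dg ltr01.
exists (Num.min (Num.min d1 d2) (Num.min m^-1 (e / 2 / A))).
  by rewrite !lt_min d10 d20 invr_gt0 m0 divr_gt0.
move=> s s0; rewrite !lt_min => /andP[/andP[s1 s2] /andP[s3 s4]].
have k2 := h2 s s0 s2; rewrite -/m in k2; have k1 := h1 s s0 s1.
have gs : `|g s - g t| <= 1.
  by rewrite (le_trans k2)// -ler_pdivlMr// mul1r ltW.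
have hq := hC (g t) (g s) ltac:(by rewrite lerDl) ltac:(by rewrite -[g s](subrK (g t)) addrC (le_trans (ler_normD _ _))// lerD2l).
have -> : F (g s) - F (g t) - (s - t) *: (f (g t) * g') =
   (F (g s) - F (g t) - f (g t) * (g s - g t)) + f (g t) * (g s - g t - (s - t) *: g').
  by rewrite /GRing.scale/=; ring.
rewrite (le_trans (ler_normD _ _))//.
have a1 : `|F (g s) - F (g t) - f (g t) * (g s - g t)| <= e / 2 * `|s - t|.
  apply: (le_trans hq); apply: (@le_trans _ _ (`|C| * (`|s - t| * m) ^+ 2)).
    apply: (@le_trans _ _ (`|C| * (g s - g t) ^+ 2)); first by rewrite ler_wpM2r ?sqr_ge0// ler_norm.
    rewrite ler_wpM2l// -[leLHS]real_normK ?num_real// ler_pXn2r ?nnegrE// mulr_ge0//; exact: ltW.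
  have st0 := normr_ge0 (s - t).
  have -> : `|C| * (`|s - t| * m) ^+ 2 = (`|C| * m ^+ 2) * `|s - t| * `|s - t| by ring.
  rewrite ler_wpM2r//; move: s4; rewrite ltr_pdivlMr// => /ltW; apply: le_trans.
  by rewrite mulrC ler_wpM2l// /A lerDl.
have a2 : `|f (g t) * (g s - g t - (s - t) *: g')| <= e / 2 * `|s - t|.
  rewrite normrM (le_trans (ler_wpM2l n0 k1))// mulrA ler_wpM2r// mulrA ler_pdivrMr// mulrC.
  by rewrite ler_pM2l// /B lerDl.
by rewrite (le_trans (lerD a1 a2))// -mulrDl -splitr.
Qed.

Lemma pt_tderiv (S : set (R -> R)) (N : (R -> R) -> R) (u : R -> R -> R) t (du : R -> R) K x : 0 <= t -> 0 < K ->
  has_tderiv (W := R -> R^o) S N u t du ->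
  (forall s, 0 <= s -> `|(s - t)^-1 * (u s x - u t x) - du x| <=
     K * `|N ((s - t)^-1 *: ((u s : R -> R^o) - u t) - (du : R -> R^o))|) ->
  sd (fun s => u s x) t (du x).
Proof.
move=> t0 K0 /has_tderivP[_ h] hx; apply/(tdiffP (@sn_R R) t0) => // e e0.
have [d d0 hd] := h _ (divr_gt0 e0 K0); exists d => // s s0 st sd.
apply: (le_trans (hx s s0)); rewrite mulrC -ler_pdivlMr//; exact: hd.
Qed.

Lemma sd_uniq (f : R -> R) t a b : 0 <= t -> sd f t a -> sd f t b -> a = b.
Proof.
move=> t0 h1 h2; apply/eqP; rewrite -subr_eq0 -normr_le0.
exact: (tdiff_uniq (@sn_R R) t0 (S := setT)) h1 h2.
Qed.

End CurveGeneral.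

(** * Rates of an arbitrary solution *)

Section Uniqueness.
Context {R : realType}.
Local Notation mu := (@lebesgue_measure R).
Variables (chi : R -> R) (chiP : cutoff chi).
Local Notation N2 := (NS (@L2norm R)).
Local Notation chi' := (derive1 chi).
Let f2 := @fnorm_L2 R.
Let fu := @fnorm_Lu R.
Let sn2 := sn_st f2.
Let snu := sn_st fu.
Let snf := sn_fn f2.

Lemma Vnorm_ge (f : R -> R) x : continuous f -> bdd f -> `|f x| <= `|Vnorm f|.
Proof.
move=> cf b; have [_ e] := Loonorm_cont cf b.
apply: (le_trans (supn_ge x b)); apply: le_trans (ler_norm _).
by rewrite /Vnorm e lerDl L2norm_ge0.
Qed.

Lemma H1norm_ge (f g : R -> R) x : ac f g -> L2 f -> L2 g -> `|f x| <= 2 * `|H1norm f|.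
Proof.
move=> a Lf Lg; have [_ ->] := H1P chiP a Lf Lg; have h := H1_sup x a Lf Lg.
rewrite (ger0_norm (sqrtr_ge0 _)); move: h (L2norm_ge0 f) (L2norm_ge0 g).
move: (L2norm f) (L2norm g) => p q h p0 q0.
have s0 := sqrtr_ge0 (p ^+ 2 + q ^+ 2).
have s2 : Num.sqrt (p ^+ 2 + q ^+ 2) ^+ 2 = p ^+ 2 + q ^+ 2 by rewrite sqr_sqrtr// addr_ge0// sqr_ge0.
have ps : p <= Num.sqrt (p ^+ 2 + q ^+ 2) by rewrite -(@ler_pXn2r _ 2) ?nnegrE// s2 lerDl sqr_ge0.
have qs : q <= Num.sqrt (p ^+ 2 + q ^+ 2) by rewrite -(@ler_pXn2r _ 2) ?nnegrE// s2 lerDr sqr_ge0.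
by lra.
Qed.

Lemma UbS_H1 z : SS (@L2 R) z -> ac (ze z) (ww z) -> ac (uh z) (vh z) ->
  [/\ ac (UbS chi z) (Ubx chi z), L2 (UbS chi z) & L2 (Ubx chi z)].
Proof.
move=> sz a1 a2; have [C0 hC0] := chi_constP chiP.
have ay : ac (yS z) (fun x => 1 + ww z x) by exact: acD (@ac_id R) a1.
have aU := acD a2 (acZ (cc z) (ac_chi chiP)).
have hc := ac_chain (smooth_quadr (chi_smooth chiP)) ay.
have cd1 := dr_cont (smooth_dr (smooth_derive (chi_smooth chiP))).
(* Keeps only [ze], on which chi(y) depends, so that the decay lemmas for states with bounded
   entries apply. *)
pose z0 : st R := mkst (ze z) (fun=> 0) (fun=> 0) (fun=> 0) (fun=> 0) (fun=> 0) 0 0.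
have [mb lu lw lv lh] := sz.
have b0 : L2b (fun=> 0 : R) := dm0 (@fnorm_L2b R).
have s0 : SS (@L2b R) z0.
  by split; [exact: mb|split; [exact: b0|exists 0 => x; rewrite normr0]|exact: b0|exact: b0|split; exact: b0].
have l1 := (chiy_L2b chiP hC0 s0).1.
have hd1 x : `|chi' x| <= C0 * ek x by have [] := hC0.2 x.
have l2 := (ek_fun_L2b hC0 s0 (mf_cont cd1) hd1).1.
have l3 := (dchi_L2b chiP hC0).1.
have l4 : L2 (fun x => chi' (yS z x) * ww z x).
  apply: (L2_le (g := fun x => C0 * ww z x) _ (L2Z C0 lw).1 _).1.
    by apply: mfM; [exact: L2_mf l2|exact: L2_mf lw].
  move=> x; rewrite !normrM ler_wpM2r// (le_trans (hd1 _))//.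
  have c0 : 0 <= C0 by have := le_trans (normr_ge0 _) (hd1 0); rewrite pmulr_lge0// ek_gt0.
  by rewrite ger0_norm// ler_piMr// ek_le1.
split.
- by have := acB aU (acZ (cc z) hc); congr ac; apply/funext => x; rewrite /UbS /Ubx /vS; ring.
- exact: (snD snf lu.1 (snZ snf (cc z) l1)).
- have := snD snf lv (snZ snf (cc z) (snB snf l3 (snD snf l2 l4))).
  by congr L2; apply/funext => x; rewrite /Ubx /vS !fctE /GRing.scale/=; ring.
Qed.

(** Both the curve and its derivative are lifted time by time, by choice; equivalence of the norms
    turns differentiability in E into differentiability of the lifted curve. *)
Lemma lift_curve X : C1E chi X -> exists Z D : R -> st R, forall t, 0 <= t ->
  [/\ lifts chi (X t) (Z t), SS (@L2 R) (D t), ac (ze (D t)) (ww (D t)), ac (uh (D t)) (vh (D t)) &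
   tdiff N2 Z t (D t)].
Proof.
move=> [EX [dX hdX]].
have /boolp.choice[Z hZ] : forall t, exists z, 0 <= t -> lifts chi (X t) z.
  move=> t; have [t0|t0] := leP 0 t; last by exists 0.
  by have [z lz] := lifts_exists chiP (EX t t0); exists z.
have /boolp.choice[D hD] : forall t, exists z, 0 <= t -> lifts chi (dX t) z.
  move=> t; have [t0|t0] := leP 0 t; last by exists 0.
  have [[S _] _] := hdX t t0.
  by have [z lz] := lifts_exists chiP S; exists z.
exists Z, D => t t0; have lD := hD t t0; have [sD [a1 a2] _ _ _] := lD.
split; [exact: hZ|exact: sD|exact: a1|exact: a2|].
have SZ s : 0 <= s -> SS (@L2 R) (Z s) by move=> /hZ[].
apply/(tdiffP sn2 t0 SZ sD) => e e0; have e4 : 0 < e / 4 by rewrite divr_gt0.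
have [/has_tderivP[_ h] _] := hdX t t0; have [d d0 hd] := h _ e4.
exists d; first exact: d0.
move=> s s0 st sd; have := hd s s0 st sd.
have lq := lifts_B (lifts_Z (s - t)^-1 (lifts_B (hZ s s0) (hZ t t0))) lD.
have [_ _ _ ->] := lifts_E chiP lq; have [sq [_ aq] _ _ _] := lq.
move=> /(le_trans (ler_norm _)) h1; have [_ h2] := En_NS sq aq.
by apply: (le_trans h2); rewrite mulrC -ler_pdivlMr.
Qed.

Section Rates.
Variables (X : R -> lag R) (Z D : R -> st R).
Hypothesis sX : system chi X.
Hypothesis lX : forall t, 0 <= t -> lifts chi (X t) (Z t).
Hypothesis SD : forall t, 0 <= t -> SS (@L2 R) (D t).
Hypothesis dZ : forall t, 0 <= t -> tdiff N2 Z t (D t).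

Let SZ t : 0 <= t -> SS (@L2 R) (Z t). Proof. by move=> /lX[]. Qed.
Let aZ t : 0 <= t -> ac (ze (Z t)) (ww (Z t)) /\ ac (uh (Z t)) (vh (Z t)). Proof. by move=> /lX[]. Qed.

Let lin (W : lmodType R) (N' : W -> R) (L : st R -> W) C t : 0 <= t -> 0 <= C ->
  (forall (a : R) (x y z : st R), L (x - y - a *: z) = L x - L y - a *: L z) ->
  (forall z, SS (@L2 R) z -> N' (L z) <= C * N2 z) -> tdiff N' (fun s => L (Z s)) t (L (D t)).
Proof.
by move=> t0 C0 l le; apply: (tdiff_lin sn2 SZ (SZ t0) (SD t0) C0 l le); exact: dZ.
Qed.

Let lin1 (W : lmodType R) (N' : W -> R) (L : st R -> W) t : 0 <= t ->
  (forall (a : R) (x y z : st R), L (x - y - a *: z) = L x - L y - a *: L z) ->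
  (forall z, SS (@L2 R) z -> N' (L z) <= N2 z) -> tdiff N' (fun s => L (Z s)) t (L (D t)).
Proof. by move=> t0 l le; apply: (lin (C := 1)) => // z sz; rewrite mul1r; exact: le. Qed.

Lemma rate_cc t : 0 <= t -> cc (D t) = 0 /\ kk (D t) = 0.
Proof.
move=> t0; have [_ _ _ _ [h1 h2]] := sX t0.
have d1 : sd (fun s => cc (Z s)) t (cc (D t)).
  by apply: (lin1 (W := R^o) (N' := Num.norm) (L := @cc R)) => // z sz; have [] := NS_parts f2 sz.
have d2 : sd (fun s => kk (Z s)) t (kk (D t)).
  by apply: (lin1 (W := R^o) (N' := Num.norm) (L := @kk R)) => // z sz; have [] := NS_parts f2 sz.
have ec s : 0 <= s -> cL chi (X s) = cc (Z s) by move=> /lX/(lifts_E chiP)[].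
have ek_ s : 0 <= s -> kL (X s) = kk (Z s) by move=> /lX/(lifts_E chiP)[].
have /(has_tderiv_tdiff _ (@sn_R R) t0)[//|_ k1] := h1.
have /(has_tderiv_tdiff _ (@sn_R R) t0)[//|_ k2] := h2.
split; [apply: (sd_uniq t0 d1)|apply: (sd_uniq t0 d2)].
  exact: (tdiff_ext ec t0 erefl k1).
exact: (tdiff_ext ek_ t0 erefl k2).
Qed.

Let cst t : 0 <= t -> cc (Z t) = cc (Z 0) /\ kk (Z t) = kk (Z 0).
Proof.
move=> t0; have h s : 0 <= s <= t -> sd (fun s => cc (Z s)) s 0 /\ sd (fun s => kk (Z s)) s 0.
  move=> /andP[s0 _]; have [e1 e2] := rate_cc s0; rewrite -{1}e1 -e2; split.
    by apply: (lin1 (W := R^o) (N' := Num.norm) (L := @cc R)) => // z sz; have [] := NS_parts f2 sz.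
  by apply: (lin1 (W := R^o) (N' := Num.norm) (L := @kk R)) => // z sz; have [] := NS_parts f2 sz.
by split; [apply: (sd_const t0 (fun s hs => (h s hs).1))|apply: (sd_const t0 (fun s hs => (h s hs).2))]; rewrite t0 lexx.
Qed.

Lemma pt_ze t x : 0 <= t -> sd (fun s => ze (Z s) x) t (ze (D t) x).
Proof.
move=> t0; apply: (lin1 (W := R^o) (N' := Num.norm) (L := fun z => ze z x)) => // z sz.
by have [h _ _ _ _] := NS_parts f2 sz; apply: le_trans h; have [[_ b] _ _ _ _] := sz; exact: supn_ge.
Qed.

Lemma pt_uh t x : 0 <= t -> sd (fun s => uh (Z s) x) t (uh (D t) x).
Proof.
move=> t0; apply: (lin1 (W := R^o) (N' := Num.norm) (L := fun z => uh z x)) => // z sz.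
by have [_ h _ _ _] := NS_parts f2 sz; apply: le_trans h; have [_ [_ b] _ _ _] := sz; exact: supn_ge.
Qed.

(** Evaluation at a point is bounded for the V norm, so the equation holds in time at each point,
    and uniqueness of scalar derivatives identifies the rate there. *)
Lemma rate_ze t : 0 <= t -> ze (D t) = US chi (Z t).
Proof.
move=> t0; have [h _ _ _ _] := sX t0; apply/funext => x.
have [sz [a1 a2] e1 e2 _] := lX t0.
have aU := acD a2 (acZ (cc (Z t)) (ac_chi chiP)).
have bchi : bdd chi by exists 1 => r; have /andP[a b] := chi_01 chiP r; rewrite ger0_norm.
apply: (sd_uniq t0 (pt_ze x t0)).
have eU : UL (X t) = US chi (Z t) by rewrite e2.
have ez s (hs : 0 <= s) : zetaL (X s) = ze (Z s) by have [] := lX hs.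
rewrite eU in h.
have := pt_tderiv (x := x) t0 ltr01 h; apply: (_ : forall A B C, A -> (B -> C) -> (A -> B) -> C) => [A B C a bc ab||].
- exact: bc (ab a).
- move=> s s0; rewrite mul1r (ez s s0) (ez t t0).
  have [[[_ b1] _ _ _ _] [as1 _] _ _ _] := lX s0; have [[[_ b0] [_ bu] _ _ _] _ _ _ _] := lX t0.
  apply: (@Vnorm_ge ((s - t)^-1 *: ((ze (Z s) : R -> R^o) - ze (Z t)) - (US chi (Z t) : R -> R^o)) x).
    exact: ac_cont (acB (acZ (s - t)^-1 (acB as1 a1)) aU).
  have nb (q : R -> R) : bdd q -> bdd (fun x => - q x).
    by move=> [M hM]; exists M => r; rewrite normrN.
  exact: (bddD (bddZ (s - t)^-1 (bddD b1 (nb _ b0))) (nb _ (bddD bu (bddZ (cc (Z t)) bchi)))).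
- by apply: tdiff_ext => // s s0; rewrite ez.
Qed.

(** The system gives the rate of Ubar in H^1, hence at every point. Subtracting the rate of c (chi -
    chi(y)), by the chain rule at fixed x, leaves that of [uh]; the kernel is the unsigned one of
    the system. *)
Lemma rate_uh t : 0 <= t -> uh (D t) = (fun x => - QS chi false (Z t) x).
Proof.
move=> t0; have [_ h _ _ _] := sX t0; apply/funext => x.
have lt := lX t0; have [sz [a1 a2] e1 e2 _] := lt.
have [_ hQ] := lifts_AQ chiP lt; have [_ ec _ _] := lifts_E chiP lt; have [_ _ _ ey] := lifts_wD chiP lt.
have eb s (hs : 0 <= s) : UbarL chi (X s) = UbS chi (Z s) by have [_ _ e] := lifts_source chiP (lX hs).
have [Hdu _] := h; have [adu Ldu Ldu'] := H1_ac chiP Hdu.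
have Hs s (hs : 0 <= s) : [/\ ac (UbS chi (Z s)) (Ubx chi (Z s)), L2 (UbS chi (Z s)) & L2 (Ubx chi (Z s))].
  by have [k1 k2] := aZ hs; exact: UbS_H1 (SZ hs) k1 k2.
have k1 : sd (fun s => UbarL chi (X s) x) t (- QL chi (X t) x - cL chi (X t) * chi' (yL (X t) x) * UL (X t) x).
  apply: (pt_tderiv (K := 2) t0 _ h) => // s s0; rewrite (eb s s0) (eb t t0).
  have [p1 p2 p3] := Hs s s0; have [q1 q2 q3] := Hs t t0.
  have LF := snB snf (snZ snf (s - t)^-1 (snB snf p2 q2)) Ldu.
  have LG := snB snf (snZ snf (s - t)^-1 (snB snf p3 q3)) Ldu'.
  exact: (H1norm_ge x (acB (acZ (s - t)^-1 (acB p1 q1)) adu) LF LG).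
have dc := sd_chain (smooth_quadr (chi_smooth chiP)) (sd_D t0 (sd_cst x t) (pt_ze x t0)).
have k2 := sd_D t0 (pt_uh x t0) (sd_Z (cc (Z 0)) t0 (sd_B t0 (sd_cst (chi x) t) dc)).
have k3 : sd (fun s => UbarL chi (X s) x) t (uh (D t) x + cc (Z 0) * (0 - chi' (x + ze (Z t) x) * (0 + ze (D t) x))).
  by apply: (tdiff_ext _ t0 erefl k2) => s s0; rewrite (eb s s0) /UbS (cst s0).1.
have := sd_uniq t0 k3 k1; rewrite hQ ec ey (rate_ze t0) e2 (cst t0).1 !add0r /yS /US (cst t0).1.
by move=> e; rewrite -[LHS](addrK (cc (Z 0) * - (chi' (x + ze (Z t) x) * (uh (Z t) x + cc (Z 0) * chi x)))) e; ring.
Qed.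

Lemma L2norm_eq0 (f : R -> R) : L2 f -> L2norm f <= 0 -> {ae mu, forall x, f x = 0}.
Proof.
move=> Lf n0; have [l h] := L2_Lu Lf; apply: (Lun_eq0 l); apply: (le_trans h).
by rewrite -(mulr0 2) ler_wpM2l.
Qed.

Lemma rate_hh t : 0 <= t -> ae_eq mu setT (hh (D t)) (hh (FS chi false (Z t))).
Proof.
move=> t0; have [_ _ h _ _] := sX t0; have [hL _] := h.
have lt := lX t0; have [hA _] := lifts_AQ chiP lt; have [_ w2 _ _] := lifts_wD chiP lt.
have d1 : tdiff (W := R -> R^o) (@L2norm R) (fun s => hh (Z s)) t (hh (D t)).
  by apply: (lin1 (W := R -> R^o) (L := @hh R)) => // z sz; have [_ _ _ q _] := NS_each f2 sz.
have hs s : 0 <= s -> [/\ mf (Defs.hL (X s)), L2 (hh (Z s)) & ae_eq mu setT (Defs.hL (X s)) (hh (Z s))].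
  by move=> s0; have [[_ _ _ _ [l _]] _ _ _ [[m e] _]] := lX s0; split.
have [L' d2] := (L2_tderiv t0 hs (L2_mf hL) (@ae_eq_refl _ _ _ mu setT _ _) (L2_mf hL)).1 h.
have Sh s (s0 : 0 <= s) : L2 (hh (Z s)) by have [] := hs s s0.
have LD : L2 (hh (D t)) by have [_ _ _ _ []] := SD t0.
have n0 := tdiff_uniq snf t0 Sh LD L' d1 d2.
have := L2norm_eq0 (snB snf LD L') n0; apply: aeS2 w2 => x e1 /eqP; rewrite subr_eq0 => /eqP e _.
by rewrite e e1// hA -mulrA.
Qed.

Lemma rate_ww t : 0 <= t -> ac (ze (D t)) (ww (D t)) -> ae_eq mu setT (ww (D t)) (vS chi (Z t)).
Proof.
move=> t0 a; have [_ [_ a2] _ _ _] := lX t0; rewrite rate_ze// in a.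
exact: (ac_ae a (acD a2 (acZ (cc (Z t)) (ac_chi chiP)))).
Qed.

(** The equation for rbar = rh - k w and the rate U_x of w cancel, up to null sets. *)
Lemma rate_rh t : 0 <= t -> ac (ze (D t)) (ww (D t)) -> ae_eq mu setT (rh (D t)) (fun=> 0).
Proof.
move=> t0 a; have ew := rate_ww t0 a; have [_ _ _ h _] := sX t0; have [hL _] := h.
have lt := lX t0; have [_ w2 _ _] := lifts_wD chiP lt; have [_ _ ek_ _] := lifts_E chiP lt.
pose L (z : st R) : R -> R^o := fun x => rh z x - kk (Z 0) * ww z x.
have Lw z : SS (@L2 R) z -> L2 (ww z) by case.
have Lr z : SS (@L2 R) z -> L2 (rh z) by move=> [_ _ _ _ []].
have LL z : SS (@L2 R) z -> L2 (L z).
  by move=> sz; exact: (snB snf (Lr z sz) (snZ snf (kk (Z 0)) (Lw z sz))).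
have d1 : tdiff (W := R -> R^o) (@L2norm R) (fun s => L (Z s)) t (L (D t)).
  apply: (lin (C := 1 + `|kk (Z 0)|)) => //.
    by move=> b x y z; apply/funext => r; rewrite /L rhB rhB rhZ wwB wwB wwZ !fctE /GRing.scale/=; ring.
  move=> z sz; have [_ q1 _ _ q2] := NS_each f2 sz.
  rewrite mulrDl mul1r (le_trans (sn_sub snf (Lr z sz) (snZ snf (kk (Z 0)) (Lw z sz))))// lerD//.
  by rewrite (sn_scale snf _ (Lw z sz)) ler_wpM2l.
have hs s : 0 <= s -> [/\ mf (rbarL (X s)), L2 (L (Z s)) & ae_eq mu setT (rbarL (X s)) (L (Z s))].
  move=> s0; have [_ _ e _] := lifts_wD chiP (lX s0); split; [exact: (lifts_mf_rbar chiP (lX s0))|exact: LL (SZ s0)|].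
  by apply: aeS e => x e' _; rewrite e'// /rbS (cst s0).2.
have [L' d2] := (L2_tderiv t0 hs (L2_mf hL) (@ae_eq_refl _ _ _ mu setT _ _) (L2_mf hL)).1 h.
have Sh s (s0 : 0 <= s) : L2 (L (Z s)) by have [] := hs s s0.
have n0 := tdiff_uniq snf t0 Sh (LL _ (SD t0)) L' d1 d2.
have := L2norm_eq0 (snB snf (LL _ (SD t0)) L') n0.
apply: (aeS2 _ (aeS2 (Q := fun x => ww (D t) x = vS chi (Z t) x /\ wD (UL (X t)) x = vS chi (Z t) x) _ ew w2)).
  move=> x [e1 e2] /eqP; rewrite subr_eq0 => /eqP; rewrite /L e1 e2 ek_ (cst t0).2 => e _.
  by rewrite -[LHS](subrK (kk (Z 0) * vS chi (Z t) x)) e; ring.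
by move=> x e1 e2; split; [exact: e1|exact: e2].
Qed.

End Rates.
End Uniqueness.

(** * Comparison with the constructed solution *)

Section Comparison.
Context {R : realType}.
Local Notation mu := (@lebesgue_measure R).
Variables (chi : R -> R) (chiP : cutoff chi).
Local Notation N2 := (NS (@L2norm R)).
Local Notation Nu := (NS (@Lun R)).
Let f2 := @fnorm_L2 R.
Let fu := @fnorm_Lu R.
Let sn2 := sn_st f2.
Let snu := sn_st fu.

Lemma fS_bound M : 0 <= M -> exists2 Cf, 0 <= Cf & forall z, SS (@L2 R) z -> N2 z <= M ->
  forall x, cv (fun s => `|fS chi z s|) x <= Cf.
Proof.
move=> M0; have [C0 hC0] := chi_constP chiP.
pose rel (z1 z2 : st R) := z1 = z2 /\ SS (@L2 R) z1 /\ N2 z1 <= M.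
have relC z1 z2 : rel z1 z2 -> rel z2 z1 by case=> ->.
have relS z1 z2 : rel z1 z2 -> SS (@L2 R) z1 by case=> _ [].
have relM z1 z2 : rel z1 z2 ->
  [/\ supn (ze z1) <= M, supn (uh z1) <= M, `|cc z1| <= M & `|kk z1| <= M].
  by case=> _ [s1 n1]; have [a b c d _] := NS_parts f2 s1; split; apply: le_trans n1.
have [C c h] := t0_f f2 M0 relC relS relM chiP hC0.
have n0 : 0 <= L2norm (@ek R) := L2norm_ge0 _.
exists (2 * (C * (M + L2norm (@ek R)))); first by rewrite !mulr_ge0// addr_ge0.
move=> z sz nz x; have [g1 g2] := dm_GG f2 sz; have [g3 g4] := fn_Z f2 C g1.
have [l1 l2] := fn_le f2 (mf_fS f2 chiP sz) g3 (fun x => le_trans (h z z (conj erefl (conj sz nz)) x).1 (ler_norm _)).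
apply: (le_trans (fn_cvx f2 l1 x)); apply: ler_wpM2l => //; apply: (le_trans l2).
rewrite g4 ger0_norm//; apply: ler_wpM2l => //; apply: (le_trans g2).
by rewrite lerD2r.
Qed.

Lemma SS_Lu z : SS (@L2 R) z -> SS (@Lu R) z /\ Nu z <= 2 * N2 z.
Proof.
move=> [b [lu bu] lw lv [lh lr]].
have [u1 u2] := L2_Lu lu; have [w1 w2] := L2_Lu lw; have [v1 v2] := L2_Lu lv.
have [h1 h2] := L2_Lu lh; have [r1 r2] := L2_Lu lr; split; first by split.
have := supn_ge0 b.2; have := supn_ge0 bu; have := normr_ge0 (cc z); have := normr_ge0 (kk z).
by rewrite /NS; lra.
Qed.

(** An arbitrary solution follows the rate with unsigned kernel in every entry but [vh], whose rate
    is known only as the space derivative of the rate of [uh]. *)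
Lemma Nu_defect (z D : st R) : SS (@L2 R) z -> SS (@L2 R) D -> ze D = US chi z ->
  uh D = (fun x => - QS chi false z x) -> cc D = 0 /\ kk D = 0 -> ae_eq mu setT (ww D) (vS chi z) ->
  ae_eq mu setT (hh D) (hh (FS chi false z)) -> ae_eq mu setT (rh D) (fun=> 0) ->
  Nu (FS chi false z - D) <= Lun (fun x => vh (FS chi false z) x - vh D x).
Proof.
move=> sz sD ez eu [ec ek_] ew eh er.
have [_ sF _] := SS_fS chiP f2 false sz.
have [[_ _] [_ _] Fw _ [Fh Fr]] := sF; have [[_ _] [_ _] Dw _ [Dh Dr]] := sD.
have ae0 (f g : R -> R) : L2 f -> L2 g -> ae_eq mu setT g f -> Lun (fun x => f x - g x) <= 0.
  move=> Lf Lg e; apply: Lun_ae0; first by apply: mfB; exact: L2_mf.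
  by apply: aeS e => x -> //; rewrite subrr.
have a1 := ae0 _ _ Fw Dw ew; have a2 := ae0 _ _ Fh Dh eh; have a3 := ae0 _ _ Fr Dr er.
have z1 : supn (fun x => ze (FS chi false z) x - ze D x) <= 0.
  by apply: supn_le => x; rewrite ez subrr normr0.
have z2 : supn (fun x => uh (FS chi false z) x - uh D x) <= 0.
  by apply: supn_le => x; rewrite eu subrr normr0.
have z3 : Lun (fun x => uh (FS chi false z) x - uh D x) <= 0.
  have -> : (fun x => uh (FS chi false z) x - uh D x) = (fun=> 0) by apply/funext => x; rewrite eu subrr.
  by apply: Lun_ae0; [exact: mf_cst|exact: aeW].
have c1 : `|cc (FS chi false z) - cc D| <= 0 by rewrite ec subrr normr0.
have c2 : `|kk (FS chi false z) - kk D| <= 0 by rewrite ek_ subrr normr0.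
rewrite /NS zeB uhB wwB vhB hhB rhB ccB kkB.
move: z1 z2 z3 a1 a2 a3 c1 c2; move: (supn _) (supn _) (Lun _) (Lun _) (Lun _) (Lun _) (Lun _) (`|_|) (`|_|).
by move=> *; lra.
Qed.

Lemma Nu_eq0 X z z' : lifts chi X z -> SS (@L2 R) z' -> ac (ze z') (ww z') -> ac (uh z') (vh z') ->
  Nu (z' - z) <= 0 -> lifts chi X z'.
Proof.
move=> [sz [a1 a2] eZ eU [[mh eh] [mr er]]] sz' a1' a2' n0.
have sd := snB sn2 sz' sz; have [sdu _] := SS_Lu sd.
have [p1 p2 p3 p4 _] := NS_parts fu sdu; have [_ _ _ q4 q5] := NS_each fu sdu.
have [[_ b1] [_ b2] _ _ [lh lr]] := sdu.
rewrite zeB in p1 b1; rewrite uhB in p2 b2; rewrite ccB in p3; rewrite kkB in p4.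
rewrite hhB in q4 lh; rewrite rhB in q5 lr.
have s0 (f g : R -> R) : bdd (fun x => f x - g x) -> supn (fun x => f x - g x) <= Nu (z' - z) -> f = g.
  move=> b le; apply/funext => x; apply/eqP; rewrite -subr_eq0 -normr_le0.
  exact: le_trans (supn_ge x b) (le_trans le n0).
have Ez := s0 _ _ b1 p1; have Eu := s0 _ _ b2 p2.
have Ec : cc z' = cc z by apply/eqP; rewrite -subr_eq0 -normr_le0 (le_trans p3).
have Ek : kk z' = kk z by apply/eqP; rewrite -subr_eq0 -normr_le0 (le_trans p4).
have Eh := Lun_eq0 lh (le_trans q4 n0); have Er := Lun_eq0 lr (le_trans q5 n0).
split; [exact: sz'|by split|by rewrite Ez|by rewrite Eu Ec|split; split; [exact: mh| |exact: mr|]].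
  by apply: (aeS2 _ eh Eh) => x e /eqP; rewrite subr_eq0 => /eqP -> _; exact: e.
by apply: (aeS2 _ er Er) => x e /eqP; rewrite subr_eq0 Ek => /eqP -> _; exact: e.
Qed.

Lemma lifts_N2 X z z' : lifts chi X z -> lifts chi X z' -> N2 (z - z') <= 0.
Proof.
move=> l l'; have h := lifts_B l l'; have h0 := lifts_B l l.
have [_ _ _ e] := lifts_E chiP h; have [_ _ _ e0] := lifts_E chiP h0.
have [s [_ a] _ _ _] := h; have [s0 [_ a0] _ _ _] := h0.
have [_ k] := En_NS s a; have [k0 _] := En_NS s0 a0.
have z0 : N2 (z - z) = 0 by rewrite subrr (sn_zero sn2).
by rewrite z0 -e0 e in k0; apply: (le_trans k); rewrite pmulr_rle0.
Qed.

Lemma double_le (a : R) : 0 < a -> a + a <= 4 * a.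
Proof. by move=> h; lra. Qed.

Lemma defect_arith (e c d n p : R) L l : 0 <= e -> 0 <= c -> l <= n -> d <= n + p -> 0 <= p ->
  L <= e * (8 * c * d + c * l) -> L <= e * (9 * c) * (n + p).
Proof.
move=> e0 c0 ln dn p0 h; apply: (le_trans h); rewrite -[leRHS]mulrA; apply: ler_wpM2l => //.
have := ler_wpM2l c0 dn; have : c * l <= c * (n + p) by apply: ler_wpM2l => //; lra.
by rewrite -!mulrA; lra.
Qed.

Lemma vh_defect_Nu z za (v : R -> R) M Cf : SS (@L2 R) z -> ac (ze z) (ww z) -> SA za -> GE chi za ->
  0 < M -> N2 z <= M -> N2 za <= M -> 0 <= Cf -> (forall x, cv (fun s => `|fS chi z s|) x <= Cf) ->
  ac (fun x => - QS chi false z x) v ->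
  Lun (fun x => vh (FS chi false z) x - v x) <= expR (2 * M) * (9 * (expR (18 * M) * Cf)) * Nu (za - z).
Proof.
move=> sz az Sa Ga M0 nz na Cf0 hCf av; have sa := SS_L2 Sa.1.
have [sd _] := SS_Lu (snB sn2 sa sz).
have [p1 _ _ _ _] := NS_parts fu sd; have [_ p2 _ _ _] := NS_each fu sd; have [[_ bw] _ _ _ _] := sd.
rewrite zeB in p1 bw; rewrite wwB in p2.
have n0 : 0 <= Nu (za - z) := sn_ge0 snu sd.
have hz x : `|ze z x| <= M.
  have [h _ _ _ _] := NS_parts f2 sz; have [[_ b] _ _ _ _] := sz.
  exact: le_trans (supn_ge x b) (le_trans h nz).
have ha x : `|ze za x| <= M.
  have [h _ _ _ _] := NS_parts f2 sa; have [[_ b] _ _ _ _] := sa.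
  exact: le_trans (supn_ge x b) (le_trans h na).
have sw : Lun (fun x => ww z x - ww za x) = Lun (fun x => ww za x - ww z x).
  by rewrite /Lun; congr supn; apply/funext => x; rewrite /cv; congr It; apply/funext => s; rewrite distrC.
have V d d0 d4 hd := vh_defect (d := d) chiP sz az Sa Ga hz ha hd d0 d4 hCf av.
rewrite sw in V; have hd1 x : `|ze z x - ze za x| <= Nu (za - z).
  by rewrite distrC; exact: le_trans (supn_ge x bw) p1.
have hd2 x : `|ze z x - ze za x| <= 4 * M.
  by apply: (le_trans (ler_normB _ _)); apply: (le_trans (lerD (hz x) (ha x))); exact: double_le.
move: (expR (2 * M)) (expR (18 * M)) (expR_ge0 (2 * M)) (expR_ge0 (18 * M)) V => e c1 e0 c0 V.
have c10 : 0 <= c1 * Cf := mulr_ge0 c0 Cf0.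
move: (Lun (fun x => ww za x - ww z x)) p2 V => l p2 V.
move: (Lun (fun x => vh (FS chi false z) x - v x)) V => L V.
move: (Nu (za - z)) n0 p2 hd1 => n n0 p2 hd1.
(* The defect estimate wants a positive width of at most 4 M: the distance is raised by [ep], which
   later tends to 0, and capped at 4 M, a bound that the difference of the two [ze] satisfies
   anyway. *)
have key ep : 0 < ep -> L <= e * (9 * (c1 * Cf)) * (n + ep).
  move=> ep0; have d0 : 0 < Num.min (n + ep) (4 * M).
    by rewrite lt_min (ltr_wpDl n0 ep0) (mulr_gt0 _ M0)// ltr0n.
  have d4 : Num.min (n + ep) (4 * M) <= 4 * M by rewrite ge_min lexx orbT.
  have dn : Num.min (n + ep) (4 * M) <= n + ep by rewrite ge_min lexx.
  have hd x : `|ze z x - ze za x| <= Num.min (n + ep) (4 * M).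
    by rewrite le_min (hd2 x) andbT (le_trans (hd1 x))// lerDl ltW.
  apply: (defect_arith e0 c10 p2 dn (ltW ep0)).
  by have := V _ d0 d4 hd; rewrite -!mulrA.
have k0 : 0 <= e * (9 * (c1 * Cf)) by exact: mulr_ge0 e0 (mulr_ge0 (ler0n _ 9) c10).
move: (e * _) k0 key => k k0 key.
apply/ler_addgt0Pr => ep ep0; have k1 : 0 < k + 1 by rewrite ltr_wpDl.
apply: (le_trans (key (ep / (k + 1)) (divr_gt0 ep0 k1))); rewrite mulrDr lerD2l.
by rewrite mulrCA ler_piMr ?(ltW ep0)// ler_pdivrMr// mul1r lerDl.
Qed.

(** Gronwall in the norm built on [Lun], where the distance to the constructed solution starts at 0.
    Vanishing distance makes the entries equal up to null sets, which is all that [lifts] records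
    for h and r. *)
Lemma sol_unique X Y : C1E chi X -> system chi X -> gsol chi Y -> lifts chi (X 0) (Y 0) ->
  forall t, 0 <= t -> lifts chi (X t) (Y t).
Proof.
move=> cX sX gY l0 T T0; have [SY _ _] := gY.
have [Z [D hZ]] := lift_curve chiP cX.
have lX t : 0 <= t -> lifts chi (X t) (Z t) by move=> /hZ[].
have SD t : 0 <= t -> SS (@L2 R) (D t) by move=> /hZ[].
have dZ t : 0 <= t -> tdiff N2 Z t (D t) by move=> /hZ[].
have aD t : 0 <= t -> ac (ze (D t)) (ww (D t)) /\ ac (uh (D t)) (vh (D t)) by move=> /hZ[].
have SZ t : 0 <= t -> SS (@L2 R) (Z t) by move=> /lX[].
have SY2 t : 0 <= t -> SS (@L2 R) (Y t) by move=> /SY[s _]; exact: SS_L2.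
have SF t : 0 <= t -> SA (FS chi true (Y t)) by move=> t0; exact: (SA_FS chiP (SY t t0)).
have SF2 t : 0 <= t -> SS (@L2 R) (FS chi true (Y t)) by move=> /SF[s _]; exact: SS_L2.
have dY t : 0 <= t -> tdiff N2 Y t (FS chi true (Y t)).
  by move=> t0; exact: (sub_tdiff (@sub2 R) t0 SY (SF t t0) (gsol_tdiff gY t0)).
have [M1 hM1] := tdiff_bdd T sn2 SZ SD dZ; have [M2 hM2] := tdiff_bdd T sn2 SY2 SF2 dY.
have [M [M0 MZ MY]] : exists M, [/\ 0 < M, forall t, 0 <= t <= T -> N2 (Z t) <= M &
    forall t, 0 <= t <= T -> N2 (Y t) <= M].
  exists (`|M1| + `|M2| + 1); split=> [|t /hM1 h|t /hM2 h]; first by rewrite ltr_wpDl// addr_ge0.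
    by rewrite (le_trans h)// -addrA (le_trans (ler_norm _))// lerDl addr_ge0.
  by rewrite (le_trans h)// (le_trans (ler_norm _))// addrAC lerDr addr_ge0.
(* The norm built on [Lun] is at most twice the one built on L^2, in which both curves are bounded
   by M. *)
have M20 : 0 <= 2 * M by rewrite mulr_ge0// ltW.
have [C CC hC] := rate_lip (chi := chi) false fu chiP M20.
have [Cf Cf0 hCf] := fS_bound (ltW M0).
pose K := expR (2 * M) * (9 * (expR (18 * M) * Cf)).
have eM : 0 <= expR (2 * M) by exact: expR_ge0.
have eM2 : 0 <= expR (18 * M) * Cf by rewrite mulr_ge0// expR_ge0.
have K0 : 0 <= K by rewrite /K mulr_ge0// mulr_ge0.
have SW t : 0 <= t -> SS (@Lu R) (Y t - Z t).
  by move=> t0; exact: (SS_Lu (snB sn2 (SY2 t t0) (SZ t t0))).1.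
have SdW t : 0 <= t -> SS (@Lu R) (FS chi true (Y t) - D t).
  by move=> t0; exact: (SS_Lu (snB sn2 (SF2 t t0) (SD t t0))).1.
have dW t : 0 <= t -> tdiff Nu (fun s => Y s - Z s) t (FS chi true (Y t) - D t).
  move=> t0; have Szm s : 0 <= s -> SS (@L2 R) ((-1) *: Z s) by move=> s0; exact: (snZ sn2 (-1) (SZ s s0)).
  have h1 := tdiff_scale (-1) sn2 SZ t0 (SD t t0) (dZ t t0).
  have h2 := tdiff_add sn2 SY2 Szm t0 (SF2 t t0) (snZ sn2 (-1) (SD t t0)) (dY t t0) h1.
  have Sadd s : 0 <= s -> SS (@L2 R) (Y s + (-1) *: Z s) by move=> s0; exact: (snD sn2 (SY2 s s0) (Szm s s0)).
  have h3 : tdiff Nu (fun s => Y s + (-1) *: Z s) t (FS chi true (Y t) + (-1) *: D t).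
    apply: (tdiff_lin (L := id) (C := 2) sn2 Sadd (Sadd t t0) (snD sn2 (SF2 t t0) (snZ sn2 (-1) (SD t t0)))) => //.
    by move=> z sz; exact: (SS_Lu sz).2.
  by apply: tdiff_ext h3 => // [s _|]; rewrite scaleN1r.
(* The constructed [y] is nondecreasing, so its rate is also the unsigned one. The difference of
   rates splits into a Lipschitz part for the unsigned rate and the defect at [Z t], both linear in
   the distance. *)
have bnd t : 0 <= t <= T -> Nu (FS chi true (Y t) - D t) <= (C + K) * Nu (Y t - Z t) + 0.
  move=> tT; have /andP[t0 _] := tT; have GY := gsol_GE chiP gY t0.
  have [eF _ _] := FS_homo chi (SA_homo (SY t t0) GY).
  have sz := SZ t t0; have sy := SY2 t t0.
  have [suz nuz] := SS_Lu sz; have [suy nuy] := SS_Lu sy.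
  have nz : Nu (Z t) <= 2 * M := le_trans nuz (ler_wpM2l (ler0n _ 2) (MZ t tT)).
  have ny : Nu (Y t) <= 2 * M := le_trans nuy (ler_wpM2l (ler0n _ 2) (MY t tT)).
  have [sFy h1] := hC _ _ suy suz ny nz.
  have [_ sFz2 _] := SS_fS chiP f2 false sz; have [sFz _] := SS_Lu sFz2.
  have [sDu _] := SS_Lu (SD t t0).
  have e : FS chi true (Y t) - D t = (FS chi false (Y t) - FS chi false (Z t)) + (FS chi false (Z t) - D t).
    by rewrite eF addrA subrK.
  rewrite e addr0 mulrDl; apply: (le_trans (sn_triangle snu (snB snu sFy sFz) (snB snu sFz sDu))).
  apply: lerD h1 _.
  have [aD1 aD2] := aD t t0.
  have ez := rate_ze chiP sX lX SD dZ t0; have eu := rate_uh chiP sX lX SD dZ t0.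
  apply: (le_trans (Nu_defect sz (SD t t0) ez eu (rate_cc chiP sX lX SD dZ t0)
    (rate_ww chiP sX lX SD dZ t0 aD1) (rate_hh chiP sX lX SD dZ t0) (rate_rh chiP sX lX SD dZ t0 aD1))).
  have [_ [az _] _ _ _] := lX t t0.
  have av : ac (fun x => - QS chi false (Z t) x) (vh (D t)) by rewrite -eu.
  exact: (vh_defect_Nu sz az (SY t t0) GY M0 (MZ t tT) (MY t tT) Cf0 (hCf _ sz (MZ t tT)) av).
have CK : 0 <= C + K by exact: addr_ge0.
have := tdiff_gronwall snu T0 CK (lexx 0) SW SdW (fun t tT => dW t (andP tT).1) bnd.
move=> /(_ T); rewrite T0 lexx => /(_ isT) => h.
have w0 : Nu (Y 0 - Z 0) <= 0.
  apply: (le_trans (SS_Lu (snB sn2 (SY2 0 (lexx 0)) (SZ 0 (lexx 0)))).2).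
  by rewrite pmulr_rle0//; exact: lifts_N2 l0 (lX 0 (lexx 0)).
have [_ [ay1 ay2]] := SY T T0.
apply: (Nu_eq0 (lX T T0) (SY2 T T0) ay1 ay2); apply: (le_trans h).
by rewrite mul0r addr0 pmulr_lle0// expR_gt0.
Qed.

Lemma Gset_gsol X0 : Gset chi X0 -> exists2 Y, gsol chi Y & lifts chi X0 (Y 0).
Proof.
move=> /(Gset_lift chiP)[z [lz Sz Gz]]; have [Y gY e] := gsol_exists chiP Sz Gz.
by exists Y => //; rewrite e.
Qed.

Lemma gsol_solution X0 Y : gsol chi Y -> lifts chi X0 (Y 0) ->
  global_solution chi X0 (fun t => lag_of chi (Y t)).
Proof.
move=> gY l; split; [exact: sol_C1E|exact: sol_system|].
have [SY _ _] := gY; exact: (lifts_eqlag (lifts_lag_of chi (SY 0 (lexx 0))) l).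
Qed.

Lemma solution_lifts X0 Y X t : gsol chi Y -> lifts chi X0 (Y 0) -> global_solution chi X0 X ->
  0 <= t -> lifts chi (X t) (Y t).
Proof.
move=> gY l [cX sX e] t0; apply: (sol_unique cX sX gY) => //.
have [EX _] := cX; have [m1 m2] := Espace_mf (EX 0 (lexx 0)).
exact: (eqlag_lifts l e m1 m2).
Qed.

(** Whichever global solution the choice in [flow] picks, [solution_lifts] ties it to the
    constructed states. *)
Lemma flow_lifts X0 Y t : gsol chi Y -> lifts chi X0 (Y 0) -> 0 <= t -> lifts chi (flow chi t X0) (Y t).
Proof.
move=> gY l t0; apply: (solution_lifts gY l) t0.
have h : exists X, global_solution chi X0 X by eexists; exact: (gsol_solution gY l).
exact: (xgetPex (fun=> X0) h).
Qed.

Lemma gsol_Gset X Y t : gsol chi Y -> 0 <= t -> lifts chi X (Y t) -> Gset chi X.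
Proof.
move=> gY t0 l; have [SY _ _] := gY.
exact: (GE_Gset chiP l (SY t t0) (gsol_GE chiP gY t0)).
Qed.

Lemma lifts_dist X X' z z' : lifts chi X z -> lifts chi X' z' ->
  Enorm chi (X - X') <= N2 (z - z') /\ N2 (z - z') <= 4 * Enorm chi (X - X').
Proof.
move=> l l'; have h := lifts_B l l'; have [_ _ _ ->] := lifts_E chiP h.
by have [s [_ a] _ _ _] := h; exact: En_NS.
Qed.

Lemma lifts_N2_le X z : lifts chi X z -> N2 z <= 4 * Enorm chi X.
Proof.
move=> l; have [_ _ _ ->] := lifts_E chiP l.
by have [s [_ a] _ _ _] := l; have [] := En_NS s a.
Qed.

End Comparison.

Theorem theorem3p6 (R : realType) (chi : R -> R) (chiP : cutoff chi) :
  (forall X0 : lag R, Gset chi X0 ->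
     [/\ exists X, global_solution chi X0 X,
         forall X Y, global_solution chi X0 X -> global_solution chi X0 Y ->
           forall t, 0 <= t -> eqlag (X t) (Y t) &
         forall X, global_solution chi X0 X ->
           forall t, 0 <= t -> Gset chi (X t)]) /\
  (forall X0 : lag R, Gset chi X0 ->
     [/\ forall t, 0 <= t -> Gset chi (flow chi t X0),
         eqlag (flow chi 0 X0) X0 &
         forall t s, 0 <= t -> 0 <= s ->
           eqlag (flow chi (t + s) X0) (flow chi t (flow chi s X0))]) /\
  (forall (X0 : lag R) (t : R), Gset chi X0 -> 0 <= t ->
     forall e : R, 0 < e -> exists2 d : R, 0 < d &
       forall (X1 : lag R) (s : R), Gset chi X1 -> 0 <= s ->
         Enorm chi (X1 - X0) < d -> `|s - t| < d ->
         Enorm chi (flow chi s X1 - flow chi t X0) < e) /\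
  (forall M T : R, 0 < M -> 0 < T -> exists C : R,
     forall Xa Xb : lag R, Gset chi Xa -> Gset chi Xb ->
       Enorm chi Xa <= M -> Enorm chi Xb <= M ->
       forall t, 0 <= t <= T ->
         Enorm chi (flow chi t Xa - flow chi t Xb) <= C * Enorm chi (Xa - Xb)).
Proof.
split=> [X0 /(Gset_gsol chiP)[Y gY l]|].
  split.
  - by exists (fun t => lag_of chi (Y t)); exact: (gsol_solution chiP gY l).
  - move=> X X' hX hX' t t0.
    exact: lifts_eqlag (solution_lifts chiP gY l hX t0) (solution_lifts chiP gY l hX' t0).
  - by move=> X hX t t0; exact: (gsol_Gset chiP gY t0 (solution_lifts chiP gY l hX t0)).
split=> [X0 /(Gset_gsol chiP)[Y gY l]|].
  have fl t (t0 : 0 <= t) := flow_lifts chiP gY l t0.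
  split=> [t t0||t s t0 s0]; first exact: (gsol_Gset chiP gY t0 (fl t t0)).
    exact: lifts_eqlag (fl 0 (lexx 0)) l.
  (* The shifted solution starts from a lift of [flow chi s X0], so both sides of the semigroup
     identity lift to the same state. *)
  have gs := gsol_shift chiP gY s0.
  have ls : lifts chi (flow chi s X0) (Y (s + 0)) by rewrite addr0; exact: fl.
  have := flow_lifts chiP gs ls t0; rewrite addrC => h.
  by apply: lifts_eqlag h; exact: fl (addr_ge0 t0 s0).
split=> [X0 t /(Gset_gsol chiP)[Y gY l] t0 e e0|M T M0 T0].
  have f2 := @fnorm_L2 R; have sn2 := sn_st f2.
  have [SY _ _] := gY; have SY2 s : 0 <= s -> SS (@L2 R) (Y s) by move=> /SY[h _]; exact: SS_L2.
  pose N2 := NS (@L2norm R); have n0 : 0 <= N2 (Y 0) := sn_ge0 sn2 (SY2 0 (lexx 0)).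
  (* Data at E-distance less than 1 have lifted states at distance at most 4. *)
  have m0 : 0 <= N2 (Y 0) + 4 by exact: addr_ge0.
  have T0 : 0 <= t + 1 by exact: addr_ge0.
  have [C C0 hC] := gsol_lip chiP m0 T0.
  have SF := SA_FS chiP (SY t t0); have SF2 := SS_L2 SF.1.
  have dY := sub_tdiff (@sub2 R) t0 SY SF (gsol_tdiff gY t0).
  have [r r0 hr] := tdiff_near sn2 t0 SY2 SF2 dY.
  have q0 : 0 < 1 + NS (@L2norm R) (FS chi true (Y t)) by rewrite ltr_wpDr// (sn_ge0 sn2 SF2).
  move: (1 + NS (@L2norm R) (FS chi true (Y t))) q0 hr => q q0 hr.
  have C1 : 0 < 4 * C + 1 by rewrite ltr_wpDl// mulr_ge0.
  have e2 : 0 < e / 2 by exact: divr_gt0.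
  (* 1 keeps s below t + 1 and the data in the ball just fixed, [r] is where increments in time are
     controlled, and the last two allot e/2 each to the change of data and the change of time. *)
  exists (Num.min (Num.min 1 r) (Num.min (e / 2 / (4 * C + 1)) (e / 2 / q))).
    by rewrite !lt_min ltr01 r0 !divr_gt0.
  move=> X1 s /(Gset_gsol chiP)[Y1 gY1 l1] s0.
  rewrite !lt_min => /andP[/andP[a1 a2] /andP[a3 a4]] /andP[/andP[b1 b2] /andP[b3 b4]].
  have [SY1 _ _] := gY1; have SY12 u : 0 <= u -> SS (@L2 R) (Y1 u) by move=> /SY1[h _]; exact: SS_L2.
  have [_ d0] := lifts_dist chiP l1 l.
  have n1 : NS (@L2norm R) (Y1 0) <= N2 (Y 0) + 4.
    have := sn_abs_sub sn2 (SY12 0 (lexx 0)) (SY2 0 (lexx 0)); rewrite ler_norml => /andP[_ h].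
    by rewrite addrC -lerBlDr; apply: (le_trans h); apply: (le_trans d0); rewrite ger_pMr// ltW.
  have n2 : NS (@L2norm R) (Y 0) <= N2 (Y 0) + 4 by rewrite lerDl.
  have sT : 0 <= s <= t + 1.
    by rewrite s0/= -lerBlDl (le_trans (ler_norm _))// ltW.
  have [_ h1] := hC _ _ gY1 gY n1 n2 s sT; have h2 := hr s s0 b2.
  have [h3 _] := lifts_dist chiP (flow_lifts chiP gY1 l1 s0) (flow_lifts chiP gY l t0).
  apply: (le_lt_trans h3); apply: (le_lt_trans (sn_tri sn2 (SY12 s s0) (SY2 s s0) (SY2 t t0))).
  rewrite [ltRHS]splitr; apply: ler_ltD.
    apply: (le_trans h1); apply: (le_trans (ler_wpM2l C0 d0)); rewrite mulrA.
    have E0 : 0 <= Enorm chi (X1 - X0).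
      have [sd _ _ _ _] := lifts_B l1 l; have := sn_ge0 sn2 sd.
      by move=> h; rewrite -(@pmulr_rge0 _ 4)// (le_trans h).
    move: a3; rewrite ltr_pdivlMr// => /ltW; apply: le_trans; rewrite mulrC ler_wpM2l//.
    by rewrite mulrC lerDl.
  by apply: (le_lt_trans h2); rewrite -ltr_pdivlMr.
have m0 : 0 <= 4 * M by rewrite mulr_ge0// ltW.
have [C C0 hC] := gsol_lip chiP m0 (ltW T0).
(* The 4 converts the distance of the lifted data back to the E-norm, as does the one in the radius
   4 M. *)
exists (C * 4) => Xa Xb /(Gset_gsol chiP)[Ya ga la] /(Gset_gsol chiP)[Yb gb lb] na nb t tT.
have /andP[t0 _] := tT.
have [h1 _] := lifts_dist chiP (flow_lifts chiP ga la t0) (flow_lifts chiP gb lb t0).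
have [_ h2] := lifts_dist chiP la lb.
have na' : NS (@L2norm R) (Ya 0) <= 4 * M by apply: (le_trans (lifts_N2_le chiP la)); rewrite ler_wpM2l.
have nb' : NS (@L2norm R) (Yb 0) <= 4 * M by apply: (le_trans (lifts_N2_le chiP lb)); rewrite ler_wpM2l.
have [_ h3] := hC _ _ ga gb na' nb' t tT.
by apply: (le_trans h1); apply: (le_trans h3); rewrite -mulrA; exact: ler_wpM2l.
Qed.
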